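(* Let $n\ge 1$, let $L$ be a linear second-order elliptic differential operator on $\mathbb{R}^n$ whose coefficients are smooth and bounded, and let $f=f(x,s):\mathbb{R}^n\times\mathbb{R}\to\mathbb{R}$. Let $a\in\mathbb{R}$. Assume: (A1) the equation $L\phi=f(x,\phi)$ on $\mathbb{R}^n$ has a $\mathcal{C}^2$ solution $\phi$; (A2) the adjoint linearized operator $L^\ast-f_u(x,\phi)$ has a negative eigenvalue $-\sigma^2$ (with $\sigma>0$) and a corresponding eigenfunction $\chi\in L^1(\mathbb{R}^n)\cap L^2(\mathbb{R}^n)$ that is non-negative; (A3) both $f(x,\phi(x))$ and $f_u(x,\phi(x))$ are bounded functions of $x\in\mathbb{R}^n$; (A4) $f(x,s)$ is convex in $s$ and is $\mathcal{C}^1$. Let $(\psi_0,\psi_1)\in H^1(\mathbb{R}^n)\times L^2(\mathbb{R}^n)$ be such that $$\frac{a+\sqrt{a^2+4\sigma^2}}{2}\int_{\mathbb{R}^n}\chi(x)\,\psi_0(x)\,dx+\int_{\mathbb{R}^n}\chi(x)\,\psi_1(x)\,dx>0.$$ Let $0<T\le\infty$ and let $u$ be a solution of $$\partial_t^2u+a\,\partial_tu+Lu=f(x,u),\qquad u(x,0)=\phi(x)+\psi_0(x),\qquad \partial_tu(x,0)=\psi_1(x)$$ on $[0,T)$ such that $u-\phi$ is continuous in $t$ with values in the energy space and $f(x,u)$ is locally integrable. (a) If $T=\infty$, then the energy norm $$\|u(t)-\phi\|_e\equiv\|u(\cdot,t)-\phi(\cdot)\|_{H^1(\mathbb{R}^n)}+\|\partial_tu(\cdot,t)\|_{L^2(\mathbb{R}^n)}$$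 must grow exponentially. (b) Assume in addition: (A5) there exist $C_0>0$ and $p>1$ such that $f(x,s)\ge C_0|s|^p$ for all $(x,s)\in\mathbb{R}^n\times\mathbb{R}$; (A6) the product $\phi\chi$ is integrable on $\mathbb{R}^n$. Then $T<\infty$.
   Context: All functions are real-valued. $f_u$ denotes the partial derivative of $f(x,s)$ with respect to its second argument $s$, and $f_u(x,\phi)$ is the multiplication operator by $x\mapsto f_u(x,\phi(x))$. $L^\ast$ is the formal adjoint of $L$. An eigenfunction is by definition not identically zero. The function $\phi$ is time-independent and is not required to be bounded or in $H^1$. ''$u-\phi$ is continuous in $t$ with values in the energy space'' means $u-\phi\in C([0,T);H^1(\mathbb{R}^n))$ and $\partial_tu\in C([0,T);L^2(\mathbb{R}^n))$. The differential equation is understood in the sense of distributions on $\mathbb{R}^n\times(0,T)$, and the initial conditions hold as equalities $u(\cdot,0)-\phi=\psi_0$ in $H^1$, $\partial_tu(\cdot,0)=\psi_1$ in $L^2$. A function $N:[0,\infty)\to[0,\infty)$ ''grows exponentially'' if there are constants $c>0$, $\mu>0$, $t_0\ge0$ with $N(t)\ge c\,e^{\mu t}$ for all $t\ge t_0$. *)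

(* Defs.v *)
From HB Require Import structures.
From mathcomp Require Import all_boot all_order all_algebra.
From mathcomp Require Import all_classical all_reals all_analysis.

Set Implicit Arguments.
Unset Strict Implicit.
Unset Printing Implicit Defensive.

Import Order.TTheory GRing.Theory Num.Theory.
Import numFieldNormedType.Exports.

Local Open Scope classical_set_scope.
Local Open Scope ring_scope.

(* R^n is 'rV[R]_n, with its canonical (sup-)normed structure, the sigma-algebra
   generated by the coordinates (which is the Borel sigma-algebra) and the n-fold
   product of the one-dimensional Lebesgue measure; see lebesgue_rV_box. *)

Definition rV_display : measure_display -> measure_display.
Proof. exact. Qed.

Section measurable_rV.
Context (R : realType) (n : nat).

Definition coord_rV (i : 'I_n) (v : 'rV[R]_n) : R := v ord0 i.

Let rV_set0 : g_sigma_preimage coord_rV set0.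
Proof. exact: sigma_algebra0. Qed.

Let rV_setC A : g_sigma_preimage coord_rV A -> g_sigma_preimage coord_rV (~` A).
Proof. exact: sigma_algebraC. Qed.

Let rV_bigcup (F : _^nat) : (forall i, g_sigma_preimage coord_rV (F i)) ->
  g_sigma_preimage coord_rV (\bigcup_i (F i)).
Proof. exact: sigma_algebra_bigcup. Qed.

HB.instance Definition _ :=
  @isMeasurable.Build (rV_display default_measure_display)
    'rV[R]_n (g_sigma_preimage coord_rV) rV_set0 rV_setC rV_bigcup.

End measurable_rV.

Lemma measurable_coord_rV (R : realType) n (i : 'I_n) :
  measurable_fun [set: 'rV[R]_n] (coord_rV i).
Proof.
move=> _ Y mY; rewrite setTI; apply: sub_sigma_algebra => /=.
rewrite -bigcup_seq/=; exists i => /=; first by rewrite mem_index_enum.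
by exists Y => //; rewrite setTI.
Qed.

Lemma measurable_fun_rVP d (T : measurableType d) (R : realType) n
    (g : T -> 'rV[R]_n) :
  measurable_fun [set: T] g <->
  forall i, measurable_fun [set: T] (coord_rV i \o g).
Proof.
split=> [mg i|mg]; first exact: measurableT_comp (measurable_coord_rV i) mg.
have mgc : g_sigma_preimage (fun i => coord_rV i \o g) `<=` measurable.
  apply: smallest_sub; first exact: sigma_algebra_measurable.
  rewrite -bigcup_seq; apply: bigcup_sub => i _.
  by move=> A [B mB <-]; exact: mg.
move=> _ A mA; apply: mgc.
by rewrite g_sigma_preimage_comp; exists A.
Qed.

Section lebesgue_rV.
Context (R : realType).
(* 'rV[R]_n as a measurableType; naming the canonical instance keeps coercions out
   of the type of lebesgue_rV. *)
Local Notation mrV n :=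
  (matrix_matrix__canonical__measurable_structure_Measurable R n).

Definition cons_rV n (z : R * 'rV[R]_n) : 'rV[R]_n.+1 :=
  \row_i oapp (fun j => z.2 ord0 j) z.1 (unlift ord0 i).

Definition uncons_rV n (v : 'rV[R]_n.+1) : R * 'rV[R]_n :=
  (v ord0 ord0, \row_j v ord0 (lift ord0 j)).

Lemma cons_rVK n : cancel (@cons_rV n) (@uncons_rV n).
Proof.
move=> [x v]; congr (_, _); rewrite /= ?mxE ?unlift_none//.
by apply/rowP => j; rewrite !mxE liftK.
Qed.

Lemma uncons_rVK n : cancel (@uncons_rV n) (@cons_rV n).
Proof.
move=> v; apply/rowP => i; rewrite mxE.
by case: unliftP => [j|] -> /=; rewrite ?mxE.
Qed.

Lemma measurable_cons_rV n : measurable_fun setT (@cons_rV n).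
Proof.
apply/measurable_fun_rVP => i; rewrite /comp /coord_rV /=.
case: (unliftP ord0 i) => [j|] ->.
- under eq_fun do rewrite mxE liftK /=.
  exact: measurableT_comp (measurable_coord_rV j) measurable_snd.
- by under eq_fun do rewrite mxE unlift_none /=; exact: measurable_fst.
Qed.

Lemma measurable_uncons_rV n : measurable_fun setT (@uncons_rV n).
Proof.
apply: measurable_fun_pair; first exact: (measurable_coord_rV ord0).
apply/measurable_fun_rVP => i; rewrite /comp /coord_rV /=.
by under eq_fun do rewrite mxE; exact: (measurable_coord_rV (lift ord0 i)).
Qed.

Section step.
Context (n : nat) (m : {sigma_finite_measure set (mrV n) -> \bar R}).

Definition lebesgue_cons : set 'rV[R]_n.+1 -> \bar R :=
  pushforward (lebesgue_measure \x m)%E (@cons_rV n).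

Let lebesgue_cons0 : lebesgue_cons set0 = 0%E.
Proof. by rewrite /lebesgue_cons /pushforward preimage_set0 measure0. Qed.

Let lebesgue_cons_ge0 A : (0 <= lebesgue_cons A)%E.
Proof. by rewrite /lebesgue_cons /pushforward; exact: measure_ge0. Qed.

Let lebesgue_cons_sigma_additive : semi_sigma_additive lebesgue_cons.
Proof.
exact: (@measure_semi_sigma_additive _ _ _
  (measure_function_pushforward__canonical__measure_function_Measure
    (lebesgue_measure \x m)%E (@measurable_cons_rV n))).
Qed.

HB.instance Definition _ := isMeasure.Build _ _ _ lebesgue_cons
  lebesgue_cons0 lebesgue_cons_ge0 lebesgue_cons_sigma_additive.

Let lebesgue_cons_sigma_finite : sigma_finite setT lebesgue_cons.
Proof.
have [F FT Foo] : sigma_finite setT (lebesgue_measure \x m)%E.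
  exact: (isSigmaFinite.sigma_finiteT
    (lebesgue_integral_fubini.measure_function_Measure_isSigmaFinite__to__measure_function_isSigmaFinite
      (@lebesgue_measure R) m)).
exists (fun k => @uncons_rV n @^-1` F k).
  by rewrite -preimage_bigcup -FT preimage_setT.
move=> k; have [mF Fk] := Foo k; split.
  by rewrite -[X in measurable X]setTI; exact: measurable_uncons_rV.
rewrite /lebesgue_cons /pushforward -comp_preimage.
by rewrite (_ : _ \o _ = id)// funeqE => z; exact: cons_rVK.
Qed.

HB.instance Definition _ := Measure_isSigmaFinite.Build _ _ _ lebesgue_cons
  lebesgue_cons_sigma_finite.

End step.

Fixpoint lebesgue_rV (n : nat) : {sigma_finite_measure set (mrV n) -> \bar R} :=
  match n with
  | 0 => [the sigma_finite_measure _ _ of @dirac _ (mrV 0) 0 R]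
  | k.+1 => [the sigma_finite_measure _ _ of lebesgue_cons (lebesgue_rV k)]
  end.

Lemma lebesgue_rV_box n (A : 'I_n -> set R) : (forall i, measurable (A i)) ->
  lebesgue_rV n [set v : 'rV[R]_n | forall i, A i (v ord0 i)] =
  (\prod_(i < n) lebesgue_measure (A i))%E.
Proof.
elim: n A => [|n IHn] A mA.
  rewrite big_ord0 /= diracE mem_set//.
  by move=> [].
rewrite big_ord_recl -IHn; last by move=> i; exact: mA.
have -> : lebesgue_rV n.+1 [set v : 'rV[R]_n.+1 | forall i, A i (v ord0 i)] =
    (lebesgue_measure \x lebesgue_rV n)%E
      (A ord0 `*` [set v : 'rV[R]_n | forall i : 'I_n, A (lift ord0 i) (v ord0 i)]).
  congr ((lebesgue_measure \x lebesgue_rV n)%E _).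
  apply/seteqP; split=> [[x v]/= Axv|[x v]/= [Ax Av] i].
    split; first by have := Axv ord0; rewrite mxE unlift_none.
    by move=> i; have := Axv (lift ord0 i); rewrite mxE liftK.
  by rewrite mxE; case: unliftP => [j|] ->.
suff mB : measurable [set v : 'rV[R]_n | forall i : 'I_n, A (lift ord0 i) (v ord0 i)].
  by rewrite product_measure1E//; exact: mA.
rewrite [X in measurable X](_ : _ =
    \bigcap_(i in [set: 'I_n]) (coord_rV i @^-1` A (lift ord0 i))).
  apply: fin_bigcap_measurable => // i _.
  by rewrite -[X in measurable X]setTI; exact: measurable_coord_rV.
apply/seteqP; split=> [v Av i _|v Av i]; first exact: Av.
exact: (Av i I).
Qed.

End lebesgue_rV.

Section calculus.
Context (R : realType).

(* Functions of class C^k on a finite-dimensional V. *)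
Fixpoint Ck (V : normedModType R) (k : nat) (g : V -> R) : Prop :=
  match k with
  | 0 => continuous g
  | j.+1 => (forall x, differentiable g x) /\ forall v, Ck j (fun x => 'D_v g x)
  end.

Definition smooth (V : normedModType R) (g : V -> R) := forall k, Ck k g.

Definition bounded_fct (V : Type) (g : V -> R) :=
  exists M : R, forall x, `|g x| <= M.

Definition test_function (V : normedModType R) (O : set V) (psi : V -> R) :=
  smooth psi /\
  exists K : set V, [/\ compact K, K `<=` O & forall x, ~ K x -> psi x = 0].

Definition partial n (i : 'I_n) (g : 'rV[R]_n -> R) : 'rV[R]_n -> R :=
  fun x => 'D_(delta_mx ord0 i) g x.

Definition f_u (X : Type) (f : X -> R -> R) (x : X) (s : R) : R :=
  derive1 (f x) s.

End calculus.

Section operators.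
Context (R : realType) (n : nat).

(* The operator  w |-> \sum_ij a_ij d_i d_j w + \sum_i b_i d_i w + c w. *)
Record diffop2 := DiffOp2 {
  coef2 : 'I_n -> 'I_n -> 'rV[R]_n -> R;
  coef1 : 'I_n -> 'rV[R]_n -> R;
  coef0 : 'rV[R]_n -> R }.

Definition smooth_bounded (L : diffop2) :=
  [/\ forall i j, smooth (coef2 L i j) /\ bounded_fct (coef2 L i j),
      forall i, smooth (coef1 L i) /\ bounded_fct (coef1 L i)
    & smooth (coef0 L) /\ bounded_fct (coef0 L)].

(* The principal symbol vanishes at no (x, xi) with xi <> 0.  Either sign of the
   symbol is allowed; for the wave operator d_t^2 + L the relevant one is
   a_ij = - delta_ij, i.e. L = - Laplacian. *)
Definition elliptic (L : diffop2) :=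
  forall (x xi : 'rV[R]_n), xi != 0 ->
    \sum_i \sum_j coef2 L i j x * xi ord0 i * xi ord0 j != 0.

Definition apply_op (L : diffop2) (w : 'rV[R]_n -> R) : 'rV[R]_n -> R :=
  fun x => \sum_i \sum_j coef2 L i j x * partial i (partial j w) x
         + \sum_i coef1 L i x * partial i w x
         + coef0 L x * w x.

Definition formal_adjoint (L : diffop2) (w : 'rV[R]_n -> R) : 'rV[R]_n -> R :=
  fun x => \sum_i \sum_j partial i (partial j (coef2 L i j \* w)) x
         - \sum_i partial i (coef1 L i \* w) x
         + coef0 L x * w x.

(* chi is an eigenfunction of L^* - V with eigenvalue lambda, where L^* acts on
   the merely integrable function chi in the sense of distributions: the
   transpose of L^* being L, <L^* chi, psi> = <chi, L psi>. *)
Definition adjoint_eigenfunction (L : diffop2) (V : 'rV[R]_n -> R) (lambda : R)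
    (chi : 'rV[R]_n -> R) :=
  ~ {ae lebesgue_rV R n, forall x, chi x = 0} /\
  forall psi, test_function setT psi ->
    \int[lebesgue_rV R n]_x (chi x * (apply_op L psi x - V x * psi x)) =
    lambda * \int[lebesgue_rV R n]_x (chi x * psi x).

End operators.

Section spaces.
Context (R : realType) (n : nat).
Local Notation mu := (lebesgue_rV R n).
Implicit Types g : 'rV[R]_n -> R.

Definition in_L1 : set ('rV[R]_n -> R) := [set g | g \in Lfun mu 1%:E].
Definition in_L2 : set ('rV[R]_n -> R) := [set g | g \in Lfun mu 2%:E].

(* Real-valued L^2 norm; meaningful on in_L2 only. *)
Definition L2norm g : R := fine ('N[mu]_2%:E[EFin \o g])%E.

Definition is_weak_gradient g (G : 'I_n -> 'rV[R]_n -> R) :=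
  forall i, in_L2 (G i) /\
    forall psi, test_function setT psi ->
      \int[mu]_x (g x * partial i psi x) = - \int[mu]_x (G i x * psi x).

Definition in_H1 : set ('rV[R]_n -> R) :=
  [set g | in_L2 g /\ exists G, is_weak_gradient g G].

(* A choice of the weak gradient, which is unique up to null sets. *)
Definition weak_gradient g : 'I_n -> 'rV[R]_n -> R :=
  xget (fun _ _ => 0) (is_weak_gradient g).

Definition H1norm g : R :=
  Num.sqrt (L2norm g ^+ 2 + \sum_i L2norm (weak_gradient g i) ^+ 2).

End spaces.

Section evolution.
Context (R : realType) (n : nat).
Implicit Types w v : R -> 'rV[R]_n -> R.

Definition time (T : \bar R) : set R := [set t | 0 <= t /\ (t%:E < T)%E].

Definition spacetime (T : \bar R) : set (R * 'rV[R]_n) :=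
  [set z | 0 < z.1 /\ (z.1%:E < T)%E].

Local Notation spacetime_measure := (lebesgue_measure \x lebesgue_rV R n)%E.

Definition locally_integrable_spacetime (T : \bar R) (g : R * 'rV[R]_n -> R) :=
  forall K, compact K -> K `<=` spacetime T ->
    spacetime_measure.-integrable K (EFin \o g).

(* w is in C([0, T[; X), for a space X of functions with norm N. *)
Definition continuous_into (X : set ('rV[R]_n -> R)) (N : ('rV[R]_n -> R) -> R)
    (T : \bar R) w :=
  (forall t, time T t -> X (w t)) /\
  forall t0, time T t0 -> N (w t - w t0) @[t --> within (time T) (nbhs t0)] --> 0.

(* v is the time derivative of w, as limit in L^2 of difference quotients. *)
Definition L2_time_derivative (T : \bar R) w v :=
  forall t0, time T t0 ->
    L2norm ((t - t0)^-1 *: (w t - w t0) - v t0) @[t --> within (time T) t0^'] --> 0.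

(* d_t^2 u + a d_t u + L u = f(x, u) in the distributions on R^n x ]0, T[. *)
Definition distributional_wave_equation (L : diffop2 R n)
    (f : 'rV[R]_n -> R -> R) (a : R) (T : \bar R) (u : R -> 'rV[R]_n -> R) :=
  forall psi : R * 'rV[R]_n -> R, test_function (spacetime T) psi ->
    \int[spacetime_measure]_(z in spacetime T)
      (u z.1 z.2 * (derive1n 2 (fun t => psi (t, z.2)) z.1
                    - a * derive1 (fun t => psi (t, z.2)) z.1
                    + formal_adjoint L (fun x => psi (z.1, x)) z.2)) =
    \int[spacetime_measure]_(z in spacetime T) (f z.2 (u z.1 z.2) * psi z).

(* u is a solution on [0, T[ with time derivative ut, such that u - phi is
   continuous in t with values in the energy space and f(x, u) is locally
   integrable.  Joint measurability of u picks a representative for which the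
   space-time integrals make sense. *)
Definition energy_solution (L : diffop2 R n) (f : 'rV[R]_n -> R -> R) (a : R)
    (phi psi0 psi1 : 'rV[R]_n -> R) (T : \bar R) (u ut : R -> 'rV[R]_n -> R) :=
  [/\ measurable_fun (spacetime T : set (measurableTypeR R * 'rV[R]_n))
        (fun z => u z.1 z.2),
      locally_integrable_spacetime T (fun z => f z.2 (u z.1 z.2))
    & distributional_wave_equation L f a T u] /\
  [/\ continuous_into (@in_H1 R n) (@H1norm R n) T
        (fun t => u t - phi),
      continuous_into (@in_L2 R n) (@L2norm R n) T ut
    & L2_time_derivative T (fun t => u t - phi) ut] /\
  {ae lebesgue_rV R n, forall x, u 0 x - phi x = psi0 x} /\
  {ae lebesgue_rV R n, forall x, ut 0 x = psi1 x}.

Definition energy_norm (w wt : 'rV[R]_n -> R) : R := H1norm w + L2norm wt.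

Definition grows_exponentially (N : R -> R) :=
  exists c m t0 : R, [/\ 0 < c, 0 < m, 0 <= t0 &
    forall t, t0 <= t -> c * expR (m * t) <= N t].

End evolution.

(* Main.v *)
Require Import Defs.
From HB Require Import structures.
From mathcomp Require Import all_boot all_order all_algebra.
From mathcomp Require Import all_classical all_reals all_analysis.
From mathcomp Require Import measurable_realfun ring lra.

(* Put w = u - phi and h(t) = \int chi w(t).  By convexity
   f(x, u) - f(x, phi) >= f_u(x, phi) w, so pairing the equation with the
   nonnegative function chi gives h'' + a h' >= sigma^2 h.  If g and - d are the
   roots of X^2 + a X - sigma^2, then exp(- g t) (h' + d h) is nondecreasing, and
   the condition on the data says that it is positive at t = 0.  Hence
   h(t) >= c exp(g t) - K, and Cauchy-Schwarz bounds the energy norm from below.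
     Under (A5), phi is bounded, and h'' + a h' is moreover at least \int chi times
   a multiple of |w|^p, up to a constant.  Testing with the translates of a fixed
   bump function of time, Young's inequality absorbs its derivatives, so that the
   means of h over windows of fixed length are bounded, which excludes T = oo.
     As chi is merely in L^1 and L^2 and solves its equation in the sense of
   distributions, theta(t) chi(x) is not an admissible test function.  The equation
   for w is tested with theta(t) rho_k(x - y) instead, rho_k being a mollifier, and
   then integrated against chi(y) zeta(y) for a cutoff zeta.  By Friedrichs' lemma
   the commutators of L with the mollification vanish as k -> oo; this only uses the
   first weak derivatives of w.  Finally zeta -> 1. *)

(** One mollifier serves two equations: as a function of [x], [rho_k(x - y)] is a test function for
    the wave equation, and as a function of [y], its product with [zeta] is one for the
    eigenfunction equation. The two resulting kernels agree to second order only after one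
    derivative has moved onto [w], which lies in H^1; what then remains is the commutator of a
    coefficient with one derivative. The coefficients are bounded but their derivatives only locally
    so; hence [k] tends to infinity while [zeta] is fixed, and the errors left for the limit in
    [zeta] contain no derivative of a coefficient. Both parts use one inequality with a free
    function [kappa], subject to kappa w - B <= theta (f(x, u) - f(x, phi) - f_u(x, phi) w).
    Convexity allows kappa = 0; superlinear growth allows kappa = theta'' - a theta', which removes
    the derivatives of theta altogether. Since [phi] itself is not assumed integrable, its equation
    is tested classically on compact supports and subtracted. Pairings are estimated by Schur's test
    and Young's inequality, hence by squares, which is the form in which the energy dominates them
    in time. *)

Set Implicit Arguments.
Unset Strict Implicit.
Unset Printing Implicit Defensive.

Import Order.TTheory GRing.Theory Num.Theory.
Import numFieldNormedType.Exports.

Local Open Scope classical_set_scope.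
Local Open Scope ring_scope.

(** * Smooth functions *)

Section Ck_theory.
Context (R : realType).
Implicit Types V W : normedModType R.

Lemma Ck_le V k (g : V -> R) : Ck k.+1 g -> Ck k g.
Proof.
elim: k g => [|k IHk] g [dg Dg].
  by move=> x; exact/differentiable_continuous/dg.
by split=> // v; exact/IHk/Dg.
Qed.

Lemma Ck_continuous V k (g : V -> R) : Ck k g -> continuous g.
Proof. by elim: k g => // k IHk g /Ck_le; exact: IHk. Qed.

Lemma Ck_cst V k (c : R) : Ck k (fun _ : V => c).
Proof.
elim: k c => [|k IHk] c; first by move=> x; exact: cst_continuous.
split=> [x|v]; first exact: differentiable_cst.
by under eq_fun do rewrite derive_cst; exact: IHk.
Qed.

Lemma CkD V k (g h : V -> R) : Ck k g -> Ck k h -> Ck k (fun x => g x + h x).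
Proof.
elim: k g h => [|k IHk] g h.
  by move=> cg ch x; apply: continuousD; [exact: cg|exact: ch].
move=> [dg Dg] [dh Dh]; split=> [x|v]; first exact: differentiableD.
rewrite (_ : 'D_v _ = (fun x => 'D_v g x + 'D_v h x)).
  exact: (IHk _ _ (Dg v) (Dh v)).
by apply/funext => x; rewrite -deriveD//; exact: diff_derivable.
Qed.

Lemma CkM V k (g h : V -> R) : Ck k g -> Ck k h -> Ck k (fun x => g x * h x).
Proof.
elim: k g h => [|k IHk] g h.
  by move=> cg ch x; apply: continuousM; [exact: cg|exact: ch].
move=> gk hk; have [dg Dg] := gk; have [dh Dh] := hk.
split=> [x|v]; first exact: differentiableM.
rewrite (_ : 'D_v _ = (fun x => g x * 'D_v h x + h x * 'D_v g x)).
  apply: CkD; first exact: (IHk _ _ (Ck_le gk) (Dh v)).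
  exact: (IHk _ _ (Ck_le hk) (Dg v)).
by apply/funext => x; rewrite deriveM//; exact: diff_derivable.
Qed.

(** The differential of [A] is the same at every point, so a directional derivative of the composite
    is again a composite with [A], of the derivative along [l v]; the induction therefore closes. *)
Lemma Ck_comp_affine V W k (A : V -> W) (l : V -> W) (g : W -> R) :
  (forall x, differentiable A x) -> (forall x v, 'd A x v = l v) ->
  Ck k g -> Ck k (fun x => g (A x)).
Proof.
move=> dA Al; elim: k g => [|k IHk] g.
  move=> cg x; apply: (@continuous_comp _ _ _ A g); last exact: cg.
  exact/differentiable_continuous/dA.
move=> [dg Dg]; split=> [x|v].
  by apply: differentiable_comp; [exact: dA|exact: dg].
rewrite (_ : 'D_v _ = (fun x => 'D_(l v) g (A x))).
  exact: (IHk _ (Dg (l v))).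
apply/funext => x; rewrite !deriveE//; last first.
  by apply: (@differentiable_comp _ _ _ _ A g).
by rewrite (@diff_comp _ _ _ _ A g)//= Al.
Qed.

Lemma derive_comp_affine V W (A : V -> W) (l : V -> W) (g : W -> R) x v :
  (forall x, differentiable A x) -> (forall x v, 'd A x v = l v) ->
  differentiable g (A x) ->
  'D_v (fun x => g (A x)) x = 'D_(l v) g (A x).
Proof.
move=> dA Al dg; rewrite !deriveE//; last first.
  by apply: (@differentiable_comp _ _ _ _ A g).
by rewrite (@diff_comp _ _ _ _ A g)//= Al.
Qed.

Lemma smooth_derive V (g : V -> R) v : smooth g -> smooth (fun x => 'D_v g x).
Proof. by move=> gs k; have [_] := gs k.+1; exact. Qed.

Lemma smooth_differentiable V (g : V -> R) x : smooth g -> differentiable g x.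
Proof. by move=> /(_ 1%N)[+ _]; exact. Qed.

Lemma smooth_cst V (c : R) : smooth (fun _ : V => c).
Proof. by move=> k; exact: Ck_cst. Qed.

Lemma smoothD V (g h : V -> R) :
  smooth g -> smooth h -> smooth (fun x => g x + h x).
Proof. by move=> gs hs k; exact: CkD. Qed.

Lemma smoothM V (g h : V -> R) :
  smooth g -> smooth h -> smooth (fun x => g x * h x).
Proof. by move=> gs hs k; exact: CkM. Qed.

Lemma smoothN V (g : V -> R) : smooth g -> smooth (fun x => - g x).
Proof.
move=> gs; rewrite (_ : (fun _ => _) = fun x => -1 * g x).
  by apply: smoothM => //; exact: smooth_cst.
by apply/funext => x; rewrite mulN1r.
Qed.

Lemma smooth_prod V (I : Type) (r : seq I) (g : I -> V -> R) :
  (forall i, smooth (g i)) -> smooth (fun x => \prod_(i <- r) g i x).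
Proof.
move=> gs; elim: r => [|i r IHr].
  by under eq_fun do rewrite big_nil; exact: smooth_cst.
by under eq_fun do rewrite big_cons; exact: smoothM.
Qed.

Lemma smooth_exp V (g : V -> R) m : smooth g -> smooth (fun x => g x ^+ m).
Proof.
move=> gs; elim: m => [|m IHm].
  by under eq_fun do rewrite expr0; exact: smooth_cst.
by under eq_fun do rewrite exprS; exact: smoothM.
Qed.

Lemma smooth_comp_affine V W (A : V -> W) (l : V -> W) (g : W -> R) :
  (forall x, differentiable A x) -> (forall x v, 'd A x v = l v) ->
  smooth g -> smooth (fun x => g (A x)).
Proof. by move=> dA Al gs k; exact: Ck_comp_affine (dA) (Al) (gs k). Qed.

End Ck_theory.

(** * Smooth functions on the line and the flat function exp(-1/x) *)

Section real_line.
Context (R : realType).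

Lemma derive_derive1 (g : R -> R) (v x : R) : derivable g x 1 ->
  'D_v g x = v * derive1 g x.
Proof.
move=> dg; have dg' : differentiable g x by exact/derivable1_diffP.
by rewrite deriveE// deriv1E.
Qed.

(** The induction on the order of differentiability is done once, for any class of functions closed
    under derivation. On the line a derivative along [v] is [v] times the ordinary one. *)
Lemma smooth_family (P : (R -> R) -> Prop) :
  (forall h, P h -> forall x : R, derivable h x 1) ->
  (forall h, P h -> P (derive1 h)) -> forall h, P h -> smooth h.
Proof.
move=> dP PP h Ph k; elim: k h Ph => [|k IHk] h Ph.
  by move=> x; apply/differentiable_continuous/derivable1_diffP/dP.
split=> [x|v]; first exact/derivable1_diffP/dP.
rewrite (_ : 'D_v h = (fun x => v * derive1 h x)); last first.
  by apply/funext => x; rewrite derive_derive1//; exact: dP.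
by apply: CkM; [exact: Ck_cst|exact/IHk/PP].
Qed.

Lemma smooth_derivable (h : R -> R) (x : R) : smooth h -> derivable h x 1.
Proof. by move=> hs; exact/derivable1_diffP/smooth_differentiable. Qed.

Lemma smooth_derive1 (h : R -> R) : smooth h -> smooth (derive1 h).
Proof. by move=> hs; rewrite (_ : derive1 h = 'D_1 h); [exact: smooth_derive|apply/funext => x; rewrite derive1E]. Qed.

(** The class made of [F] alone and of all smooth functions is closed under derivation. *)
Lemma smooth_primitive (F g : R -> R) :
  (forall x, is_derive x (1 : R) F (g x)) -> smooth g -> smooth F.
Proof.
move=> dF gs; pose P h := h = F \/ smooth h.
apply: (@smooth_family P); last by left.
  by move=> h [->//|hs] x; exact: smooth_derivable.
move=> h [->|hs]; right; last exact: smooth_derive1.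
by rewrite (_ : derive1 F = g)//; apply/funext => x; rewrite derive1E derive_val.
Qed.

Lemma smooth_expRM (c : R) : smooth (fun x : R => expR (c * x)).
Proof.
pose P h := exists d, h = fun x => d * expR (c * x).
apply: (@smooth_family P); last first.
  by exists 1; apply/funext => x; rewrite mul1r.
  move=> h [d ->]; exists (d * c); apply/funext => x.
  by rewrite derive1E derive_val /GRing.scale/=; ring.
by move=> h [d ->] x.
Qed.

(* [flat p] is exp(-1/x) times a polynomial in 1/x, extended by 0: this class of
   functions is stable under differentiation. *)
Definition flat (p : {poly R}) (x : R) : R :=
  if 0 < x then p.[x^-1] * expR (- x^-1) else 0.

(** Induction on the polynomial with rate [e / 2]: the other half of the exponential absorbs the new
    factor [s], because exp(e s / 2) >= 1 + e s / 2. *)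
Lemma horner_le_expR (p : {poly R}) (e : R) : 0 < e ->
  exists2 C : R, 0 <= C & forall s : R, 0 <= s -> `|p.[s]| <= C * expR (e * s).
Proof.
elim/poly_ind: p e => [|p c IHp] e e0.
  by exists 0 => // s _; rewrite horner0 normr0 mul0r.
have e20 : 0 < e / 2 by rewrite divr_gt0.
have [C C0 HC] := IHp _ e20.
exists (C * (2 / e) + `|c|); first by rewrite addr_ge0// mulr_ge0// divr_ge0// ltW.
move=> s s0; rewrite hornerMXaddC (le_trans (ler_normD _ _))// mulrDl lerD//.
  rewrite normrM (ger0_norm s0).
  have -> : e * s = e / 2 * s + e / 2 * s by field.
  rewrite expRD.
  have -> : C * (2 / e) * (expR (e / 2 * s) * expR (e / 2 * s)) =
    (C * expR (e / 2 * s)) * (2 / e * expR (e / 2 * s)) by ring.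
  apply: ler_pM => //; first exact: HC.
  have := expR_ge1Dx (e / 2 * s) => h.
  apply: (@le_trans _ _ (2 / e * (e / 2 * s))).
    by rewrite le_eqVlt; apply/orP; left; apply/eqP; field; rewrite gt_eqF.
  rewrite ler_wpM2l ?divr_ge0 ?ltW//.
  by apply: lt_le_trans h; rewrite ltrDr.
by rewrite ler_peMr// -expR0 ler_expR mulr_ge0// ltW.
Qed.

Lemma flat_bounded (p : {poly R}) : exists2 C : R, 0 <= C & forall x : R, `|flat p x| <= C.
Proof.
have [C C0 HC] := @horner_le_expR p 1 ltr01; exists C => // x.
rewrite /flat; case: ifPn => x0; last by rewrite normr0.
rewrite normrM (ger0_norm (expR_ge0 _)).
have := HC x^-1; rewrite invr_ge0 (ltW x0) mul1r => /(_ isT) h.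
by rewrite expRN ler_pdivrMr ?expR_gt0.
Qed.

(** The boundedness of the flat function of [p * 'X^2], multiplied by [x ^+ 2]. A quadratic bound
    makes the difference quotient at 0 vanish. *)
Lemma flat_le (p : {poly R}) :
  exists2 C : R, 0 <= C & forall x : R, `|flat p x| <= C * x ^+ 2.
Proof.
have [C C0 HC] := flat_bounded (p * 'X^2); exists C => // x.
have := HC x; rewrite /flat; case: ifPn => x0.
  rewrite (_ : p.[_] * _ = (p * 'X^2).[x^-1] * expR (- x^-1) * x ^+ 2).
    by move=> h; rewrite normrM [X in _ * X]ger0_norm ?sqr_ge0// ler_wpM2r ?sqr_ge0.
  by rewrite hornerM hornerXn; field; rewrite gt_eqF.
by rewrite normr0 => _; rewrite mulr_ge0// sqr_ge0.
Qed.

Lemma is_derive_flat (p : {poly R}) (x : R) :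
  is_derive x (1 : R) (flat p) (flat ('X^2 * (p - p^`())) x).
Proof.
have [x0|x0|->] := ltgtP x 0.
- rewrite {2}/flat ltNge ltW//=.
  apply: (@near_eq_is_derive _ _ _ (cst 0)).
  near=> y; rewrite /flat ltNge ltW//=; near: y; exact: lt_nbhsl.
- rewrite {2}/flat x0.
  apply: (@near_eq_is_derive _ _ _ (fun x : R => p.[x^-1] * expR (- x^-1))).
    near=> y; rewrite /flat ifT//; near: y; exact: lt_nbhsr.
  have xn0 : x != 0 by rewrite gt_eqF.
  have dV : is_derive x (1 : R) (fun y : R => y^-1) (- x ^- 2).
    by have := is_deriveV xn0 (is_derive_id x (1:R)); rewrite /GRing.scale/= mulr1.
  have dp : is_derive (x^-1) (1 : R) (horner p) (p^`()).[x^-1].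
    by have := is_derive_poly p x^-1.
  apply: is_derive_eq.
  by rewrite hornerM hornerXn hornerD hornerN /GRing.scale/= exprVn; ring.
- rewrite {2}/flat ltxx.
  have [C C0 HC] := flat_le p.
  have f0 : flat p 0 = 0 by rewrite /flat ltxx.
  have cv : h^-1 *: (flat p (h *: (1 : R) + 0) - flat p 0) @[h --> 0^'] --> (0 : R).
    apply/cvgr0Pnorm_le => e e0; near=> h.
    rewrite f0 subr0 addr0 /GRing.scale/= mulr1 normrM.
    have hn0 : h != 0 by near: h; exact: nbhs_dnbhs_neq.
    rewrite normfV mulrC ler_pdivrMr ?normr_gt0//.
    apply: (le_trans (HC _)); rewrite -real_normK ?num_real// expr2 mulrA.
    rewrite ler_wpM2r//.
    apply: (@le_trans _ _ ((C + 1) * `|h|)).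
      by rewrite ler_wpM2r// lerDl.
    rewrite mulrC -ler_pdivlMr ?ltr_wpDl//.
    near: h; apply: dnbhs0_le; rewrite divr_gt0// ltr_wpDl//.
  split; first by apply/cvg_ex; exists 0; exact: cv.
  by apply/cvg_lim => //; exact: cv.
Unshelve. all: by end_near. Qed.

Lemma smooth_flat (p : {poly R}) : smooth (flat p).
Proof.
pose P h := exists q, h = flat q.
apply: (@smooth_family P); last by exists p.
  by move=> h [q ->] x; have [] := is_derive_flat q x.
move=> h [q ->]; exists ('X^2 * (q - q^`())); apply/funext => x.
by rewrite derive1E; have [_ ->] := is_derive_flat q x.
Qed.

End real_line.

(** * A smooth step whose derivative is a bump of mass one *)

Section smooth_step.
Context (R : realType).

Lemma smooth_comp_line (h : R -> R) (c d : R) :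
  smooth h -> smooth (fun x : R => h (c * x + d)).
Proof.
have dA (x : R) : is_derive x (1 : R) (fun y => c * y + d) c.
  by apply: is_derive_eq; rewrite addr0 /GRing.scale/= mulr1.
have dfA (x : R) : differentiable (fun y : R => c * y + d) x.
  by apply/derivable1_diffP; have [] := dA x.
apply: (@smooth_comp_affine _ _ _ (fun y : R => c * y + d) (fun v => v * c)) => // x v.
rewrite deriv1E; last by have [] := dA x.
by rewrite derive1E derive_val.
Qed.

Lemma is_derive_comp_line (h : R -> R) (c d x : R) : smooth h ->
  is_derive x (1 : R) (fun x : R => h (c * x + d)) (c * derive1 h (c * x + d)).
Proof.
move=> hs.
have hd y : derivable h y 1 by exact: smooth_derivable.
have dh : is_derive (c * x + d) (1 : R) h (derive1 h (c * x + d)).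
  by rewrite derive1E; exact: derivableP.
have dA : is_derive x (1 : R) (fun y => c * y + d) c.
  by apply: is_derive_eq; rewrite addr0 /GRing.scale/= mulr1.
by apply: is_derive_eq; rewrite /GRing.scale/= mulrC.
Qed.

(** The product of exp(-1/(1+x)) and exp(-1/(1-x)) is positive exactly on ]-1, 1[; it and its
    primitive are divided by the total mass. Step and bump are produced together because the one
    yields cutoffs, the other mollifiers, and their relation gives the mass of the mollifiers. *)
Lemma smooth_step_exists : exists S b : R -> R,
  [/\ smooth S, smooth b, forall x, is_derive x (1 : R) S (b x) &
   [/\ forall x, 0 <= b x, forall x, 1 <= `|x| -> b x = 0,
       forall x, x <= -1 -> S x = 0, forall x, 1 <= x -> S x = 1 &
       forall x, 0 <= S x <= 1]].
Proof.
pose e := flat (1 : {poly R}).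
have es : smooth e by exact: smooth_flat.
have e0 x : x <= 0 -> e x = 0 by move=> x0; rewrite /e /flat ltNge x0.
have egt x : 0 < x -> 0 < e x.
  by move=> x0; rewrite /e /flat x0 hornerC mul1r expR_gt0.
have ege x : 0 <= e x.
  by have [/e0->//|/egt/ltW] := leP x 0.
pose b x := e (1 * x + 1) * e (-1 * x + 1).
have bs : smooth b by apply: smoothM; exact: smooth_comp_line.
have cb : continuous b by exact: (Ck_continuous (bs 0%N)).
have bge x : 0 <= b x by rewrite mulr_ge0.
have b0 x : 1 <= `|x| -> b x = 0.
  rewrite ler_normr /b => /orP[|] x1.
    by rewrite [e (-1 * _ + _)]e0 ?mulr0//; lra.
  by rewrite [e (1 * _ + _)]e0 ?mul0r//; lra.
have bgt x : `|x| < 1 -> 0 < b x.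
  by rewrite ltr_norml => /andP[? ?]; rewrite mulr_gt0// egt//; lra.
(* Starting at -2 keeps every [x >= -1] away from the left end point, as the fundamental theorem
   requires; below -1 the primitive is locally 0. *)
pose F x := (\int[lebesgue_measure]_(t in `[-2, x]) b t)%R.
have F0 x : x <= -1 -> F x = 0.
  move=> x1; rewrite /F (@eq_Rintegral _ _ _ _ _ (cst 0)).
    by rewrite Rintegral_cst//= mul0r.
  move=> y; rewrite inE/= in_itv/= => /andP[_ yx]; apply: b0.
  by rewrite ler_normr; apply/orP; right; lra.
have dF x : is_derive x (1 : R) F (b x).
  have [x1|x1] := ltP x (-1).
    rewrite b0; last by rewrite ler_normr; apply/orP; right; lra.
    apply: (@near_eq_is_derive _ _ _ (cst 0)).
    near=> y; rewrite F0//; apply: ltW; near: y; exact: lt_nbhsl.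
  have [||||dF F'] := @continuous_FTC1_closed R b (-2) x (x + 1).
  - by rewrite ltrDl.
  - apply: continuous_compact_integrable; first exact: segment_compact.
    exact: continuous_subspaceT.
  - lra.
  - exact: cb.
  by split => //; rewrite -derive1E.
have derF x : derivable F x 1 by have [] := dF x.
have F' x : derive1 F x = b x by rewrite derive1E; have [_ ->] := dF x.
have cF : continuous F.
  by move=> x; exact/differentiable_continuous/derivable1_diffP.
have ndF x y : x <= y -> F x <= F y.
  rewrite le_eqVlt => /predU1P[->//|xy].
  apply: (@ger0_derive1_ndecr _ F x y) => //; last exact: ltW.
    by move=> z _; rewrite F'.
  exact: continuous_subspaceT.
have F1 x : 1 <= x -> F x = F 1.
  move=> x1; apply/eqP; rewrite eq_le (ndF _ _ x1) andbT.
  apply: (@ler0_derive1_nincr _ F 1 x) => //.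
    move=> z /[!in_itv]/= /andP[z1 _].
    by rewrite F' b0// ler_normr (ltW z1).
  exact: continuous_subspaceT.
have c0 : 0 < F 1.
  rewrite -(F0 (-1))//.
  apply: (@gtr0_derive1_incr _ F (-1) 1) => //.
    by move=> z /[!in_itv]/= z1; rewrite F'; apply: bgt; rewrite ltr_norml.
  exact: continuous_subspaceT.
exists (fun x => (F 1)^-1 * F x), (fun x => (F 1)^-1 * b x).
have bs' : smooth (fun x => (F 1)^-1 * b x).
  by apply: smoothM => //; exact: smooth_cst.
have dF' x : is_derive x (1 : R) (fun x => (F 1)^-1 * F x) ((F 1)^-1 * b x).
  by have h := dF x; apply: is_derive_eq.
split => //; first exact: smooth_primitive dF' bs'.
split => [x|x x1|x x1|x x1|x].
- by rewrite mulr_ge0// invr_ge0 ltW.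
- by rewrite b0// mulr0.
- by rewrite (F0 x x1) mulr0.
- by rewrite (F1 x x1) mulVf // gt_eqF.
- have F0x : 0 <= F x.
    by have [/F0->//|x1] := leP x (-1); rewrite -(F0 (-1))//; apply/ndF/ltW.
  have Fx1 : F x <= F 1.
    by have [/F1->//|x1] := leP 1 x; apply/ndF/ltW.
  rewrite mulr_ge0 ?invr_ge0 ?(ltW c0)//=.
  by rewrite mulrC ler_pdivrMr// mul1r.
Unshelve. all: by end_near. Qed.

End smooth_step.

(** * Measure and integration on row vectors *)

Section rV_topology.
Context (R : realType) (n : nat).
Implicit Types v w : 'rV[R]_n.

Lemma coord_le_norm v i : `|v ord0 i| <= `|v|.
Proof. by rewrite /Num.norm/= mx_normrE; exact: (le_bigmax _ _ (ord0, i)). Qed.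

Lemma norm_lt_coord v e : 0 < e -> (forall i, `|v ord0 i| < e) -> `|v| < e.
Proof.
move=> e0 ve; rewrite /Num.norm/= mx_normrE; apply: bigmax_lt => // -[i j] _ /=.
by rewrite (ord1 i).
Qed.

Lemma continuous_coord i : continuous (fun v => v ord0 i).
Proof. by move=> v; exact: coord_continuous. Qed.

Lemma compact_box (M : R) : compact [set v : 'rV[R]_n | forall i, `|v ord0 i| <= M].
Proof.
rewrite (_ : mkset _ = [set v : 'rV[R]_n | forall i, `[- M, M]%classic (v ord0 i)]).
  by apply: (@rV_compact _ _ (fun=> `[- M, M]%classic)) => i; exact: segment_compact.
by apply/seteqP; split=> v /= vM i; have := vM i; rewrite in_itv/= ler_norml.
Qed.

Lemma bounded_on_box (g : 'rV[R]_n -> R) (M : R) : continuous g ->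
  exists2 C : R, 0 <= C & forall v, (forall i, `|v ord0 i| <= M) -> `|g v| <= C.
Proof.
move=> cg.
have /compact_bounded[C [_ HC]] : compact (g @` [set v : 'rV[R]_n | forall i, `|v ord0 i| <= M]).
  apply: continuous_compact; last exact: compact_box.
  exact: continuous_subspaceT.
exists (`|C| + 1); first by rewrite addr_ge0.
move=> v vM; apply: (HC (`|C| + 1)); last by exists v.
by rewrite (le_lt_trans (ler_norm C))// ltrDl.
Qed.

Definition obox (a b : 'rV[R]_n) : set 'rV[R]_n :=
  [set v | forall i, a ord0 i < v ord0 i < b ord0 i].

Definition oboxes := [set B | exists a b, B = obox a b].

Lemma measurable_set_box (A : 'I_n -> set R) : (forall i, measurable (A i)) ->
  measurable [set v : 'rV[R]_n | forall i, A i (v ord0 i)].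
Proof.
move=> mA; rewrite [X in measurable X](_ : _ =
    \bigcap_(i in [set: 'I_n]) (coord_rV i @^-1` A i)).
  apply: fin_bigcap_measurable => // i _.
  by rewrite -[X in measurable X]setTI; exact: measurable_coord_rV.
by apply/seteqP; split=> [v Av i _|v Av i]; [exact: Av|exact: (Av i I)].
Qed.

Lemma oboxE a b : obox a b =
  [set v | forall i, `]a ord0 i, b ord0 i[%classic (v ord0 i)].
Proof. by apply/seteqP; split=> v /= vab i; have := vab i; rewrite in_itv. Qed.

Lemma measurable_obox a b : measurable (obox a b).
Proof. by rewrite oboxE; apply: (@measurable_set_box (fun i => `]a ord0 i, b ord0 i[%classic)) => i; exact: measurable_itv. Qed.

Lemma setI_closed_oboxes : setI_closed oboxes.
Proof.
move=> _ _ [a [b ->]] [c [d ->]].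
exists (\row_i Num.max (a ord0 i) (c ord0 i)), (\row_i Num.min (b ord0 i) (d ord0 i)).
apply/seteqP; split=> v /=.
  by move=> [vab vcd] i; rewrite !mxE gt_max lt_min; move: (vab i) (vcd i) =>
    /andP[-> ->] /andP[-> ->].
move=> h; split=> i; have := h i; rewrite !mxE gt_max lt_min.
  by move=> /andP[/andP[-> _] /andP[-> _]].
by move=> /andP[/andP[_ ->] /andP[_ ->]].
Qed.

(** Open boxes form a generator closed under intersection, which the monotone class argument for
    approximate identities relies on. A half-space in one coordinate is the union of boxes whose
    other sides are ]-k, k[. *)
Lemma measurable_rV_oboxes : @measurable _ 'rV[R]_n = <<s oboxes >>.
Proof.
apply/seteqP; split; last first.
  apply: smallest_sub; first exact: sigma_algebra_measurable.
  by move=> _ [a [b ->]]; exact: measurable_obox.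
apply: smallest_sub; first exact: smallest_sigma_algebra.
rewrite -bigcup_seq; apply: bigcup_sub => i _ _ [B mB <-].
pose T := g_sigma_algebraType oboxes.
suff mi : measurable_fun [set: T] (fun v : T => (v : 'rV[R]_n) ord0 i).
  exact: mi.
apply: (@measurability _ _ T _ _ _ _ (RGenOInfty.measurableE R)) => _ [_ [a ->] <-].
rewrite setTI (_ : _ @^-1` _ = \bigcup_k obox
   (\row_j (if j == i then a else - k%:R)) (\row_j k%:R)).
  apply: bigcup_measurable => k _; apply: sub_sigma_algebra.
  by eexists; eexists; reflexivity.
apply/seteqP; split=> [v /=|v [k _] /= /(_ i)]; last first.
  by rewrite !mxE eqxx => /andP[+ _]; rewrite in_itv/= andbT.
rewrite in_itv/= andbT => av.
have /andP[_ vk] := truncn_itv (normr_ge0 v); set k := (Num.truncn `|v|).+1 in vk.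
exists k => // j; rewrite !mxE.
have := le_lt_trans (coord_le_norm v j) vk; rewrite ltr_norml => /andP[v1 ->].
by rewrite andbT; case: eqVneq => [->|].
Qed.

(** Rational corners make the union countable, so open sets belong to the sigma-algebra of the
    coordinates. *)
Lemma open_bigcup_obox (O : set 'rV[R]_n) : open O ->
  O = \bigcup_(pq in [set pq : 'rV[rat]_n * 'rV[rat]_n |
         obox (map_mx ratr pq.1) (map_mx ratr pq.2) `<=` O])
       obox (map_mx ratr pq.1) (map_mx ratr pq.2).
Proof.
move=> oO; apply/seteqP; split=> [v Ov|v [pq /= sO]]; last exact: sO.
have : nbhs v O by exact: open_nbhs_nbhs.
move=> /nbhs_ballP[e /= e0 veO].
have H i : exists pq : rat * rat, v ord0 i - e < ratr pq.1 < v ord0 i /\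
    v ord0 i < ratr pq.2 < v ord0 i + e.
  have /rat_in_itvoo[p /[!in_itv]/= hp] : v ord0 i - e < v ord0 i by rewrite ltrBlDr ltrDl.
  have /rat_in_itvoo[q /[!in_itv]/= hq] : v ord0 i < v ord0 i + e by rewrite ltrDl.
  by exists (p, q).
have [h hP] := choice H.
exists (\row_i (h i).1, \row_i (h i).2) => /=; last first.
  by move=> i; rewrite !mxE; have [/andP[_ ->] /andP[-> _]] := hP i.
move=> w wh; apply: veO; rewrite mx_norm_ball /ball_/=.
apply: norm_lt_coord => // i; rewrite !mxE; have := wh i; rewrite !mxE => /andP[w1 w2].
have [/andP[h1 _] /andP[_ h2]] := hP i.
by rewrite ltr_norml; apply/andP; split; lra.
Qed.

Lemma measurable_open_rV (O : set 'rV[R]_n) : open O -> measurable O.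
Proof.
move=> /open_bigcup_obox ->; rewrite bigcup_mkcond.
apply: countable_bigcupT_measurable => [|pq]; first exact: countableP.
by case: ifPn => _; [exact: measurable_obox|exact: measurable0].
Qed.

Lemma continuous_measurable_rV (g : 'rV[R]_n -> R) :
  continuous g -> measurable_fun setT g.
Proof.
move=> /continuousP cg.
apply: (measurability _ (RGenOpens.measurableE R)) => _ [_ [a [b ->] <-]].
by rewrite setTI; apply: measurable_open_rV; apply: cg; exact: interval_open.
Qed.

Lemma measurable_rV_sub2 :
  measurable_fun setT (fun z : 'rV[R]_n * 'rV[R]_n => z.1 - z.2).
Proof.
apply/measurable_fun_rVP => i; rewrite /comp/= /coord_rV; under eq_fun do rewrite !mxE.
apply: (@measurable_funB _ _ _ _ (fun z : 'rV[R]_n * 'rV[R]_n => z.1 ord0 i) (fun z => z.2 ord0 i)).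
- exact: (measurableT_comp (measurable_coord_rV i) measurable_fst).
- exact: (measurableT_comp (measurable_coord_rV i) measurable_snd).
Qed.

End rV_topology.

Lemma abse_fine_le (R : realType) (e : \bar R) : (`|(fine e)%:E| <= `|e|)%E.
Proof. by case: e => //=; rewrite normr0 ?leey. Qed.

(** * Fubini's theorem for real-valued integrals *)

Section Rintegral_prod.
Context d1 d2 (T1 : measurableType d1) (T2 : measurableType d2) (R : realType).
Variables (m1 : {sigma_finite_measure set T1 -> \bar R}).
Variables (m2 : {sigma_finite_measure set T2 -> \bar R}).
Variable f : T1 * T2 -> R.
Hypothesis fi : (m1 \x m2)%E.-integrable setT (EFin \o f).

(** Almost every slice is integrable, and there [fine] loses nothing. On the remaining null set the
    real inner integral may be a default value. *)
Let ae1 : {ae m1, forall x, (\int[m2]_y f (x, y))%:E = fubini_F m2 (EFin \o f) x}.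
Proof.
apply: filterS (ae_integrable1 fi) => x fx.
by rewrite /fubini_F/= fineK//; exact: integrable_fin_num.
Qed.

Let ae2 : {ae m2, forall y, (\int[m1]_x f (x, y))%:E = fubini_G m1 (EFin \o f) y}.
Proof.
apply: filterS (ae_integrable2 fi) => y fy.
by rewrite /fubini_G/= fineK//; exact: integrable_fin_num.
Qed.

Lemma measurable_Rintegral1 : measurable_fun setT (fun x => \int[m2]_y f (x, y)).
Proof.
by apply: (measurableT_comp (fine_measurable measurableT)); exact: measurable_fubini_F fi.
Qed.

Lemma measurable_Rintegral2 : measurable_fun setT (fun y => \int[m1]_x f (x, y)).
Proof.
by apply: (measurableT_comp (fine_measurable measurableT)); exact: measurable_fubini_G fi.
Qed.

Lemma integrable_Rintegral1 :
  m1.-integrable setT (EFin \o (fun x => \int[m2]_y f (x, y))).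
Proof.
apply: (le_integrable measurableT _ _ (integrable_fubini_F fi)).
  exact/measurable_EFinP/measurable_Rintegral1.
by move=> x _; exact: abse_fine_le.
Qed.

Lemma integrable_Rintegral2 :
  m2.-integrable setT (EFin \o (fun y => \int[m1]_x f (x, y))).
Proof.
have mf : measurable_fun setT (EFin \o f) by exact: measurable_int fi.
have maf : measurable_fun setT (abse \o (EFin \o f)) by exact: measurableT_comp.
apply/integrableP; split; first exact/measurable_EFinP/measurable_Rintegral2.
have /integrableP[_] := fi; apply: le_lt_trans.
rewrite (fubini_tonelli2 (abse \o (EFin \o f)))//=.
apply: ge0_le_integral => //.
- apply/measurable_EFinP/measurableT_comp => //; exact: measurable_Rintegral2.
- by apply: measurable_fun_fubini_tonelli_G => //= z.
move=> y _; apply: (le_trans (abse_fine_le _)).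
rewrite /fubini_G/=; apply: le_abse_integral => //.
exact: (measurableT_comp mf (pair2_measurable y)).
Qed.

Lemma Rintegral_prod1 :
  \int[(m1 \x m2)%E]_z f z = \int[m1]_x \int[m2]_y f (x, y).
Proof.
rewrite /Rintegral -(integral12_prod_meas1 fi); congr fine.
apply: ae_eq_integral => //.
- exact: measurable_fubini_F fi.
- exact/measurable_EFinP/measurable_Rintegral1.
- by apply: filterS ae1 => x /= -> _.
Qed.

Lemma Rintegral_prod2 :
  \int[(m1 \x m2)%E]_z f z = \int[m2]_y \int[m1]_x f (x, y).
Proof.
rewrite /Rintegral -(integral21_prod_meas1 fi); congr fine.
apply: ae_eq_integral => //.
- exact: measurable_fubini_G fi.
- exact/measurable_EFinP/measurable_Rintegral2.
- by apply: filterS ae2 => x /= -> _.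
Qed.

End Rintegral_prod.

(** * Compactly supported functions on the line *)

Section compact_support_line.
Context (R : realType).
Local Notation leb := (@lebesgue_measure R).

Lemma integrable_continuous_itv (g : R -> R) (a b : R) : continuous g ->
  (forall x, x \notin `[a, b] -> g x = 0) -> leb.-integrable setT (EFin \o g).
Proof.
move=> cg g0.
have : leb.-integrable `[a, b] (EFin \o g).
  apply: continuous_compact_integrable; first exact: segment_compact.
  exact: continuous_subspaceT.
rewrite integrable_mkcond//; apply: eq_integrable => // x _.
rewrite patchE; case: ifPn => // /negP xab /=; rewrite g0//.
by apply/negP => h; apply: xab; rewrite inE.
Qed.

Lemma Rintegral_itvT (g : R -> R) (a b : R) :
  (forall x, x \notin `[a, b] -> g x = 0) ->
  \int[leb]_x g x = \int[leb]_(x in `[a, b]) g x.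
Proof.
move=> g0; rewrite [RHS]Rintegral_mkcond; apply: eq_Rintegral => x _.
rewrite patchE; case: ifPn => // /negP xab; apply: g0; apply/negP => ?; apply: xab.
by rewrite inE.
Qed.

Lemma Rintegral_derive (G g : R -> R) (a b : R) : a < b -> continuous g ->
  (forall x, is_derive x (1 : R) G (g x)) ->
  \int[leb]_(x in `[a, b]) g x = G b - G a.
Proof.
move=> ab cg dG; have derG x : derivable G x 1 by have [] := dG x.
have cG : continuous G.
  by move=> x; exact/differentiable_continuous/derivable1_diffP.
rewrite /Rintegral (@continuous_FTC2 _ g G)//.
- exact: continuous_subspaceT.
- split => [x _//||].
  + by apply: cvg_at_right_filter; exact: cG.
  + by apply: cvg_at_left_filter; exact: cG.
- by move=> x _; rewrite derive1E; have [_ ->] := dG x.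
Qed.

Lemma Rintegral_derive_eq0 (G g : R -> R) (M : R) : continuous g ->
  (forall x, is_derive x (1 : R) G (g x)) -> 
  (forall x, M < `|x| -> G x = 0) -> (forall x, M < `|x| -> g x = 0) ->
  \int[leb]_x g x = 0.
Proof.
(* The end points of [-(|M| + 1), |M| + 1] lie strictly outside the support, whatever the sign of
   [M]. *)
move=> cg dG G0 g0; have M0 : 0 < `|M| + 1 by rewrite ltr_wpDl.
have MM : M < `|M| + 1 by rewrite (le_lt_trans (ler_norm _))// ltrDl.
rewrite (@Rintegral_itvT g (- (`|M| + 1)) (`|M| + 1)); last first.
  move=> x; rewrite in_itv/= -ler_norml -ltNge => Mx; apply: g0.
  exact: lt_trans Mx.
rewrite (@Rintegral_derive G)//; last by rewrite gtrN.
by rewrite !G0 ?subrr// ?normrN gtr0_norm.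
Qed.

End compact_support_line.

(** * Integration over R^n by induction on the dimension *)

Section rV_integration.
Context (R : realType).
Local Notation mu n := (lebesgue_rV R n).
Local Notation leb := (@lebesgue_measure R).

Lemma continuous_rV (T : topologicalType) n (g : T -> 'rV[R]_n) :
  (forall i, continuous (fun t => g t ord0 i)) -> continuous g.
Proof.
move=> cg t; apply/cvgrPdist_lt => e e0.
have : \forall s \near t, forall i, `|g t ord0 i - g s ord0 i| < e.
  apply: filter_forall => i; move: (cg i t) => /cvgrPdist_lt; exact.
apply: filterS => s gs; apply: norm_lt_coord => // i.
by rewrite !mxE.
Qed.

Lemma continuous_cons_rVl n x : continuous (fun v : 'rV[R]_n => cons_rV (x, v)).
Proof.
apply: continuous_rV => i.
case: (unliftP ord0 i) => [j ->|->]; under eq_fun do rewrite mxE ?liftK ?unlift_none/=.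
  exact: continuous_coord.
by move=> v; exact: cst_continuous.
Qed.

Lemma continuous_cons_rVr n (v : 'rV[R]_n) : continuous (fun x : R => cons_rV (x, v)).
Proof.
apply: continuous_rV => i.
case: (unliftP ord0 i) => [j ->|->]; under eq_fun do rewrite mxE ?liftK ?unlift_none/=.
  by move=> x; exact: cst_continuous.
by move=> x; exact: cvg_id.
Qed.

Let prodT n : measurableType _ := (measurableTypeR R * 'rV[R]_n)%type.

Lemma ge0_integral_rVS n (F : 'rV[R]_n.+1 -> \bar R) : measurable_fun setT F ->
  (forall v, 0 <= F v)%E ->
  (\int[mu n.+1]_v F v = \int[(leb \x mu n)%E]_z F (cons_rV z))%E.
Proof.
move=> mF F0.
have := @ge0_integral_pushforward _ _ (prodT n) _ R (@cons_rV R n)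
  (@measurable_cons_rV R n) (leb \x mu n)%E setT F measurableT mF (fun y _ => F0 y).
by rewrite preimage_setT.
Qed.

Lemma integrable_rVS n (F : 'rV[R]_n.+1 -> R) : (mu n.+1).-integrable setT (EFin \o F) ->
  (leb \x mu n)%E.-integrable setT (EFin \o (F \o @cons_rV R n)).
Proof.
move=> /integrableP[mF iF]; apply/integrableP; split.
  by apply: (measurableT_comp mF); exact: measurable_cons_rV.
rewrite -(@ge0_integral_rVS n (fun v => `|(EFin \o F) v|%E))//.
exact: measurableT_comp.
Qed.

Lemma Rintegral_rVS n (F : 'rV[R]_n.+1 -> R) : (mu n.+1).-integrable setT (EFin \o F) ->
  \int[mu n.+1]_v F v = \int[(leb \x mu n)%E]_z F (cons_rV z).
Proof.
move=> iF; rewrite /Rintegral; congr fine.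
have := @integral_pushforward _ _ (prodT n) _ R (@cons_rV R n)
  (@measurable_cons_rV R n) (leb \x mu n)%E setT (EFin \o F).
rewrite preimage_setT; apply => //; first exact: measurable_int iF.
exact: integrable_rVS.
Qed.

Definition outside n (M : R) (v : 'rV[R]_n) := exists i, M < `|v ord0 i|.

Lemma outsideN n (M : R) (v : 'rV[R]_n) :
  ~ outside M v -> forall i, `|v ord0 i| <= M.
Proof. by move=> nv i; rewrite leNgt; apply/negP => Mv; apply: nv; exists i. Qed.

Definition cube n (c : 'rV[R]_n) (M : R) : set 'rV[R]_n :=
  [set v | forall i, `|v ord0 i - c ord0 i| <= M].

Lemma lebesgue_rV_cube n (c : 'rV[R]_n) (M : R) : 0 <= M ->
  mu n (cube c M) = ((2 * M) ^+ n)%:E.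
Proof.
move=> M0.
rewrite (_ : cube c M = [set v : 'rV[R]_n | forall i,
   `[c ord0 i - M, c ord0 i + M]%classic (v ord0 i)]); last first.
  by apply/seteqP; split=> v /= vM i; have := vM i; rewrite in_itv/= ler_distl.
rewrite (@lebesgue_rV_box R n (fun i => `[c ord0 i - M, c ord0 i + M]%classic)) => [|i].
  rewrite (eq_bigr (fun=> (2 * M)%:E)) => [|i _].
    by rewrite prodEFin prodr_const card_ord.
  rewrite lebesgue_measure_itv/= lte_fin.
  have -> : (c ord0 i - M < c ord0 i + M) = (0 < M) by lra.
  move: M0; rewrite le_eqVlt => /predU1P[<-|->]; first by rewrite ltxx mulr0.
  by rewrite -EFinD; congr EFin; ring.
exact: measurable_itv.
Qed.

Lemma lebesgue_rV_cube_lty n (c : 'rV[R]_n) (M : R) : 0 <= M ->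
  (mu n (cube c M) < +oo)%E.
Proof. by move=> M0; rewrite lebesgue_rV_cube// ltry. Qed.

Lemma measurable_cube n (c : 'rV[R]_n) (M : R) :
  measurable (cube c M).
Proof.
rewrite (_ : cube c M = [set v : 'rV[R]_n | forall i,
   `[c ord0 i - M, c ord0 i + M]%classic (v ord0 i)]); last first.
  by apply/seteqP; split=> v /= vM i; have := vM i; rewrite in_itv/= ler_distl.
by apply: (@measurable_set_box R n (fun i => `[c ord0 i - M, c ord0 i + M]%classic)).
Qed.

Lemma integrable_continuous_rV n (F : 'rV[R]_n -> R) (M : R) :
  continuous F -> (forall v, outside M v -> F v = 0) ->
  (mu n).-integrable setT (EFin \o F).
Proof.
move=> cF F0.
pose K := cube (0 : 'rV[R]_n) `|M|.
have mK : measurable K by exact: measurable_cube.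
have : (mu n).-integrable K (EFin \o F).
  apply: measurable_bounded_integrable => //.
  - by apply: lebesgue_rV_cube_lty.
  - by apply: measurable_funTS; exact: continuous_measurable_rV.
  - have [C C0 HC] := bounded_on_box `|M| cF.
    exists C; split; first exact: num_real.
    move=> C' CC' v Kv; rewrite /= (le_trans (HC v _))//; last exact: ltW.
    by move=> i; have := Kv i; rewrite mxE subr0.
rewrite integrable_mkcond//; apply: eq_integrable => // v _.
rewrite patchE; case: ifPn => //; rewrite notin_setE => Kv /=; rewrite F0//.
apply: contrapT => nv; apply: Kv => i; rewrite mxE subr0.
exact: le_trans (outsideN nv i) (ler_norm _).
Qed.

Lemma outside_cons n (M x : R) (v : 'rV[R]_n) : outside M v -> outside M (cons_rV (x, v)).
Proof. by move=> [i Mi]; exists (lift ord0 i); rewrite mxE liftK. Qed.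

Lemma outside_cons0 n (M x : R) (v : 'rV[R]_n) : M < `|x| -> outside M (cons_rV (x, v)).
Proof. by move=> Mx; exists ord0; rewrite mxE unlift_none. Qed.

Lemma cons_rV_delta n (x h : R) (v : 'rV[R]_n) j :
  h *: delta_mx ord0 (lift ord0 j) + cons_rV (x, v) =
  cons_rV (x, h *: delta_mx ord0 j + v).
Proof.
apply/rowP => i; rewrite !mxE eqxx/=; case: unliftP => [k ->|->] /=.
  by rewrite !mxE eqxx/= (inj_eq lift_inj).
by rewrite mulr0 add0r.
Qed.

Lemma cons_rV_delta0 n (x h : R) (v : 'rV[R]_n) :
  h *: delta_mx ord0 ord0 + cons_rV (x, v) = cons_rV (h *: (1 : R) + x, v).
Proof.
apply/rowP => i; rewrite !mxE eqxx/=; case: unliftP => [k ->|->] /=.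
  by rewrite mulr0 add0r.
by rewrite /GRing.scale/= !mulr1.
Qed.

(** Fubini splits off coordinate 0. If the derivative is along another coordinate, the induction
    hypothesis applies to each slice; if it is along coordinate 0, that integral is done first, by
    the one-dimensional case. *)
Lemma divergence_eq0 n (F dF : 'rV[R]_n -> R) (i : 'I_n) (M : R) :
  continuous dF ->
  (forall v, is_derive v (delta_mx ord0 i) F (dF v)) ->
  (forall v, outside M v -> F v = 0) -> (forall v, outside M v -> dF v = 0) ->
  \int[mu n]_v dF v = 0.
Proof.
elim: n i F dF => [[]//|n IHn] i F dF cdF FdF F0 dF0.
have idF := integrable_continuous_rV cdF dF0.
rewrite Rintegral_rVS//; have idFc := integrable_rVS idF.
case: (unliftP ord0 i) FdF => [j ->|->] FdF.
- rewrite (Rintegral_prod1 idFc) (@eq_Rintegral _ _ _ _ _ (cst 0)).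
    by rewrite Rintegral_cst// mul0r.
  move=> x _; apply: (IHn j (fun v => F (cons_rV (x, v)))).
  + move=> v; apply: (@continuous_comp _ _ _ (fun v => cons_rV (x, v)) dF).
      exact: continuous_cons_rVl.
    exact: cdF.
  + move=> v; have [dv ev] := FdF (cons_rV (x, v)).
    have E : (fun h : R => h^-1 *: (F (h *: delta_mx ord0 (lift ord0 j) + cons_rV (x, v))
        - F (cons_rV (x, v)))) =
      (fun h : R => h^-1 *: (F (cons_rV (x, h *: delta_mx ord0 j + v))
        - F (cons_rV (x, v)))).
      by apply/funext => h; rewrite cons_rV_delta.
    by split; [move: dv; rewrite /derivable/= E|move: ev; rewrite /derive/= E].
  + by move=> v ov; apply: F0; exact: outside_cons.
  + by move=> v ov; apply: dF0; exact: outside_cons.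
- rewrite (Rintegral_prod2 idFc) (@eq_Rintegral _ _ _ _ _ (cst 0)).
    by rewrite Rintegral_cst// mul0r.
  move=> v _; apply: (@Rintegral_derive_eq0 _ (fun x => F (cons_rV (x, v))) _ M).
  + move=> x; apply: (@continuous_comp _ _ _ (fun x => cons_rV (x, v)) dF).
      exact: continuous_cons_rVr.
    exact: cdF.
  + move=> x; have [dv ev] := FdF (cons_rV (x, v)).
    have E : (fun h : R => h^-1 *: (F (h *: delta_mx ord0 ord0 + cons_rV (x, v))
        - F (cons_rV (x, v)))) =
      (fun h : R => h^-1 *: (F (cons_rV (h *: (1 : R) + x, v))
        - F (cons_rV (x, v)))).
      by apply/funext => h; rewrite cons_rV_delta0.
    by split; [move: dv; rewrite /derivable/= E|move: ev; rewrite /derive/= E].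
  + by move=> x Mx; apply: F0; exact: outside_cons0.
  + by move=> x Mx; apply: dF0; exact: outside_cons0.
Qed.

(** Tonelli in extended reals: nonnegativity spares any integrability hypothesis. This computes the
    mass of a product mollifier. *)
Lemma integral_rV_prod n (g : 'I_n -> R -> R) : (forall i, continuous (g i)) ->
  (forall i x, 0 <= g i x) ->
  (\int[mu n]_v (\prod_(i < n) g i (v ord0 i))%:E =
   \prod_(i < n) \int[leb]_x (g i x)%:E)%E.
Proof.
elim: n g => [|n IHn] g cg g0.
  rewrite big_ord0 (_ : (fun _ => _) = (cst 1%E)).
    by rewrite integral_cst//= mul1e diracT.
  by apply/funext => v; rewrite big_ord0.
have cprod m (h : 'I_m -> R -> R) : (forall i, continuous (h i)) ->
    continuous (fun v : 'rV[R]_m => \prod_(i < m) h i (v ord0 i)).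
  move=> ch; elim: (index_enum _) => [|i r IHr].
    by under eq_fun do rewrite big_nil; move=> v; exact: cst_continuous.
  under eq_fun do rewrite big_cons; move=> v; apply: continuousM; last exact: IHr.
  by apply: (@continuous_comp _ _ _ (fun v : 'rV[R]_m => v ord0 i) (h i));
    [exact: continuous_coord|exact: ch].
have mprod : measurable_fun setT (fun v : 'rV[R]_n.+1 => (\prod_(i < n.+1) g i (v ord0 i))%:E).
  by apply/measurable_EFinP; apply: continuous_measurable_rV; exact: cprod.
have prod0 m (h : 'I_m -> R -> R) : (forall i x, 0 <= h i x) ->
    forall v : 'rV[R]_m, 0 <= \prod_(i < m) h i (v ord0 i).
  by move=> h0 v; apply: prodr_ge0.
rewrite ge0_integral_rVS//; last by move=> v; rewrite lee_fin prod0.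
rewrite fubini_tonelli1//=; last first.
- by move=> z; rewrite lee_fin prod0.
- by apply: (measurableT_comp mprod); exact: measurable_cons_rV.
rewrite big_ord_recl -IHn//.
have g0x : measurable_fun setT (fun x => (g ord0 x)%:E).
  by apply/measurable_EFinP; exact: continuous_measurable_fun.
rewrite -ge0_integralZr//; last 2 first.
- by move=> x _; rewrite lee_fin.
- apply: integral_ge0 => v _; rewrite lee_fin.
  by apply: (prod0 n (fun i => g (lift ord0 i))).
apply: eq_integral => x _; rewrite /fubini_F -ge0_integralZl//; last 3 first.
- apply/measurable_EFinP; apply: continuous_measurable_rV.
  by apply: (cprod n (fun i => g (lift ord0 i))) => i.
- by move=> v _; rewrite lee_fin; apply: (prod0 n (fun i => g (lift ord0 i))).
- by rewrite lee_fin.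
apply: eq_integral => v _ /=; rewrite big_ord_recl mxE unlift_none/= -EFinM.
by congr (_ * _)%:E; apply: eq_bigr => i _; rewrite mxE liftK.
Qed.

End rV_integration.

(** * Integrable and square-integrable real functions *)

Section rintegrable.
Context d (T : measurableType d) (R : realType) (m : {measure set T -> \bar R}).
Implicit Types f g h : T -> R.

Definition rintegrable f := m.-integrable setT (EFin \o f).

Lemma rintegrable_measurable f : rintegrable f -> measurable_fun setT f.
Proof. by move=> fi; apply/measurable_EFinP; exact: measurable_int fi. Qed.

Lemma rintegrable_le g f : measurable_fun setT f -> (forall x, `|f x| <= g x) -> rintegrable g ->
  rintegrable f.
Proof.
move=> mf fg gi; apply: (le_integrable measurableT _ _ gi).
  exact/measurable_EFinP.
by move=> x _ /=; rewrite lee_fin (le_trans (fg x))// ler_norm.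
Qed.

Lemma rintegrable0 : rintegrable (fun=> 0).
Proof. exact: integrable0. Qed.

Lemma rintegrableD f g : rintegrable f -> rintegrable g -> rintegrable (fun x => f x + g x).
Proof.
move=> fi gi; have := (integrableD measurableT fi gi).
by apply: eq_integrable.
Qed.

Lemma rintegrableB f g : rintegrable f -> rintegrable g -> rintegrable (fun x => f x - g x).
Proof.
move=> fi gi; have := (integrableB measurableT fi gi).
by apply: eq_integrable.
Qed.

Lemma rintegrableZl c f : rintegrable f -> rintegrable (fun x => c * f x).
Proof.
move=> fi; have := (integrableZl measurableT c fi).
by apply: eq_integrable.
Qed.

Lemma rintegrableZr c f : rintegrable f -> rintegrable (fun x => f x * c).
Proof. by move=> fi; under eq_fun do rewrite mulrC; exact: rintegrableZl. Qed.

Lemma rintegrable_norm f : rintegrable f -> rintegrable (fun x => `|f x|).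
Proof. exact: integrable_norm. Qed.

Lemma rintegrable_sum (I : Type) (s : seq I) (f : I -> T -> R) :
  (forall i, rintegrable (f i)) -> rintegrable (fun x => \sum_(i <- s) f i x).
Proof.
move=> fi; elim: s => [|i s IHs].
  by under eq_fun do rewrite big_nil; exact: rintegrable0.
by under eq_fun do rewrite big_cons; exact: rintegrableD.
Qed.

Lemma rintegrable_bounded f g (C : R) : rintegrable f -> measurable_fun setT g ->
  (forall x, `|g x| <= C) -> rintegrable (fun x => f x * g x).
Proof.
move=> fi mg gC; apply: (@rintegrable_le (fun x => `|f x| * C)).
- exact: (measurable_funM (rintegrable_measurable fi)).
- by move=> x; rewrite normrM ler_wpM2l.
- exact/rintegrableZr/rintegrable_norm.
Qed.

Lemma rintegrable_indic (A : set T) : measurable A -> (m A < +oo)%E ->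
  rintegrable (\1_A : T -> R).
Proof.
move=> mA fA; apply/integrableP; split.
  by apply/measurable_EFinP; exact: measurable_indic.
rewrite (eq_integral (fun x => (\1_A x)%:E)); last first.
  by move=> t _; rewrite gee0_abs// lee_fin.
by rewrite integral_indic// setIT.
Qed.

Lemma ae_eq_Rintegral f g : measurable_fun setT f -> measurable_fun setT g ->
  {ae m, forall x, f x = g x} -> \int[m]_x f x = \int[m]_x g x.
Proof.
move=> mf mg fg; rewrite /Rintegral; congr fine; apply: ae_eq_integral => //.
- exact/measurable_EFinP.
- exact/measurable_EFinP.
- by apply: filterS fg => x /= -> _.
Qed.

Lemma Rintegral_sum (I : Type) (s : seq I) (f : I -> T -> R) :
  (forall i, rintegrable (f i)) ->
  \int[m]_x (\sum_(i <- s) f i x) = \sum_(i <- s) \int[m]_x f i x.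
Proof.
move=> fi; elim: s => [|i s IHs].
  by under eq_Rintegral do rewrite big_nil; rewrite Rintegral_cst// mul0r big_nil.
under eq_Rintegral do rewrite big_cons.
by rewrite RintegralD//; [rewrite big_cons IHs|exact: fi|exact: rintegrable_sum].
Qed.

Lemma Rintegral_le f g : rintegrable f -> rintegrable g -> (forall x, f x <= g x) ->
  \int[m]_x f x <= \int[m]_x g x.
Proof. by move=> fi gi fg; apply: le_Rintegral. Qed.

Lemma Rintegral_norm_le f g : rintegrable f -> rintegrable g -> (forall x, `|f x| <= g x) ->
  `|\int[m]_x f x| <= \int[m]_x g x.
Proof.
move=> fi gi fg; apply: (le_trans (le_normr_Rintegral measurableT fi)).
by apply: Rintegral_le => //; exact: rintegrable_norm.
Qed.

Lemma EFin_Rintegral f : rintegrable f -> (\int[m]_x f x)%:E = (\int[m]_x (f x)%:E)%E.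
Proof. by move=> fi; rewrite /Rintegral fineK//; exact: integrable_fin_num. Qed.

Lemma Rdominated_cvg (f_ : nat -> T -> R) f g :
  (forall k, measurable_fun setT (f_ k)) -> measurable_fun setT f ->
  {ae m, forall x, f_ k x @[k --> \oo] --> f x} ->
  rintegrable g -> (forall k x, `|f_ k x| <= g x) ->
  rintegrable f /\ \int[m]_x f_ k x @[k --> \oo] --> \int[m]_x f x.
Proof.
move=> mf_ mf f_f gi f_g.
have [] := @dominated_convergence _ _ _ m setT measurableT
  (fun k => EFin \o f_ k) (EFin \o f) (EFin \o g) _ _ _ gi _.
- by move=> k; exact/measurable_EFinP.
- exact/measurable_EFinP.
- by apply: filterS f_f => x fx _; apply: cvg_EFin => //; exact: nearW.
- by apply: nearW => x k _ /=; rewrite lee_fin.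
move=> fi _ cv; split => //.
have f_i k : rintegrable (f_ k) by exact: (rintegrable_le (mf_ k) (f_g k)).
by apply: fine_cvg; rewrite -/(Rintegral _ _ _) EFin_Rintegral.
Qed.

Definition sq_integrable f := measurable_fun setT f /\ rintegrable (fun x => f x ^+ 2).

(** The square of the L^2 norm. Squares add over the components of a gradient and pass through
    Tonelli, without any square root. *)
Definition sqint f := \int[m]_x (f x ^+ 2).

Lemma sqint_ge0 f : 0 <= sqint f.
Proof. by apply: Rintegral_ge0 => x _; exact: sqr_ge0. Qed.

(** The difference of the two sides is a square divided by [2 * c]. The weight [c] stays free in
    order to balance a small factor against one that is not small. *)
Lemma young_le (c u v : R) : 0 < c -> `|u * v| <= (c * u ^+ 2 + c^-1 * v ^+ 2) / 2.
Proof.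
move=> c0; rewrite normrM -[u ^+ 2]real_normK ?num_real// -[v ^+ 2]real_normK ?num_real//.
set x := `|u|; set y := `|v|; rewrite -subr_ge0.
have -> : (c * x ^+ 2 + c^-1 * y ^+ 2) / 2 - x * y = (c * x - y) ^+ 2 / (2 * c).
  by field; rewrite gt_eqF.
by rewrite divr_ge0 ?sqr_ge0// mulr_ge0// ltW.
Qed.

Lemma rintegrable_sqM f g : sq_integrable f -> sq_integrable g -> rintegrable (fun x => f x * g x).
Proof.
move=> [mf fi] [mg gi]; apply: (@rintegrable_le (fun x => (1 * f x ^+ 2 + 1^-1 * g x ^+ 2) / 2)).
- exact: measurable_funM.
- by move=> x; exact: young_le.
- by apply: rintegrableZr; apply: rintegrableD; exact: rintegrableZl.
Qed.

Lemma normr_Rintegral_sqM c f g : 0 < c -> sq_integrable f -> sq_integrable g ->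
  `|\int[m]_x (f x * g x)| <= (c * sqint f + c^-1 * sqint g) / 2.
Proof.
move=> c0 fs gs; have [mf fi] := fs; have [mg gi] := gs.
have e : rintegrable (fun x => (c * f x ^+ 2 + c^-1 * g x ^+ 2) / 2).
  by apply: rintegrableZr; apply: rintegrableD; exact: rintegrableZl.
apply: (le_trans (Rintegral_norm_le (rintegrable_sqM fs gs) e (fun x => young_le _ _ c0))).
rewrite RintegralZr//; last by apply: rintegrableD; exact: rintegrableZl.
rewrite RintegralD//; [|exact: rintegrableZl|exact: rintegrableZl].
by rewrite !RintegralZl.
Qed.

Lemma sq_integrable_le g f : measurable_fun setT f -> (forall x, `|f x| <= `|g x|) ->
  sq_integrable g -> sq_integrable f.
Proof.
move=> mf fg [mg gi]; split => //; apply: (@rintegrable_le (fun x => g x ^+ 2)) => //.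
  exact: measurable_funX.
by move=> x; rewrite normrX -[g x ^+ 2]real_normK ?num_real// lerXn2r ?nnegrE.
Qed.

Lemma sq_integrableZ c f : sq_integrable f -> sq_integrable (fun x => c * f x).
Proof.
move=> [mf fi]; split; first exact: measurable_funM.
by under eq_fun do rewrite exprMn; exact: rintegrableZl.
Qed.

Lemma sq_integrableD f g : sq_integrable f -> sq_integrable g ->
  sq_integrable (fun x => f x + g x).
Proof.
move=> fs gs; have [mf fi] := fs; have [mg gi] := gs.
split; first exact: measurable_funD.
under eq_fun do rewrite sqrrD.
apply: rintegrableD => //; apply: rintegrableD => //.
under eq_fun do rewrite -mulr_natl.
exact/rintegrableZl/rintegrable_sqM.
Qed.

Lemma sq_integrableB f g : sq_integrable f -> sq_integrable g ->
  sq_integrable (fun x => f x - g x).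
Proof.
move=> fs gs; have := sq_integrableD fs (sq_integrableZ (-1) gs).
by under [X in sq_integrable X]eq_fun do rewrite mulN1r.
Qed.

Lemma sq_integrable_bounded f g (C : R) : sq_integrable f -> measurable_fun setT g ->
  (forall x, `|g x| <= C) -> sq_integrable (fun x => f x * g x).
Proof.
move=> fs mg gC; have [mf _] := fs; apply: sq_integrable_le (sq_integrableZ C fs).
  exact: measurable_funM.
by move=> x; rewrite !normrM mulrC ler_wpM2r// (le_trans (gC x))// ler_norm.
Qed.

Lemma sq_integrable0 : sq_integrable (fun=> 0).
Proof. by split => //; under eq_fun do rewrite expr0n/=; exact: rintegrable0. Qed.

Lemma sqintD_le f g : sq_integrable f -> sq_integrable g ->
  sqint (fun x => f x + g x) <= 2 * sqint f + 2 * sqint g.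
Proof.
move=> fs gs; have [mf fi] := fs; have [mg gi] := gs.
rewrite -RintegralZl// -RintegralZl// -RintegralD//; [|exact: rintegrableZl|exact: rintegrableZl].
apply: Rintegral_le.
- by have [] := sq_integrableD fs gs.
- by apply: rintegrableD; exact: rintegrableZl.
- move=> x; rewrite -subr_ge0.
  have -> : 2 * f x ^+ 2 + 2 * g x ^+ 2 - (f x + g x) ^+ 2 = (f x - g x) ^+ 2 by ring.
  exact: sqr_ge0.
Qed.

End rintegrable.

Section in_L2_sq_integrable.
Context (R : realType) (n : nat).
Local Notation mu := (lebesgue_rV R n).

Lemma in_L2_sq (g : 'rV[R]_n -> R) : in_L2 g -> sq_integrable mu g.
Proof.
rewrite /in_L2/= => g2; split; last exact: Lfun2_integrable_sqr.
by move: g2; rewrite inE => /andP[/[!inE]].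
Qed.

Lemma L2norm_sq (g : 'rV[R]_n -> R) : in_L2 g -> L2norm g ^+ 2 = sqint mu g.
Proof.
move=> g2; have [mg gi] := in_L2_sq g2.
have N := powR_Lnorm mu (EFin \o g) (_ : (2 : R) != 0).
have g2' : g \in Lfun mu 2%:E := g2.
have fin : ('N[mu]_2%:E[EFin \o g] < +oo)%E.
  by move: g2'; rewrite inE => /andP[_]; rewrite inE.
have E : ('N[mu]_2%:E[EFin \o g] `^ 2 = (sqint mu g)%:E)%E.
  rewrite N; last by rewrite gt_eqF.
  rewrite EFin_Rintegral//; apply: eq_integral => x _ /=.
  by rewrite powR_mulrn// real_normK ?num_real.
have f : 'N[mu]_2%:E[EFin \o g]%E \is a fin_num.
  by rewrite ge0_fin_numE ?Lnorm_ge0.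
apply: EFin_inj; rewrite -E /L2norm -{2}(fineK f) poweR_EFin.
by rewrite powR_mulrn// fine_ge0// Lnorm_ge0.
Qed.

Lemma L2norm_ge0 (g : 'rV[R]_n -> R) : 0 <= L2norm g.
Proof. by rewrite /L2norm fine_ge0// Lnorm_ge0. Qed.

End in_L2_sq_integrable.

(** * Mollifier kernels *)

Section kernels.
Context (R : realType) (n : nat).
Local Notation mu := (lebesgue_rV R n).
Local Notation rV := 'rV[R]_n.
Implicit Types (g h : rV -> R) (N : rV * rV -> R).

(** Height [A] within distance [e] of the diagonal: in either variable the majorant has mass
    [A * (2 * e) ^+ n], the constant of Schur's test. *)
Definition kernel_bound N (A e : R) :=
  forall x y, `|N (x, y)| <= A * \1_(cube y e) x.

Lemma cube_sym (x y : rV) (e : R) : cube y e x = cube x e y.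
Proof. by apply/propext; split=> xy i; rewrite distrC; exact: xy. Qed.

Lemma measurable_near_diagonal (e : R) :
  measurable_fun setT (fun z : rV * rV => \1_(cube z.2 e) z.1 : R).
Proof.
rewrite (_ : (fun z => _) = \1_(cube (0 : rV) e) \o (fun z : rV * rV => z.1 - z.2)).
  apply: measurableT_comp; last exact: measurable_rV_sub2.
  by apply: measurable_indic; exact: measurable_cube.
apply/funext => z; rewrite /= !indicE; congr (_%:R); congr nat_of_bool.
apply/idP/idP; rewrite !inE => h i; have := h i; rewrite !mxE subr0//.
Qed.

Lemma integral_cube_indic (y : rV) (e A : R) : 0 <= e -> 0 <= A ->
  (\int[mu]_x (A * \1_(cube y e) x)%:E = (A * (2 * e) ^+ n)%:E)%E.
Proof.
move=> e0 A0; have mc := @measurable_cube R n y e.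
have mi : measurable_fun setT (EFin \o (\1_(cube y e) : rV -> R)).
  by apply/measurable_EFinP; exact: measurable_indic.
rewrite (@eq_integral _ _ _ _ _ (fun x => A%:E * (EFin \o \1_(cube y e)) x)%E)//.
rewrite ge0_integralZl//; last by move=> x _; rewrite lee_fin.
by rewrite integral_indic// setIT EFinM; congr (_ * _)%E; exact: lebesgue_rV_cube.
Qed.

Lemma integral_cube_indic' (x : rV) (e A : R) : 0 <= e -> 0 <= A ->
  (\int[mu]_y (A * \1_(cube y e) x)%:E = (A * (2 * e) ^+ n)%:E)%E.
Proof.
move=> e0 A0; rewrite -(@integral_cube_indic x e A)//; apply: eq_integral => y _.
congr (_%:E); congr (_ * _); rewrite !indicE; congr (_%:R); congr nat_of_bool.
by apply/idP/idP; rewrite !inE cube_sym.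
Qed.

Variables (N : rV * rV -> R) (A e M : R).
Hypotheses (mN : measurable_fun setT N) (A0 : 0 <= A) (e0 : 0 <= e).
Hypotheses (bN : kernel_bound N A e) (AM : A * (2 * e) ^+ n <= M).

Let k (z : rV * rV) := A * \1_(cube z.2 e) z.1.

Let k0 z : 0 <= k z. Proof. by rewrite mulr_ge0. Qed.

Let mk : measurable_fun setT k.
Proof. by apply: measurable_funM => //; exact: measurable_near_diagonal. Qed.

Let rintegrable_sq_kernel1 g : sq_integrable mu g ->
  rintegrable (mu \x mu)%E (fun z => g z.1 ^+ 2 * k z) /\
  \int[(mu \x mu)%E]_z (g z.1 ^+ 2 * k z) <= M * sqint mu g.
Proof.
move=> gs; have [mg gi] := gs.
have m1 : measurable_fun setT (fun z : rV * rV => g z.1 ^+ 2 * k z).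
  apply: measurable_funM => //; apply: measurable_funX.
  exact: (measurableT_comp mg measurable_fst).
have E : (\int[(mu \x mu)%E]_z (g z.1 ^+ 2 * k z)%:E <= (M * sqint mu g)%:E)%E.
  rewrite fubini_tonelli1; last 2 first.
  - exact/measurable_EFinP.
  - by move=> z; rewrite lee_fin mulr_ge0// sqr_ge0.
  rewrite /sqint -RintegralZl// EFin_Rintegral; last exact: rintegrableZl.
  apply: ge0_le_integral => //.
  - by move=> x _; apply: integral_ge0 => y _; rewrite lee_fin mulr_ge0// sqr_ge0.
  - apply: measurable_fun_fubini_tonelli_F; first exact/measurable_EFinP.
    by move=> z; rewrite lee_fin mulr_ge0// sqr_ge0.
  - by apply/measurable_EFinP; apply: measurable_funM => //; exact: measurable_funX.
  - move=> x _; rewrite /fubini_F/=.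
    under eq_integral do rewrite EFinM.
    rewrite ge0_integralZl//; last 3 first.
    + apply/measurable_EFinP.
      exact: (measurableT_comp mk (pair1_measurable x)).
    + by move=> y _; rewrite lee_fin.
    + by rewrite lee_fin sqr_ge0.
    by rewrite integral_cube_indic'// -EFinM lee_fin mulrC ler_wpM2r// sqr_ge0.
have I : rintegrable (mu \x mu)%E (fun z => g z.1 ^+ 2 * k z).
  apply/integrableP; split; first exact/measurable_EFinP.
  apply: le_lt_trans (ltry (M * sqint mu g)); apply: le_trans E.
  rewrite le_eqVlt; apply/orP; left; apply/eqP; apply: eq_integral => z _ /=.
  by rewrite ger0_norm// mulr_ge0// sqr_ge0.
by split => //; rewrite -lee_fin EFin_Rintegral.
Qed.

Let rintegrable_sq_kernel2 h : sq_integrable mu h ->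
  rintegrable (mu \x mu)%E (fun z => h z.2 ^+ 2 * k z) /\
  \int[(mu \x mu)%E]_z (h z.2 ^+ 2 * k z) <= M * sqint mu h.
Proof.
move=> gs; have [mg gi] := gs.
have m1 : measurable_fun setT (fun z : rV * rV => h z.2 ^+ 2 * k z).
  apply: measurable_funM => //; apply: measurable_funX.
  exact: (measurableT_comp mg measurable_snd).
have E : (\int[(mu \x mu)%E]_z (h z.2 ^+ 2 * k z)%:E <= (M * sqint mu h)%:E)%E.
  rewrite fubini_tonelli2; last 2 first.
  - exact/measurable_EFinP.
  - by move=> z; rewrite lee_fin mulr_ge0// sqr_ge0.
  rewrite /sqint -RintegralZl// EFin_Rintegral; last exact: rintegrableZl.
  apply: ge0_le_integral => //.
  - by move=> x _; apply: integral_ge0 => y _; rewrite lee_fin mulr_ge0// sqr_ge0.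
  - apply: measurable_fun_fubini_tonelli_G; first exact/measurable_EFinP.
    by move=> z; rewrite lee_fin mulr_ge0// sqr_ge0.
  - by apply/measurable_EFinP; apply: measurable_funM => //; exact: measurable_funX.
  - move=> x _; rewrite /fubini_G/=.
    under eq_integral do rewrite EFinM.
    rewrite ge0_integralZl//; last 3 first.
    + apply/measurable_EFinP.
      exact: (measurableT_comp mk (pair2_measurable x)).
    + by move=> y _; rewrite lee_fin.
    + by rewrite lee_fin sqr_ge0.
    by rewrite integral_cube_indic// -EFinM lee_fin mulrC ler_wpM2r// sqr_ge0.
have I : rintegrable (mu \x mu)%E (fun z => h z.2 ^+ 2 * k z).
  apply/integrableP; split; first exact/measurable_EFinP.
  apply: le_lt_trans (ltry (M * sqint mu h)); apply: le_trans E.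
  rewrite le_eqVlt; apply/orP; left; apply/eqP; apply: eq_integral => z _ /=.
  by rewrite ger0_norm// mulr_ge0// sqr_ge0.
by split => //; rewrite -lee_fin EFin_Rintegral.
Qed.

Let kernel_young (c : R) g h (z : rV * rV) : 0 < c ->
  `|g z.1 * h z.2 * N z| <=
  (c * (g z.1 ^+ 2 * k z) + c^-1 * (h z.2 ^+ 2 * k z)) / 2.
Proof.
move=> c0; have -> : (c * (g z.1 ^+ 2 * k z) + c^-1 * (h z.2 ^+ 2 * k z)) / 2 =
  (c * g z.1 ^+ 2 + c^-1 * h z.2 ^+ 2) / 2 * k z by ring.
rewrite normrM; apply: ler_pM => //; first exact: young_le.
by have := bN z.1 z.2; rewrite -surjective_pairing.
Qed.

Lemma measurable_kernel g h : measurable_fun setT g -> measurable_fun setT h ->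
  measurable_fun setT (fun z : rV * rV => g z.1 * h z.2 * N z).
Proof.
move=> mg mh; apply: measurable_funM => //; apply: measurable_funM.
- exact: (measurableT_comp mg measurable_fst).
- exact: (measurableT_comp mh measurable_snd).
Qed.

Lemma rintegrable_kernel g h : sq_integrable mu g -> sq_integrable mu h ->
  rintegrable (mu \x mu)%E (fun z => g z.1 * h z.2 * N z).
Proof.
move=> gs hs; have [mg _] := gs; have [mh _] := hs.
apply: (rintegrable_le _ (fun z => @kernel_young 1 g h z ltr01)).
  exact: measurable_kernel.
apply: rintegrableZr; apply: rintegrableD; apply: rintegrableZl.
  by have [] := rintegrable_sq_kernel1 gs.
by have [] := rintegrable_sq_kernel2 hs.
Qed.

(** Schur's test. After Young's inequality each square depends on one variable only, and integrating
    the majorant of the kernel in the other variable costs at most [M]. *)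
Lemma normr_Rintegral_kernel c g h : 0 < c ->
  sq_integrable mu g -> sq_integrable mu h ->
  `|\int[(mu \x mu)%E]_z (g z.1 * h z.2 * N z)| <=
  M * (c * sqint mu g + c^-1 * sqint mu h) / 2.
Proof.
move=> c0 gs hs.
have [i1 l1] := rintegrable_sq_kernel1 gs; have [i2 l2] := rintegrable_sq_kernel2 hs.
have I : rintegrable (mu \x mu)%E
    (fun z => (c * (g z.1 ^+ 2 * k z) + c^-1 * (h z.2 ^+ 2 * k z)) / 2).
  by apply: rintegrableZr; apply: rintegrableD; exact: rintegrableZl.
apply: (le_trans (Rintegral_norm_le (rintegrable_kernel gs hs) I (fun z => kernel_young g h z c0))).
rewrite RintegralZr//; last by apply: rintegrableD; exact: rintegrableZl.
rewrite RintegralD//; [|exact: rintegrableZl|exact: rintegrableZl].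
rewrite !RintegralZl// ler_wpM2r ?invr_ge0// mulrDr.
have ci : 0 < c^-1 by rewrite invr_gt0.
by rewrite lerD// [M * _]mulrCA ler_wpM2l// ltW.
Qed.

Lemma rintegrable_kernel_slice (y : rV) : rintegrable mu (fun x => N (x, y)).
Proof.
apply: (@rintegrable_le _ _ _ mu (fun x => A * \1_(cube y e) x)).
- exact: (measurableT_comp mN (pair2_measurable y)).
- by move=> x; exact: bN.
- apply/rintegrableZl/rintegrable_indic; first exact: measurable_cube.
  exact: lebesgue_rV_cube_lty.
Qed.

(** A bound independent of [y], which serves as the dominating constant for smoothed indicators of
    boxes. *)
Lemma normr_kernel_slice (y : rV) (D : set rV) : measurable D ->
  `|\int[mu]_x (\1_D x * N (x, y))| <= M.
Proof.
move=> mD.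
have I : rintegrable mu (fun x => A * \1_(cube y e) x).
  apply/rintegrableZl/rintegrable_indic; first exact: measurable_cube.
  exact: lebesgue_rV_cube_lty.
have E : \int[mu]_x (A * \1_(cube y e) x) = A * (2 * e) ^+ n.
  by apply: EFin_inj; rewrite EFin_Rintegral// integral_cube_indic.
apply: le_trans AM; rewrite -E.
apply: Rintegral_norm_le => //.
  under eq_fun do rewrite mulrC.
  apply: (@rintegrable_bounded _ _ _ _ _ _ 1); first exact: rintegrable_kernel_slice.
  - exact: measurable_indic.
  - by move=> x; rewrite indicE; case: (_ \in _); rewrite ?normr0 ?normr1.
move=> x; rewrite normrM; apply: le_trans (bN x y).
rewrite ler_piMl// indicE; case: (_ \in _); rewrite ?normr0 ?normr1//.
Qed.

End kernels.

(** * Approximate identities in L^2 *)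

Section approximate_identity.
Context (R : realType) (n : nat).
Local Notation mu := (lebesgue_rV R n).
Local Notation rV := 'rV[R]_n.

Lemma negligible_hyperplane (i : 'I_n) (c : R) : mu [set v : rV | v ord0 i = c] = 0%E.
Proof.
rewrite (_ : mkset _ = [set v : rV | forall j,
    (if j == i then [set c] else setT) (v ord0 j)]); last first.
  apply/seteqP; split=> [v /= vc j|v /= /(_ i)]; last by rewrite eqxx.
  by case: eqVneq => [->|].
rewrite (@lebesgue_rV_box R n (fun j => if j == i then [set c] else setT)).
  by rewrite (bigD1 i)//= eqxx lebesgue_measure_set1 mul0e.
by move=> j; case: ifP => _ //; exact: measurable_set1.
Qed.

(** The smoothed indicator of a box need not converge to the indicator on the faces, but these are
    null sets. *)
Lemma negligible_obox_boundary (a b : rV) :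
  {ae mu, forall v : rV, forall i, v ord0 i != a ord0 i /\ v ord0 i != b ord0 i}.
Proof.
have H i c : {ae mu, forall v : rV, v ord0 i != c}.
  exists [set v : rV | v ord0 i = c]; split.
  - rewrite -[X in measurable X]setTI.
    exact: (measurable_coord_rV i measurableT (measurable_set1 c)).
  - exact: negligible_hyperplane.
  - by move=> v /= /negP; rewrite negbK => /eqP.
have : {ae mu, forall v : rV, forall i, v ord0 i != a ord0 i}.
  apply: filter_forall => i; exact: H.
have : {ae mu, forall v : rV, forall i, v ord0 i != b ord0 i}.
  apply: filter_forall => i; exact: H.
by apply: filterS2 => v va vb i; split.
Qed.

Variables (N : nat -> rV * rV -> R) (A e : nat -> R) (M c : R) (h : rV -> R).
Hypotheses (mN : forall k, measurable_fun setT (N k)).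
Hypotheses (A0 : forall k, 0 <= A k) (e0 : forall k, 0 <= e k).
Hypotheses (bN : forall k, kernel_bound (N k) (A k) (e k)).
Hypotheses (AM : forall k, A k * (2 * e k) ^+ n <= M).
Hypothesis (ecvg : e k @[k --> \oo] --> 0).
Hypothesis (Nc : forall k y, \int[mu]_x N k (x, y) = c).
Hypotheses (hs : sq_integrable mu h) (hi : rintegrable mu h).

(* [P] holds for indicators of boxes, hence, by a monotone class argument, for
   those of bounded measurable sets, and it passes to L^2 limits. *)
Let Q k (g : rV -> R) := \int[(mu \x mu)%E]_z (g z.1 * h z.2 * N k z).
Let P (g : rV -> R) := Q k g @[k --> \oo] --> c * \int[mu]_x (g x * h x).

Let M0 : 0 <= M.
Proof. by apply: le_trans (AM 0%N); rewrite mulr_ge0// exprn_ge0// mulr_ge0. Qed.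

Let PZ a g : sq_integrable mu g -> P g -> P (fun x => a * g x).
Proof.
move=> gs Pg; rewrite /P.
rewrite (_ : (fun k => _) = (fun k => a * Q k g)).
  rewrite (_ : c * _ = a * (c * \int[mu]_x (g x * h x))).
    by apply: cvgMr; exact: Pg.
  rewrite (_ : \int[mu]_x (a * g x * h x) = a * \int[mu]_x (g x * h x)); first by ring.
  rewrite -RintegralZl//; last exact: rintegrable_sqM.
  by apply: eq_Rintegral => x _; rewrite mulrA.
apply/funext => k; rewrite -RintegralZl//.
  by apply: eq_Rintegral => x _; rewrite !mulrA.
exact: (rintegrable_kernel (mN k) (A0 k) (e0 k) (bN k) (AM k)).
Qed.

Let PD g1 g2 : sq_integrable mu g1 -> sq_integrable mu g2 -> P g1 -> P g2 ->
  P (fun x => g1 x + g2 x).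
Proof.
move=> s1 s2 P1 P2; rewrite /P.
rewrite (_ : (fun k => _) = (fun k => Q k g1 + Q k g2)).
  rewrite (_ : c * _ = c * \int[mu]_x (g1 x * h x) + c * \int[mu]_x (g2 x * h x)).
    by apply: cvgD; [exact: P1|exact: P2].
  rewrite -mulrDr -RintegralD//; [|exact: rintegrable_sqM|exact: rintegrable_sqM].
  by congr (_ * _); apply: eq_Rintegral => x _; rewrite mulrDl.
apply/funext => k; rewrite -RintegralD//.
- by apply: eq_Rintegral => x _; rewrite !mulrDl.
- exact: (rintegrable_kernel (mN k) (A0 k) (e0 k) (bN k) (AM k)).
- exact: (rintegrable_kernel (mN k) (A0 k) (e0 k) (bN k) (AM k)).
Qed.

Let PB g1 g2 : sq_integrable mu g1 -> sq_integrable mu g2 -> P g1 -> P g2 ->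
  P (fun x => g1 x - g2 x).
Proof.
move=> s1 s2 P1 P2.
rewrite (_ : (fun x => _) = (fun x => g1 x + -1 * g2 x)).
  by apply: PD => //; [exact: sq_integrableZ|exact: PZ].
by apply/funext => x; rewrite mulN1r.
Qed.

Let Psum (I : Type) (s : seq I) (g : I -> rV -> R) :
  (forall i, sq_integrable mu (g i)) -> (forall i, P (g i)) ->
  P (fun x => \sum_(i <- s) g i x).
Proof.
move=> gs Pg.
suff [] : P (fun x => \sum_(i <- s) g i x) /\ sq_integrable mu (fun x => \sum_(i <- s) g i x) by [].
elim: s => [|i s [IHs IHs']].
  under eq_fun do rewrite big_nil; split; last exact: sq_integrable0.
  rewrite /P (_ : (fun k => Q k _) = fun=> 0); last first.
    apply/funext => k; rewrite /Q; under eq_Rintegral do rewrite !mul0r.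
    by rewrite Rintegral_cst// mul0r.
  under eq_Rintegral do rewrite mul0r.
  by rewrite Rintegral_cst// mul0r mulr0; exact: cvg_cst.
under eq_fun do rewrite big_cons.
by split; [exact: PD|exact: sq_integrableD].
Qed.

(** The bound on [Q k] does not depend on [k], so L^2 approximation of [g] suffices. The weight and
    then the distance are chosen so that the terms of [h] and of [g - g'] each contribute
    [r / 4]. *)
Let Pclosed g : sq_integrable mu g ->
  (forall d, 0 < d -> exists g', [/\ sq_integrable mu g', P g' &
     sqint mu (fun x => g x - g' x) <= d]) -> P g.
Proof.
move=> gs H; apply/cvgrPdist_le => r r0.
pose S := sqint mu h.
have S0 : 0 <= S by exact: sqint_ge0.
pose K := M + `|c| + 1.
have K0 : 0 < K by rewrite ltr_wpDl// addr_ge0.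
have S1 : 0 < S + 1 by rewrite ltr_wpDl.
(* weight for Young's inequality *)
pose l := K * (S + 1) * 2 / r.
have l0 : 0 < l by rewrite divr_gt0// !mulr_gt0.
have d0 : 0 < r / (2 * l * K) by rewrite divr_gt0// mulr_gt0// mulr_gt0.
have [g' [gs' Pg' dg]] := H _ d0.
have gds : sq_integrable mu (fun x => g x - g' x) by exact: sq_integrableB.
have small : K * (l * sqint mu (fun x => g x - g' x) + l^-1 * S) / 2 <= r / 2.
  rewrite ler_wpM2r ?invr_ge0//.
  apply: (@le_trans _ _ (K * (l * (r / (2 * l * K)) + l^-1 * (S + 1)))).
    rewrite ler_wpM2l ?(ltW K0)// lerD// ler_wpM2l ?invr_ge0 ?(ltW l0)//.
    by rewrite lerDl.
  rewrite le_eqVlt; apply/orP; left; apply/eqP; rewrite /l; field.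
  by rewrite !gt_eqF.
set D2 := l * sqint mu (fun x => g x - g' x) + l^-1 * S in small.
have D20 : 0 <= D2.
  by rewrite addr_ge0// mulr_ge0 ?invr_ge0 ?(ltW l0)// sqint_ge0.
move/cvgrPdist_le: Pg' => /(_ (r / 2)); rewrite divr_gt0// => /(_ isT).
apply: filterS => k hk.
have -> : c * \int[mu]_x (g x * h x) - Q k g =
    c * \int[mu]_x ((g x - g' x) * h x) + (c * \int[mu]_x (g' x * h x) - Q k g')
    - Q k (fun x => g x - g' x).
  have -> : Q k (fun x => g x - g' x) = Q k g - Q k g'.
    rewrite -RintegralB//.
    - by apply: eq_Rintegral => x _; rewrite !mulrBl.
    - exact: (rintegrable_kernel (mN k) (A0 k) (e0 k) (bN k) (AM k)).
    - exact: (rintegrable_kernel (mN k) (A0 k) (e0 k) (bN k) (AM k)).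
  have -> : \int[mu]_x ((g x - g' x) * h x) =
      \int[mu]_x (g x * h x) - \int[mu]_x (g' x * h x).
    rewrite -RintegralB//; [|exact: rintegrable_sqM|exact: rintegrable_sqM].
    by apply: eq_Rintegral => x _; rewrite mulrBl.
  by ring.
have b1 : `|c * \int[mu]_x ((g x - g' x) * h x)| <= `|c| * (D2 / 2).
  by rewrite normrM ler_wpM2l//; exact: normr_Rintegral_sqM.
have b2 : `|Q k (fun x => g x - g' x)| <= M * D2 / 2.
  exact: (normr_Rintegral_kernel (mN k) (A0 k) (e0 k) (bN k) (AM k)).
have b3 : `|c| * (D2 / 2) + M * D2 / 2 <= K * D2 / 2.
  rewrite -subr_ge0 /K; have -> : (M + `|c| + 1) * D2 / 2 - (`|c| * (D2 / 2) + M * D2 / 2)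
    = D2 / 2 by field.
  by rewrite divr_ge0.
apply: (le_trans (ler_normB _ _)); rewrite (splitr r).
apply: (@le_trans _ _ (`|c| * (D2 / 2) + r / 2 + M * D2 / 2)).
  by apply: lerD => //; apply: (le_trans (ler_normD _ _)); exact: lerD.
by rewrite addrAC lerD2r; exact: le_trans b3 small.
Qed.

Lemma sq_integrable_indic (D : set rV) : measurable D -> (mu D < +oo)%E ->
  sq_integrable mu (\1_D : rV -> R).
Proof.
move=> mD fD; split; first exact: measurable_indic.
rewrite (_ : (fun x => _) = (\1_D : rV -> R)); first exact: rintegrable_indic.
by apply/funext => x; rewrite indicE; case: (_ \in _); rewrite ?expr1n ?expr0n.
Qed.

Lemma finite_sub_cube (D : set rV) (r : R) : measurable D ->
  D `<=` cube (0 : rV) r -> (mu D < +oo)%E.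
Proof.
move=> mD Dr; have [r0|r0] := leP 0 r.
  apply: le_lt_trans (lebesgue_rV_cube_lty 0 r0).
  by apply: le_measure => //; rewrite inE//; exact: measurable_cube.
apply: le_lt_trans (lebesgue_rV_cube_lty (0 : rV) (normr_ge0 r)).
apply: le_measure => //; rewrite ?inE//; first exact: measurable_cube.
by move=> v /Dr h' i; apply: le_trans (h' i) _; exact: ler_norm.
Qed.

Lemma obox_sub_cube (a b : rV) : obox a b `<=` cube 0 (`|a| + `|b|).
Proof.
move=> v vab i; have /andP[av vb] := vab i; rewrite mxE subr0.
have := coord_le_norm a i; have := coord_le_norm b i; rewrite !ler_norml.
by move=> /andP[? ?] /andP[? ?]; apply/andP; split; lra.
Qed.

(** For [y] in the box the whole kernel slice eventually lies in the box and has mass [c]; for [y]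
    outside the closed box it eventually misses it. Domination by [M] times |h| is where the
    integrability of [h] enters. *)
Let Pbox (a b : rV) : P \1_(obox a b).
Proof.
set B := obox a b; have mB : measurable B by exact: measurable_obox.
have Bs : sq_integrable mu (\1_B : rV -> R).
  by apply: sq_integrable_indic => //; exact: finite_sub_cube (@obox_sub_cube a b).
pose q k y := \int[mu]_x (\1_B x * N k (x, y)).
have qi k y : rintegrable mu (fun x => \1_B x * N k (x, y)).
  under eq_fun do rewrite mulrC.
  apply: (@rintegrable_bounded _ _ _ _ _ _ 1).
  - exact: (rintegrable_kernel_slice (mN k) (e0 k) (bN k)).
  - exact: measurable_indic.
  - by move=> x; rewrite indicE; case: (_ \in _); rewrite ?normr0 ?normr1.
have qE k : Q k \1_B = \int[mu]_y (h y * q k y).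
  rewrite /Q Rintegral_prod2; last exact: (rintegrable_kernel (mN k) (A0 k) (e0 k) (bN k) (AM k)).
  apply: eq_Rintegral => y _; rewrite -RintegralZl//; last exact: qi.
  by apply: eq_Rintegral => x _; rewrite mulrCA mulrA.
have mq k : measurable_fun setT (fun y => h y * q k y).
  have := measurable_Rintegral2
    (rintegrable_kernel (mN k) (A0 k) (e0 k) (bN k) (AM k) Bs hs).
  congr measurable_fun; apply/funext => y /=.
  rewrite -RintegralZl//; last exact: qi.
  by apply: eq_Rintegral => x _ /=; rewrite mulrCA mulrA.
have qM k y : `|q k y| <= M.
  exact: (normr_kernel_slice (mN k) (A0 k) (e0 k) (bN k) (AM k)).
rewrite /P (_ : (fun k => Q k \1_B) = (fun k => \int[mu]_y (h y * q k y))); last exact/funext.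
rewrite (_ : c * _ = \int[mu]_y (h y * (c * \1_B y))); last first.
  rewrite -RintegralZl//; last exact: rintegrable_sqM.
  by apply: eq_Rintegral => y _; ring.
have [mh _] := hs.
have := @Rdominated_cvg _ _ _ mu (fun k y => h y * q k y) (fun y => h y * (c * \1_B y))
  (fun y => `|h y| * M).
case => //.
- apply: measurable_funM => //; apply: measurable_funM => //.
- apply: filterS (negligible_obox_boundary a b) => y yab.
  apply: cvgMr; rewrite indicE.
  have [yB|yB] := boolP (y \in B).
  + rewrite mulr1; apply: cvg_near_cst.
    have : \forall k \near \oo, forall i, e k < y ord0 i - a ord0 i /\ e k < b ord0 i - y ord0 i.
      apply: filter_forall => i; move: yB; rewrite inE => /(_ i) /andP[ay yb].
      have h1 : 0 < y ord0 i - a ord0 i by rewrite subr_gt0.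
      have h2 : 0 < b ord0 i - y ord0 i by rewrite subr_gt0.
      near=> k; split; near: k.
        exact: (cvgr_lt _ ecvg).
      exact: (cvgr_lt _ ecvg).
    apply: filterS => k hk; rewrite /q -(Nc k y); apply: eq_Rintegral => x _.
    rewrite indicE; have [xB|xB] := boolP (x \in B); first by rewrite mul1r.
    rewrite mul0r; apply/esym/eqP; rewrite -normr_eq0 eq_le normr_ge0 andbT.
    apply: (le_trans (bN k x y)); rewrite indicE memNset ?mulr0//.
    move=> xc; move: xB; rewrite notin_setE; apply => i.
    have [h1 h2] := hk i; have := xc i; rewrite ler_distl => /andP[? ?].
    by apply/andP; split; lra.
  + rewrite mulr0; apply: cvg_near_cst.
    have [i iab] : exists i, y ord0 i < a ord0 i \/ b ord0 i < y ord0 i.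
      apply: contrapT => /forallNP nab; move: yB; rewrite notin_setE; apply => i.
      have [ya yb] := yab i; have := nab i => /not_orP[/negP h1 /negP h2].
      rewrite -!leNgt in h1 h2; rewrite !lt_neqAle h1 h2 yb eq_sym ya//.
    have : \forall k \near \oo, e k < a ord0 i - y ord0 i \/ e k < y ord0 i - b ord0 i.
      case: iab => iab.
        have h1 : 0 < a ord0 i - y ord0 i by rewrite subr_gt0.
        by near=> k; left; near: k; exact: (cvgr_lt _ ecvg).
      have h1 : 0 < y ord0 i - b ord0 i by rewrite subr_gt0.
      by near=> k; right; near: k; exact: (cvgr_lt _ ecvg).
    apply: filterS => k hk; rewrite /q (@eq_Rintegral _ _ _ _ _ (cst 0)).
      by rewrite Rintegral_cst// mul0r.
    move=> x _; rewrite indicE; have [xB|xB] := boolP (x \in B); last by rewrite mul0r.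
    rewrite mul1r; apply/eqP; rewrite -normr_eq0 eq_le normr_ge0 andbT.
    apply: (le_trans (bN k x y)); rewrite indicE memNset ?mulr0//.
    move=> xc; move: xB; rewrite inE => /(_ i) /andP[? ?].
    have := xc i; rewrite ler_distl => /andP[? ?].
    by case: hk => hk; lra.
- exact/rintegrableZr/rintegrable_norm.
- by move=> k y; rewrite normrM ler_wpM2l.
Unshelve. all: by end_near. Qed.

(** Pointwise convergence under an L^2 majorant is convergence in L^2, since (g - g_m)^2 <= 2 g^2 +
    2 G^2. *)
Let Pdct g G (g_ : nat -> rV -> R) : sq_integrable mu g -> sq_integrable mu G ->
  (forall m, sq_integrable mu (g_ m)) -> (forall m, P (g_ m)) ->
  (forall x, g_ m x @[m --> \oo] --> g x) -> (forall m x, `|g_ m x| <= `|G x|) -> P g.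
Proof.
move=> gs Gs gs_ Pg_ cvg_g g_G; apply: Pclosed => // d d0.
have [mg gi] := gs; have [mG Gi] := Gs.
have := @Rdominated_cvg _ _ _ mu (fun m x => (g x - g_ m x) ^+ 2) (fun=> 0)
  (fun x => 2 * g x ^+ 2 + 2 * G x ^+ 2).
case.
- by move=> m; have [mgm _] := gs_ m; apply: measurable_funX; exact: measurable_funB.
- exact: measurable_cst.
- apply: nearW => x.
  rewrite [X in _ --> X](_ : 0 = (g x - g x) ^+ 2); last by rewrite subrr expr0n.
  rewrite expr2; under eq_fun do rewrite expr2.
  by apply: cvgM; apply: cvgB; [exact: cvg_cst|exact: cvg_g|exact: cvg_cst|exact: cvg_g].
- by apply: rintegrableD; exact: rintegrableZl.
- move=> m x; rewrite ger0_norm ?sqr_ge0//.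
  have : g_ m x ^+ 2 <= G x ^+ 2.
    rewrite -[g_ m x ^+ 2]real_normK ?num_real// -[G x ^+ 2]real_normK ?num_real//.
    by rewrite lerXn2r ?nnegrE.
  have := sqr_ge0 (g x + g_ m x); nra.
move=> _; rewrite Rintegral_cst// mul0r => /cvgrPdist_le /(_ d d0) [m _ /(_ m (leqnn m))].
rewrite sub0r normrN => hm; exists (g_ m); split => //.
exact: le_trans (ler_norm _) hm.
Qed.

Let ocube (r : R) : set rV := obox (const_mx (- r)) (const_mx r).

Let mocube r : measurable (ocube r). Proof. exact: measurable_obox. Qed.

Let indicIE (A' B : set rV) x : (\1_(A' `&` B) x : R) = \1_A' x * \1_B x.
Proof. by rewrite indicI. Qed.

Let indic_ocube_sq (S : set rV) r : measurable S ->
  sq_integrable mu (\1_(S `&` ocube r) : rV -> R).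
Proof.
move=> mS; apply: sq_integrable_indic; first exact: measurableI.
by apply: finite_sub_cube; [exact: measurableI|move=> v [_ /obox_sub_cube]; exact].
Qed.

(** Dynkin induction from boxes. The fixed cube keeps all indicators in L^2, so that complements
    become differences and disjoint unions become dominated limits. *)
Let Pindic (S : set rV) r : measurable S -> P \1_(S `&` ocube r).
Proof.
move=> mS; have : <<s @oboxes R n >> S by rewrite -measurable_rV_oboxes.
move: S {mS}; apply: (@dynkin_induction _ _ (@oboxes R n)
  (fun S => P \1_(S `&` ocube r)) (@measurable_rV_oboxes R n) (@setI_closed_oboxes R n)).
- by rewrite setTI; exact: Pbox.
- move=> _ [a [b ->]].
  have [a' [b' ->]] := setI_closed_oboxes (ex_intro _ a (ex_intro _ b erefl))
    (ex_intro _ _ (ex_intro _ _ (erefl (ocube r)))).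
  exact: Pbox.
- move=> S mS PS.
  rewrite (_ : \1_(_ `&` _) = (fun x => \1_(setT `&` ocube r) x - \1_(S `&` ocube r) x)).
    apply: PB => //; try exact: indic_ocube_sq.
    by rewrite setTI; exact: Pbox.
  apply/funext => x; rewrite !indicIE !indicE in_setC in_setT.
  by case: (x \in S); rewrite /= ?mul1r ?mul0r ?subrr ?subr0.
- move=> F mF tF PF.
  apply: (@Pdct _ \1_(setT `&` ocube r)
    (fun m x => \sum_(k <- index_iota 0 m) \1_(F k `&` ocube r) x)).
  + by apply: indic_ocube_sq; exact: bigcup_measurable.
  + exact: indic_ocube_sq.
  + move=> m; elim: (index_iota 0 m) => [|k s IHs].
      by under eq_fun do rewrite big_nil; exact: sq_integrable0.
    under eq_fun do rewrite big_cons; apply: sq_integrableD => //.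
    exact: indic_ocube_sq.
  + by move=> m; apply: Psum => // k; exact: indic_ocube_sq.
  + move=> x; rewrite indicIE indicE.
    have [xF|xF] := boolP (x \in \bigcup_k F k); last first.
      rewrite mul0r; apply: cvg_near_cst; apply: nearW => m; apply: big1 => k _.
      rewrite indicIE indicE memNset ?mul0r// => xFk.
      by move: xF; rewrite notin_setE; apply; exists k.
    move: xF; rewrite inE => -[j _ xFj]; rewrite mul1r.
    apply: cvg_near_cst; exists j.+1 => // m /= jm.
    rewrite big_mkord (bigD1 (Ordinal jm))//= indicIE [\1_(F j) _]indicE mem_set// mul1r.
    rewrite big1 ?addr0// => k kj; rewrite indicIE indicE memNset ?mul0r// => xFk.
    move/trivIsetP: tF => /(_ k j I I) /(_ kj) /seteqP[+ _] => /(_ x); apply.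
    by split.
  + move=> m x; rewrite indicIE indicE in_setT mul1r.
    have -> : \sum_(k <- index_iota 0 m) \1_(F k `&` ocube r) x =
      \1_(ocube r) x * \sum_(k <- index_iota 0 m) \1_(F k) x :> R.
      by rewrite big_distrr/=; apply: eq_bigr => k _; rewrite indicIE mulrC.
    (* As the sets are disjoint, at most one summand is nonzero at [x]. *)
    rewrite normrM ler_piMr// ger0_norm; last by apply: sumr_ge0.
    have [[j xFj]|nF] := pselect (exists j, F j x); last first.
      rewrite big1// => k _; rewrite indicE memNset// => xFk.
      by apply: nF; exists k.
    have E k : \1_(F k) x = (k == j)%:R :> R.
      rewrite indicE; case: eqVneq => [->|kj]; first by rewrite mem_set.
      rewrite memNset// => xFk.
      move/trivIsetP: tF => /(_ k j I I) /(_ kj) /seteqP[+ _] => /(_ x); apply.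
      by split.
    under eq_bigr do rewrite E.
    rewrite (_ : \sum_(k <- _) _ = (count_mem j (index_iota 0 m))%:R).
      by rewrite count_uniq_mem ?iota_uniq// lern1 leq_b1.
    by rewrite -sum1_count natr_sum [RHS]big_mkcond/=; apply: eq_bigr => k _; case: (k == j).
Qed.

Let ocube_near (x : rV) : \forall m \near \oo, x \in ocube m%:R.
Proof.
have /andP[_ xm] := Num.Theory.truncn_itv (normr_ge0 x).
set m0 := (Num.truncn `|x|).+1 in xm.
exists m0 => // m /= m0m; rewrite inE => i; rewrite !mxE.
have := le_lt_trans (coord_le_norm x i) (lt_le_trans xm _); rewrite -ltr_norml; apply.
by rewrite ler_nat.
Qed.

Import HBNNSimple.

(** Simple functions from below, cut to cubes that grow with [m]: the level sets then have finite
    measure, and [g] itself is the L^2 majorant. *)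
Let Pge0 g : sq_integrable mu g -> (forall x, 0 <= g x) -> P g.
Proof.
move=> gs g0; have [mg gi] := gs.
have mEg : measurable_fun setT (EFin \o g) by exact/measurable_EFinP.
pose s m := nnsfun_approx measurableT mEg m.
have scvg x : s m x @[m --> \oo] --> g x.
  have := @cvg_nnsfun_approx _ _ R setT measurableT (EFin \o g) mEg _ x I.
  by move=> /(_ (fun y _ => g0 y)) /fine_cvg.
have sle m x : s m x <= g x.
  have nd : nondecreasing_seq (s^~ x).
    by move=> i j ij; have /lefP := nd_nnsfun_approx measurableT mEg ij; exact.
  have := nondecreasing_cvgn_le nd (cvgP _ (scvg x)) m.
  by rewrite (cvg_lim _ (scvg x)).
have sge0 m x : 0 <= s m x by exact: fun_ge0.
pose g_ m x := s m x * \1_(ocube m%:R) x.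
have g_E m : g_ m = (fun x => \sum_(i <- finmap.enum_fset (fset_set (range (s m))))
    (i * \1_((s m @^-1` [set i]) `&` ocube m%:R) x)).
  apply/funext => x; rewrite /g_ fimfunE fsbig_finite//= big_distrl/=.
  by apply: eq_bigr => i _; rewrite indicIE mulrA.
have g_s m i : sq_integrable mu (fun x => i * \1_((s m @^-1` [set i]) `&` ocube m%:R) x).
  apply: sq_integrableZ; apply: indic_ocube_sq.
  exact: measurable_sfunP.
apply: (@Pdct _ g g_) => //.
- move=> m; apply: sq_integrable_le gs.
    by apply: measurable_funM => //; exact: measurable_indic.
  move=> x; rewrite /g_ normrM !ger0_norm//.
  apply: le_trans (sle m x); by rewrite ler_piMr// indicE lern1 leq_b1.
- move=> m; rewrite g_E; apply: Psum => // i; apply: PZ.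
    by apply: indic_ocube_sq; exact: measurable_sfunP.
  by apply: Pindic; exact: measurable_sfunP.
- move=> x; rewrite -[g x]mulr1; apply: cvgM; first exact: scvg.
  apply: cvg_near_cst; apply: filterS (ocube_near x) => m xm.
  by rewrite indicE xm.
- move=> m x; rewrite /g_ normrM !ger0_norm//.
  apply: le_trans (sle m x); by rewrite ler_piMr// indicE lern1 leq_b1.
Qed.

(** The kernels are neither nonnegative nor of convolution form, and their common mass [c] is
    arbitrary: it is 1 for mollifiers and 0 for commutators. Positive and negative parts reduce the
    claim to nonnegative [g]. *)
Lemma approximate_identity g : sq_integrable mu g ->
  \int[(mu \x mu)%E]_z (g z.1 * h z.2 * N k z) @[k --> \oo] -->
  c * \int[mu]_x (g x * h x).
Proof.
move=> gs; have [mg _] := gs.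
rewrite (_ : g = fun x => Num.max (g x) 0 - Num.max (- g x) 0); last first.
  by apply/funext => x; rewrite /Num.max; case: ltP => ?; case: ltP => ?; lra.
have s1 : sq_integrable mu (fun x => Num.max (g x) 0).
  apply: sq_integrable_le gs; first exact: measurable_maxr.
  by move=> x; rewrite /Num.max; case: ltP => ?; rewrite ?normr0.
have s2 : sq_integrable mu (fun x => Num.max (- g x) 0).
  apply: sq_integrable_le gs; first by apply: measurable_maxr => //; exact: measurable_funN.
  by move=> x; rewrite /Num.max; case: ltP => ?; rewrite ?normr0 ?normrN.
by apply: PB => //; apply: Pge0 => // x; rewrite le_max lexx orbT.
Qed.

End approximate_identity.

(** * Affine changes of variable and functions supported in cubes *)

Section affine_maps.
Context (R : realType).
Implicit Types V W : normedModType R.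

Lemma is_diff_affine V (s : R) (c : V) (x : V) :
  is_diff x (fun y : V => s *: y + c) (fun v => s *: v).
Proof.
have h : is_diff x (( *:%R s : V -> V) + cst c) (( *:%R s : V -> V) + 0).
  exact: is_diffD.
by apply: (is_diff_eq h); apply/funext => v; rewrite /= /GRing.add/= addr0.
Qed.

Lemma smooth_affine V (s : R) (c : V) (g : V -> R) :
  smooth g -> smooth (fun x => g (s *: x + c)).
Proof.
apply: (@smooth_comp_affine _ _ _ (fun y : V => s *: y + c) (fun v => s *: v)).
  by move=> x; have := is_diff_affine s c x => -[].
by move=> x v; have [_ ->] := is_diff_affine s c x.
Qed.

Lemma derive_affine V (s : R) (c : V) (g : V -> R) x v : smooth g ->
  'D_v (fun x => g (s *: x + c)) x = s * 'D_v g (s *: x + c).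
Proof.
move=> gs; rewrite (@derive_comp_affine _ _ _ (fun y : V => s *: y + c) (fun v => s *: v)).
- by rewrite !deriveE ?linearZ//; exact: smooth_differentiable.
- by move=> y; have := is_diff_affine s c y => -[].
- by move=> y w; have [_ ->] := is_diff_affine s c y.
- exact: smooth_differentiable.
Qed.

Lemma is_diff_linear V W (f : V -> W) (x : V) : linear f -> continuous f ->
  is_diff x f f.
Proof.
move=> lf cf.
pose fl : {linear V -> W} := HB.pack f (GRing.isLinear.Build R V W *:%R f lf).
split; first exact: (linear_differentiable (f := fl)).
exact: (diff_lin (f := fl)).
Qed.

Lemma smooth_comp_linear V W (l : V -> W) (g : W -> R) : linear l -> continuous l ->
  smooth g -> smooth (fun x => g (l x)).
Proof.
move=> ll cl; apply: (@smooth_comp_affine _ _ _ l l).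
  by move=> z; have [] := is_diff_linear z ll cl.
by move=> z v; have [_ ->] := is_diff_linear z ll cl.
Qed.

Lemma smooth_fst V (h : R -> R) : smooth h -> smooth (fun z : R * V => h z.1).
Proof. by apply: smooth_comp_linear => // z; exact: cvg_fst. Qed.

Lemma smooth_snd V (g : V -> R) : smooth g -> smooth (fun z : R * V => g z.2).
Proof. by apply: smooth_comp_linear => // z; exact: cvg_snd. Qed.

End affine_maps.

Section rV_calculus.
Context (R : realType) (n : nat).
Local Notation rV := 'rV[R]_n.
Implicit Types (f g : rV -> R).

Lemma smooth_coord (i : 'I_n) (h : R -> R) : smooth h -> smooth (fun x : rV => h (x ord0 i)).
Proof.
apply: (@smooth_comp_linear _ _ _ (fun x : rV => x ord0 i)).
  by move=> a u v; rewrite !mxE.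
exact: continuous_coord.
Qed.

Lemma smooth_continuous (V : normedModType R) (g : V -> R) : smooth g -> continuous g.
Proof. by move=> /(_ 0%N). Qed.

Lemma smooth_measurable f : smooth f -> measurable_fun setT f.
Proof. by move=> fs; apply: continuous_measurable_rV; exact: smooth_continuous. Qed.

Lemma smooth_partial i f : smooth f -> smooth (partial i f).
Proof. exact: smooth_derive. Qed.

Lemma partialM i f g x : differentiable f x -> differentiable g x ->
  partial i (fun x => f x * g x) x = f x * partial i g x + g x * partial i f x.
Proof. by move=> df dg; rewrite /partial deriveM//; exact: diff_derivable. Qed.

Lemma subE (x y : rV) : x - y = 1 *: x + - y. Proof. by rewrite scale1r. Qed.

Lemma subEr (x y : rV) : x - y = -1 *: y + x. Proof. by rewrite scaleN1r addrC. Qed.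

Lemma smooth_translate f y : smooth f -> smooth (fun x => f (x - y)).
Proof. by move=> fs; under eq_fun do rewrite subE; exact: smooth_affine. Qed.

Lemma smooth_reflect f x : smooth f -> smooth (fun y => f (x - y)).
Proof. by move=> fs; under eq_fun do rewrite subEr; exact: smooth_affine. Qed.

Lemma partial_translate i f y : smooth f ->
  partial i (fun x => f (x - y)) = (fun x => partial i f (x - y)).
Proof.
move=> fs; apply/funext => x; rewrite /partial.
under [X in 'D__ X _]eq_fun do rewrite subE.
by rewrite derive_affine// mul1r -subE.
Qed.

Lemma partial_reflect i f x : smooth f ->
  partial i (fun y => f (x - y)) = (fun y => - partial i f (x - y)).
Proof.
move=> fs; apply/funext => y; rewrite /partial.
under [X in 'D__ X _]eq_fun do rewrite subEr.
by rewrite derive_affine// mulN1r -subEr.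
Qed.

Lemma smooth_dilate f s : smooth f -> smooth (fun x => f (s *: x)).
Proof. by move=> fs; under eq_fun do rewrite -[_ *: _]addr0; exact: smooth_affine. Qed.

Lemma partial_dilate i f s : smooth f ->
  partial i (fun x => f (s *: x)) = (fun x => s * partial i f (s *: x)).
Proof.
move=> fs; apply/funext => x; rewrite /partial.
under [X in 'D__ X _]eq_fun do rewrite -[_ *: _]addr0.
by rewrite derive_affine// addr0.
Qed.

Lemma is_derive_partial i f x : differentiable f x ->
  is_derive x (delta_mx ord0 i) f (partial i f x).
Proof. by move=> df; split => //; exact: diff_derivable. Qed.

Definition supported_in (c : rV) (r : R) f := forall x, ~ cube c r x -> f x = 0.

Lemma cubeN_ex (c : rV) r x : ~ cube c r x -> exists i, r < `|x ord0 i - c ord0 i|.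
Proof.
move=> ncx; apply: contrapT => /forallNP H; apply: ncx => i.
by rewrite leNgt; apply/negP.
Qed.

(** The complement of the closed cube is open, so near each of its points the function coincides
    with 0. *)
Lemma supported_partial c r i f : supported_in c r f -> supported_in c r (partial i f).
Proof.
move=> fc x /cubeN_ex[j rj].
rewrite /partial (_ : 'D__ f x = 'D_(delta_mx ord0 i) (cst 0 : rV -> R) x).
  exact: derive_cst.
apply: near_eq_derive.
have : \forall y \near x, r < `|(y : rV) ord0 j - c ord0 j|.
  have cy : {for x, continuous (fun y : rV => y ord0 j - c ord0 j)}.
    by apply: continuousB; [exact: continuous_coord|exact: cst_continuous].
  exact: (cvgr_gt _ (cvg_norm cy)).
apply: filterS => y ry; apply: fc => /(_ j); by rewrite leNgt ry.
Qed.

Lemma supportedM c r f g : supported_in c r g -> supported_in c r (fun x => f x * g x).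
Proof. by move=> gc x /gc ->; rewrite mulr0. Qed.

Lemma supportedMr c r f g : supported_in c r g -> supported_in c r (fun x => g x * f x).
Proof. by move=> gc x /gc ->; rewrite mul0r. Qed.

Lemma supported_outside c r f x : supported_in c r f -> outside (`|c| + `|r|) x -> f x = 0.
Proof.
move=> fc [i ri]; apply: fc => /(_ i); apply/negP; rewrite -ltNge.
have := coord_le_norm c i; have := ler_norm r; have := lerB_dist (x ord0 i) (c ord0 i).
lra.
Qed.

Lemma compact_cube (c : rV) r : compact (cube c r).
Proof.
rewrite (_ : cube c r = [set v : rV | forall i,
   `[c ord0 i - r, c ord0 i + r]%classic (v ord0 i)]); last first.
  by apply/seteqP; split=> v /= vM i; have := vM i; rewrite in_itv/= ler_distl.
apply: (@rV_compact _ _ (fun i => `[c ord0 i - r, c ord0 i + r]%classic)) => i.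
exact: segment_compact.
Qed.

Lemma bounded_on_cube f c r : continuous f ->
  exists2 C : R, 0 <= C & forall x, cube c r x -> `|f x| <= C.
Proof.
move=> cf; have [C C0 HC] := @bounded_on_box R n f (`|c| + `|r|) cf.
exists C => // x cx; apply: HC => i; rewrite leNgt; apply/negP => h.
have := cx i; apply/negP; rewrite -ltNge.
have := coord_le_norm c i; have := ler_norm r; have := lerB_dist (x ord0 i) (c ord0 i).
lra.
Qed.

Lemma supported_bounded f c r : continuous f -> supported_in c r f ->
  exists2 C : R, 0 <= C & forall x, `|f x| <= C.
Proof.
move=> cf fc; have [C C0 HC] := @bounded_on_cube f c r cf.
exists C => // x; have [/HC//|/fc ->] := pselect (cube c r x).
by rewrite normr0.
Qed.

Lemma test_function_supported f c r : smooth f -> supported_in c r f ->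
  test_function setT f.
Proof. by move=> fs fc; split => //; exists (cube c r); split => //; exact: compact_cube. Qed.

Lemma rintegrable_supported f c r : continuous f -> supported_in c r f ->
  rintegrable (lebesgue_rV R n) f.
Proof.
move=> cf fc; apply: (@integrable_continuous_rV R n f (`|c| + `|r|)) => // x.
exact: supported_outside.
Qed.

Lemma sq_integrable_supported f c r : continuous f -> supported_in c r f ->
  sq_integrable (lebesgue_rV R n) f.
Proof.
move=> cf fc; split; first exact: continuous_measurable_rV.
apply: (@rintegrable_supported _ c r).
  by move=> x; under eq_fun do rewrite expr2; apply: continuousM; exact: cf.
by move=> x /fc ->; rewrite expr0n.
Qed.

Lemma Rintegral_partial_eq0 f i c r : Ck 1 f -> supported_in c r f ->
  \int[lebesgue_rV R n]_x partial i f x = 0.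
Proof.
move=> [df Df] fc; apply: (@divergence_eq0 R n f _ i (`|c| + `|r|)).
- exact: (Df (delta_mx ord0 i)).
- by move=> x; exact: is_derive_partial.
- by move=> x; exact: supported_outside.
- by move=> x; exact/supported_outside/supported_partial.
Qed.

Lemma derive_sum_partial f x v : differentiable f x ->
  'D_v f x = \sum_i v ord0 i * partial i f x.
Proof.
move=> df; rewrite deriveE// [in LHS](row_sum_delta v) linear_sum/=.
by apply: eq_bigr => i _; rewrite linearZ/= /partial deriveE.
Qed.

(** Mean value theorem along the segment, which stays in the convex cube. Distances are in the sup
    norm, whence the factor [n]. *)
Lemma lipschitz_on_cube f r (C e : R) x y : (forall x, differentiable f x) ->
  (forall i x, cube 0 r x -> `|partial i f x| <= C) ->
  cube 0 r x -> cube 0 r y -> cube y e x -> `|f x - f y| <= n%:R * (e * C).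
Proof.
move=> df fC rx ry xye.
pose g (s : R) := f (s *: (x - y) + y).
have dg s : is_derive s (1 : R) g ('D_(x - y) f (s *: (x - y) + y)).
  have h : is_diff s (fun s : R => s *: (x - y) + y) (fun v : R => v *: (x - y)).
    have h' : is_diff s ((fun s : R => s *: (x - y)) + cst y) ((fun v : R => v *: (x - y)) + 0).
      exact: is_diffD.
    by apply: (is_diff_eq h'); apply/funext => v; rewrite /= /GRing.add/= addr0.
  have dfs : is_diff (s *: (x - y) + y) f ('d f (s *: (x - y) + y)).
    exact: differentiableP.
  have dgs : is_diff s g ('d f (s *: (x - y) + y) \o (fun v : R => v *: (x - y))).
    exact: is_diff_comp.
  have [dg1 dg2] := dgs.
  split; first exact: diff_derivable.
  by rewrite !deriveE// dg2/= scale1r.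
have cg : continuous g.
  by move=> s; apply/differentiable_continuous/derivable1_diffP; have [] := dg s.
have [|c' /[!in_itv]/= /andP[c0 c1] E] := @MVT_segment R g _ 0 1 ler01 (fun s _ => dg s).
  exact: continuous_subspaceT.
have -> : f x - f y = g 1 - g 0.
  by rewrite /g scale1r scale0r add0r subrK.
rewrite E subr0 mulr1 derive_sum_partial//.
apply: (le_trans (ler_norm_sum _ _ _)).
rewrite (_ : n%:R * (e * C) = \sum_(i < n) e * C); last by rewrite sumr_const card_ord mulr_natl.
apply: ler_sum => i _; rewrite normrM; apply: ler_pM => //.
  by rewrite !mxE; exact: xye.
apply: fC => j; rewrite !mxE subr0.
have := rx j; have := ry j; rewrite !mxE !subr0.
have -> : c' * (x ord0 j - y ord0 j) + y ord0 j = c' * x ord0 j + (1 - c') * y ord0 j by ring.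
move=> hy hx; apply: (le_trans (ler_normD _ _)); rewrite !normrM (ger0_norm c0).
rewrite (ger0_norm (_ : 0 <= 1 - c')) ?subr_ge0//.
have c1' : 0 <= 1 - c' by rewrite subr_ge0.
have h1 := ler_wpM2l c0 hx; have h2 := ler_wpM2l c1' hy.
by lra.
Qed.

End rV_calculus.

(** * Mollification and the commutator lemma *)

Section mollifier.
Context (R : realType).

Definition smooth_step : R -> R := sval (cid (smooth_step_exists R)).

Definition bump : R -> R := sval (cid (svalP (cid (smooth_step_exists R)))).

Lemma smooth_stepP : [/\ smooth smooth_step, smooth bump,
   forall x, is_derive x (1 : R) smooth_step (bump x) &
   [/\ forall x, 0 <= bump x, forall x, 1 <= `|x| -> bump x = 0,
       forall x, x <= -1 -> smooth_step x = 0, forall x, 1 <= x -> smooth_step x = 1 &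
       forall x, 0 <= smooth_step x <= 1]].
Proof. exact: svalP (cid (svalP (cid (smooth_step_exists R)))). Qed.

Lemma smooth_bump : smooth bump. Proof. by have [] := smooth_stepP. Qed.

Lemma smooth_smooth_step : smooth smooth_step. Proof. by have [] := smooth_stepP. Qed.

Lemma is_derive_smooth_step x : is_derive x (1 : R) smooth_step (bump x).
Proof. by have [] := smooth_stepP. Qed.

Lemma bump_ge0 x : 0 <= bump x.
Proof. by have [_ _ _ []] := smooth_stepP. Qed.

Lemma bump_eq0 x : 1 <= `|x| -> bump x = 0.
Proof. by have [_ _ _ [_ + _ _ _]] := smooth_stepP; exact. Qed.

Lemma smooth_step_eq0 x : x <= -1 -> smooth_step x = 0.
Proof. by have [_ _ _ [_ _ + _ _]] := smooth_stepP; exact. Qed.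

Lemma smooth_step_eq1 x : 1 <= x -> smooth_step x = 1.
Proof. by have [_ _ _ [_ _ _ + _]] := smooth_stepP; exact. Qed.

Lemma smooth_step_itv x : 0 <= smooth_step x <= 1.
Proof. by have [_ _ _ [_ _ _ _]] := smooth_stepP; exact. Qed.

Definition plateau (t : R) := smooth_step (1 * t + 2) * smooth_step (-1 * t + 2).

Lemma smooth_plateau : smooth plateau.
Proof. by apply: smoothM; apply: smooth_comp_line; exact: smooth_smooth_step. Qed.

Lemma plateau_itv t : 0 <= plateau t <= 1.
Proof.
have /andP[h0 h1] := smooth_step_itv (1 * t + 2).
have /andP[k0 k1] := smooth_step_itv (-1 * t + 2).
by rewrite mulr_ge0//= mulr_ile1.
Qed.

Lemma plateau_eq1 t : `|t| <= 1 -> plateau t = 1.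
Proof.
rewrite ler_norml => /andP[h0 h1].
by rewrite /plateau !smooth_step_eq1 ?mul1r//; lra.
Qed.

Lemma plateau_eq0 t : 3 < `|t| -> plateau t = 0.
Proof.
rewrite /plateau ltr_normr => /orP[h|h].
  by rewrite [X in _ * X]smooth_step_eq0 ?mulr0//; lra.
by rewrite smooth_step_eq0 ?mul0r//; lra.
Qed.

(** The rescaled bump is the derivative of the rescaled step, which climbs from 0 to 1 between
    [y - e] and [y + e]. *)
Lemma Rintegral_bump (e y : R) : 0 < e ->
  \int[lebesgue_measure]_x (e^-1 * bump (e^-1 * (x - y))) = 1.
Proof.
move=> e0; have e1 : 0 < e^-1 by rewrite invr_gt0.
have E x : e^-1 * (x - y) = e^-1 * x + - (e^-1 * y) by rewrite mulrBr.
under eq_Rintegral do rewrite E.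
rewrite (@Rintegral_itvT _ _ (y - e) (y + e)).
  have dG x : is_derive x (1 : R) (fun x : R => smooth_step (e^-1 * x + - (e^-1 * y)))
      (e^-1 * bump (e^-1 * x - e^-1 * y)).
    have := is_derive_comp_line e^-1 (- (e^-1 * y)) x smooth_smooth_step.
    by rewrite derive1E; have [_ ->] := is_derive_smooth_step (e^-1 * x + - (e^-1 * y)).
  have cg : continuous (fun x : R => e^-1 * bump (e^-1 * x - e^-1 * y)).
    apply: smooth_continuous; apply: smoothM; first exact: smooth_cst.
    by apply: smooth_comp_line; exact: smooth_bump.
  have ab : y - e < y + e by lra.
  rewrite (Rintegral_derive ab cg dG) smooth_step_eq1 ?smooth_step_eq0 ?subr0// -E.
    by rewrite addrAC subrr add0r mulrN mulVf// gt_eqF.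
  by rewrite addrAC subrr add0r mulVf// gt_eqF.
move=> x; rewrite in_itv/= -ler_distl -ltNge => ex.
rewrite -E bump_eq0 ?mulr0// normrM (gtr0_norm e1).
by rewrite mulrC ler_pdivlMr// mul1r ltW.
Qed.

Variable n : nat.
Local Notation rV := 'rV[R]_n.
Local Notation mu := (lebesgue_rV R n).
Implicit Types (f g : rV -> R).

Definition unit_mollifier (z : rV) : R := \prod_(i < n) bump (z ord0 i).

Lemma smooth_unit_mollifier : smooth unit_mollifier.
Proof. by apply: smooth_prod => i; apply: smooth_coord; exact: smooth_bump. Qed.

Lemma supported_unit_mollifier : supported_in 0 1 unit_mollifier.
Proof.
move=> z /cubeN_ex[i]; rewrite mxE subr0 => zi.
by rewrite /unit_mollifier (bigD1 i)//= bump_eq0 ?mul0r// ltW.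
Qed.

Definition mollifier (e : R) (z : rV) : R := e^-1 ^+ n * unit_mollifier (e^-1 *: z).

Lemma smooth_mollifier e : smooth (mollifier e).
Proof.
by apply: smoothM; [exact: smooth_cst|exact: smooth_dilate smooth_unit_mollifier].
Qed.

Lemma mollifier_ge0 e z : 0 < e -> 0 <= mollifier e z.
Proof.
move=> e0; apply: mulr_ge0; first by rewrite exprn_ge0// invr_ge0 ltW.
by apply: prodr_ge0 => i _; exact: bump_ge0.
Qed.

Lemma cube_dilate e (z : rV) : 0 < e -> cube 0 1 (e^-1 *: z) -> cube 0 e z.
Proof.
move=> e0 h i; have := h i; rewrite !mxE !subr0 normrM gtr0_norm ?invr_gt0//.
by rewrite mulrC ler_pdivrMr// mul1r.
Qed.

Lemma supported_dilate e f : 0 < e -> supported_in 0 1 f ->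
  supported_in 0 e (fun z => f (e^-1 *: z)).
Proof. by move=> e0 f1 z nz; apply: f1 => /(cube_dilate e0). Qed.

Lemma supported_mollifier e : 0 < e -> supported_in 0 e (mollifier e).
Proof.
by move=> e0; apply: supportedM; apply: supported_dilate => //; exact: supported_unit_mollifier.
Qed.

Lemma partial_mollifier e i : partial i (mollifier e) =
  (fun z => e^-1 ^+ n * (e^-1 * partial i unit_mollifier (e^-1 *: z))).
Proof.
apply/funext => z; rewrite /mollifier partialM; last 2 first.
- exact: differentiable_cst.
- by apply: smooth_differentiable; exact: smooth_dilate smooth_unit_mollifier.
rewrite partial_dilate; last exact: smooth_unit_mollifier.
by rewrite /partial derive_cst mulr0 addr0.
Qed.

Lemma Rintegral_mollifier e y : 0 < e -> \int[mu]_x mollifier e (x - y) = 1.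
Proof.
move=> e0; have e1 : 0 <= e^-1 by rewrite invr_ge0 ltW.
pose g (i : 'I_n) (s : R) := e^-1 * bump (e^-1 * (s - y ord0 i)).
have cg i : continuous (g i).
  apply: smooth_continuous; apply: smoothM; first exact: smooth_cst.
  under eq_fun do rewrite mulrBr.
  by apply: smooth_comp_line; exact: smooth_bump.
have g0 i s : 0 <= g i s by rewrite mulr_ge0// bump_ge0.
rewrite /Rintegral (_ : (\int[_]_x _ = 1)%E)//.
under eq_integral => x _.
  rewrite /mollifier /unit_mollifier.
  rewrite (_ : _ * _ = \prod_(i < n) g i (x ord0 i)); last first.
    have -> : e^-1 ^+ n = \prod_(i < n) e^-1 by rewrite prodr_const card_ord.
    rewrite -big_split/=.
    by apply: eq_bigr => i _; rewrite !mxE.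
  over.
rewrite integral_rV_prod//; apply: big1 => i _.
rewrite -(EFin_Rintegral (m := lebesgue_measure)).
  by rewrite Rintegral_bump.
apply: (@integrable_continuous_itv _ (g i) (y ord0 i - e) (y ord0 i + e)) => //.
move=> x; rewrite in_itv/= -ler_distl -ltNge => ex.
rewrite /g bump_eq0 ?mulr0// normrM gtr0_norm ?invr_gt0//.
by rewrite mulrC ler_pdivlMr// mul1r ltW.
Qed.

(** The scale invariance that makes Schur's constant independent of [k]. *)
Lemma rescale_bound (C e : R) : 0 < e -> C * e^-1 ^+ n * (2 * e) ^+ n = C * 2 ^+ n.
Proof.
move=> e0; rewrite exprMn -!mulrA; congr (_ * _).
by rewrite mulrCA -exprMn mulVf ?gt_eqF// expr1n mulr1.
Qed.

Lemma kernel_bound_conv (r : rV -> R) (A e : R) : 0 <= A -> supported_in 0 e r ->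
  (forall z, `|r z| <= A) -> kernel_bound (fun z => r (z.1 - z.2)) A e.
Proof.
move=> A0 re rA x y /=; rewrite indicE; have [xy|xy] := boolP (x \in cube y e).
  by rewrite mulr1.
rewrite mulr0 re ?normr0// => h; move: xy; rewrite notin_setE; apply => i.
by have := h i; rewrite !mxE subr0.
Qed.

Lemma measurable_conv (r : rV -> R) : continuous r ->
  measurable_fun setT (fun z : rV * rV => r (z.1 - z.2)).
Proof.
move=> cr; apply: (measurableT_comp (continuous_measurable_rV cr)).
exact: measurable_rV_sub2.
Qed.

Definition eps (k : nat) : R := k.+1%:R^-1.

Lemma eps_gt0 k : 0 < eps k. Proof. by rewrite invr_gt0. Qed.

Lemma eps_le1 k : eps k <= 1. Proof. by rewrite invf_le1 ?ler1n. Qed.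

Lemma cvg_eps : eps k @[k --> \oo] --> 0. Proof. exact: cvg_harmonic. Qed.

Definition moll_kernel k (z : rV * rV) := mollifier (eps k) (z.1 - z.2).

Lemma moll_kernel_bound : exists2 C : R, 0 <= C & forall k,
  kernel_bound (moll_kernel k) (C * (eps k)^-1 ^+ n) (eps k).
Proof.
have [C C0 HC] := supported_bounded
  (smooth_continuous smooth_unit_mollifier) supported_unit_mollifier.
exists C => // k; have e0 := eps_gt0 k.
have e1 : 0 <= (eps k)^-1 ^+ n by rewrite exprn_ge0// invr_ge0 ltW.
apply: kernel_bound_conv; first exact: mulr_ge0.
  exact: supported_mollifier.
by move=> z; rewrite normrM ger0_norm// mulrC ler_wpM2r.
Qed.

Lemma measurable_moll_kernel k : measurable_fun setT (moll_kernel k).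
Proof. by apply: measurable_conv; exact/smooth_continuous/smooth_mollifier. Qed.

Definition pairing (g h : rV -> R) (N : rV * rV -> R) :=
  \int[(mu \x mu)%E]_z (g z.1 * h z.2 * N z).

Lemma moll_pairing_cvg g h : sq_integrable mu g -> sq_integrable mu h ->
  rintegrable mu h ->
  pairing g h (moll_kernel k) @[k --> \oo] --> \int[mu]_x (g x * h x).
Proof.
move=> gs hs hi; have [C C0 HC] := moll_kernel_bound.
rewrite -[X in _ --> X]mul1r.
apply: (@approximate_identity R n moll_kernel (fun k => C * (eps k)^-1 ^+ n) eps
  (C * 2 ^+ n)) => //.
- exact: measurable_moll_kernel.
- by move=> k; rewrite mulr_ge0// exprn_ge0// invr_ge0 ltW// eps_gt0.
- by move=> k; rewrite ltW// eps_gt0.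
- by move=> k; rewrite rescale_bound// eps_gt0.
- exact: cvg_eps.
- by move=> k y; exact: Rintegral_mollifier (eps_gt0 k).
Qed.

(** Uniform in [k]: applied to the time slices of [w], this bound becomes a majorant in time that
    only involves the energy. *)
Definition bounded_pairing (N : nat -> rV * rV -> R) (M : R) := 0 <= M /\
  forall g h k, sq_integrable mu g -> sq_integrable mu h ->
    rintegrable (mu \x mu)%E (fun z => g z.1 * h z.2 * N k z) /\
    `|pairing g h (N k)| <= M * (sqint mu g + sqint mu h).

Lemma bounded_pairingP (N : nat -> rV * rV -> R) (C : R) : 0 <= C ->
  (forall k, measurable_fun setT (N k)) ->
  (forall k, kernel_bound (N k) (C * (eps k)^-1 ^+ n) (eps k)) ->
  bounded_pairing N (C * 2 ^+ n).
Proof.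
move=> C0 mN bN; have M0 : 0 <= C * 2 ^+ n by rewrite mulr_ge0// exprn_ge0.
split => // g h k gs hs; have e0 := eps_gt0 k.
have A0 : 0 <= C * (eps k)^-1 ^+ n by rewrite mulr_ge0// exprn_ge0// invr_ge0 ltW.
have AM : C * (eps k)^-1 ^+ n * (2 * eps k) ^+ n <= C * 2 ^+ n by rewrite rescale_bound.
split; first exact: rintegrable_kernel (mN k) A0 (ltW e0) (bN k) AM _ _ gs hs.
have := normr_Rintegral_kernel (mN k) A0 (ltW e0) (bN k) AM ltr01 gs hs.
move=> /le_trans; apply; rewrite invr1 !mul1r.
have s0 : 0 <= C * 2 ^+ n * (sqint mu g + sqint mu h).
  by rewrite mulr_ge0// addr_ge0// sqint_ge0.
by rewrite ler_pdivrMr// ler_peMr// ler1n.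
Qed.

Lemma moll_bounded_pairing : exists M, bounded_pairing moll_kernel M.
Proof.
have [C C0 HC] := moll_kernel_bound.
by exists (C * 2 ^+ n); apply: bounded_pairingP => //; exact: measurable_moll_kernel.
Qed.

End mollifier.

(** * Friedrichs' commutator lemma *)

Section friedrichs.
Context (R : realType) (n : nat).
Local Notation rV := 'rV[R]_n.
Local Notation mu := (lebesgue_rV R n).
Local Notation eps := (@eps R).
Local Notation rho k := (@mollifier R n (eps k)).

Variables (a : rV -> R) (j : 'I_n) (r : R).
Hypothesis a_smooth : smooth a.

(** The commutator of multiplication by [a] with mollified differentiation. The indicator confines
    [y] to a cube, because the derivatives of [a] are bounded on compact sets only; it disappears
    against a function supported there. *)
Definition commutator_kernel k (z : rV * rV) : R := \1_(cube 0 r) z.2 *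
  (partial j (fun x => a x * rho k (x - z.2)) z.1 - a z.2 * partial j (rho k) (z.1 - z.2)).

Lemma commutator_kernelE k z : commutator_kernel k z = \1_(cube 0 r) z.2 *
  ((a z.1 - a z.2) * partial j (rho k) (z.1 - z.2) + rho k (z.1 - z.2) * partial j a z.1).
Proof.
have rs : smooth (rho k) by exact: smooth_mollifier.
rewrite /commutator_kernel partialM; last 2 first.
- exact: smooth_differentiable.
- exact/smooth_differentiable/smooth_translate.
by rewrite partial_translate//; congr (_ * _); ring.
Qed.

Lemma measurable_commutator_kernel k : measurable_fun setT (commutator_kernel k).
Proof.
have rs : smooth (rho k) by exact: smooth_mollifier.
have m1 : measurable_fun setT (fun z : rV * rV => z.1) by exact: measurable_fst.
have m2 : measurable_fun setT (fun z : rV * rV => z.2) by exact: measurable_snd.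
have ma : measurable_fun setT a by exact: smooth_measurable.
have mda : measurable_fun setT (partial j a).
  by apply: smooth_measurable; exact: smooth_partial.
rewrite (_ : commutator_kernel k = (fun z => \1_(cube 0 r) z.2 *
  ((a z.1 - a z.2) * partial j (rho k) (z.1 - z.2) + rho k (z.1 - z.2) * partial j a z.1))).
  apply: measurable_funM.
    apply: (measurableT_comp _ m2); apply: measurable_indic; exact: measurable_cube.
  apply: measurable_funD; apply: measurable_funM.
  - by apply: measurable_funB; [exact: (measurableT_comp ma m1)|exact: (measurableT_comp ma m2)].
  - by apply: measurable_conv; exact/smooth_continuous/smooth_partial.
  - by apply: measurable_conv; exact/smooth_continuous.
  - exact: (measurableT_comp mda m1).
by apply/funext => z; rewrite commutator_kernelE.
Qed.

(** Differentiating the mollifier costs one factor [(eps k)^-1], which [a x - a y = O(eps k)] on the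
    support pays back. The other term is the mollifier times a derivative of [a]. *)
Lemma commutator_kernel_bound : exists2 C : R, 0 <= C & forall k,
  kernel_bound (commutator_kernel k) (C * (eps k)^-1 ^+ n) (eps k).
Proof.
(* As [eps k <= 1], a point within [eps k] of the cube of size [r] lies in the one of size [K]. *)
pose K := `|r| + 1.
have [C1 C10 HC1] : exists2 C : R, 0 <= C & forall i x, cube 0 K x -> `|partial i a x| <= C.
  have H i : exists C : R, 0 <= C /\ forall x, cube 0 K x -> `|partial i a x| <= C.
    have [C C0 HC] := @bounded_on_cube R n (partial i a) 0 K
      (smooth_continuous (smooth_partial i a_smooth)).
    by exists C.
  have [C HC] := choice H.
  exists (\sum_i C i); first by apply: sumr_ge0 => i _; have [] := HC i.
  move=> i x Kx; have [_ /(_ x Kx) h] := HC i; apply: (le_trans h).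
  rewrite (bigD1 i)//= lerDl; apply: sumr_ge0 => l _; have [] := HC l.
  by [].
have [C2 C20 HC2] := supported_bounded
  (smooth_continuous (@smooth_unit_mollifier R n)) (@supported_unit_mollifier R n).
have [C3 C30 HC3] := supported_bounded
  (smooth_continuous (smooth_partial j (@smooth_unit_mollifier R n)))
  (supported_partial j (@supported_unit_mollifier R n)).
exists (n%:R * C1 * C3 + C2 * C1).
  by rewrite addr_ge0// mulr_ge0// mulr_ge0.
move=> k x y; have e0 := @eps_gt0 R k; have e1 := @eps_le1 R k.
set E := (eps k)^-1 ^+ n.
have E0 : 0 <= E by rewrite exprn_ge0// invr_ge0 ltW.
rewrite commutator_kernelE /=.
have [xy|xy] := pselect (cube y (eps k) x); last first.
  have nxy : ~ cube 0 (eps k) (x - y).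
    by move=> h; apply: xy => i; have := h i; rewrite !mxE subr0.
  rewrite (supported_mollifier e0 nxy) (supported_partial j (supported_mollifier e0) nxy).
  by rewrite mul0r mulr0 addr0 mulr0 normr0 mulr_ge0// mulr_ge0// addr_ge0// !mulr_ge0.
rewrite [\1_(cube y _) x]indicE mem_set// mulr1 indicE.
have [yr|yr] := boolP (y \in cube 0 r); last first.
  by rewrite mul0r normr0 mulr_ge0// addr_ge0// !mulr_ge0.
rewrite mul1r; move: yr; rewrite inE => yr.
have Ky : cube 0 K y.
  move=> i; apply: (le_trans (yr i)); rewrite /K.
  by apply: (le_trans (ler_norm _)); rewrite lerDl.
have Kx : cube 0 K x.
  move=> i; have := yr i; have := xy i; rewrite !mxE !subr0 /K.
  have := lerB_dist (x ord0 i) (y ord0 i); have := ler_norm r.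
  by lra.
have l1 : `|a x - a y| <= n%:R * (eps k * C1).
  exact: (@lipschitz_on_cube R n a K C1 (eps k) x y (fun x => smooth_differentiable x a_smooth)).
have l2 : `|partial j (rho k) (x - y)| <= E * ((eps k)^-1 * C3).
  rewrite partial_mollifier normrM ger0_norm// ler_wpM2l//.
  by rewrite normrM ger0_norm ?invr_ge0 ?(ltW e0)// ler_wpM2l// invr_ge0 ltW.
have l3 : `|rho k (x - y)| <= E * C2.
  by rewrite normrM ger0_norm// ler_wpM2l.
apply: (le_trans (ler_normD _ _)).
rewrite (normrM (a x - a y)) (normrM (mollifier _ _)).
apply: (@le_trans _ _ (n%:R * (eps k * C1) * (E * ((eps k)^-1 * C3)) + E * C2 * C1)).
  by apply: lerD; apply: ler_pM => //; exact: HC1.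
rewrite le_eqVlt; apply/orP; left; apply/eqP; field.
by rewrite gt_eqF.
Qed.

(** As a function of [x] the kernel is the derivative of (a(x) - a(y)) rho_k(x - y), which has
    compact support. *)
Lemma Rintegral_commutator_kernel k y : \int[mu]_x commutator_kernel k (x, y) = 0.
Proof.
have rs : smooth (rho k) by exact: smooth_mollifier.
pose F x := (a x - a y) * rho k (x - y).
have Fs : smooth F.
  apply: smoothM; last exact: smooth_translate.
  by apply: smoothD => //; exact: smooth_cst.
have Fc : supported_in y (eps k) F.
  apply: supportedM => x nxy; apply: supported_mollifier; first exact: eps_gt0.
  by move=> h; apply: nxy => i; have := h i; rewrite !mxE subr0.
have pF x : partial j F x =
    (a x - a y) * partial j (rho k) (x - y) + rho k (x - y) * partial j a x.
  rewrite partialM; last 2 first.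
  - by apply: smooth_differentiable; apply: smoothD => //; exact: smooth_cst.
  - exact/smooth_differentiable/smooth_translate.
  rewrite partial_translate//; congr (_ + _ * _).
  rewrite /partial (_ : (fun x => a x - a y) = a - cst (a y))// deriveB//.
    by rewrite derive_cst subr0.
  by apply/diff_derivable/smooth_differentiable.
rewrite (@eq_Rintegral _ _ _ _ _ (fun x => \1_(cube 0 r) y * partial j F x)); last first.
  by move=> x _; rewrite commutator_kernelE pF.
rewrite RintegralZl//; last first.
  apply: (@rintegrable_supported R n (partial j F) y (eps k)).
    exact/smooth_continuous/smooth_partial.
  exact: supported_partial.
by rewrite (@Rintegral_partial_eq0 R n F j y (eps k))// mulr0.
Qed.

Lemma commutator_bounded_pairing : exists M, bounded_pairing commutator_kernel M.
Proof.
have [C C0 HC] := commutator_kernel_bound; exists (C * 2 ^+ n).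
by apply: bounded_pairingP => //; exact: measurable_commutator_kernel.
Qed.

(** An approximate identity of mass 0; no smoothness of [g] or [h] enters. *)
Lemma friedrichs g h : sq_integrable mu g -> sq_integrable mu h -> rintegrable mu h ->
  pairing g h (commutator_kernel k) @[k --> \oo] --> (0 : R).
Proof.
move=> gs hs hi; have [C C0 HC] := commutator_kernel_bound.
rewrite -[X in _ --> X](mul0r (\int[mu]_x (g x * h x))).
apply: (@approximate_identity R n commutator_kernel (fun k => C * (eps k)^-1 ^+ n) eps
  (C * 2 ^+ n)) => //.
- exact: measurable_commutator_kernel.
- by move=> k; rewrite mulr_ge0// exprn_ge0// invr_ge0 ltW// eps_gt0.
- by move=> k; rewrite ltW// eps_gt0.
- by move=> k; rewrite rescale_bound// eps_gt0.
- exact: cvg_eps.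
- by move=> k y; exact: Rintegral_commutator_kernel.
Qed.

End friedrichs.

(** * Integrals with their integrability, and kernels near the diagonal *)

Section has_integral.
Context d (T : measurableType d) (R : realType) (m : {measure set T -> \bar R}).
Implicit Types (f g : T -> R) (u v : R).

(** Value and integrability travel together, since the real integral of a non-integrable function is
    a default value and not additive. *)
Definition has_integral f v := rintegrable m f /\ \int[m]_x f x = v.

Lemma has_integralP f : rintegrable m f -> has_integral f (\int[m]_x f x).
Proof. by []. Qed.

Lemma has_integralD f g u v : has_integral f u -> has_integral g v ->
  has_integral (fun x => f x + g x) (u + v).
Proof. by move=> [fi <-] [gi <-]; split; [exact: rintegrableD|rewrite RintegralD]. Qed.

Lemma has_integralB f g u v : has_integral f u -> has_integral g v ->
  has_integral (fun x => f x - g x) (u - v).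
Proof. by move=> [fi <-] [gi <-]; split; [exact: rintegrableB|rewrite RintegralB]. Qed.

Lemma has_integralZ c f u : has_integral f u -> has_integral (fun x => c * f x) (c * u).
Proof. by move=> [fi <-]; split; [exact: rintegrableZl|rewrite RintegralZl]. Qed.

Lemma has_integralN f u : has_integral f u -> has_integral (fun x => - f x) (- u).
Proof.
move=> fu; have := has_integralZ (-1) fu; rewrite mulN1r.
by under [X in has_integral X]eq_fun do rewrite mulN1r.
Qed.

Lemma has_integral_sum (I : Type) (s : seq I) (f : I -> T -> R) (u : I -> R) :
  (forall i, has_integral (f i) (u i)) ->
  has_integral (fun x => \sum_(i <- s) f i x) (\sum_(i <- s) u i).
Proof.
move=> fu; split; first by apply: rintegrable_sum => i; have [] := fu i.
rewrite Rintegral_sum; last by move=> i; have [] := fu i.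
by apply: eq_bigr => i _; have [] := fu i.
Qed.

Lemma has_integral_eq f g u v : (forall x, f x = g x) -> has_integral f u ->
  has_integral g v -> u = v.
Proof. by move=> fg [_ <-] [_ <-]; apply: eq_Rintegral => x _. Qed.

Lemma eq_has_integral f g u : (forall x, f x = g x) -> has_integral f u -> has_integral g u.
Proof. by move=> fg; rewrite (_ : f = g)//; exact/funext. Qed.

End has_integral.

Section local_kernels.
Context (R : realType) (n : nat).
Local Notation rV := 'rV[R]_n.
Local Notation mu := (lebesgue_rV R n).

(** The bound may depend on the cube and on the kernel. It only justifies Fubini at fixed [k];
    bounds uniform in [k] are obtained separately, after cancellation. *)
Definition local_kernel (e : R) (N : rV * rV -> R) := measurable_fun setT N /\
  forall r, exists2 A, 0 <= A & kernel_bound (fun z => \1_(cube 0 r) z.2 * N z) A e.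

Lemma eq_local_kernel e N1 N2 : (forall z, N1 z = N2 z) ->
  local_kernel e N1 -> local_kernel e N2.
Proof. by move=> E; rewrite (_ : N1 = N2)//; exact/funext. Qed.

Lemma local_kernelD e N1 N2 : local_kernel e N1 -> local_kernel e N2 ->
  local_kernel e (fun z => N1 z + N2 z).
Proof.
move=> [m1 b1] [m2 b2]; split; first exact: measurable_funD.
move=> r; have [A1 A10 h1] := b1 r; have [A2 A20 h2] := b2 r.
exists (A1 + A2); first exact: addr_ge0.
move=> x y; rewrite mulrDr mulrDl; apply: (le_trans (ler_normD _ _)).
by apply: lerD; [exact: h1|exact: h2].
Qed.

Lemma local_kernelN e N : local_kernel e N -> local_kernel e (fun z => - N z).
Proof.
move=> [mN bN]; split; first exact: measurable_funN.
move=> r; have [A A0 h] := bN r; exists A => // x y.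
by rewrite mulrN normrN; exact: h.
Qed.

Lemma local_kernelB e N1 N2 : local_kernel e N1 -> local_kernel e N2 ->
  local_kernel e (fun z => N1 z - N2 z).
Proof. by move=> l1 l2; apply: local_kernelD => //; exact: local_kernelN. Qed.

Lemma local_kernel0 e : local_kernel e (fun=> 0).
Proof.
split; first exact: measurable_cst.
by move=> r; exists 0 => // x y; rewrite mulr0 normr0 mul0r.
Qed.

Lemma local_kernel_sum e (I : Type) (s : seq I) (N : I -> rV * rV -> R) :
  (forall i, local_kernel e (N i)) -> local_kernel e (fun z => \sum_(i <- s) N i z).
Proof.
move=> lN; elim: s => [|i s IHs].
  by under eq_fun do rewrite big_nil; exact: local_kernel0.
by under eq_fun do rewrite big_cons; exact: local_kernelD.
Qed.

Lemma bounded_on_shifted_cube (p : rV -> R) (r e : R) :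
  (forall r, exists C : R, 0 <= C /\ forall x, cube 0 r x -> `|p x| <= C) ->
  exists2 C : R, 0 <= C & forall x y, cube 0 r y -> cube y e x -> `|p x| <= C.
Proof.
move=> /(_ (r + e)) [C [C0 HC]]; exists C => // x y ry xy; apply: HC => i.
have := ry i; have := xy i; rewrite !mxE !subr0.
have := lerB_dist (x ord0 i) (y ord0 i).
by lra.
Qed.

(* [p] is only required to be locally bounded, in order to allow for the potential *)
Lemma local_kernel_left e (p q : rV -> R) : measurable_fun setT p ->
  (forall r, exists C : R, 0 <= C /\ forall x, cube 0 r x -> `|p x| <= C) ->
  continuous q -> supported_in 0 e q ->
  local_kernel e (fun z => p z.1 * q (z.1 - z.2)).
Proof.
move=> mp bp cq sq; have [C C0 HC] := supported_bounded cq sq.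
split.
  apply: measurable_funM; last exact: measurable_conv.
  exact: (measurableT_comp mp measurable_fst).
move=> r; have [C' C'0 HC'] := @bounded_on_shifted_cube p r e bp.
exists (C' * C); first exact: mulr_ge0.
move=> x y /=; rewrite [\1_(cube 0 r) y]indicE; have [yr|yr] := boolP (y \in cube 0 r); last first.
  by rewrite mul0r normr0 mulr_ge0// mulr_ge0.
rewrite mul1r; move: yr; rewrite inE => yr.
rewrite indicE; have [xy|xy] := boolP (x \in cube y e).
  rewrite mulr1 normrM; apply: ler_pM => //.
  by apply: (HC' x y) => //; move: xy; rewrite inE.
rewrite sq ?mulr0 ?normr0// => h; move: xy; rewrite notin_setE; apply => i.
by have := h i; rewrite !mxE subr0.
Qed.

Lemma local_kernel_right e (p q : rV -> R) : measurable_fun setT p ->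
  (forall r, exists C : R, 0 <= C /\ forall x, cube 0 r x -> `|p x| <= C) ->
  continuous q -> supported_in 0 e q ->
  local_kernel e (fun z => p z.2 * q (z.1 - z.2)).
Proof.
move=> mp bp cq sq; have [C C0 HC] := supported_bounded cq sq.
split.
  apply: measurable_funM; last exact: measurable_conv.
  exact: (measurableT_comp mp measurable_snd).
move=> r; have [C' [C'0 HC']] := bp r.
exists (C' * C); first exact: mulr_ge0.
move=> x y /=; rewrite [\1_(cube 0 r) y]indicE; have [yr|yr] := boolP (y \in cube 0 r); last first.
  by rewrite mul0r normr0 mulr_ge0// mulr_ge0.
rewrite mul1r; move: yr; rewrite inE => yr.
rewrite indicE; have [xy|xy] := boolP (x \in cube y e).
  by rewrite mulr1 normrM; apply: ler_pM => //; exact: HC'.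
rewrite sq ?mulr0 ?normr0// => h; move: xy; rewrite notin_setE; apply => i.
by have := h i; rewrite !mxE subr0.
Qed.

(** The support of [h] supplies the indicator on which the local bound depends. *)
Lemma local_kernel_integrable e r N g h : 0 <= e -> local_kernel e N ->
  sq_integrable mu g -> sq_integrable mu h -> supported_in 0 r h ->
  rintegrable (mu \x mu)%E (fun z => g z.1 * h z.2 * N z).
Proof.
move=> e0 [mN bN] gs hs hr; have [A A0 bA] := bN r.
rewrite (_ : (fun z => _) = (fun z => g z.1 * h z.2 * (\1_(cube 0 r) z.2 * N z))).
  apply: (rintegrable_kernel _ A0 e0 bA (lexx _) gs hs).
  apply: measurable_funM => //.
  apply: (measurableT_comp _ measurable_snd); apply: measurable_indic.
  exact: measurable_cube.
apply/funext => z; rewrite indicE; have [zr|zr] := boolP (z.2 \in cube 0 r).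
  by rewrite mul1r.
by rewrite hr ?mulr0 ?mul0r//; move: zr; rewrite notin_setE.
Qed.

Lemma pairing_has_integral g h (N : rV * rV -> R) (G : rV -> R) :
  rintegrable (mu \x mu)%E (fun z => g z.1 * h z.2 * N z) ->
  (forall y, has_integral mu (fun x => g x * N (x, y)) (G y)) ->
  has_integral mu (fun y => h y * G y) (pairing g h N).
Proof.
move=> I H.
have E y : \int[mu]_x (g x * h y * N (x, y)) = h y * G y.
  have [i <-] := H y; rewrite -RintegralZl//.
  by apply: eq_Rintegral => x _; rewrite mulrA [h y * _]mulrC.
split.
  have := integrable_Rintegral2 I.
  by under [X in _.-integrable _ (_ \o X)]eq_fun do rewrite E.
rewrite /pairing (Rintegral_prod2 I).
by apply: eq_Rintegral => y _; rewrite E.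
Qed.

(** Integration in [y] first, the order in which the eigenfunction equation can be used for each
    fixed [x]. *)
Lemma pairing_swap_eq0 g h (N : rV * rV -> R) :
  rintegrable (mu \x mu)%E (fun z => g z.1 * h z.2 * N z) ->
  (forall x, has_integral mu (fun y => h y * N (x, y)) 0) ->
  pairing g h N = 0.
Proof.
move=> I H; rewrite /pairing (Rintegral_prod1 I).
rewrite (@eq_Rintegral _ _ _ _ _ (cst 0)).
  by rewrite Rintegral_cst// mul0r.
move=> x _; have [i E] := H x.
transitivity (\int[mu]_y (g x * (h y * N (x, y)))).
  by apply: eq_Rintegral => y _; rewrite mulrA.
by rewrite RintegralZl// E mulr0.
Qed.

Lemma sq_integrable_local_slice e N y : 0 <= e -> local_kernel e N ->
  sq_integrable mu (fun x => N (x, y)).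
Proof.
move=> e0 [mN bN]; have [A A0 bA] := bN `|y|.
have yy : y \in cube 0 `|y|.
  by rewrite inE => i; rewrite mxE subr0; exact: coord_le_norm.
have mNy : measurable_fun setT (fun x => N (x, y)).
  exact: (measurableT_comp mN (pair2_measurable y)).
have Is : sq_integrable mu (fun x => A * \1_(cube y e) x).
  apply/sq_integrableZ/sq_integrable_indic; first exact: measurable_cube.
  exact: lebesgue_rV_cube_lty.
apply: sq_integrable_le Is => // x.
have := bA x y; rewrite /= [\1_(cube 0 _) y]indicE yy mul1r => /le_trans; apply.
exact: ler_norm.
Qed.

(** A majorant that is a product of a function of [x] and one of [y], as needed to integrate over
    time and both space variables at once. *)
Lemma local_kernel_product_bound e r N h : e <= 1 -> local_kernel e N -> supported_in 0 r h ->
  exists2 A, 0 <= A & forall x y, `|h y * N (x, y)| <= A * `|h y| * \1_(cube 0 (r + 1)) x.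
Proof.
move=> e1 [mN bN] hr; have [A A0 bA] := bN r; exists A => // x y.
have [yr|yr] := pselect (cube 0 r y); last by rewrite hr// mul0r normr0 mulr0 mul0r.
have := bA x y; rewrite /= [\1_(cube 0 r) y]indicE mem_set// mul1r => h1.
rewrite normrM [A * _]mulrC -mulrA ler_wpM2l//; apply: (le_trans h1).
rewrite ler_wpM2l// !indicE ler_nat; have [xy|//] := boolP (x \in cube y e).
rewrite mem_set//; move: xy; rewrite inE => xy i.
have := yr i; have := xy i; rewrite !mxE !subr0.
by have := lerB_dist (x ord0 i) (y ord0 i); lra.
Qed.

End local_kernels.

(** * The eigenfunction equation against a mollified function *)

Section spatial_identity.
Context (R : realType) (n : nat).
Local Notation rV := 'rV[R]_n.
Local Notation mu := (lebesgue_rV R n).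
Local Notation eps := (@eps R).
Local Notation rho k := (@mollifier R n (eps k)).

Lemma locally_bounded_continuous (p : rV -> R) : continuous p ->
  forall r, exists C : R, 0 <= C /\ forall x, cube 0 r x -> `|p x| <= C.
Proof.
by move=> cp r; have [C C0 HC] := @bounded_on_cube R n p 0 r cp; exists C.
Qed.

Lemma locally_bounded (p : rV -> R) : bounded_fct p ->
  forall r, exists C : R, 0 <= C /\ forall x, cube 0 r x -> `|p x| <= C.
Proof.
move=> [C HC] r; exists `|C|; split => // x _.
exact: le_trans (HC x) (ler_norm _).
Qed.

Lemma smooth_sum (I : Type) (s : seq I) (f : I -> rV -> R) :
  (forall i, smooth (f i)) -> smooth (fun x => \sum_(i <- s) f i x).
Proof.
move=> fs; elim: s => [|i s IHs].
  by under eq_fun do rewrite big_nil; exact: smooth_cst.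
by under eq_fun do rewrite big_cons; exact: smoothD.
Qed.

Variables (L : diffop2 R n) (V : rV -> R) (sigma : R) (chi zeta : rV -> R) (r : R).
Hypothesis L_coef : smooth_bounded L.
Hypotheses (V_meas : measurable_fun setT V) (V_bounded : bounded_fct V).
Hypotheses (chi_sq : sq_integrable mu chi) (chi_int : rintegrable mu chi).
Hypothesis chi_eigen : forall psi, test_function setT psi ->
  \int[mu]_x (chi x * (apply_op L psi x - V x * psi x)) =
  - sigma ^+ 2 * \int[mu]_x (chi x * psi x).
Hypotheses (zeta_smooth : smooth zeta) (zeta_supp : supported_in 0 r zeta).

Let a2s i j : smooth (Defs.coef2 L i j). Proof. by have [/(_ i j)[]] := L_coef. Qed.
Let a2b i j : bounded_fct (Defs.coef2 L i j). Proof. by have [/(_ i j)[]] := L_coef. Qed.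
Let a1s i : smooth (Defs.coef1 L i). Proof. by have [_ /(_ i)[]] := L_coef. Qed.
Let a1b i : bounded_fct (Defs.coef1 L i). Proof. by have [_ /(_ i)[]] := L_coef. Qed.
Let a0s : smooth (Defs.coef0 L). Proof. by have [_ _ []] := L_coef. Qed.
Let a0b : bounded_fct (Defs.coef0 L). Proof. by have [_ _ []] := L_coef. Qed.

Definition cut_chi (x : rV) : R := zeta x * chi x.

(** What the spatial part of the linearized wave equation becomes when tested with rho_k(x - y): the
    adjoint operator acts in [x]. *)
Definition wave_kernel k (z : rV * rV) : R :=
  formal_adjoint L (fun x => rho k (x - z.2)) z.1 - V z.1 * rho k (z.1 - z.2).

(** Here [L] acts in [y], on a test function of the eigenfunction equation; paired with [chi] in
    [y], this kernel gives 0. Subtracting it from [wave_kernel] is what cancels the second-order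
    terms. *)
Definition eigen_kernel k (z : rV * rV) : R :=
  let psi := fun y => zeta y * rho k (z.1 - y) in
  apply_op L psi z.2 - V z.2 * psi z.2 + sigma ^+ 2 * psi z.2.

Let rs k : smooth (rho k). Proof. exact: smooth_mollifier. Qed.
Let e0 k : 0 < eps k. Proof. exact: eps_gt0. Qed.
Let rsupp k : supported_in 0 (eps k) (rho k). Proof. exact: supported_mollifier. Qed.

Let drs k i : smooth (partial i (rho k)). Proof. exact: smooth_partial. Qed.
Let drsupp k i : supported_in 0 (eps k) (partial i (rho k)).
Proof. exact: supported_partial. Qed.
Let ddrs k i j : smooth (partial i (partial j (rho k))). Proof. exact: smooth_partial. Qed.
Let ddrsupp k i j : supported_in 0 (eps k) (partial i (partial j (rho k))).
Proof. exact: supported_partial. Qed.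

Lemma partial_fun_mulM i (f g : rV -> R) : smooth f -> smooth g ->
  partial i (fun x => f x * g x) = (fun x => f x * partial i g x + g x * partial i f x).
Proof.
by move=> fs gs; apply/funext => x; rewrite partialM//; exact: smooth_differentiable.
Qed.

Lemma partial_fun_addD i (f g : rV -> R) : smooth f -> smooth g ->
  partial i (fun x => f x + g x) = (fun x => partial i f x + partial i g x).
Proof.
move=> fs gs; apply/funext => x; rewrite /partial deriveD//;
  by apply/diff_derivable/smooth_differentiable.
Qed.

Lemma partial_fun_oppN i (f : rV -> R) : smooth f ->
  partial i (fun x => - f x) = (fun x => - partial i f x).
Proof.
move=> fs; apply/funext => x; rewrite /partial deriveN//.
by apply/diff_derivable/smooth_differentiable.
Qed.

(** In expanded form every term is a locally bounded function of [x] times a derivative of the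
    mollifier, hence a local kernel. *)
Lemma wave_kernelE k z : wave_kernel k z =
  \sum_i \sum_j ((Defs.coef2 L i j z.1 * partial i (partial j (rho k)) (z.1 - z.2)
    + partial i (Defs.coef2 L i j) z.1 * partial j (rho k) (z.1 - z.2))
    + (partial j (Defs.coef2 L i j) z.1 * partial i (rho k) (z.1 - z.2)
    + partial i (partial j (Defs.coef2 L i j)) z.1 * rho k (z.1 - z.2)))
  - \sum_i (Defs.coef1 L i z.1 * partial i (rho k) (z.1 - z.2)
    + partial i (Defs.coef1 L i) z.1 * rho k (z.1 - z.2))
  + Defs.coef0 L z.1 * rho k (z.1 - z.2) - V z.1 * rho k (z.1 - z.2).
Proof.
rewrite /wave_kernel /formal_adjoint; congr (_ - _ + _ - _).
  apply: eq_bigr => i _; apply: eq_bigr => j _.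
  rewrite (_ : (Defs.coef2 L i j \* _) = (fun x => Defs.coef2 L i j x * rho k (x - z.2)))//.
  have s1 : smooth (fun x => rho k (x - z.2)) by exact: smooth_translate.
  have s2 : smooth (fun x => partial j (rho k) (x - z.2)) by exact: smooth_translate.
  rewrite partial_fun_mulM// partial_translate// partial_fun_addD; last 2 first.
  - exact: smoothM.
  - by apply: smoothM => //; exact: smooth_partial.
  rewrite partial_fun_mulM// partial_fun_mulM//; last exact: smooth_partial.
  rewrite !partial_translate//.
  move: (Defs.coef2 L i j z.1) (partial i (Defs.coef2 L i j) z.1)
    (partial j (Defs.coef2 L i j) z.1) (partial i (partial j (Defs.coef2 L i j)) z.1)
    (rho k (z.1 - z.2)) (partial i (rho k) (z.1 - z.2)) (partial j (rho k) (z.1 - z.2))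
    (partial i (partial j (rho k)) (z.1 - z.2)).
  by move=> *; ring.
apply: eq_bigr => i _.
rewrite (_ : (Defs.coef1 L i \* _) = (fun x => Defs.coef1 L i x * rho k (x - z.2)))//.
rewrite partial_fun_mulM//; last exact: smooth_translate.
by rewrite partial_translate//; ring.
Qed.

Let lks k (p q : rV -> R) : smooth p -> smooth q -> supported_in 0 (eps k) q ->
  local_kernel (eps k) (fun z => p z.1 * q (z.1 - z.2)).
Proof.
move=> ps qs qsupp; apply: local_kernel_left => //.
- exact: smooth_measurable.
- by apply: locally_bounded_continuous; exact: smooth_continuous.
- exact: smooth_continuous.
Qed.

Let lks' k (p q : rV -> R) : smooth p -> smooth q -> supported_in 0 (eps k) q ->
  local_kernel (eps k) (fun z => p z.2 * q (z.1 - z.2)).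
Proof.
move=> ps qs qsupp; apply: local_kernel_right => //.
- exact: smooth_measurable.
- by apply: locally_bounded_continuous; exact: smooth_continuous.
- exact: smooth_continuous.
Qed.

Lemma local_wave_kernel k : local_kernel (eps k) (wave_kernel k).
Proof.
apply: (eq_local_kernel (fun z => esym (wave_kernelE k z))).
apply: local_kernelB.
  apply: local_kernelD; last exact: lks.
  apply: local_kernelB.
    apply: local_kernel_sum => i; apply: local_kernel_sum => j.
    apply: local_kernelD; apply: local_kernelD; apply: lks => //;
      by do 2?apply: smooth_partial.
  by apply: local_kernel_sum => i; apply: local_kernelD; apply: lks => //;
    apply: smooth_partial.
apply: local_kernel_left => //; first exact: locally_bounded.
exact: smooth_continuous.
Qed.

Let zs i : smooth (partial i zeta). Proof. exact: smooth_partial. Qed.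
Let zzs i j : smooth (partial i (partial j zeta)). Proof. exact: smooth_partial. Qed.

Lemma eigen_kernelE k z : eigen_kernel k z =
  \sum_i \sum_j Defs.coef2 L i j z.2 *
    ((partial i (partial j zeta) z.2 * rho k (z.1 - z.2)
      - partial j zeta z.2 * partial i (rho k) (z.1 - z.2))
     - (partial i zeta z.2 * partial j (rho k) (z.1 - z.2)
      - zeta z.2 * partial i (partial j (rho k)) (z.1 - z.2)))
  + \sum_i Defs.coef1 L i z.2 * (partial i zeta z.2 * rho k (z.1 - z.2)
      - zeta z.2 * partial i (rho k) (z.1 - z.2))
  + Defs.coef0 L z.2 * (zeta z.2 * rho k (z.1 - z.2))
  - V z.2 * (zeta z.2 * rho k (z.1 - z.2))
  + sigma ^+ 2 * (zeta z.2 * rho k (z.1 - z.2)).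
Proof.
have d1 j : partial j (fun y => zeta y * rho k (z.1 - y)) =
    (fun y => partial j zeta y * rho k (z.1 - y) - zeta y * partial j (rho k) (z.1 - y)).
  rewrite partial_fun_mulM//; last exact: smooth_reflect.
  by rewrite partial_reflect//; apply/funext => y; ring.
rewrite /eigen_kernel /apply_op; congr (_ + _ + _ - _ + _).
  apply: eq_bigr => i _; apply: eq_bigr => j _; congr (_ * _).
  have s1 : smooth (fun y => rho k (z.1 - y)) by exact: smooth_reflect.
  have s2 : smooth (fun y => partial j (rho k) (z.1 - y)) by exact: smooth_reflect.
  have s3 : smooth (fun y => partial j zeta y * rho k (z.1 - y)) by exact: smoothM.
  have s4 : smooth (fun y => zeta y * partial j (rho k) (z.1 - y)) by exact: smoothM.
  rewrite d1 partial_fun_addD//; last exact: smoothN.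
  rewrite partial_fun_oppN// partial_fun_mulM// partial_fun_mulM//.
  rewrite !partial_reflect//.
  move: (partial i (partial j zeta) z.2) (partial j zeta z.2) (partial i zeta z.2)
    (zeta z.2) (rho k (z.1 - z.2)) (partial i (rho k) (z.1 - z.2))
    (partial j (rho k) (z.1 - z.2)) (partial i (partial j (rho k)) (z.1 - z.2)).
  by move=> *; ring.
by apply: eq_bigr => i _; rewrite d1.
Qed.

Let lks2 k (p p' q : rV -> R) : smooth p -> smooth p' -> smooth q ->
  supported_in 0 (eps k) q ->
  local_kernel (eps k) (fun z => p z.2 * (p' z.2 * q (z.1 - z.2))).
Proof.
move=> ps ps' qs qsupp; under eq_fun do rewrite mulrA.
by apply: (@lks' k (fun y => p y * p' y)) => //; exact: smoothM.
Qed.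

Lemma local_eigen_kernel k : local_kernel (eps k) (eigen_kernel k).
Proof.
apply: (eq_local_kernel (fun z => esym (eigen_kernelE k z))).
apply: local_kernelD; last first.
  by apply: (@lks2 k (fun=> sigma ^+ 2)) => //; exact: smooth_cst.
apply: local_kernelB; last first.
  under eq_fun do rewrite mulrA.
  apply: (@local_kernel_right R n (eps k) (fun y => V y * zeta y)) => //.
  - by apply: measurable_funM => //; exact: smooth_measurable.
  - move=> s; have [C1 [C10 H1]] := locally_bounded V_bounded s.
    have [C2 [C20 H2]] := locally_bounded_continuous (smooth_continuous zeta_smooth) s.
    exists (C1 * C2); split; first exact: mulr_ge0.
    by move=> x sx; rewrite normrM; apply: ler_pM => //; [exact: H1|exact: H2].
  - exact: smooth_continuous.
apply: local_kernelD; last exact: lks2.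
apply: local_kernelD.
  apply: local_kernel_sum => i; apply: local_kernel_sum => j.
  under eq_fun do rewrite !mulrBr.
  by apply: local_kernelB; apply: local_kernelB; exact: lks2.
apply: local_kernel_sum => i; under eq_fun do rewrite !mulrBr.
by apply: local_kernelB; exact: lks2.
Qed.

(** The weak gradient is an explicit companion instead of the chosen [weak_gradient], so that pairs
    can be added and negated exactly. *)
Definition weak_pair (W : rV -> R) (D : 'I_n -> rV -> R) :=
  [/\ sq_integrable mu W, forall i, sq_integrable mu (D i) &
   forall i psi, test_function setT psi ->
     \int[mu]_x (W x * partial i psi x) = - \int[mu]_x (D i x * psi x)].

Lemma weak_pair_has_integral W D i psi c s : weak_pair W D -> smooth psi ->
  supported_in c s psi ->
  has_integral mu (fun x => W x * partial i psi x) (- \int[mu]_x (D i x * psi x)).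
Proof.
move=> [Ws Ds WD] ps pc; split; last by apply: WD; exact: test_function_supported pc.
apply: rintegrable_sqM => //; apply: sq_integrable_supported (supported_partial i pc).
exact/smooth_continuous/smooth_partial.
Qed.

Lemma supported_translate e y (q : rV -> R) : supported_in 0 e q ->
  supported_in y e (fun x => q (x - y)).
Proof. by move=> qc x nx; apply: qc => h; apply: nx => i; have := h i; rewrite !mxE subr0. Qed.

Lemma sq_integrable_translate e y (q : rV -> R) : smooth q -> supported_in 0 e q ->
  sq_integrable mu (fun x => q (x - y)).
Proof.
move=> qs qc; apply: (@sq_integrable_supported R n _ y e).
  exact/smooth_continuous/smooth_translate.
exact: supported_translate.
Qed.

Lemma has_integral_conv k (g : rV -> R) y : sq_integrable mu g ->
  has_integral mu (fun x => g x * moll_kernel k (x, y)) (\int[mu]_x (g x * rho k (x - y))).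
Proof.
by move=> gs; split => //; apply: rintegrable_sqM => //; apply: sq_integrable_translate; [exact: rs|exact: rsupp].
Qed.

Let pr k (g h : rV -> R) := pairing g h (moll_kernel k).

Let prP k g h : sq_integrable mu g -> sq_integrable mu h ->
  has_integral mu (fun y => h y * \int[mu]_x (g x * rho k (x - y))) (pr k g h).
Proof.
move=> gs hs; apply: pairing_has_integral => [|y]; last exact: has_integral_conv.
by have [M [_ HM]] := moll_bounded_pairing R n; have [] := HM g h k gs hs.
Qed.

Lemma cut_chi_sq : sq_integrable mu cut_chi.
Proof.
have [C C0 HC] := supported_bounded (smooth_continuous zeta_smooth) zeta_supp.
rewrite /cut_chi; under eq_fun do rewrite mulrC.
by apply: sq_integrable_bounded HC => //; exact: smooth_measurable.
Qed.

Lemma cut_chi_int : rintegrable mu cut_chi.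
Proof.
have [C C0 HC] := supported_bounded (smooth_continuous zeta_smooth) zeta_supp.
rewrite /cut_chi; under eq_fun do rewrite mulrC.
by apply: rintegrable_bounded HC => //; exact: smooth_measurable.
Qed.

Lemma cut_chi_supp : supported_in 0 r cut_chi.
Proof. by move=> x nx; rewrite /cut_chi zeta_supp ?mul0r. Qed.

Let c0V_meas : measurable_fun setT (fun x => Defs.coef0 L x - V x).
Proof. by apply: measurable_funB => //; exact: smooth_measurable. Qed.

Let c0V_bounded : exists C : R, forall x, `|Defs.coef0 L x - V x| <= C.
Proof.
have [C1 H1] := a0b; have [C2 H2] := V_bounded; exists (C1 + C2) => x.
by apply: (le_trans (ler_normB _ _)); exact: lerD.
Qed.

Section weak_pairing.
Variables (W : rV -> R) (D : 'I_n -> rV -> R) (WD : weak_pair W D).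

Let Ws : sq_integrable mu W. Proof. by have [] := WD. Qed.
Let Ds i : sq_integrable mu (D i). Proof. by have [] := WD. Qed.

(** Both kernel slices are expressed in these integrals, in which one derivative has moved onto [W].
    The only singular ones are [al] and [be], and they meet in the combination al - a_ij(y) be, a
    commutator. *)
Let al k i j y := \int[mu]_x (D i x * partial j (fun x => Defs.coef2 L i j x * rho k (x - y)) x).
Let be k i j y := \int[mu]_x (D i x * partial j (rho k) (x - y)).
Let ga k i y := \int[mu]_x (D i x * rho k (x - y)).
Let de k i y := \int[mu]_x (D i x * Defs.coef1 L i x * rho k (x - y)).
Let om k y := \int[mu]_x (W x * rho k (x - y)).
Let et k y := \int[mu]_x (W x * (Defs.coef0 L x - V x) * rho k (x - y)).

Let Wc0V : sq_integrable mu (fun x => W x * (Defs.coef0 L x - V x)).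
Proof. by have [C HC] := c0V_bounded; exact: sq_integrable_bounded HC. Qed.

Let Db i : sq_integrable mu (fun x => D i x * Defs.coef1 L i x).
Proof.
have [C HC] := a1b i; apply: sq_integrable_bounded HC => //.
exact: smooth_measurable.
Qed.

Let wave_slice k y : has_integral mu (fun x => W x * wave_kernel k (x, y))
  (\sum_i \sum_j (- al k i j y) - \sum_i (- de k i y) + et k y).
Proof.
have s1 : smooth (fun x => rho k (x - y)) by exact: smooth_translate.
have c1 : supported_in y (eps k) (fun x => rho k (x - y)) by exact: supported_translate.
apply: (@eq_has_integral _ _ _ _ (fun x =>
  \sum_i \sum_j W x * partial i (partial j (fun x => Defs.coef2 L i j x * rho k (x - y))) x
  - \sum_i W x * partial i (fun x => Defs.coef1 L i x * rho k (x - y)) x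
  + W x * (Defs.coef0 L x - V x) * rho k (x - y))).
  move=> x; rewrite /wave_kernel /formal_adjoint/=.
  set A := (X in _ = _ * (X - _ + _ - _)); set B := (X in _ = _ * (_ - X + _ - _)).
  rewrite (_ : W x * (A - B + _ - _) = W x * A - W x * B +
    W x * (Defs.coef0 L x - V x) * rho k (x - y)); last by ring.
  rewrite /A /B !big_distrr/=; congr (_ - _ + _).
  by apply: eq_bigr => i _; rewrite big_distrr.
apply: has_integralD.
  apply: has_integralB.
    apply: has_integral_sum => i; apply: has_integral_sum => j.
    apply: (@weak_pair_has_integral W D i _ y (eps k)) => //.
      by apply: smooth_partial; exact: smoothM.
    by apply: supported_partial; exact: supportedM.
  apply: has_integral_sum => i.
  have -> : de k i y = \int[mu]_x (D i x * (Defs.coef1 L i x * rho k (x - y))).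
    by apply: eq_Rintegral => x _; rewrite mulrA.
  apply: (@weak_pair_has_integral W D i _ y (eps k)) => //; first exact: smoothM.
  exact: supportedM.
exact: has_integral_conv.
Qed.

Let eigen_slice k y : has_integral mu (fun x => W x * eigen_kernel k (x, y))
  (\sum_i \sum_j Defs.coef2 L i j y *
    ((partial i (partial j zeta) y * om k y + partial j zeta y * ga k i y)
     + (partial i zeta y * ga k j y - zeta y * be k i j y))
  + \sum_i Defs.coef1 L i y * (partial i zeta y * om k y + zeta y * ga k i y)
  + Defs.coef0 L y * (zeta y * om k y) - V y * (zeta y * om k y)
  + sigma ^+ 2 * (zeta y * om k y)).
Proof.
have I0 : has_integral mu (fun x => W x * rho k (x - y)) (om k y) by exact: has_integral_conv.
have I1 i : has_integral mu (fun x => W x * partial i (rho k) (x - y)) (- ga k i y).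
  apply: (@eq_has_integral _ _ _ _ (fun x => W x * partial i (fun x => rho k (x - y)) x)).
    by move=> x; rewrite partial_translate.
  apply: (@weak_pair_has_integral W D i _ y (eps k)) => //; first exact: smooth_translate.
  exact: supported_translate.
have I2 i j : has_integral mu (fun x => W x * partial i (partial j (rho k)) (x - y)) (- be k i j y).
  apply: (@eq_has_integral _ _ _ _
      (fun x => W x * partial i (fun x => partial j (rho k) (x - y)) x)).
    by move=> x; rewrite partial_translate.
  apply: (@weak_pair_has_integral W D i _ y (eps k)) => //; first exact: smooth_translate.
  exact: supported_translate.
apply: (@eq_has_integral _ _ _ _ (fun x =>
  \sum_i \sum_j Defs.coef2 L i j y *
    ((partial i (partial j zeta) y * (W x * rho k (x - y))
      - partial j zeta y * (W x * partial i (rho k) (x - y)))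
     - (partial i zeta y * (W x * partial j (rho k) (x - y))
      - zeta y * (W x * partial i (partial j (rho k)) (x - y))))
  + \sum_i Defs.coef1 L i y * (partial i zeta y * (W x * rho k (x - y))
      - zeta y * (W x * partial i (rho k) (x - y)))
  + Defs.coef0 L y * (zeta y * (W x * rho k (x - y)))
  - V y * (zeta y * (W x * rho k (x - y)))
  + sigma ^+ 2 * (zeta y * (W x * rho k (x - y))))).
  move=> x; rewrite eigen_kernelE/= !(mulrDr (W x)) !big_distrr/= mulrN.
  congr (_ + _ + _ - _ + _); [|apply: eq_bigr => i _; ring|ring|ring|ring].
  apply: eq_bigr => i _; rewrite big_distrr/=; apply: eq_bigr => j _.
  move: (Defs.coef2 L i j y) (partial i (partial j zeta) y) (partial j zeta y)
    (partial i zeta y) (zeta y) (W x) (rho k (x - y)) (partial i (rho k) (x - y))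
    (partial j (rho k) (x - y)) (partial i (partial j (rho k)) (x - y)).
  by move=> *; ring.
apply: has_integralD; last by do 2 apply: has_integralZ.
apply: has_integralB; last by do 2 apply: has_integralZ.
apply: has_integralD; last by do 2 apply: has_integralZ.
apply: has_integralD.
  apply: has_integral_sum => i; apply: has_integral_sum => j; apply: has_integralZ.
  rewrite (_ : _ + _ = partial i (partial j zeta) y * om k y
    - partial j zeta y * - ga k i y
    - (partial i zeta y * - ga k j y - zeta y * - be k i j y)); last first.
    by move: (om k y) (ga k i y) (ga k j y) (be k i j y) => *; ring.
  by apply: has_integralB; apply: has_integralB; apply: has_integralZ.
apply: has_integral_sum => i; apply: has_integralZ.
rewrite -[zeta y * ga k i y]opprK -[- (zeta y * _)]mulrN.
by apply: has_integralB; apply: has_integralZ.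
Qed.

Lemma has_integral_commutator k i j y : has_integral mu
  (fun x => D i x * commutator_kernel (Defs.coef2 L i j) j r k (x, y))
  (\1_(cube 0 r) y * (al k i j y - Defs.coef2 L i j y * be k i j y)).
Proof.
have s1 : smooth (fun x => rho k (x - y)) by exact: smooth_translate.
have c1 : supported_in y (eps k) (fun x => rho k (x - y)) by exact: supported_translate.
apply: (@eq_has_integral _ _ _ _ (fun x => \1_(cube 0 r) y *
  (D i x * partial j (fun x => Defs.coef2 L i j x * rho k (x - y)) x -
   Defs.coef2 L i j y * (D i x * partial j (rho k) (x - y))))).
  move=> x; rewrite /commutator_kernel/=.
  move: (\1_(cube 0 r) y) (partial _ (fun _ => _) x) (partial j (rho k) (x - y)) (D i x)
    (Defs.coef2 L i j y).
  by move=> *; ring.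
apply: has_integralZ; apply: has_integralB; last apply: has_integralZ.
  split => //; apply: rintegrable_sqM => //; apply: (@sq_integrable_supported R n _ y (eps k)).
    by apply/smooth_continuous/smooth_partial; exact: smoothM.
  by apply: supported_partial; exact: supportedM.
split => //; apply: rintegrable_sqM => //.
by apply: (@sq_integrable_translate (eps k) y (partial j (rho k))); [exact: drs|exact: drsupp].
Qed.

Lemma wave_pairing_has_integral k : has_integral mu (fun y => cut_chi y *
    (\sum_i \sum_j (- al k i j y) - \sum_i (- de k i y) + et k y))
  (pairing W cut_chi (wave_kernel k)).
Proof.
apply: pairing_has_integral => [|y]; last exact: wave_slice.
apply: (@local_kernel_integrable R n (eps k) r) => //; first exact/ltW.
- exact: local_wave_kernel.
- exact: cut_chi_sq.
- exact: cut_chi_supp.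
Qed.

(** The double integral is computed in both orders. With [y] inside, each fixed [x] gives the
    eigenfunction equation tested with zeta(y) rho_k(x - y), hence 0; with [x] inside, the weak
    gradient of [W] gives the displayed integrand. *)
Lemma eigen_pairing_has_integral k : has_integral mu (fun y => chi y *
  (\sum_i \sum_j Defs.coef2 L i j y *
    ((partial i (partial j zeta) y * om k y + partial j zeta y * ga k i y)
     + (partial i zeta y * ga k j y - zeta y * be k i j y))
  + \sum_i Defs.coef1 L i y * (partial i zeta y * om k y + zeta y * ga k i y)
  + Defs.coef0 L y * (zeta y * om k y) - V y * (zeta y * om k y)
  + sigma ^+ 2 * (zeta y * om k y))) 0.
Proof.
(* Only the values of [chi] on the support of [zeta] matter; cutting it there yields the compact
   support which integrability of the local kernel requires. *)
pose chi' y := \1_(cube 0 r) y * chi y.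
have chi's : sq_integrable mu chi'.
  rewrite /chi'; under eq_fun do rewrite mulrC.
  apply: (@sq_integrable_bounded _ _ _ _ _ _ 1) => //.
    by apply: measurable_indic; exact: measurable_cube.
  by move=> x; rewrite indicE; case: (_ \in _); rewrite ?normr1 ?normr0.
have chi'r : supported_in 0 r chi'.
  by move=> x nx; rewrite /chi' indicE memNset ?mul0r.
have chi'M f y : (~ cube 0 r y -> f y = 0) -> chi' y * f y = chi y * f y.
  move=> f0; rewrite /chi' indicE; have [yr|yr] := boolP (y \in cube 0 r).
    by rewrite mul1r.
  by rewrite f0 ?mulr0//; move: yr; rewrite notin_setE.
have I : rintegrable (mu \x mu)%E (fun z => W z.1 * chi' z.2 * eigen_kernel k z).
  by apply: (@local_kernel_integrable R n (eps k) r) => //; [exact/ltW|exact: local_eigen_kernel].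
have out_eq0 x y : ~ cube 0 r y -> eigen_kernel k (x, y) = 0.
  move=> yr; rewrite eigen_kernelE/=.
  rewrite (zeta_supp yr) !(mul0r, mulr0) !big1 ?(addr0, subr0, mulr0)// => i _.
    by rewrite (supported_partial i zeta_supp yr) !mul0r subr0 mulr0.
  apply: big1 => j _.
  rewrite (supported_partial i (supported_partial j zeta_supp) yr).
  rewrite (supported_partial i zeta_supp yr) (supported_partial j zeta_supp yr).
  move: (rho k (x - y)) (partial i (rho k) (x - y)) (partial j (rho k) (x - y))
    (partial i (partial j (rho k)) (x - y)).
  by move=> *; ring.
have P0 : pairing W chi' (eigen_kernel k) = 0.
  apply: pairing_swap_eq0 => // x.
  pose psi y := zeta y * rho k (x - y).
  have psis : smooth psi by apply: smoothM => //; exact: smooth_reflect.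
  have psisupp : supported_in 0 r psi by exact: supportedMr.
  have ti : rintegrable mu (fun y => chi y * psi y).
    by apply: rintegrable_sqM => //; apply: sq_integrable_supported psisupp; exact: smooth_continuous.
  have tiV : rintegrable mu (fun y => chi y * psi y * V y).
    by have [C HC] := V_bounded; exact: rintegrable_bounded HC.
  have opi : rintegrable mu (fun y => chi y * apply_op L psi y).
    have ops : smooth (fun y => \sum_i \sum_j Defs.coef2 L i j y * partial i (partial j psi) y
         + \sum_i Defs.coef1 L i y * partial i psi y + Defs.coef0 L y * psi y).
      apply: smoothD; last exact: smoothM.
      apply: smoothD; apply: smooth_sum => i; last by apply: smoothM => //; exact: smooth_partial.
      by apply: smooth_sum => j; apply: smoothM => //; do 2 apply: smooth_partial.
    apply: rintegrable_sqM => //; apply: (@sq_integrable_supported R n _ 0 r).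
      exact: smooth_continuous ops.
    move=> y yr; rewrite /apply_op psisupp// mulr0 addr0 !big1 ?addr0// => i _.
      by rewrite (supported_partial i psisupp yr) mulr0.
    by rewrite big1// => j _; rewrite (supported_partial i (supported_partial j psisupp) yr) mulr0.
  have E y : chi y * (apply_op L psi y - V y * psi y) + sigma ^+ 2 * (chi y * psi y) =
      chi' y * eigen_kernel k (x, y).
    rewrite (chi'M (fun y => eigen_kernel k (x, y))); last exact: out_eq0.
    rewrite (_ : eigen_kernel k (x, y) = apply_op L psi y - V y * psi y + sigma ^+ 2 * psi y)//.
    by move: (apply_op L psi y) (psi y) => *; ring.
  apply: (eq_has_integral E); rewrite -(addNr (sigma ^+ 2 * \int[mu]_y (chi y * psi y))).
  apply: has_integralD; last exact: has_integralZ.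
  rewrite -mulNr -chi_eigen; last exact: test_function_supported psisupp.
  split => //; have := rintegrableB opi tiV; apply: eq_integrable => // y _ /=.
  by congr (_%:E); ring.
have := pairing_has_integral I (fun y => eigen_slice k y); rewrite P0.
apply: eq_has_integral => y; set E := (X in chi' y * X).
apply: (chi'M (fun=> E)) => yr; rewrite /E.
rewrite (zeta_supp yr) !(mul0r, mulr0) !big1 ?(addr0, subr0, mulr0)// => i _.
  by rewrite (supported_partial i zeta_supp yr) !mul0r addr0 mulr0.
apply: big1 => j _.
rewrite (supported_partial i (supported_partial j zeta_supp) yr).
rewrite (supported_partial i zeta_supp yr) (supported_partial j zeta_supp yr).
by rewrite !mul0r !(addr0, subr0) mulr0.
Qed.

Definition commutator i j : nat -> rV * rV -> R :=
  commutator_kernel (Defs.coef2 L i j) j r.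

(** The vanishing eigenfunction pairing is subtracted under the [y] integral. Second-order terms
    become commutators, derivatives falling on [zeta] become cutoff terms, and each lower-order
    coefficient appears twice, once evaluated at [x] and once at [y], so that the two cancel in the
    limit. *)
Lemma wave_pairingE k : pairing W cut_chi (wave_kernel k) =
  (\sum_i \sum_j (- pairing (D i) cut_chi (commutator i j k)
     - (pr k W (fun y => chi y * Defs.coef2 L i j y * partial i (partial j zeta) y)
      + pr k (D i) (fun y => chi y * Defs.coef2 L i j y * partial j zeta y)
      + pr k (D j) (fun y => chi y * Defs.coef2 L i j y * partial i zeta y)))
  + \sum_i (pr k (fun x => D i x * Defs.coef1 L i x) cut_chi
     - pr k (D i) (fun y => cut_chi y * Defs.coef1 L i y)
     - pr k W (fun y => chi y * Defs.coef1 L i y * partial i zeta y)))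
  + (pr k (fun x => W x * (Defs.coef0 L x - V x)) cut_chi
     - pr k W (fun y => cut_chi y * (Defs.coef0 L y - V y)))
  - sigma ^+ 2 * pr k W cut_chi.
Proof.
have hc := cut_chi_sq.
have h1 (q p : rV -> R) : smooth q -> bounded_fct q -> smooth p -> supported_in 0 r p ->
    sq_integrable mu (fun y => chi y * q y * p y).
  move=> qs [C HC] ps pc; have [C' C'0 HC'] := supported_bounded (smooth_continuous ps) pc.
  apply: sq_integrable_bounded HC'; last exact: smooth_measurable.
  by apply: sq_integrable_bounded HC => //; exact: smooth_measurable.
have h2 (q : rV -> R) : measurable_fun setT q -> bounded_fct q ->
    sq_integrable mu (fun y => cut_chi y * q y).
  by move=> qm [C HC]; exact: sq_integrable_bounded HC.
have Icomm i j : has_integral mu (fun y => cut_chi y * (al k i j y - Defs.coef2 L i j y * be k i j y))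
    (pairing (D i) cut_chi (commutator i j k)).
  have [M [_ HM]] := @commutator_bounded_pairing R n (Defs.coef2 L i j) j r (a2s i j).
  have [I _] := HM (D i) cut_chi k (Ds i) hc.
  have := pairing_has_integral I (fun y => @has_integral_commutator k i j y).
  apply: eq_has_integral => y; rewrite indicE; have [yr|yr] := boolP (y \in cube 0 r).
    by rewrite mul1r.
  by rewrite cut_chi_supp ?mul0r//; move: yr; rewrite notin_setE.
have zj j : supported_in 0 r (partial j zeta) by exact: supported_partial.
have zij i j : supported_in 0 r (partial i (partial j zeta)) by exact: supported_partial.
apply: (@has_integral_eq _ _ _ mu (fun y =>
  cut_chi y * (\sum_i \sum_j (- al k i j y) - \sum_i (- de k i y) + et k y) -
  chi y * (\sum_i \sum_j Defs.coef2 L i j y *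
    ((partial i (partial j zeta) y * om k y + partial j zeta y * ga k i y)
     + (partial i zeta y * ga k j y - zeta y * be k i j y))
  + \sum_i Defs.coef1 L i y * (partial i zeta y * om k y + zeta y * ga k i y)
  + Defs.coef0 L y * (zeta y * om k y) - V y * (zeta y * om k y)
  + sigma ^+ 2 * (zeta y * om k y)))
  (fun y => (\sum_i \sum_j (- (cut_chi y * (al k i j y - Defs.coef2 L i j y * be k i j y))
     - (chi y * Defs.coef2 L i j y * partial i (partial j zeta) y * om k y
      + chi y * Defs.coef2 L i j y * partial j zeta y * ga k i y
      + chi y * Defs.coef2 L i j y * partial i zeta y * ga k j y))
  + \sum_i (cut_chi y * de k i y - cut_chi y * Defs.coef1 L i y * ga k i y
     - chi y * Defs.coef1 L i y * partial i zeta y * om k y))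
  + (cut_chi y * et k y - cut_chi y * (Defs.coef0 L y - V y) * om k y)
  - sigma ^+ 2 * (cut_chi y * om k y))).
- move=> y.
  rewrite (_ : \sum_i \sum_j (- al k i j y) - \sum_i - de k i y =
    \sum_i (\sum_j (- al k i j y) + de k i y)); last first.
    by rewrite -sumrN -big_split/=; apply: eq_bigr => i _; rewrite opprK.
  rewrite -!big_split/=.
  set A := \sum_i (\sum_j - al k i j y + _).
  set B := \sum_i (\sum_j Defs.coef2 _ _ _ _ * _ + _).
  set C := (X in _ = X + _ - _).
  have -> : C = cut_chi y * A - chi y * B.
    rewrite /A /B /C !big_distrr/= -sumrB; apply: eq_bigr => i _.
    rewrite !mulrDr !big_distrr/= opprD addrACA -sumrB; congr (_ + _).
      apply: eq_bigr => j _; rewrite /cut_chi.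
      move: (Defs.coef2 L i j y) (partial i (partial j zeta) y) (partial j zeta y)
        (partial i zeta y) (zeta y) (chi y) (al k i j y) (be k i j y) (ga k i y) (ga k j y) (om k y).
      by move=> *; ring.
    rewrite /cut_chi; move: (Defs.coef1 L i y) (partial i zeta y) (zeta y) (chi y)
      (de k i y) (ga k i y) (om k y).
    by move=> *; ring.
  rewrite /cut_chi; move: A B (Defs.coef0 L y) (V y) (zeta y) (chi y) (om k y) (et k y).
  by move=> *; ring.
- rewrite -[X in has_integral _ _ X]subr0; apply: has_integralB.
    exact: wave_pairing_has_integral.
  exact: eigen_pairing_has_integral.
apply: has_integralB; last by apply: has_integralZ; exact: prP.
apply: has_integralD.
  apply: has_integralD; apply: has_integral_sum => i.
    apply: has_integral_sum => j; apply: has_integralB.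
      by apply: has_integralN; exact: Icomm.
    by do 2?apply: has_integralD; apply: prP => //; exact: h1.
  apply: has_integralB; last by apply: prP => //; exact: h1.
  by apply: has_integralB; apply: prP => //; apply: h2 => //; exact: smooth_measurable.
by apply: has_integralB; apply: prP => //; exact: h2.
Qed.

End weak_pairing.

Definition energy (W : rV -> R) (D : 'I_n -> rV -> R) :=
  sqint mu W + \sum_i sqint mu (D i).

Lemma energy_ge0 W D : 0 <= energy W D.
Proof. by rewrite addr_ge0 ?sqint_ge0// sumr_ge0// => i _; exact: sqint_ge0. Qed.

Lemma sqint_le_energy W D : sqint mu W <= energy W D.
Proof. by rewrite lerDl sumr_ge0// => i _; exact: sqint_ge0. Qed.

Lemma sqint_le_energyD W D i : sqint mu (D i) <= energy W D.
Proof.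
rewrite /energy (bigD1 i)//= addrCA lerDl addr_ge0 ?sqint_ge0// sumr_ge0// => j _.
exact: sqint_ge0.
Qed.

(** Bound and limit are carried together through sums and differences. The bound has [1 + energy]
    because Young's inequality leaves a constant from the fixed factor. *)
Definition tame (F : (rV -> R) -> ('I_n -> rV -> R) -> nat -> R)
    (l : (rV -> R) -> ('I_n -> rV -> R) -> R) :=
  exists2 C, 0 <= C & forall W D, sq_integrable mu W -> (forall i, sq_integrable mu (D i)) ->
    (forall k, `|F W D k| <= C * (1 + energy W D)) /\ F W D k @[k --> \oo] --> l W D.

Lemma tameD F G l m : tame F l -> tame G m ->
  tame (fun W D k => F W D k + G W D k) (fun W D => l W D + m W D).
Proof.
move=> [C C0 HC] [C' C'0 HC']; exists (C + C'); first exact: addr_ge0.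
move=> W D Ws Ds; have [b c] := HC W D Ws Ds; have [b' c'] := HC' W D Ws Ds; split.
  by move=> k; rewrite mulrDl (le_trans (ler_normD _ _))// lerD.
exact: cvgD.
Qed.

Lemma tameZ a F l : tame F l -> tame (fun W D k => a * F W D k) (fun W D => a * l W D).
Proof.
move=> [C C0 HC]; exists (`|a| * C); first by rewrite mulr_ge0.
move=> W D Ws Ds; have [b c] := HC W D Ws Ds; split.
  by move=> k; rewrite normrM -mulrA ler_wpM2l.
exact: cvgMr.
Qed.

Lemma tameN F l : tame F l -> tame (fun W D k => - F W D k) (fun W D => - l W D).
Proof.
move=> [C C0 HC]; exists C => // W D Ws Ds; have [b c] := HC W D Ws Ds; split.
  by move=> k; rewrite normrN.
exact: cvgN.
Qed.

Lemma tameB F G l m : tame F l -> tame G m ->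
  tame (fun W D k => F W D k - G W D k) (fun W D => l W D - m W D).
Proof. by move=> tF tG; apply: tameD => //; exact: tameN. Qed.

Lemma tame_sum (I : Type) (s : seq I) F l : (forall i, tame (F i) (l i)) ->
  tame (fun W D k => \sum_(i <- s) F i W D k) (fun W D => \sum_(i <- s) l i W D).
Proof.
move=> tF; elim: s => [|i s [C C0 HC]].
  exists 0 => // W D _ _; split; first by move=> k; rewrite big_nil mul0r normr0.
  by under eq_fun do rewrite big_nil; rewrite big_nil; exact: cvg_cst.
have [C' C'0 HC'] := tameD (tF i) (ex_intro2 _ _ C C0 HC).
exists C' => // W D Ws Ds; have [b c] := HC' W D Ws Ds; split.
  by move=> k; rewrite big_cons.
by under eq_fun do rewrite big_cons; rewrite big_cons.
Qed.

(** The constant comes from C E + S <= (C + S)(1 + E), where E is the energy and S the integral of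
    [h ^+ 2]. *)
Lemma tame_pairing (Phi : (rV -> R) -> ('I_n -> rV -> R) -> rV -> R) h
    (N : nat -> rV * rV -> R) M c C :
  bounded_pairing N M -> sq_integrable mu h ->
  (forall g, sq_integrable mu g ->
    pairing g h (N k) @[k --> \oo] --> c * \int[mu]_x (g x * h x)) ->
  0 <= C ->
  (forall W D, sq_integrable mu W -> (forall i, sq_integrable mu (D i)) ->
    sq_integrable mu (Phi W D) /\ sqint mu (Phi W D) <= C * energy W D) ->
  tame (fun W D k => pairing (Phi W D) h (N k))
    (fun W D => c * \int[mu]_x (Phi W D x * h x)).
Proof.
move=> [M0 HM] hs cN C0 HPhi; exists (M * (C + sqint mu h)).
  by rewrite mulr_ge0// addr_ge0// sqint_ge0.
move=> W D Ws Ds; have [Ps Pe] := HPhi W D Ws Ds; split; last exact: cN.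
move=> k; have [_ b] := HM (Phi W D) h k Ps hs; apply: (le_trans b).
rewrite -mulrA ler_wpM2l//.
have := energy_ge0 W D; have := sqint_ge0 mu h; nra.
Qed.

Lemma sqintM_bounded (g q : rV -> R) (C : R) : sq_integrable mu g -> measurable_fun setT q ->
  (forall x, `|q x| <= C) -> sqint mu (fun x => g x * q x) <= C ^+ 2 * sqint mu g.
Proof.
move=> gs mq qC; have [mg gi] := gs.
have [_ gqi] := sq_integrable_bounded gs mq qC.
rewrite /sqint -RintegralZl//; apply: Rintegral_le => //; first exact: rintegrableZl.
move=> x; rewrite exprMn mulrC ler_wpM2r ?sqr_ge0// -real_normK ?num_real//.
by rewrite lerXn2r ?nnegrE// (le_trans (normr_ge0 _) (qC x)).
Qed.

Lemma tame_moll (Phi : (rV -> R) -> ('I_n -> rV -> R) -> rV -> R) h C :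
  sq_integrable mu h -> rintegrable mu h -> 0 <= C ->
  (forall W D, sq_integrable mu W -> (forall i, sq_integrable mu (D i)) ->
    sq_integrable mu (Phi W D) /\ sqint mu (Phi W D) <= C * energy W D) ->
  tame (fun W D k => pr k (Phi W D) h) (fun W D => \int[mu]_x (Phi W D x * h x)).
Proof.
move=> hs hi C0 HPhi; have [M HM] := moll_bounded_pairing R n.
have : tame (fun W D k => pr k (Phi W D) h) (fun W D => 1 * \int[mu]_x (Phi W D x * h x)).
  apply: (@tame_pairing Phi h (@moll_kernel R n) M 1 C) => // g gs.
  by rewrite mul1r; exact: (moll_pairing_cvg gs hs hi).
by move=> [C' C'0 HC']; exists C' => // W D Ws Ds; have := HC' W D Ws Ds; rewrite mul1r.
Qed.

Lemma tame_moll0 h : sq_integrable mu h -> rintegrable mu h ->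
  tame (fun W D k => pr k W h) (fun W D => \int[mu]_x (W x * h x)).
Proof.
move=> hs hi; apply: (@tame_moll (fun W D => W) h 1) => // W D Ws Ds; split => //.
by rewrite mul1r sqint_le_energy.
Qed.

Lemma tame_moll1 i h : sq_integrable mu h -> rintegrable mu h ->
  tame (fun W D k => pr k (D i) h) (fun W D => \int[mu]_x (D i x * h x)).
Proof.
move=> hs hi; apply: (@tame_moll (fun W D => D i) h 1) => // W D Ws Ds; split => //.
by rewrite mul1r sqint_le_energyD.
Qed.

(* the terms which arise from differentiating the cutoff *)
Definition cutoff_error (W : rV -> R) (D : 'I_n -> rV -> R) : R :=
  \sum_i \sum_j (\int[mu]_x (W x * (chi x * Defs.coef2 L i j x * partial i (partial j zeta) x))
    + \int[mu]_x (D i x * (chi x * Defs.coef2 L i j x * partial j zeta x))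
    + \int[mu]_x (D j x * (chi x * Defs.coef2 L i j x * partial i zeta x)))
  + \sum_i \int[mu]_x (W x * (chi x * Defs.coef1 L i x * partial i zeta x)).

(* The bound by the energy of [W], uniform in [k], is what dominated convergence in
   time requires. *)
Lemma wave_pairing_cvg : exists2 C, 0 <= C & forall W D, weak_pair W D ->
  (forall k, `|pairing W cut_chi (wave_kernel k)| <= C * (1 + energy W D)) /\
  pairing W cut_chi (wave_kernel k) @[k --> \oo] -->
    - cutoff_error W D - sigma ^+ 2 * \int[mu]_x (W x * cut_chi x).
Proof.
have hs := cut_chi_sq; have hi := cut_chi_int.
have h1 (q p : rV -> R) : smooth q -> bounded_fct q -> smooth p -> supported_in 0 r p ->
    sq_integrable mu (fun y => chi y * q y * p y) /\ rintegrable mu (fun y => chi y * q y * p y).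
  move=> qs [C HC] ps pc; have [C' C'0 HC'] := supported_bounded (smooth_continuous ps) pc.
  have mq := smooth_measurable qs; have mp := smooth_measurable ps.
  split; first by apply: sq_integrable_bounded HC' => //; exact: sq_integrable_bounded HC.
  by apply: rintegrable_bounded HC' => //; exact: rintegrable_bounded HC.
have h2 (q : rV -> R) : measurable_fun setT q -> bounded_fct q ->
    sq_integrable mu (fun y => cut_chi y * q y) /\ rintegrable mu (fun y => cut_chi y * q y).
  by move=> qm [C HC]; split; [exact: sq_integrable_bounded HC|exact: rintegrable_bounded HC].
have zj j : supported_in 0 r (partial j zeta) by exact: supported_partial.
have zij i j : supported_in 0 r (partial i (partial j zeta)) by exact: supported_partial.
(* The limit is 0, written as mass 0 times an integral in order to match the general form. *)
have tc i j : tame (fun W D k => pairing (D i) cut_chi (commutator i j k))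
    (fun W D => 0 * \int[mu]_x (D i x * cut_chi x)).
  have [M HM] := @commutator_bounded_pairing R n (Defs.coef2 L i j) j r (a2s i j).
  apply: (@tame_pairing (fun W D => D i) cut_chi (commutator i j) M 0 1) => //.
    by move=> g gs; rewrite mul0r; exact: friedrichs.
  by move=> W D Ws Ds; rewrite mul1r sqint_le_energyD.
have tb i : tame (fun W D k => pr k (fun x => D i x * Defs.coef1 L i x) cut_chi)
    (fun W D => \int[mu]_x (D i x * Defs.coef1 L i x * cut_chi x)).
  have [C HC] := a1b i.
  have mb : measurable_fun setT (Defs.coef1 L i) by exact: smooth_measurable.
  apply: (@tame_moll (fun W D x => D i x * Defs.coef1 L i x) cut_chi (C ^+ 2)) => //.
    exact: sqr_ge0.
  move=> W D Ws Ds; split; first exact: sq_integrable_bounded HC.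
  apply: (le_trans (@sqintM_bounded _ _ _ (Ds i) mb HC)).
  by rewrite ler_wpM2l ?sqr_ge0// sqint_le_energyD.
have tc0 : tame (fun W D k => pr k (fun x => W x * (Defs.coef0 L x - V x)) cut_chi)
    (fun W D => \int[mu]_x (W x * (Defs.coef0 L x - V x) * cut_chi x)).
  have [C HC] := c0V_bounded.
  apply: (@tame_moll (fun W D x => W x * (Defs.coef0 L x - V x)) cut_chi (C ^+ 2)) => //.
    exact: sqr_ge0.
  move=> W D Ws Ds; split; first exact: sq_integrable_bounded HC.
  apply: (le_trans (@sqintM_bounded _ _ _ Ws c0V_meas HC)).
  by rewrite ler_wpM2l ?sqr_ge0// sqint_le_energy.
have [C C0 HC] : tame (fun W D k =>
  (\sum_i \sum_j (- pairing (D i) cut_chi (commutator i j k)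
     - (pr k W (fun y => chi y * Defs.coef2 L i j y * partial i (partial j zeta) y)
      + pr k (D i) (fun y => chi y * Defs.coef2 L i j y * partial j zeta y)
      + pr k (D j) (fun y => chi y * Defs.coef2 L i j y * partial i zeta y)))
  + \sum_i (pr k (fun x => D i x * Defs.coef1 L i x) cut_chi
     - pr k (D i) (fun y => cut_chi y * Defs.coef1 L i y)
     - pr k W (fun y => chi y * Defs.coef1 L i y * partial i zeta y)))
  + (pr k (fun x => W x * (Defs.coef0 L x - V x)) cut_chi
     - pr k W (fun y => cut_chi y * (Defs.coef0 L y - V y)))
  - sigma ^+ 2 * pr k W cut_chi)
  (fun W D => (\sum_i \sum_j (- (0 * \int[mu]_x (D i x * cut_chi x))
     - (\int[mu]_x (W x * (chi x * Defs.coef2 L i j x * partial i (partial j zeta) x))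
      + \int[mu]_x (D i x * (chi x * Defs.coef2 L i j x * partial j zeta x))
      + \int[mu]_x (D j x * (chi x * Defs.coef2 L i j x * partial i zeta x))))
  + \sum_i (\int[mu]_x (D i x * Defs.coef1 L i x * cut_chi x)
     - \int[mu]_x (D i x * (cut_chi x * Defs.coef1 L i x))
     - \int[mu]_x (W x * (chi x * Defs.coef1 L i x * partial i zeta x))))
  + (\int[mu]_x (W x * (Defs.coef0 L x - V x) * cut_chi x)
     - \int[mu]_x (W x * (cut_chi x * (Defs.coef0 L x - V x))))
  - sigma ^+ 2 * \int[mu]_x (W x * cut_chi x)).
  apply: tameB; last by apply/tameZ/tame_moll0.
  apply: tameD; last first.
    by apply: tameB => //; apply: tame_moll0; have [] := h2 _ c0V_meas c0V_bounded.
  apply: tameD; apply: tame_sum => i.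
    apply: tame_sum => j; apply: tameB; first exact: tameN.
    apply: tameD; first apply: tameD.
    - by apply: tame_moll0; have [] := h1 _ _ (a2s i j) (a2b i j) (zzs i j) (zij i j).
    - by apply: tame_moll1; have [] := h1 _ _ (a2s i j) (a2b i j) (zs j) (zj j).
    - by apply: tame_moll1; have [] := h1 _ _ (a2s i j) (a2b i j) (zs i) (zj i).
  apply: tameB; last first.
    by apply: tame_moll0; have [] := h1 _ _ (a1s i) (a1b i) (zs i) (zj i).
  apply: tameB => //.
  by apply: tame_moll1; have [] := h2 _ (smooth_measurable (a1s i)) (a1b i).
exists C => // W D WD; have [Ws Ds _] := WD; have [b c] := HC W D Ws Ds; split.
  by move=> k; rewrite (wave_pairingE WD); exact: b.
under eq_fun do rewrite (wave_pairingE WD).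
rewrite (_ : - cutoff_error W D - _ = (\sum_i \sum_j (- (0 * \int[mu]_x (D i x * cut_chi x))
     - (\int[mu]_x (W x * (chi x * Defs.coef2 L i j x * partial i (partial j zeta) x))
      + \int[mu]_x (D i x * (chi x * Defs.coef2 L i j x * partial j zeta x))
      + \int[mu]_x (D j x * (chi x * Defs.coef2 L i j x * partial i zeta x))))
  + \sum_i (\int[mu]_x (D i x * Defs.coef1 L i x * cut_chi x)
     - \int[mu]_x (D i x * (cut_chi x * Defs.coef1 L i x))
     - \int[mu]_x (W x * (chi x * Defs.coef1 L i x * partial i zeta x))))
  + (\int[mu]_x (W x * (Defs.coef0 L x - V x) * cut_chi x)
     - \int[mu]_x (W x * (cut_chi x * (Defs.coef0 L x - V x))))
  - sigma ^+ 2 * \int[mu]_x (W x * cut_chi x)); first exact: c.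
congr (_ - _).
rewrite (_ : \int[mu]_x (W x * (Defs.coef0 L x - V x) * cut_chi x) =
  \int[mu]_x (W x * (cut_chi x * (Defs.coef0 L x - V x)))); last first.
  by apply: eq_Rintegral => x _; rewrite -mulrA [cut_chi x * _]mulrC.
rewrite subrr addr0 /cutoff_error opprD -!sumrN; congr (_ + _); apply: eq_bigr => i _.
  by rewrite -sumrN; apply: eq_bigr => j _; rewrite mul0r oppr0 add0r.
rewrite (_ : \int[mu]_x (D i x * Defs.coef1 L i x * cut_chi x) =
  \int[mu]_x (D i x * (cut_chi x * Defs.coef1 L i x))); last first.
  by apply: eq_Rintegral => x _; rewrite -mulrA [cut_chi x * _]mulrC.
by rewrite subrr add0r.
Qed.

End spatial_identity.

(** * Classical derivatives and the adjoint operator *)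

Section schwarz.
Context (R : realType) (V : normedModType R).
Implicit Types f : V -> R.

Lemma is_derive_line f (u c : V) (s : R) : differentiable f (s *: u + c) ->
  is_derive s (1 : R) (fun s : R => f (s *: u + c)) ('D_u f (s *: u + c)).
Proof.
move=> df.
have h : is_diff s (fun s : R => s *: u + c) (fun v : R => v *: u).
  have h' : is_diff s ((fun s : R => s *: u) + cst c) ((fun v : R => v *: u) + 0).
    exact: is_diffD.
  by apply: (is_diff_eq h'); apply/funext => v; rewrite /= /GRing.add/= addr0.
have dfs : is_diff (s *: u + c) f ('d f (s *: u + c)) by exact: differentiableP.
have [dg1 dg2] : is_diff s (fun s : R => f (s *: u + c))
    ('d f (s *: u + c) \o (fun v : R => v *: u)) by exact: is_diff_comp.
by split; [exact: diff_derivable|rewrite !deriveE// dg2/= scale1r].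
Qed.

Lemma mean_value_line f (u c : V) (h : R) : (forall x, differentiable f x) -> 0 <= h ->
  exists2 t, 0 <= t <= h & f (h *: u + c) - f c = h * 'D_u f (t *: u + c).
Proof.
move=> df h0; have dg s := @is_derive_line f u c s (df _).
have [|t ht E] := @MVT_segment R (fun s : R => f (s *: u + c)) _ 0 h h0 (fun s _ => dg s).
  apply: continuous_subspaceT => s.
  by apply/differentiable_continuous/derivable1_diffP; have [] := dg s.
exists t; first by move: ht; rewrite in_itv.
by move: E; rewrite scale0r add0r subr0 mulrC.
Qed.

(** The mean value theorem, once along [v] for the difference in direction [u], and once along [u]
    for the derivative along [v]. *)
Lemma second_difference f (u v x : V) (h : R) : Ck 2 f -> 0 <= h ->
  exists s t, [/\ 0 <= s <= h, 0 <= t <= h &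
    f (h *: v + (h *: u + x)) - f (h *: u + x) - (f (h *: v + x) - f x) =
    h * (h * 'D_u (fun y => 'D_v f y) (s *: u + (t *: v + x)))].
Proof.
move=> [df /(_ v)[dDf _]] h0.
pose g (t : R) := f (t *: v + (h *: u + x)) - f (t *: v + x).
have dg t : is_derive t (1 : R) g
    ('D_v f (t *: v + (h *: u + x)) - 'D_v f (t *: v + x)).
  by apply: is_deriveB; apply: is_derive_line.
have [|t ht E] := @MVT_segment R g _ 0 h h0 (fun t _ => dg t).
  apply: continuous_subspaceT => t.
  by apply/differentiable_continuous/derivable1_diffP; have [] := dg t.
have [s hs E'] := @mean_value_line (fun y => 'D_v f y) u (t *: v + x) h dDf h0.
exists s, t; split => //.
rewrite -E'; move: E; rewrite /g scale0r !add0r subr0 => E.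
rewrite (addrCA (h *: u)) [RHS]mulrC -E.
move: (f (h *: v + (h *: u + x))) (f (h *: u + x)) (f (h *: v + x)) (f x) => *.
by ring.
Qed.

(** The second difference is symmetric in [u] and [v], so the two mixed derivatives agree at two
    points as close to [x] as desired; continuity does the rest. Green's formula for a merely C^2
    function uses this symmetry. *)
Lemma derive_derive_sym f (u v x : V) : Ck 2 f ->
  'D_u (fun y => 'D_v f y) x = 'D_v (fun y => 'D_u f y) x.
Proof.
move=> f2; have [_ Df] := f2.
have c1 : continuous (fun y => 'D_u (fun y => 'D_v f y) y) by have [_] := Df v; apply.
have c2 : continuous (fun y => 'D_v (fun y => 'D_u f y) y) by have [_] := Df u; apply.
set A := fun y => 'D_u (fun y => 'D_v f y) y; set B := fun y => 'D_v (fun y => 'D_u f y) y.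
suff : `|A x - B x| <= 0 by rewrite normr_le0 subr_eq0 => /eqP.
apply/ler_addgt0Pl => e e0; rewrite addr0.
have /cvgrPdist_lt /(_ (e / 2)) /(_ (divr_gt0 e0 (ltr0Sn _ 1))) hA := c1 x.
have /cvgrPdist_lt /(_ (e / 2)) /(_ (divr_gt0 e0 (ltr0Sn _ 1))) hB := c2 x.
have /nbhs_ballP[d /= d0 hd] : nbhs x ([set t | `|A x - A t| < e / 2] `&`
    [set t | `|B x - B t| < e / 2]) by exact: filterI hA hB.
(* With [h = d / (2 * K)] both intermediate points lie within [d / 2] of [x]. *)
pose K := `|u| + `|v| + 1.
have K0 : 0 < K by rewrite ltr_wpDl// addr_ge0.
pose h := d / (2 * K).
have h0 : 0 < h by rewrite divr_gt0// mulr_gt0.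
have near_x (a b : V) s t : 0 <= s <= h -> 0 <= t <= h -> `|a| + `|b| + 1 <= K ->
    ball x d (s *: a + (t *: b + x)).
  move=> /andP[s0 sh] /andP[t0 th] ab; rewrite -ball_normE /= distrC addrA addrK.
  apply: (le_lt_trans (ler_normD _ _)); rewrite !normrZ !ger0_norm//.
  have hK : h * K = d / 2 by rewrite /h; field; rewrite gt_eqF.
  have d2 : d / 2 < d by lra.
  apply: le_lt_trans d2; rewrite -hK.
  have := ler_wpM2r (normr_ge0 a) sh; have := ler_wpM2r (normr_ge0 b) th.
  have := ler_wpM2l (ltW h0) ab; lra.
have [s [t [hs ht E]]] := second_difference u v x f2 (ltW h0).
have [s' [t' [hs' ht' E']]] := second_difference v u x f2 (ltW h0).
have EE : A (s *: u + (t *: v + x)) = B (s' *: v + (t' *: u + x)).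
  apply: (mulfI (lt0r_neq0 h0)); apply: (mulfI (lt0r_neq0 h0)).
  apply: (etrans (esym E)); apply: etrans E'; rewrite (addrCA (h *: v)).
  move: (f (h *: u + (h *: v + x))) (f (h *: u + x)) (f (h *: v + x)) (f x) => *.
  by ring.
have [+ _] := hd _ (near_x u v s t hs ht (lexx _)).
have [|_ +] := hd _ (near_x v u s' t' hs' ht' _); first by rewrite (addrC `|v|).
rewrite /= EE; move: (B (s' *: v + _)) => C h1 h2.
move: (A x) (B x) h1 h2 => p q h1 h2.
apply: (le_trans (ler_distD C p q)); rewrite [e]splitr [`|C - q|]distrC.
exact/ltW/ltrD.
Qed.

End schwarz.

Section adjoint.
Context (R : realType) (n : nat).
Local Notation rV := 'rV[R]_n.
Local Notation mu := (lebesgue_rV R n).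

Variables (L : diffop2 R n) (c : rV) (r : R) (eta : rV -> R).
Hypotheses (L_coef : smooth_bounded L) (eta_smooth : smooth eta)
  (eta_supp : supported_in c r eta).

Let a2s i j : smooth (Defs.coef2 L i j). Proof. by have [/(_ i j)[]] := L_coef. Qed.
Let a1s i : smooth (Defs.coef1 L i). Proof. by have [_ /(_ i)[]] := L_coef. Qed.
Let a0s : smooth (Defs.coef0 L). Proof. by have [_ _ []] := L_coef. Qed.

Lemma smooth_formal_adjoint : smooth (formal_adjoint L eta).
Proof.
apply: smoothD; last exact: smoothM.
apply: smoothD; last apply: smoothN; apply: smooth_sum => i.
  by apply: smooth_sum => j; do 2 apply: smooth_partial; exact: smoothM.
by apply: smooth_partial; exact: smoothM.
Qed.

Lemma supported_formal_adjoint : supported_in c r (formal_adjoint L eta).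
Proof.
move=> x nx; rewrite /formal_adjoint (eta_supp nx) mulr0 addr0.
rewrite !big1 ?subr0// => i _.
  exact: (supported_partial i (supportedM _ eta_supp)).
apply: big1 => j _.
exact: (supported_partial i (supported_partial j (supportedM _ eta_supp))).
Qed.

(** The integrand is a sum of derivatives of compactly supported C^1 functions. All growth of [phi]
    is harmless, [eta] having compact support. *)
Lemma green_formula (phi : rV -> R) : Ck 2 phi ->
  has_integral mu (fun x => phi x * formal_adjoint L eta x - apply_op L phi x * eta x) 0.
Proof.
move=> phi2; have phi1 := Ck_le phi2; have [dphi Dphi] := phi2.
have I F i : Ck 1 F -> supported_in c r F -> has_integral mu (partial i F) 0.
  move=> F1 Fc; split; last exact: Rintegral_partial_eq0 F1 Fc.
  by apply: rintegrable_supported (supported_partial i Fc); have [_] := F1; apply.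
pose g i j x := Defs.coef2 L i j x * eta x.
have gs i j : smooth (g i j) by exact: smoothM.
pose b i x := Defs.coef1 L i x * eta x.
have bs i : smooth (b i) by exact: smoothM.
have cg i j : supported_in c r (g i j) by exact: supportedM.
apply: (@eq_has_integral _ _ _ mu (fun x =>
  \sum_i \sum_j (partial i (fun x => phi x * partial j (g i j) x) x
    - partial j (fun x => partial i phi x * g i j x) x)
  - \sum_i partial i (fun x => phi x * b i x) x)).
  move=> x; rewrite /formal_adjoint /apply_op.
  have -> : \sum_i partial i (fun x => phi x * b i x) x =
      phi x * (\sum_i partial i (Defs.coef1 L i \* eta) x)
      + (\sum_i Defs.coef1 L i x * partial i phi x) * eta x.
    rewrite big_distrr big_distrl -big_split; apply: eq_bigr => i _ /=.
    rewrite partialM//; last exact: smooth_differentiable.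
    by rewrite /b mulrAC.
  have -> : \sum_i \sum_j (partial i (fun x => phi x * partial j (g i j) x) x
      - partial j (fun x => partial i phi x * g i j x) x) =
      phi x * (\sum_i \sum_j partial i (partial j (Defs.coef2 L i j \* eta)) x)
      - (\sum_i \sum_j Defs.coef2 L i j x * partial i (partial j phi) x) * eta x.
    rewrite big_distrr big_distrl -sumrB; apply: eq_bigr => i _ /=.
    rewrite big_distrr big_distrl -sumrB; apply: eq_bigr => j _ /=.
    rewrite partialM//; last exact/smooth_differentiable/smooth_partial.
    rewrite partialM; last 2 first.
    - by have [] := Dphi (delta_mx ord0 i).
    - exact: smooth_differentiable.
    rewrite (_ : partial i (partial j phi) x = partial j (partial i phi) x); last first.
      exact: derive_derive_sym.
    rewrite -/(g i j) /g.
    move: (partial i (partial j _) x) (partial j (partial i phi) x)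
      (partial j _ x) (partial i phi x) => *; ring.
  by ring.
have E0 : \sum_(i < n) \sum_(j < n) (0 - 0) - \sum_(i < n) 0 = 0 :> R.
  by rewrite !big1 ?subr0// => i _; rewrite big1// => j _; rewrite subr0.
rewrite -[X in has_integral _ _ X]E0.
apply: has_integralB; apply: has_integral_sum => i.
  apply: has_integral_sum => j; apply: has_integralB; apply: I.
  - by apply: CkM => //; exact: smooth_partial (gs i j) 1%N.
  - exact/supportedM/supported_partial.
  - by apply: CkM; [exact: Dphi|exact: gs].
  - exact: supportedM.
apply: I; last by apply: supportedM; exact: supportedM.
by apply: CkM => //; exact: bs.
Qed.

End adjoint.

(** * Products of functions, and functions supported in a time interval *)

Section product.
Context d1 d2 (T1 : measurableType d1) (T2 : measurableType d2) (R : realType).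
Variables (m1 : {sigma_finite_measure set T1 -> \bar R}).
Variables (m2 : {sigma_finite_measure set T2 -> \bar R}).
Implicit Types (p : T1 -> R) (q : T2 -> R).

Lemma measurable_prodM p q : measurable_fun setT p -> measurable_fun setT q ->
  measurable_fun setT (fun z : T1 * T2 => p z.1 * q z.2).
Proof.
move=> mp mq; apply: measurable_funM.
- exact: (measurableT_comp mp measurable_fst).
- exact: (measurableT_comp mq measurable_snd).
Qed.

Lemma rintegrable_prodM p q : rintegrable m1 p -> rintegrable m2 q ->
  rintegrable (m1 \x m2)%E (fun z => p z.1 * q z.2).
Proof.
move=> pi qi; have mp := rintegrable_measurable pi; have mq := rintegrable_measurable qi.
have mpq := measurable_prodM mp mq.
apply/integrableP; split; first exact/measurable_EFinP.
have mapq : measurable_fun setT (abse \o (EFin \o (fun z : T1 * T2 => p z.1 * q z.2))).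
  by apply: measurableT_comp => //; exact/measurable_EFinP.
rewrite (fubini_tonelli1 (abse \o (EFin \o (fun z : T1 * T2 => p z.1 * q z.2))))//=.
under eq_integral => x _.
  rewrite /fubini_F/=.
  under eq_integral do rewrite normrM EFinM.
  rewrite ge0_integralZl//; last first.
    by apply/measurable_EFinP; exact: measurableT_comp mq.
  rewrite -EFin_Rintegral; last exact: rintegrable_norm.
  over.
rewrite ge0_integralZr//; last 2 first.
- by apply/measurable_EFinP; exact: measurableT_comp mp.
- by rewrite lee_fin Rintegral_ge0.
by rewrite -EFin_Rintegral ?ltry//; exact: rintegrable_norm.
Qed.

Lemma has_integral_prodM p q P Q : has_integral m1 p P -> has_integral m2 q Q ->
  has_integral (m1 \x m2)%E (fun z => p z.1 * q z.2) (P * Q).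
Proof.
move=> [pi <-] [qi <-]; have I := rintegrable_prodM pi qi; split => //.
rewrite (Rintegral_prod1 I) -RintegralZr//.
by apply: eq_Rintegral => x _; rewrite -RintegralZl.
Qed.

Lemma sq_integrable_prodM p q : sq_integrable m1 p -> sq_integrable m2 q ->
  sq_integrable (m1 \x m2)%E (fun z => p z.1 * q z.2).
Proof.
move=> [mp ip] [mq iq]; split; first exact: measurable_prodM.
by under eq_fun do rewrite exprMn; exact: (rintegrable_prodM ip iq).
Qed.

End product.

Section interval_support.
Context (R : realType) (s0 s1 : R).
Hypothesis s01 : s0 < s1.
Local Notation lam := (@lebesgue_measure R).

Definition zero_outside (p : R -> R) := forall t, ~ s0 <= t <= s1 -> p t = 0.

Lemma zero_outside_derive1 p : zero_outside p -> zero_outside (derive1 p).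
Proof.
move=> p0 t nt; rewrite derive1E.
rewrite (_ : 'D_1 p t = 'D_1 (cst 0 : R -> R) t); first exact: derive_cst.
apply: near_eq_derive.
have : nbhs t [set s : R | ~ s0 <= s <= s1].
  have -> : [set s : R | ~ s0 <= s <= s1] = [set` `]-oo, s0[] `|` [set` `]s1, +oo[].
    apply/seteqP; split => s /=; rewrite !in_itv/= ?andbT.
      by move/negP; rewrite negb_and -!ltNge => /orP.
    by case=> h; apply/negP; rewrite negb_and -!ltNge h ?orbT.
  apply: open_nbhs_nbhs; split.
    by apply: openU; exact: interval_open.
  by move: nt => /= /negP; rewrite negb_and -!ltNge !in_itv/= ?andbT => /orP.
by apply: filterS => s /p0.
Qed.

Definition indS : R -> R := \1_(`[s0, s1]%classic).

Lemma indS_in t : s0 <= t <= s1 -> indS t = 1.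
Proof. by move=> h; rewrite /indS indicE mem_set//= in_itv. Qed.

Lemma indS_out t : ~ s0 <= t <= s1 -> indS t = 0.
Proof. by move=> h; rewrite /indS indicE memNset//= in_itv. Qed.

Lemma measurable_indS : measurable_fun setT indS.
Proof. exact: measurable_indic. Qed.

Lemma has_integral_indS : has_integral lam indS (s1 - s0).
Proof.
have f : (lam `[s0, s1]%classic < +oo)%E by rewrite lebesgue_measure_itv/= lte_fin s01 ltry.
split; first exact: rintegrable_indic.
rewrite /Rintegral /indS integral_indic// setIT; have := lebesgue_measure_itv `[s0, s1].
rewrite /= lte_fin s01 => ->.
by rewrite -EFinD.
Qed.

Lemma sq_integrable_indSM (p : R -> R) : measurable_fun setT p ->
  (exists C, forall t, s0 <= t <= s1 -> `|p t| <= C) ->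
  sq_integrable lam (fun t => indS t * p t).
Proof.
move=> mp [C HC]; have [I _] := has_integral_indS.
apply: (@sq_integrable_le _ _ _ lam (fun t => C * indS t) (fun t => indS t * p t)).
- by apply: measurable_funM => //; exact: measurable_indS.
- move=> t; have [h|h] := pselect (s0 <= t <= s1).
    by rewrite indS_in// mul1r mulr1 (le_trans (HC t h))// ler_norm.
  by rewrite indS_out// mul0r mulr0.
- apply: sq_integrableZ; split; first exact: measurable_indS.
  by rewrite (_ : (fun _ => _) = indS)//; apply/funext => t; rewrite /indS indicE; case: (_ \in _);
    rewrite ?expr1n ?expr0n.
Qed.

Lemma continuous_bounded_segment (p : R -> R) : continuous p ->
  exists C, forall t, s0 <= t <= s1 -> `|p t| <= C.
Proof.
move=> cp.
have : bounded_set (p @` `[s0, s1]).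
  apply: compact_bounded; apply: continuous_compact; last exact: segment_compact.
  exact: continuous_subspaceT.
move=> [M [_ /(_ (M + 1))]]; rewrite ltrDl ltr01 => /(_ isT) HM.
by exists (M + 1) => t ht; apply: HM; exists t => //=; rewrite in_itv.
Qed.

Lemma sq_integrable_indS_continuous p : continuous p ->
  sq_integrable lam (fun t => indS t * p t).
Proof.
move=> cp; apply: sq_integrable_indSM; last exact: continuous_bounded_segment.
exact: continuous_measurable_fun.
Qed.

Lemma zero_outsideM p q : zero_outside p -> zero_outside (fun t => q t * p t).
Proof. by move=> p0 t /p0 ->; rewrite mulr0. Qed.

Lemma indSM_zero_outside p : zero_outside p -> (fun t => indS t * p t) = p.
Proof.
move=> p0; apply/funext => t; have [h|h] := pselect (s0 <= t <= s1).
  by rewrite indS_in// mul1r.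
by rewrite (p0 t h) mulr0.
Qed.

Lemma sq_integrable_zero_outside p : continuous p -> zero_outside p -> sq_integrable lam p.
Proof.
by move=> cp p0; have := sq_integrable_indS_continuous cp; rewrite indSM_zero_outside.
Qed.

Lemma rintegrable_indS_continuous p : continuous p -> rintegrable lam (fun t => indS t * p t).
Proof.
move=> cp; have [I _] := has_integral_indS.
have h1 : sq_integrable lam (fun t => indS t * 1).
  by apply: sq_integrable_indS_continuous => t; exact: cst_continuous.
have := rintegrable_sqM h1 (sq_integrable_indS_continuous cp).
rewrite (_ : (fun t => _) = (fun t => indS t * p t))//.
apply/funext => t; have [h|h] := pselect (s0 <= t <= s1).
  by rewrite indS_in// !mul1r.
by rewrite indS_out// !mul0r.
Qed.

Lemma rintegrable_zero_outside p : continuous p -> zero_outside p -> rintegrable lam p.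
Proof.
by move=> cp p0; have := rintegrable_indS_continuous cp; rewrite indSM_zero_outside.
Qed.

Lemma Rintegral_derive1_zero_outside p : smooth p -> zero_outside p ->
  has_integral lam (derive1 p) 0.
Proof.
move=> ps p0; have dps := smooth_derive1 ps; have p'0 := zero_outside_derive1 p0.
have c (q : R -> R) : smooth q -> continuous q by exact: smooth_continuous.
split; first by apply: rintegrable_zero_outside => //; exact: c.
have big x : `|s0| + `|s1| < `|x| -> ~ s0 <= x <= s1.
  move=> + /andP[h0 h1]; apply/negP; rewrite -leNgt ler_norml.
  have := ler_norm s1; have := ler_norm (- s0); rewrite normrN.
  have := normr_ge0 s1; have := normr_ge0 s0.
  by move=> *; apply/andP; split; lra.
apply: (@Rintegral_derive_eq0 R p _ (`|s0| + `|s1|)).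
- exact: c.
- by move=> x; rewrite derive1E; apply: derivableP; exact: smooth_derivable.
- by move=> x /big /p0.
- by move=> x /big /p'0.
Qed.

End interval_support.

Lemma formal_adjointZ (R : realType) (n : nat) (L : diffop2 R n) (c : R) (eta : 'rV[R]_n -> R)
    (L_coef : smooth_bounded L) : smooth eta ->
  formal_adjoint L (fun x => c * eta x) = (fun x => c * formal_adjoint L eta x).
Proof.
have a2s i j : smooth (Defs.coef2 L i j) by have [/(_ i j)[]] := L_coef.
have a1s i : smooth (Defs.coef1 L i) by have [_ /(_ i)[]] := L_coef.
move=> es; have pZ i (g : 'rV[R]_n -> R) : smooth g ->
    partial i (fun x => c * g x) = (fun x => c * partial i g x).
  move=> gs; apply/funext => x; rewrite /partial deriveZ//.
  exact/diff_derivable/smooth_differentiable.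
apply/funext => x; rewrite /formal_adjoint !mulrDr mulrN !big_distrr/= [c * (_ * _)]mulrCA.
congr (_ - _ + _); apply: eq_bigr => i _.
  rewrite big_distrr/=; apply: eq_bigr => j _.
  rewrite (_ : _ \* _ = (fun x => c * (Defs.coef2 L i j x * eta x))); last first.
    by apply/funext => y /=; rewrite mulrCA.
  by rewrite pZ ?pZ//; [apply: smooth_partial|]; exact: smoothM.
rewrite (_ : _ \* _ = (fun x => c * (Defs.coef1 L i x * eta x))); last first.
  by apply/funext => y /=; rewrite mulrCA.
by rewrite pZ//; exact: smoothM.
Qed.

(** * Testing the wave equation *)

Section tested_equation.
Context (R : realType) (n : nat).
Local Notation rV := 'rV[R]_n.
Local Notation mu := (lebesgue_rV R n).
Local Notation lam := (@lebesgue_measure R).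
Local Notation eps := (@eps R).
Local Notation rho k := (@mollifier R n (eps k)).

Variables (L : diffop2 R n) (f : rV -> R -> R) (a : R) (phi V : rV -> R) (T : \bar R)
  (u : R -> rV -> R).
Hypotheses (L_coef : smooth_bounded L) (phi_C2 : Ck 2 phi)
  (phi_eq : forall x, apply_op L phi x = f x (phi x))
  (V_meas : measurable_fun setT V) (V_bounded : bounded_fct V)
  (f_loc : locally_integrable_spacetime T (fun z => f z.2 (u z.1 z.2)))
  (pde : distributional_wave_equation L f a T u).
Variables (s0 s1 : R).
Hypotheses (s0_gt0 : 0 < s0) (s01 : s0 < s1) (s1T : (s1%:E < T)%E).
Local Notation ind := (@indS R s0 s1).

(** Cut to [s0, s1], the difference is square integrable over all of space-time, and its values at
    times outside [0, T[ are irrelevant. Test functions supported in [s0, s1] do not see the cut. *)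
Definition perturbation (z : R * rV) : R := ind z.1 * (u z.1 z.2 - phi z.2).

Hypothesis w_sq : sq_integrable (lam \x mu)%E perturbation.

Variables (theta : R -> R).
Hypotheses (theta_smooth : smooth theta) (theta0 : zero_outside s0 s1 theta).

Let theta' := derive1 theta.
Let theta'' := derive1 (derive1 theta).
Let theta's : smooth theta'. Proof. exact: smooth_derive1. Qed.
Let theta''s : smooth theta''. Proof. exact: smooth_derive1. Qed.
Let theta'0 : zero_outside s0 s1 theta'. Proof. exact: zero_outside_derive1. Qed.
Let theta''0 : zero_outside s0 s1 theta''. Proof. exact: zero_outside_derive1. Qed.

Let beta t := theta'' t - a * theta' t.
Let betas : smooth beta.
Proof. by apply: smoothD => //; apply: smoothN; apply: smoothM => //; exact: smooth_cst. Qed.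
Let beta0 : zero_outside s0 s1 beta.
Proof. by move=> t nt; rewrite /beta theta''0// theta'0// mulr0 subr0. Qed.

Section one_test_function.
Variables (eta : rV -> R) (c : rV) (r : R).
Hypotheses (eta_smooth : smooth eta) (eta_supp : supported_in c r eta).

Let Lstar := formal_adjoint L eta.
Let Ls : smooth Lstar. Proof. exact: smooth_formal_adjoint. Qed.
Let Lc : supported_in c r Lstar. Proof. exact: supported_formal_adjoint. Qed.

Let sq_time (p : R -> R) : smooth p -> zero_outside s0 s1 p -> sq_integrable lam p.
Proof. by move=> ps p0; apply: (sq_integrable_zero_outside s01) p0; exact: smooth_continuous. Qed.

Let sq_space (q : rV -> R) : smooth q -> supported_in c r q -> sq_integrable mu q.
Proof. by move=> qs q0; apply: sq_integrable_supported q0; exact: smooth_continuous. Qed.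

(** The adjoint of the damped wave operator applied to theta(t) eta(x); the sign of [a] in [beta]
    comes from integration by parts. *)
Definition dual_test (z : R * rV) : R := beta z.1 * eta z.2 + theta z.1 * Lstar z.2.

Lemma sq_integrable_dual_test : sq_integrable (lam \x mu)%E dual_test.
Proof.
by apply: sq_integrableD; apply: sq_integrable_prodM;
  [exact: sq_time|exact: sq_space|exact: sq_time|exact: sq_space].
Qed.

Let phic : continuous phi. Proof. exact: Ck_continuous phi_C2. Qed.

Let Lphic : continuous (apply_op L phi).
Proof.
have [_ Dphi] := phi_C2.
have a2s i j : smooth (Defs.coef2 L i j) by have [/(_ i j)[]] := L_coef.
have a1s i : smooth (Defs.coef1 L i) by have [_ /(_ i)[]] := L_coef.
have a0s : smooth (Defs.coef0 L) by have [_ _ []] := L_coef.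
have k0 (q : rV -> R) : smooth q -> Ck 0 q by move=> qs; exact: qs.
have csum (F : 'I_n -> rV -> R) : (forall i, Ck 0 (F i)) -> Ck 0 (fun x => \sum_i F i x).
  move=> cF; elim: (index_enum _) => [|i s IHs].
    by under eq_fun do rewrite big_nil; move=> x; exact: cst_continuous.
  by under eq_fun do rewrite big_cons; exact: (@CkD R _ 0).
apply: (@CkD R _ 0); last by apply: CkM; [exact: k0|exact: phic].
apply: CkD; apply: (csum) => i.
  apply: (csum) => j; apply: CkM; first exact: k0.
  by have [_] := Dphi (delta_mx ord0 j); exact.
apply: CkM; first exact: k0.
by have [d _] := Dphi (delta_mx ord0 i); move=> y; exact/differentiable_continuous.
Qed.

Let supp_int (g q : rV -> R) : continuous g -> smooth q -> supported_in c r q ->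
  rintegrable mu (fun x => g x * q x).
Proof.
move=> cg qs qc; apply: (@rintegrable_supported R n _ c r); last exact: supportedM.
by move=> x; apply: continuousM; [exact: cg|exact/smooth_continuous].
Qed.

(** The time factor [beta] has integral 0 and the space factor obeys Green's formula. This is the
    tested equation of [phi], obtained without any integrability of [phi]. *)
Lemma stationary_integral : has_integral (lam \x mu)%E
  (fun z => phi z.2 * dual_test z - theta z.1 * (apply_op L phi z.2 * eta z.2)) 0.
Proof.
have Hg2 := green_formula L_coef eta_smooth eta_supp phi_C2.
have Hb : has_integral lam beta 0.
  rewrite -(subr0 0) -[X in _ - X](mulr0 a).
  apply: has_integralB; last apply: has_integralZ;
    by apply: (Rintegral_derive1_zero_outside s01).
have Ht : has_integral lam theta (\int[lam]_t theta t).
  apply: has_integralP; apply: (rintegrable_zero_outside s01) => //.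
  exact: smooth_continuous.
have Hg := has_integralP (supp_int phic eta_smooth eta_supp).
apply: (@eq_has_integral _ _ _ (lam \x mu)%E (fun z => beta z.1 * (phi z.2 * eta z.2) +
  theta z.1 * (phi z.2 * Lstar z.2 - apply_op L phi z.2 * eta z.2))).
  by move=> z; rewrite /dual_test; ring.
have -> : 0 = 0 * (\int[mu]_x (phi x * eta x)) + (\int[lam]_t theta t) * 0.
  by rewrite mul0r mulr0 addr0.
apply: has_integralD.
  exact: (@has_integral_prodM _ _ _ _ _ lam mu _ _ _ _ Hb Hg).
exact: (@has_integral_prodM _ _ _ _ _ lam mu _ _ _ _ Ht Hg2).
Qed.

Let slab := (`[s0, s1]%classic `*` cube c r) : set (R * rV).

Let slab_compact : compact slab.
Proof. by apply: compact_setX; [exact: segment_compact|exact: compact_cube]. Qed.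

Let slab_sub : slab `<=` spacetime T.
Proof.
move=> z [/= + _]; rewrite in_itv/= => /andP[h0 h1]; split.
  exact: lt_le_trans h0.
by apply: le_lt_trans s1T; rewrite lee_fin.
Qed.

Lemma test_function_prod : test_function (spacetime T) (fun z => theta z.1 * eta z.2).
Proof.
split; first by apply: smoothM; [exact: smooth_fst|exact: smooth_snd].
exists slab; split => // z nz.
have [zt|zt] := pselect (s0 <= z.1 <= s1); last by rewrite theta0 ?mul0r.
rewrite eta_supp ?mulr0// => zc; exact: nz.
Qed.

(** The test function lives on [s0, s1] times a cube, a compact subset of the open strip because
    [0 < s0] and [s1 < T]. *)
Lemma rintegrable_source : rintegrable (lam \x mu)%E
  (fun z => theta z.1 * (f z.2 (u z.1 z.2) * eta z.2)).
Proof.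
have mslab : measurable (slab : set (measurableTypeR R * rV)).
  by apply: measurableX; [exact: measurable_itv|exact: measurable_cube].
have [C C0 HC] := supported_bounded (smooth_continuous eta_smooth) eta_supp.
have [C' HC'] := @continuous_bounded_segment R s0 s1 theta (smooth_continuous theta_smooth).
have I := f_loc slab_compact slab_sub.
have I' : rintegrable (lam \x mu)%E ((fun z => f z.2 (u z.1 z.2)) \_ slab).
  have := (integrable_mkcond _ mslab).1 I; apply: eq_integrable => // z _ /=.
  by rewrite !patchE; case: ifP.
have mte : measurable_fun setT (fun z : R * rV => theta z.1 * eta z.2).
  apply: (@measurable_prodM _ _ _ _ _ theta eta); last exact: smooth_measurable.
  by apply: continuous_measurable_fun; exact: smooth_continuous.
have mteC z : `|theta z.1 * eta z.2| <= `|C'| * C.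
  rewrite normrM; apply: ler_pM => //.
  have [h|h] := pselect (s0 <= z.1 <= s1); last by rewrite theta0// normr0.
  exact: le_trans (HC' _ h) (ler_norm _).
have := rintegrable_bounded I' mte mteC.
apply: eq_integrable => // z _ /=; congr (_%:E).
rewrite patchE; case: ifPn => zs; first by rewrite mulrCA.
rewrite (_ : point = 0 :> R)// mul0r.
have [zt|zt] := pselect (s0 <= z.1 <= s1); last by rewrite theta0// mul0r.
rewrite eta_supp ?mulr0// => zc; move: zs; rewrite notin_setE; apply.
by split => //=.
Qed.

Lemma dual_testE z : derive1n 2 (fun t => theta t * eta z.2) z.1
    - a * derive1 (fun t => theta t * eta z.2) z.1
    + formal_adjoint L (fun x => theta z.1 * eta x) z.2 = dual_test z.
Proof.
have dM (p : R -> R) (k : R) : smooth p ->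
    derive1 (fun t => p t * k) = (fun t => derive1 p t * k).
  move=> ps; apply/funext => t; rewrite !derive1E deriveMr//.
    by rewrite /GRing.scale/= mulrC.
  exact: smooth_derivable.
rewrite /derive1n/= !dM// formal_adjointZ// /dual_test /beta /theta'' /theta' /Lstar.
move: (formal_adjoint L eta z.2) (derive1 (derive1 theta) z.1) (derive1 theta z.1).
by move=> *; ring.
Qed.

(** The equation of [u] minus that of [phi]. The distributional equation only equates two real
    integrals; integrability of its left side is recovered by writing [u] as the perturbation plus
    [phi]. *)
Lemma tested_equation : has_integral (lam \x mu)%E
  (fun z => perturbation z * dual_test z -
    theta z.1 * ((f z.2 (u z.1 z.2) - f z.2 (phi z.2)) * eta z.2)) 0.
Proof.
have out0 z : z \notin spacetime T -> ind z.1 = 0 /\ theta z.1 = 0 /\ dual_test z = 0.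
  move=> nz; have zt : ~ s0 <= z.1 <= s1.
    move=> /andP[h0 h1]; move: nz; rewrite notin_setE; apply; split.
      exact: lt_le_trans h0.
    by apply: le_lt_trans s1T; rewrite lee_fin.
  by rewrite /dual_test indS_out// theta0// beta0// !mul0r addr0.
have I1 := rintegrable_sqM w_sq sq_integrable_dual_test.
have I2 := rintegrable_source.
have [I3 E3] := stationary_integral.
have := pde test_function_prod; rewrite [LHS]Rintegral_mkcond [RHS]Rintegral_mkcond.
set lhs := \int[_]_x _; set rhs := \int[_]_x _ => lr.
have rhsE : rhs = \int[(lam \x mu)%E]_z (theta z.1 * (f z.2 (u z.1 z.2) * eta z.2)).
  apply: eq_Rintegral => z _; rewrite patchE; case: ifPn => [_|/out0[_ [-> _]]].
    by rewrite mulrCA.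
  by rewrite mul0r.
have indK z : ind z.1 * dual_test z = dual_test z.
  have [h|h] := pselect (s0 <= z.1 <= s1); first by rewrite indS_in// mul1r.
  by rewrite /dual_test theta0// beta0// !mul0r addr0 mulr0.
have lhsE : lhs = \int[(lam \x mu)%E]_z (u z.1 z.2 * dual_test z).
  apply: eq_Rintegral => z _; rewrite patchE; case: ifPn => [_|/out0[_ [_ ->]]].
    by rewrite dual_testE.
  by rewrite mulr0.
have wK z : perturbation z * dual_test z = (u z.1 z.2 - phi z.2) * dual_test z.
  by rewrite /perturbation mulrAC indK mulrC.
have Hs : has_integral (lam \x mu)%E (fun z => perturbation z * dual_test z +
    (phi z.2 * dual_test z - theta z.1 * (apply_op L phi z.2 * eta z.2)))
    (\int[(lam \x mu)%E]_z (perturbation z * dual_test z)).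
  rewrite -[X in has_integral _ _ X]addr0; apply: has_integralD => //.
have I4 : rintegrable (lam \x mu)%E (fun z => theta z.1 * (apply_op L phi z.2 * eta z.2)).
  apply: (@rintegrable_prodM _ _ _ _ _ lam mu theta (fun x => apply_op L phi x * eta x)).
    by apply: (rintegrable_zero_outside s01) => //; exact: smooth_continuous.
  exact: supp_int.
have Hu : has_integral (lam \x mu)%E (fun z => u z.1 z.2 * dual_test z) rhs.
  split; last by rewrite -lhsE.
  have := rintegrableD Hs.1 I4; apply: eq_integrable => // z _ /=; congr (_%:E).
  by rewrite wK; move: (dual_test z) (apply_op L phi z.2) => *; ring.
have Hf : has_integral (lam \x mu)%E (fun z => theta z.1 * (f z.2 (u z.1 z.2) * eta z.2)) rhs.
  by split.
have := has_integralB (has_integralB Hu Hf) stationary_integral; rewrite subrr subr0.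
apply: eq_has_integral => z; rewrite phi_eq wK.
by move: (dual_test z) => *; ring.
Qed.

End one_test_function.

(** The pointwise estimate of the nonlinearity can be multiplied by the mollifier, which is
    nonnegative. Having mass one, the mollifier turns [B] into [B * (s1 - s0)], independently of [k]
    and [y]. *)
Lemma tested_inequality (kappa : R -> R) (B : R) k y : continuous kappa ->
  (forall t x, s0 <= t <= s1 -> kappa t * (u t x - phi x) - B <=
    theta t * (f x (u t x) - f x (phi x) - V x * (u t x - phi x))) ->
  - (B * (s1 - s0)) <= \int[(lam \x mu)%E]_z (perturbation z *
    ((beta z.1 - ind z.1 * kappa z.1) * moll_kernel k (z.2, y)
     + theta z.1 * wave_kernel L V k (z.2, y))).
Proof.
move=> ck H; pose eta x := rho k (x - y).
have etas : smooth eta by apply: smooth_translate; exact: smooth_mollifier.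
have etac : supported_in y (eps k) eta.
  by apply: supported_translate; apply: supported_mollifier; exact: eps_gt0.
have eta_sq : sq_integrable mu eta.
  by apply: sq_integrable_supported etac; exact: smooth_continuous.
have [I0 E0] := tested_equation etas etac.
have Ik : rintegrable (lam \x mu)%E (fun z => perturbation z * (ind z.1 * kappa z.1 * eta z.2)).
  apply: rintegrable_sqM => //.
  apply: (@sq_integrable_prodM _ _ _ _ _ lam mu (fun t => ind t * kappa t) eta) => //.
  exact: sq_integrable_indS_continuous.
have Iv : rintegrable (lam \x mu)%E (fun z => perturbation z * (theta z.1 * (eta z.2 * V z.2))).
  apply: rintegrable_sqM => //.
  apply: (@sq_integrable_prodM _ _ _ _ _ lam mu theta (fun x => eta x * V x)) => //.
    by apply: (sq_integrable_zero_outside s01) => //; exact: smooth_continuous.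
  by have [C HC] := V_bounded; exact: sq_integrable_bounded HC.
have Id := rintegrable_sqM w_sq (sq_integrable_dual_test etas etac).
have Hb : has_integral (lam \x mu)%E (fun z => - B * (ind z.1 * eta z.2)) (- B * ((s1 - s0) * 1)).
  apply: has_integralZ; apply: (@has_integral_prodM _ _ _ _ _ lam mu ind eta).
    exact: has_integral_indS.
  split; last by apply: Rintegral_mollifier; exact: eps_gt0.
  by apply: rintegrable_supported etac; exact: smooth_continuous.
have Il : rintegrable (lam \x mu)%E (fun z => perturbation z * dual_test eta z -
    perturbation z * (ind z.1 * kappa z.1 * eta z.2) -
    perturbation z * (theta z.1 * (eta z.2 * V z.2))).
  by apply: rintegrableB => //; exact: rintegrableB.
rewrite (_ : \int[_]_z _ = \int[(lam \x mu)%E]_z (perturbation z * dual_test eta z -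
    perturbation z * (ind z.1 * kappa z.1 * eta z.2) -
    perturbation z * (theta z.1 * (eta z.2 * V z.2)))); last first.
  apply: eq_Rintegral => z _; rewrite /dual_test /wave_kernel /moll_kernel/= -/eta.
  rewrite -/(eta z.2); move: (formal_adjoint L eta z.2) (eta z.2) (perturbation z) => *.
  by ring.
rewrite -[X in _ <= X]subr0 -[X in _ <= _ - X]E0 -RintegralB//.
have [Ib <-] : has_integral (lam \x mu)%E (fun z => - B * (ind z.1 * eta z.2)) (- (B * (s1 - s0))).
  by rewrite -mulNr -[s1 - s0]mulr1.
apply: Rintegral_le => //; first exact: rintegrableB.
move=> z; rewrite (_ : _ - _ - _ - _ = theta z.1 * ((f z.2 (u z.1 z.2) - f z.2 (phi z.2)) * eta z.2)
    - perturbation z * (ind z.1 * kappa z.1 * eta z.2) -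
    perturbation z * (theta z.1 * (eta z.2 * V z.2))); last first.
  by move: (dual_test eta z) (perturbation z) (eta z.2) => *; ring.
rewrite /perturbation; have [h|h] := pselect (s0 <= z.1 <= s1); last first.
  by rewrite indS_out// theta0// !(mul0r, mulr0) !subr0.
rewrite indS_in// !mul1r.
have eta0 : 0 <= eta z.2 by apply: mollifier_ge0; exact: eps_gt0.
have := ler_wpM2r eta0 (H z.1 z.2 h).
move: (eta z.2) (u z.1 z.2) (phi z.2) (f z.2 (u z.1 z.2)) (f z.2 (phi z.2)) (V z.2)
  (theta z.1) (kappa z.1) => e v p fv fp w th ka.
by rewrite mulrBl => h'; lra.
Qed.

End tested_equation.

(** Packaged as sigma-finite so that space-time can itself be a factor of a product with the
    variable [y]. *)
Definition sigma_finite_prod d1 d2 (T1 : measurableType d1) (T2 : measurableType d2)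
    (R : realType) (m1 : {sigma_finite_measure set T1 -> \bar R})
    (m2 : {sigma_finite_measure set T2 -> \bar R}) :
    {sigma_finite_measure set (T1 * T2)%type -> \bar R} :=
  HB.pack_for {sigma_finite_measure set (T1 * T2)%type -> \bar R} (m1 \x m2)%E
    (Measure_isSigmaFinite.Build _ _ _ (m1 \x m2)%E (isSigmaFinite.sigma_finiteT
      (lebesgue_integral_fubini.measure_function_Measure_isSigmaFinite__to__measure_function_isSigmaFinite
        m1 m2))).

(** Used twice, for the limits in the mollifier and in the cutoff. The conclusion includes
    measurability because the limit in [k] is the integrand for the limit in [m]. *)
Lemma Rintegral_cvg_ge (R : realType) d (T : measurableType d) (m : {measure set T -> \bar R})
    (J_ : nat -> T -> R) (J g : T -> R) (c_ : nat -> R) (c : R) :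
  (forall k, measurable_fun setT (J_ k)) -> (forall t, J_ k t @[k --> \oo] --> J t) ->
  rintegrable m g -> (forall k t, `|J_ k t| <= g t) ->
  c_ k @[k --> \oo] --> c -> (forall k, c_ k <= \int[m]_t J_ k t) ->
  [/\ measurable_fun setT J, (forall t, `|J t| <= g t) & c <= \int[m]_t J t].
Proof.
move=> mJ_ cJ gi bJ cc le_c.
have mJ : measurable_fun setT J by apply: (measurable_fun_cvg mJ_) => t _; exact: cJ.
have [_ cI] : rintegrable m J /\ \int[m]_t J_ k t @[k --> \oo] --> \int[m]_t J t.
  by apply: (@Rdominated_cvg _ _ _ _ _ _ g) => //; exact: aeW.
split => // [t|].
  have cn : `|J_ k t| @[k --> \oo] --> `|J t| by apply: cvg_norm; exact: cJ.
  rewrite -(cvg_lim _ cn)//; apply: limr_le; first by apply/cvg_ex; exists `|J t|.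
  by apply: nearW => k; exact: bJ.
rewrite -(cvg_lim _ cc)// -(cvg_lim _ cI)//; apply: ler_lim.
- by apply/cvg_ex; exists c.
- by apply/cvg_ex; eexists; exact: cI.
- by apply: nearW.
Qed.

(** * Removing the mollification and the cutoff *)

Section spacetime_limit.
Context (R : realType) (n : nat).
Local Notation rV := 'rV[R]_n.
Local Notation mu := (lebesgue_rV R n).
Local Notation lam := (@lebesgue_measure R).
Local Notation eps := (@eps R).

Variables (L : diffop2 R n) (V : rV -> R) (sigma : R) (chi zeta : rV -> R) (r : R).
Hypothesis L_coef : smooth_bounded L.
Hypotheses (V_meas : measurable_fun setT V) (V_bounded : bounded_fct V).
Hypotheses (chi_sq : sq_integrable mu chi) (chi_int : rintegrable mu chi).
Hypothesis chi_eigen : forall psi, test_function setT psi ->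
  \int[mu]_x (chi x * (apply_op L psi x - V x * psi x)) =
  - sigma ^+ 2 * \int[mu]_x (chi x * psi x).
Hypothesis chi_ge0 : forall x, 0 <= chi x.
Hypotheses (zeta_smooth : smooth zeta) (zeta_supp : supported_in 0 r zeta)
  (zeta_ge0 : forall x, 0 <= zeta x).
Variables (s0 s1 E0 Q : R) (w : R * rV -> R) (D : R -> 'I_n -> rV -> R).
Hypotheses (r_ge0 : 0 <= r) (s01 : s0 < s1) (w_sq : sq_integrable (lam \x mu)%E w).
Hypothesis w0 : forall t x, ~ s0 <= t <= s1 -> w (t, x) = 0.
Hypothesis wD : forall t, s0 <= t <= s1 ->
  weak_pair (fun x => w (t, x)) (D t) /\ energy (fun x => w (t, x)) (D t) <= E0.
Variables (alpha theta : R -> R) (Ca : R).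
Hypotheses (alpha_meas : measurable_fun setT alpha) (theta_meas : measurable_fun setT theta).
Hypotheses (alpha0 : zero_outside s0 s1 alpha) (theta0 : zero_outside s0 s1 theta).
Hypotheses (alphaC : forall t, `|alpha t| <= Ca) (thetaC : forall t, `|theta t| <= Ca).
Hypothesis tested : forall k y, - Q <= \int[(lam \x mu)%E]_z (w z *
  (alpha z.1 * moll_kernel k (z.2, y) + theta z.1 * wave_kernel L V k (z.2, y))).

Local Notation h := (cut_chi chi zeta).
Local Notation ind := (@indS R s0 s1).

Let e0 k : 0 < eps k. Proof. exact: eps_gt0. Qed.
Let e1 k : eps k <= 1. Proof. exact: eps_le1. Qed.
Let Ca0 : 0 <= Ca. Proof. exact: le_trans (normr_ge0 _) (alphaC 0). Qed.
Let hs : sq_integrable mu h. Proof. exact: cut_chi_sq zeta_supp. Qed.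
Let hi : rintegrable mu h. Proof. exact: cut_chi_int zeta_supp. Qed.
Let hr : supported_in 0 r h. Proof. exact: cut_chi_supp. Qed.
Let h0 x : 0 <= h x. Proof. by rewrite mulr_ge0. Qed.

Lemma local_moll_kernel k : local_kernel (eps k) (@moll_kernel R n k).
Proof.
apply: (@eq_local_kernel _ _ _ (fun z : rV * rV => 1 * mollifier (eps k) (z.1 - z.2))).
  by move=> z; rewrite mul1r.
apply: (@local_kernel_left R n (eps k) (fun=> 1)).
- exact: measurable_cst.
- by move=> ?; exists 1; split => // ? _; rewrite normr1.
- exact/smooth_continuous/smooth_mollifier.
- exact: supported_mollifier.
Qed.

Let lw k : local_kernel (eps k) (wave_kernel L V k). Proof. exact: local_wave_kernel. Qed.

Let sq_w t : sq_integrable mu (fun x => w (t, x)).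
Proof.
have [/wD[[]]//|nt] := pselect (s0 <= t <= s1).
rewrite (_ : (fun x => w (t, x)) = fun=> 0); first exact: sq_integrable0.
by apply/funext => x; exact: w0.
Qed.

(** The integrand in (t, x, y). With [y] outermost the tested inequality applies for each [y]; with
    [t] outermost the spatial pairing of each time slice appears. *)
Let full k (z : (R * rV) * rV) : R := w z.1 * h z.2 *
  (alpha z.1.1 * moll_kernel k (z.1.2, z.2) + theta z.1.1 * wave_kernel L V k (z.1.2, z.2)).

Let sq_time p : measurable_fun setT p -> zero_outside s0 s1 p ->
  (forall t, `|p t| <= Ca) -> sq_integrable lam p.
Proof.
move=> mp p0 pC; rewrite -(indSM_zero_outside p0).
by apply: (sq_integrable_indSM s01) => //; exists Ca.
Qed.

Lemma rintegrable_full k : rintegrable ((lam \x mu) \x mu)%E (full k).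
Proof.
have [A1 A10 H1] := local_kernel_product_bound (e1 k) (local_moll_kernel k) hr.
have [A2 A20 H2] := local_kernel_product_bound (e1 k) (lw k) hr.
(* The factor of (t, x) in a product majorant: |w| times a bounded function of bounded support; the
   factor of [y] is |h|. *)
pose p (z : R * rV) := `|w z| * (ind z.1 * (Ca * (A1 + A2) * \1_(cube 0 (r + 1)) z.2)).
have pI : rintegrable (lam \x mu)%E p.
  have Is : sq_integrable (lam \x mu)%E
      (fun z : R * rV => ind z.1 * (Ca * (A1 + A2) * \1_(cube 0 (r + 1)) z.2)).
    apply: (@sq_integrable_prodM _ _ _ _ _ lam mu ind
      (fun x => Ca * (A1 + A2) * \1_(cube 0 (r + 1)) x)).
      rewrite (_ : ind = (fun t => ind t * 1)); last by apply/funext => t; rewrite mulr1.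
      by apply: sq_integrable_indS_continuous => // t; exact: cst_continuous.
    apply: sq_integrableZ; apply: sq_integrable_indic; first exact: measurable_cube.
    by apply: lebesgue_rV_cube_lty; rewrite addr_ge0.
  rewrite /p; have := rintegrable_norm (rintegrable_sqM w_sq Is).
  apply: eq_integrable => // z _ /=; congr (_%:E); rewrite normrM; congr (_ * _).
  have i0 : 0 <= ind z.1 by rewrite /indS indicE ler0n.
  have c0 : 0 <= \1_(cube 0 (r + 1)) z.2 :> R by rewrite indicE ler0n.
  by rewrite ger0_norm// !mulr_ge0// addr_ge0.
apply: (@rintegrable_le _ _ _ ((lam \x mu) \x mu)%E (fun z => p z.1 * `|h z.2|)).
- rewrite /full; apply: measurable_funM.
    by apply: measurable_prodM; [have [] := w_sq|have [] := hs].
  have m1 : measurable_fun setT (fun z : (R * rV) * rV => z.1.1).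
    exact: (measurableT_comp measurable_fst measurable_fst).
  have m2 : measurable_fun setT (fun z : (R * rV) * rV => (z.1.2, z.2)).
    apply: measurable_fun_pair => //=.
    exact: (measurableT_comp measurable_snd measurable_fst).
  apply: measurable_funD; apply: measurable_funM.
  + exact: (measurableT_comp alpha_meas m1).
  + exact: (measurableT_comp (local_moll_kernel k).1 m2).
  + exact: (measurableT_comp theta_meas m1).
  + exact: (measurableT_comp (lw k).1 m2).
- move=> [[t x] y]; rewrite /full /p/=.
  have [ht|ht] := pselect (s0 <= t <= s1); last by rewrite w0// normr0 !mul0r normr0.
  rewrite indS_in// mul1r -[w (t, x) * h y * _]mulrA normrM -[X in _ <= X]mulrA ler_wpM2l// mulrDr.
  apply: (le_trans (ler_normD _ _)); rewrite (mulrCA (h y) (alpha t)) (mulrCA (h y) (theta t)).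
  rewrite (normrM (alpha t)) (normrM (theta t)).
  apply: (@le_trans _ _ (Ca * (A1 * `|h y| * \1_(cube 0 (r + 1)) x) +
    Ca * (A2 * `|h y| * \1_(cube 0 (r + 1)) x))).
    by apply: lerD; apply: ler_pM; rewrite ?H1 ?H2.
  by rewrite le_eqVlt; apply/orP; left; apply/eqP; ring.
- exact: (@rintegrable_prodM _ _ _ _ _ (sigma_finite_prod lam mu) mu p (fun y => `|h y|)
    pI (rintegrable_norm hi)).
Qed.

Let J k t := alpha t * pairing (fun x => w (t, x)) h (@moll_kernel R n k) +
  theta t * pairing (fun x => w (t, x)) h (wave_kernel L V k).

Lemma Rintegral_full_slices k : measurable_fun setT (J k) /\
  \int[((lam \x mu) \x mu)%E]_z full k z = \int[lam]_t J k t.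
Proof.
have I := rintegrable_full k.
have I1 := @integrable_Rintegral1 _ _ _ _ R (sigma_finite_prod lam mu) mu _ I.
have E t : \int[mu]_x \int[mu]_y full k ((t, x), y) = J k t.
  have Im : rintegrable (mu \x mu)%E (fun z => w (t, z.1) * h z.2 * moll_kernel k z).
    exact: (local_kernel_integrable (ltW (e0 k)) (local_moll_kernel k) (sq_w t) hs hr).
  have Iw : rintegrable (mu \x mu)%E (fun z => w (t, z.1) * h z.2 * wave_kernel L V k z).
    exact: (local_kernel_integrable (ltW (e0 k)) (lw k) (sq_w t) hs hr).
  have H := has_integralD (has_integralZ (alpha t) (has_integralP Im))
    (has_integralZ (theta t) (has_integralP Iw)).
  have : has_integral (mu \x mu)%E (fun z => full k ((t, z.1), z.2)) (J k t).
    apply: eq_has_integral H => -[x y]; rewrite /full/=.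
    by move: (moll_kernel k (x, y)) (wave_kernel L V k (x, y)) => *; ring.
  by move=> [IJ <-]; rewrite (Rintegral_prod1 IJ).
split.
  have := @measurable_Rintegral1 _ _ _ _ R lam mu _ I1.
  by under eq_fun do rewrite E.
rewrite (@Rintegral_prod1 _ _ _ _ R (sigma_finite_prod lam mu) mu _ I).
rewrite (@Rintegral_prod1 _ _ _ _ R lam mu _ I1).
by apply: eq_Rintegral => t _; exact: E.
Qed.

(** For each [y] the tested inequality is multiplied by h(y), which is nonnegative since [chi] and
    [zeta] are. *)
Lemma Rintegral_full_ge k : - Q * \int[mu]_y h y <= \int[((lam \x mu) \x mu)%E]_z full k z.
Proof.
have I := rintegrable_full k.
have I2 := @integrable_Rintegral2 _ _ _ _ R (sigma_finite_prod lam mu) mu _ I.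
rewrite (@Rintegral_prod2 _ _ _ _ R (sigma_finite_prod lam mu) mu _ I) -RintegralZl//; apply: Rintegral_le => //.
  exact: rintegrableZl.
move=> y.
have Ik : rintegrable (lam \x mu)%E (fun z => w z * (alpha z.1 * moll_kernel k (z.2, y)
    + theta z.1 * wave_kernel L V k (z.2, y))).
  apply: rintegrable_sqM => //; apply: sq_integrableD.
    apply: (@sq_integrable_prodM _ _ _ _ _ lam mu alpha (fun x => moll_kernel k (x, y))).
      exact: sq_time.
    exact: (sq_integrable_local_slice y (ltW (e0 k)) (local_moll_kernel k)).
  apply: (@sq_integrable_prodM _ _ _ _ _ lam mu theta (fun x => wave_kernel L V k (x, y))).
    exact: sq_time.
  exact: (sq_integrable_local_slice y (ltW (e0 k)) (lw k)).
have -> : \int[sigma_finite_prod lam mu]_x full k (x, y) =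
    h y * \int[(lam \x mu)%E]_z (w z *
      (alpha z.1 * moll_kernel k (z.2, y) + theta z.1 * wave_kernel L V k (z.2, y))).
  rewrite -RintegralZl//; apply: eq_Rintegral => -[t x] _; rewrite /full/=.
  by rewrite mulrAC mulrC.
by rewrite mulrC ler_wpM2l.
Qed.

Definition limit_density t := alpha t * \int[mu]_x (w (t, x) * h x) +
  theta t * (- cutoff_error L chi zeta (fun x => w (t, x)) (D t)
    - sigma ^+ 2 * \int[mu]_x (w (t, x) * h x)).

(** The uniform bound by [E0] dominates the slices in time. The gradients [D t] are selected time by
    time, without any measurability in [t]; the density is measurable all the same, being a limit of
    pairings in which they do not occur. *)
Lemma limit_inequality : measurable_fun setT limit_density /\
  - Q * \int[mu]_y h y <= \int[lam]_t limit_density t.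
Proof.
have [C C0 HC] := wave_pairing_cvg L_coef V_meas V_bounded chi_sq chi_int chi_eigen
  zeta_smooth zeta_supp.
have [M [M0 HM]] := moll_bounded_pairing R n.
pose g t := ind t * (Ca * (M * (E0 + sqint mu h) + C * (1 + E0))).
have [||||||m _ ineq] := @Rintegral_cvg_ge R _ _ lam J limit_density g
  (fun=> - Q * \int[mu]_y h y) (- Q * \int[mu]_y h y).
- by move=> k; have [] := Rintegral_full_slices k.
- move=> t; rewrite /J /limit_density.
  have [ht|ht] := pselect (s0 <= t <= s1); last first.
    rewrite alpha0// theta0// !mul0r.
    by under eq_fun do rewrite !mul0r; exact: cvg_cst.
  have [wp _] := wD ht; have [_ c] := HC _ _ wp.
  by apply: cvgD; apply: cvgMr => //; exact: moll_pairing_cvg.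
- rewrite /g; apply: rintegrableZr; exact: (has_integral_indS s01).1.
- move=> k t; rewrite /g /J.
  have [ht|ht] := pselect (s0 <= t <= s1); last first.
    by rewrite alpha0// theta0// indS_out// !mul0r addr0 normr0.
  rewrite indS_in// mul1r; have [wp wE] := wD ht.
  have [+ _] := HC _ _ wp => /(_ k) b2; have [_ b1] := HM _ _ k (sq_w t) hs.
  apply: (le_trans (ler_normD _ _)); rewrite 2!normrM mulrDr.
  apply: lerD; apply: ler_pM => //.
    apply: (le_trans b1); rewrite ler_wpM2l// lerD2r.
    exact: le_trans (sqint_le_energy _ (D t)) wE.
  by apply: (le_trans b2); rewrite ler_wpM2l// lerD2l.
- exact: cvg_cst.
- by move=> k; have [_ <-] := Rintegral_full_slices k; exact: Rintegral_full_ge.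
- by split.
Qed.

End spacetime_limit.

(** * Cutoffs in space and their errors *)

Section cutoff.
Context (R : realType) (n : nat).
Local Notation rV := 'rV[R]_n.
Local Notation mu := (lebesgue_rV R n).
Local Notation eps := (@eps R).

Definition unit_cutoff (x : rV) : R := \prod_i plateau (x ord0 i).

Lemma smooth_unit_cutoff : smooth unit_cutoff.
Proof. by apply: smooth_prod => i; apply: smooth_coord; exact: smooth_plateau. Qed.

Lemma supported_unit_cutoff : supported_in 0 3 unit_cutoff.
Proof.
move=> x /cubeN_ex[i]; rewrite mxE subr0 => xi.
by rewrite /unit_cutoff (bigD1 i)//= plateau_eq0// mul0r.
Qed.

Definition cutoff m (x : rV) : R := unit_cutoff (eps m *: x).

Lemma smooth_cutoff m : smooth (cutoff m).
Proof. by apply: smooth_dilate; exact: smooth_unit_cutoff. Qed.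

Lemma supported_cutoff m : supported_in 0 (3 / eps m) (cutoff m).
Proof.
have e0 := @eps_gt0 R m.
move=> x /cubeN_ex[i]; rewrite mxE subr0 => xi; apply: supported_unit_cutoff => /(_ i).
apply/negP; rewrite -ltNge !mxE subr0 normrM gtr0_norm//.
by rewrite mulrC -ltr_pdivrMr.
Qed.

Lemma cutoff_itv m x : 0 <= cutoff m x <= 1.
Proof.
apply/andP; split; first by apply: prodr_ge0 => i _; have /andP[] := plateau_itv (((eps m *: x) : rV) ord0 i).
by apply: prodr_ile1 => i _; exact: plateau_itv.
Qed.

Lemma cutoff_cvg x : cutoff m x @[m --> \oo] --> (1 : R).
Proof.
have /cvgrPdist_lt /(_ 1 ltr01) ev : eps m * `|x| @[m --> \oo] --> (0 : R).
  by rewrite -[X in _ --> X](mul0r `|x|); apply: cvgMl; exact: cvg_eps.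
apply: cvg_near_cst; apply: filterS ev => m; rewrite sub0r normrN => h.
apply: big1 => i _; apply: plateau_eq1; rewrite !mxE normrM gtr0_norm ?eps_gt0//.
have e0 := ltW (@eps_gt0 R m).
apply: le_trans (ltW h); rewrite (ger0_norm (mulr_ge0 e0 (normr_ge0 x))).
by rewrite ler_wpM2l// coord_le_norm.
Qed.

(** Dilation gives one factor [eps m] per derivative; for second derivatives one of the two is
    bounded by 1. *)
Lemma partial_cutoff_bound : exists2 C : R, 0 <= C & forall m,
  (forall i x, `|partial i (cutoff m) x| <= C * eps m) /\
  (forall i j x, `|partial i (partial j (cutoff m)) x| <= C * eps m).
Proof.
have us := smooth_unit_cutoff.
have B (F : 'I_n -> rV -> R) : (forall i, exists C : R, 0 <= C /\ forall x, `|F i x| <= C) ->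
    exists2 C : R, 0 <= C & forall i x, `|F i x| <= C.
  move=> /choice[C HC]; exists (\sum_i C i); first by apply: sumr_ge0 => i _; have [] := HC i.
  move=> i x; have [_ /(_ x) h] := HC i; apply: (le_trans h).
  by rewrite (bigD1 i)//= lerDl; apply: sumr_ge0 => j _; have [] := HC j.
have [C1 C10 H1] : exists2 C : R, 0 <= C & forall i x, `|partial i unit_cutoff x| <= C.
  apply: B => i; have [C C0 HC] := supported_bounded
    (smooth_continuous (smooth_partial i us)) (supported_partial i supported_unit_cutoff).
  by exists C.
have H2' j : exists C : R, 0 <= C /\ forall i x, `|partial i (partial j unit_cutoff) x| <= C.
  have [C C0 HC] := B (fun i => partial i (partial j unit_cutoff)) (fun i =>
    let: ex_intro2 C C0 HC := supported_bounded
      (smooth_continuous (smooth_partial i (smooth_partial j us)))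
      (supported_partial i (supported_partial j supported_unit_cutoff)) in
    ex_intro _ C (conj C0 HC)).
  by exists C.
have [C2 H2] := choice H2'.
have S0 : 0 <= \sum_j C2 j by apply: sumr_ge0 => j _; have [] := H2 j.
have e0 m : 0 < eps m by exact: eps_gt0.
have e0' m : 0 <= eps m by exact: ltW.
have pc m i : partial i (cutoff m) = (fun x => eps m * partial i unit_cutoff (eps m *: x)).
  by rewrite /cutoff partial_dilate.
exists (C1 + \sum_j C2 j); first exact: addr_ge0.
move=> m; split=> [i x|i j x].
  rewrite pc normrM gtr0_norm// mulrC ler_wpM2r//.
  by apply: (le_trans (H1 i _)); rewrite lerDl.
have -> : partial i (partial j (cutoff m)) x =
    eps m * (eps m * partial i (partial j unit_cutoff) (eps m *: x)).
  rewrite pc /partial deriveZ; last first.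
    apply/diff_derivable/smooth_differentiable.
    exact: (@smooth_dilate R n (partial j unit_cutoff) (eps m) (smooth_partial j us)).
  rewrite -/(partial i (fun x => partial j unit_cutoff (eps m *: x)) x).
  by rewrite partial_dilate//; exact: smooth_partial.
rewrite normrM gtr0_norm// mulrC ler_wpM2r// normrM gtr0_norm//.
apply: (@le_trans _ _ (1 * \sum_j C2 j)); last by rewrite mul1r lerDr.
apply: ler_pM => //; first exact: eps_le1.
have [_ h] := H2 j; apply: (le_trans (h i _)).
by rewrite (bigD1 j)//= lerDl; apply: sumr_ge0 => l _; have [] := H2 l.
Qed.

Variables (L : diffop2 R n) (chi : rV -> R).
Hypotheses (L_coef : smooth_bounded L) (chi_sq : sq_integrable mu chi).

Lemma cutoff_error_term W (p q : rV -> R) (A e : R) : sq_integrable mu W ->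
  measurable_fun setT p -> measurable_fun setT q ->
  (forall x, `|p x| <= A) -> (forall x, `|q x| <= e) ->
  `|\int[mu]_x (W x * (chi x * p x * q x))| <= A * e * ((sqint mu W + sqint mu chi) / 2).
Proof.
move=> Ws mp mq pA qe.
have A0 : 0 <= A := le_trans (normr_ge0 _) (pA 0).
have e0 : 0 <= e := le_trans (normr_ge0 _) (qe 0).
have [mW iW] := Ws; have [mc ic] := chi_sq.
have -> : A * e * ((sqint mu W + sqint mu chi) / 2) =
    \int[mu]_x (A * e * ((1 * W x ^+ 2 + 1^-1 * chi x ^+ 2) / 2)).
  rewrite RintegralZl//; last first.
    by apply: rintegrableZr; apply: rintegrableD; exact: rintegrableZl.
  rewrite RintegralZr//; last by apply: rintegrableD; exact: rintegrableZl.
  rewrite RintegralD//; [|exact: rintegrableZl|exact: rintegrableZl].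
  by rewrite !RintegralZl// invr1 !mul1r.
apply: Rintegral_norm_le.
- apply: rintegrable_sqM => //; apply: sq_integrable_bounded qe => //.
  exact: sq_integrable_bounded pA.
- by apply: rintegrableZl; apply: rintegrableZr; apply: rintegrableD; exact: rintegrableZl.
- move=> x; rewrite (_ : W x * _ = p x * q x * (W x * chi x)); last by ring.
  rewrite 2!normrM; apply: ler_pM => //; last exact: young_le.
  exact: ler_pM.
Qed.

(** Every term has a derivative of [zeta] and an undifferentiated coefficient, which is bounded on
    the whole space. So [K] does not depend on the support of [zeta]. *)
Lemma cutoff_error_bound : exists2 K : R, 0 <= K & forall (zeta : rV -> R) (e : R), 0 <= e ->
  smooth zeta ->
  (forall i x, `|partial i zeta x| <= e) -> (forall i j x, `|partial i (partial j zeta) x| <= e) ->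
  forall W D, sq_integrable mu W -> (forall i, sq_integrable mu (D i)) ->
  `|cutoff_error L chi zeta W D| <= K * e * (energy W D + sqint mu chi).
Proof.
have [h2 h1 _] := L_coef.
have H2 i : exists A : 'I_n -> R, forall j x, `|Defs.coef2 L i j x| <= A j.
  have h j : exists C, forall x, `|Defs.coef2 L i j x| <= C by have [] := h2 i j.
  by have [A HA] := choice h; exists A.
have [A2 HA2] := choice H2.
have [A1 HA1] : exists A : 'I_n -> R, forall j x, `|Defs.coef1 L j x| <= A j.
  have h j : exists C, forall x, `|Defs.coef1 L j x| <= C by have [] := h1 j.
  by have [A HA] := choice h; exists A.
have m2 i j : measurable_fun setT (Defs.coef2 L i j).
  by apply: smooth_measurable; have [] := h2 i j.
have m1 i : measurable_fun setT (Defs.coef1 L i).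
  by apply: smooth_measurable; have [] := h1 i.
have A10 i : 0 <= A1 i := le_trans (normr_ge0 _) (HA1 i 0).
have A20 i j : 0 <= A2 i j := le_trans (normr_ge0 _) (HA2 i j 0).
have S1 : 0 <= \sum_i A1 i by apply: sumr_ge0.
have S2 : 0 <= \sum_i \sum_j A2 i j by apply: sumr_ge0 => i _; apply: sumr_ge0.
(* Three integrals for each second-order coefficient and one for each first-order coefficient. *)
exists (3 * (\sum_i \sum_j A2 i j) + \sum_i A1 i).
  by rewrite addr_ge0// mulr_ge0.
move=> zeta e e0 zs he1 he2 W D Ws Ds.
set E := energy W D + sqint mu chi.
have E0 : 0 <= E by rewrite addr_ge0 ?energy_ge0 ?sqint_ge0.
have term (W' p q : rV -> R) A : sq_integrable mu W' -> sqint mu W' <= energy W D ->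
    measurable_fun setT p -> smooth q -> (forall x, `|p x| <= A) -> (forall x, `|q x| <= e) ->
    `|\int[mu]_x (W' x * (chi x * p x * q x))| <= A * e * E.
  move=> W's W'E mp qs pA qe; have A0 : 0 <= A := le_trans (normr_ge0 _) (pA 0).
  apply: (le_trans (cutoff_error_term W's mp (smooth_measurable qs) pA qe)).
  rewrite ler_wpM2l ?mulr_ge0//; have := sqint_ge0 mu W'; have := sqint_ge0 mu chi.
  by rewrite /E; lra.
have dz i : smooth (partial i zeta) by exact: smooth_partial.
have ddz i j : smooth (partial i (partial j zeta)) by exact: smooth_partial.
apply: (le_trans (ler_normD _ _)); rewrite -mulrA mulrDl; apply: lerD.
  rewrite big_distrr/= big_distrl/=; apply: (le_trans (ler_norm_sum _ _ _)).
  apply: ler_sum => i _; rewrite big_distrr/= big_distrl/=.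
  apply: (le_trans (ler_norm_sum _ _ _)); apply: ler_sum => j _.
  have b0 := term W _ _ _ Ws (sqint_le_energy W D) (m2 i j) (ddz i j) (HA2 i j) (he2 i j).
  have b1 := term (D i) _ _ _ (Ds i) (sqint_le_energyD W D i) (m2 i j) (dz j) (HA2 i j) (he1 j).
  have b2 := term (D j) _ _ _ (Ds j) (sqint_le_energyD W D j) (m2 i j) (dz i) (HA2 i j) (he1 i).
  apply: (le_trans (ler_normD _ _)); apply: (le_trans (lerD (ler_normD _ _) (lexx _))).
  by apply: (le_trans (lerD (lerD b0 b1) b2)); rewrite le_eqVlt; apply/orP; left; apply/eqP; ring.
rewrite big_distrl/=; apply: (le_trans (ler_norm_sum _ _ _)); apply: ler_sum => i _.
by rewrite mulrA; exact: (term W _ _ _ Ws (sqint_le_energy W D) (m1 i) (dz i) (HA1 i) (he1 i)).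
Qed.

End cutoff.

(** * The inequality for the mean against [chi] *)

Section key_inequality.
Context (R : realType) (n : nat).
Local Notation rV := 'rV[R]_n.
Local Notation mu := (lebesgue_rV R n).
Local Notation lam := (@lebesgue_measure R).
Local Notation eps := (@eps R).

Variables (L : diffop2 R n) (V : rV -> R) (sigma : R) (chi : rV -> R).
Hypothesis L_coef : smooth_bounded L.
Hypotheses (V_meas : measurable_fun setT V) (V_bounded : bounded_fct V).
Hypotheses (chi_sq : sq_integrable mu chi) (chi_int : rintegrable mu chi).
Hypothesis chi_eigen : forall psi, test_function setT psi ->
  \int[mu]_x (chi x * (apply_op L psi x - V x * psi x)) =
  - sigma ^+ 2 * \int[mu]_x (chi x * psi x).
Hypothesis chi_ge0 : forall x, 0 <= chi x.
Variables (s0 s1 E0 Q : R) (w : R * rV -> R) (D : R -> 'I_n -> rV -> R).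
Hypotheses (s01 : s0 < s1) (w_sq : sq_integrable (lam \x mu)%E w).
Hypothesis w0 : forall t x, ~ s0 <= t <= s1 -> w (t, x) = 0.
Hypothesis wD : forall t, s0 <= t <= s1 ->
  weak_pair (fun x => w (t, x)) (D t) /\ energy (fun x => w (t, x)) (D t) <= E0.
Variables (alpha theta : R -> R) (Ca : R).
Hypotheses (alpha_meas : measurable_fun setT alpha) (theta_meas : measurable_fun setT theta).
Hypotheses (alpha0 : zero_outside s0 s1 alpha) (theta0 : zero_outside s0 s1 theta).
Hypotheses (alphaC : forall t, `|alpha t| <= Ca) (thetaC : forall t, `|theta t| <= Ca).
Hypothesis tested : forall k y, - Q <= \int[(lam \x mu)%E]_z (w z *
  (alpha z.1 * moll_kernel k (z.2, y) + theta z.1 * wave_kernel L V k (z.2, y))).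

Lemma cut_chi_le m x : `|cut_chi chi (@cutoff R n m) x| <= `|chi x|.
Proof.
rewrite normrM; have /andP[c0 c1] := @cutoff_itv R n m x.
by rewrite ger0_norm// ler_piMl.
Qed.

Lemma Rintegral_cut_chi_cvg (g : rV -> R) : measurable_fun setT g ->
  rintegrable mu (fun x => g x * chi x) ->
  \int[mu]_x (g x * cut_chi chi (@cutoff R n m) x) @[m --> \oo] -->
    \int[mu]_x (g x * chi x).
Proof.
move=> mg gi; have [mc _] := chi_sq.
have [//|||//||_] := @Rdominated_cvg _ _ _ mu
  (fun m x => g x * cut_chi chi (@cutoff R n m) x) (fun x => g x * chi x)
  (fun x => `|g x * chi x|) => //.
- move=> m; apply: measurable_funM => //; apply: measurable_funM => //.
  by apply: smooth_measurable; exact: smooth_cutoff.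
- exact: rintegrable_measurable gi.
- apply: aeW => x; apply: cvgMr; rewrite /cut_chi -[X in _ --> X]mul1r.
  by apply: cvgMl; exact: cutoff_cvg.
- exact: rintegrable_norm.
- by move=> m x; rewrite !(normrM (g x)) ler_wpM2l// cut_chi_le.
Qed.

(** The cutoff tends to 1 with an error O(eps m) that is uniform in time. Membership of [chi] in L^2
    takes care of the pairing with [w], membership in L^1 of the left side. *)
Lemma key_inequality : - (Q * \int[mu]_x chi x) <=
  \int[lam]_t ((alpha t - sigma ^+ 2 * theta t) * \int[mu]_x (w (t, x) * chi x)).
Proof.
have Ca0 : 0 <= Ca := le_trans (normr_ge0 _) (alphaC 0).
have e0 m : 0 < eps m by exact: eps_gt0.
have [C C0 HC] := @partial_cutoff_bound R n.
have [K K0 HK] := cutoff_error_bound L_coef chi_sq.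
have sq_w t : sq_integrable mu (fun x => w (t, x)).
  have [/wD[[]]//|nt] := pselect (s0 <= t <= s1).
  rewrite (_ : (fun x => w (t, x)) = fun=> 0); first exact: sq_integrable0.
  by apply/funext => x; exact: w0.
have ce t m : s0 <= t <= s1 ->
    `|cutoff_error L chi (@cutoff R n m) (fun x => w (t, x)) (D t)| <=
      K * (C * eps m) * (E0 + sqint mu chi).
  move=> ht; have [[Ws Ds _] wE] := wD ht; have [b1 b2] := HC m.
  have ee : 0 <= C * eps m by rewrite mulr_ge0// ltW.
  have h := HK _ _ ee (@smooth_cutoff R n m) b1 b2 _ _ Ws Ds; apply: (le_trans h).
  by rewrite ler_wpM2l ?lerD2r// mulr_ge0.
have wh t m : s0 <= t <= s1 ->
    `|\int[mu]_x (w (t, x) * cut_chi chi (@cutoff R n m) x)| <= E0 + sqint mu chi.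
  move=> ht; have [[Ws Ds _] wE] := wD ht.
  have cs := cut_chi_sq chi_sq (@smooth_cutoff R n m) (@supported_cutoff R n m).
  apply: (le_trans (normr_Rintegral_sqM ltr01 Ws cs)); rewrite invr1 !mul1r.
  have : sqint mu (cut_chi chi (@cutoff R n m)) <= sqint mu chi.
    apply: Rintegral_le; [by have [] := cs|by have [] := chi_sq|].
    move=> x; rewrite -[leLHS]real_normK ?num_real// -[leRHS]real_normK ?num_real//.
    by rewrite lerXn2r ?nnegrE//; exact: cut_chi_le.
  have := sqint_le_energy (fun x => w (t, x)) (D t).
  have := sqint_ge0 mu (fun x => w (t, x)); have := sqint_ge0 mu chi.
  by lra.
pose B := E0 + sqint mu chi.
pose g t := (indS s0 s1 t) * (Ca * B + Ca * (K * C * B + sigma ^+ 2 * B)).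
have li m := @limit_inequality R n L V sigma chi (@cutoff R n m) (3 / eps m) L_coef V_meas
  V_bounded chi_sq chi_int chi_eigen chi_ge0 (@smooth_cutoff R n m) (@supported_cutoff R n m)
  (fun x => (andP (@cutoff_itv R n m x)).1) s0 s1 E0 Q w D
  (divr_ge0 (ler0n _ 3) (ltW (e0 m))) s01 w_sq w0 wD alpha theta Ca
  alpha_meas theta_meas alpha0 theta0 alphaC thetaC tested.
have [||||||_ _] := @Rintegral_cvg_ge R _ _ lam
  (fun m => limit_density L sigma chi (@cutoff R n m) w D alpha theta)
  (fun t => (alpha t - sigma ^+ 2 * theta t) * \int[mu]_x (w (t, x) * chi x)) g
  (fun m => - Q * \int[mu]_y cut_chi chi (@cutoff R n m) y) (- Q * \int[mu]_x chi x).
- by move=> m; have [] := li m.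
- move=> t; rewrite /limit_density.
  have [ht|ht] := pselect (s0 <= t <= s1); last first.
    rewrite alpha0// theta0// mulr0 subr0 mul0r.
    by under eq_fun do rewrite !mul0r addr0; exact: cvg_cst.
  have [[Ws Ds _] wE] := wD ht.
  have cw : \int[mu]_x (w (t, x) * cut_chi chi (@cutoff R n m) x) @[m --> \oo] -->
      \int[mu]_x (w (t, x) * chi x).
    by apply: Rintegral_cut_chi_cvg; [have [] := Ws|exact: rintegrable_sqM].
  have c0 : cutoff_error L chi (@cutoff R n m) (fun x => w (t, x)) (D t) @[m --> \oo] -->
      (0 : R).
    apply/norm_cvg0P; apply: (@squeeze_cvgr _ _ _ _ (fun=> 0) (fun m => K * (C * eps m) * B)).
    - by apply: nearW => m; rewrite normr_ge0 ce.
    - exact: cvg_cst.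
    - rewrite -(mul0r B); apply: cvgMl; rewrite -(mulr0 K); apply: cvgMr.
      by rewrite -(mulr0 C); apply: cvgMr; exact: cvg_eps.
  rewrite (_ : (alpha t - _) * _ = alpha t * \int[mu]_x (w (t, x) * chi x) +
    theta t * (- 0 - sigma ^+ 2 * \int[mu]_x (w (t, x) * chi x))); last by ring.
  apply: cvgD; apply: cvgMr => //.
  by apply: cvgB; [exact: cvgN|exact: cvgMr].
- by rewrite /g; apply: rintegrableZr; exact: (has_integral_indS s01).1.
- move=> m t; rewrite /g /limit_density.
  have [ht|ht] := pselect (s0 <= t <= s1); last first.
    by rewrite alpha0// theta0// indS_out// !mul0r addr0 normr0.
  rewrite indS_in// mul1r; have h1 := ce t m ht; have h2 := wh t m ht.
  have B0 : 0 <= B := le_trans (normr_ge0 _) h2.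
  apply: (le_trans (ler_normD _ _)); rewrite (normrM (alpha t)) (normrM (theta t)).
  apply: lerD; apply: ler_pM => //.
  apply: (le_trans (ler_normB _ _)); rewrite normrN normrM.
  rewrite (ger0_norm (sqr_ge0 sigma)); apply: lerD; last by rewrite ler_wpM2l// sqr_ge0.
  apply: (le_trans h1); rewrite -!mulrA ler_wpM2l// ler_wpM2l// -[leRHS]mul1r.
  by rewrite ler_wpM2r// eps_le1.
- apply: cvgMr.
  have E (q : rV -> R) : \int[mu]_x q x = \int[mu]_x (1 * q x).
    by apply: eq_Rintegral => x _; rewrite mul1r.
  rewrite E; under eq_fun do rewrite E.
  apply: (@Rintegral_cut_chi_cvg (fun=> 1)); first exact: measurable_cst.
  exact: rintegrableZl.
- by move=> m; have [] := li m.
by rewrite mulNr.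
Qed.

End key_inequality.

(** * The energy space *)

Section energy_space.
Context (R : realType) (n : nat).
Local Notation rV := 'rV[R]_n.
Local Notation mu := (lebesgue_rV R n).
Local Notation lam := (@lebesgue_measure R).
Implicit Types g h : rV -> R.

Lemma in_L2P g : in_L2 g <-> sq_integrable mu g.
Proof.
split=> [|[mg gi]]; first exact: in_L2_sq.
rewrite /in_L2/= inE; apply/andP; split; first by rewrite inE.
rewrite inE /finite_norm /=; apply: (@lty_poweRy _ _ 2); first by rewrite gt_eqF.
rewrite poweR_Lnorm ?gt_eqF// (eq_integral (fun x => ((g x) ^+ 2)%:E)).
  by rewrite -EFin_Rintegral// ltry.
by move=> x _ /=; rewrite powR_mulrn// real_normK ?num_real.
Qed.

(** Young's inequality with the optimal weight, the ratio of the two norms, each enlarged by some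
    [d > 0] lest it vanish. *)
Lemma cauchy_schwarz g h : sq_integrable mu g -> sq_integrable mu h ->
  `|\int[mu]_x (g x * h x)| <= L2norm g * L2norm h.
Proof.
move=> gs hs; have gE := L2norm_sq (proj2 (in_L2P g) gs).
have hE := L2norm_sq (proj2 (in_L2P h) hs).
have A0 := L2norm_ge0 g; have B0 := L2norm_ge0 h.
move: (L2norm g) (L2norm h) A0 B0 gE hE => A B A0 B0 gE hE.
apply/ler_addgt0Pl => e e0.
(* With norms A and B, Young's bound exceeds A B by d (A + B) / 2, which is at most [e]. *)
pose d := e / (A + B + 1).
have S0 : 0 < A + B + 1 by rewrite ltr_wpDl ?addr_ge0.
have d0 : 0 < d by rewrite divr_gt0.
have Ad : 0 < A + d by rewrite ltr_wpDl.
have Bd : 0 < B + d by rewrite ltr_wpDl.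
have c0 : 0 < (B + d) / (A + d) by rewrite divr_gt0.
apply: (le_trans (normr_Rintegral_sqM c0 gs hs)); rewrite -gE -hE invf_div.
have h1 : (B + d) / (A + d) * A ^+ 2 <= (B + d) * A.
  rewrite -mulrA ler_wpM2l ?(ltW Bd)// mulrC ler_pdivrMr// expr2 ler_wpM2l// lerDl.
  exact: ltW.
have h2 : (A + d) / (B + d) * B ^+ 2 <= (A + d) * B.
  rewrite -mulrA ler_wpM2l ?(ltW Ad)// mulrC ler_pdivrMr// expr2 ler_wpM2l// lerDl.
  exact: ltW.
have de : d * (A + B) <= e.
  rewrite /d mulrAC ler_pdivrMr// ler_wpM2l ?(ltW e0)// lerDl.
  exact: ler01.
have : d * A + d * B <= e by rewrite -mulrDr.
have := mulr_ge0 (ltW d0) A0; have := mulr_ge0 (ltW d0) B0.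
by move: h1 h2; rewrite !mulrDl [B * A]mulrC; lra.
Qed.

Lemma weak_gradient_pair g : in_H1 g -> weak_pair g (weak_gradient g) /\
  H1norm g ^+ 2 = energy g (weak_gradient g).
Proof.
move=> [g2 [G gG]]; have gw : is_weak_gradient g (weak_gradient g).
  by rewrite /weak_gradient; case: xgetP => [D _ //|/(_ G)].
split.
  split; first exact: in_L2_sq.
    by move=> i; apply: in_L2_sq; have [] := gw i.
  by move=> i; have [] := gw i.
rewrite /H1norm sqr_sqrtr; last first.
  by rewrite addr_ge0 ?sqr_ge0// sumr_ge0// => i _; exact: sqr_ge0.
rewrite L2norm_sq//; congr (_ + _); apply: eq_bigr => i _.
by rewrite L2norm_sq//; have [] := gw i.
Qed.

Lemma test_function_sq psi : test_function setT psi ->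
  sq_integrable mu psi /\ forall i, sq_integrable mu (partial i psi).
Proof.
move=> [ps [K [cK _ psi0]]].
have [M [_ /(_ (M + 1))]] := compact_bounded cK; rewrite ltrDl ltr01 => /(_ isT) HM.
have pc : supported_in 0 (M + 1) psi.
  move=> x nx; apply: psi0 => Kx; apply: nx => i; rewrite mxE subr0.
  exact: le_trans (coord_le_norm _ _) (HM x Kx).
split; first by apply: sq_integrable_supported pc; exact: smooth_continuous.
move=> i; apply: sq_integrable_supported (supported_partial i pc).
exact/smooth_continuous/smooth_partial.
Qed.

(** Chosen weak gradients are additive only up to null sets, whereas explicit ones add exactly. The
    factor 2 comes from (a + b)^2 <= 2 a^2 + 2 b^2 and replaces the triangle inequality for the H^1
    norm. *)
Lemma weak_pairD g h D E : weak_pair g D -> weak_pair h E ->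
  weak_pair (fun x => g x + h x) (fun i x => D i x + E i x) /\
  energy (fun x => g x + h x) (fun i x => D i x + E i x) <= 2 * energy g D + 2 * energy h E.
Proof.
move=> [gs Ds gD] [hs Es hE]; split.
  split; [exact: sq_integrableD|by move=> i; exact: sq_integrableD|].
  move=> i psi tpsi.
  have [ps2 dps2] := test_function_sq tpsi.
  under eq_Rintegral do rewrite mulrDl.
  under [in RHS]eq_Rintegral do rewrite mulrDl.
  rewrite !RintegralD//; [|exact: rintegrable_sqM..].
  by rewrite gD// hE// opprD.
apply: (le_trans (lerD (sqintD_le gs hs) (ler_sum _ (fun i _ => sqintD_le (Ds i) (Es i))))).
by rewrite big_split/= -!big_distrr/= /energy !mulrDr addrACA.
Qed.

Lemma in_H1_weak_pair g D : weak_pair g D -> in_H1 g.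
Proof.
move=> [gs Ds gD]; split; first exact/in_L2P.
by exists D => i; split; [exact/in_L2P|exact: gD].
Qed.

Lemma weak_pairN g D : weak_pair g D -> weak_pair (fun x => - g x) (fun i x => - D i x).
Proof.
move=> [gs Ds gD]; have N h : sq_integrable mu h -> sq_integrable mu (fun x => - h x).
  by move=> /(sq_integrableZ (-1)); under [X in sq_integrable _ X]eq_fun do rewrite mulN1r.
split; [exact: N|by move=> i; exact: N|].
move=> i psi tpsi; have [ps2 dps2] := test_function_sq tpsi.
have NR (q p : rV -> R) : sq_integrable mu q -> sq_integrable mu p ->
    \int[mu]_x (- q x * p x) = - \int[mu]_x (q x * p x).
  move=> qs pps; rewrite -mulN1r -RintegralZl//; last exact: rintegrable_sqM.
  by apply: eq_Rintegral => x _; rewrite mulNr mulN1r.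
by rewrite !NR// gD// opprK.
Qed.

Section uniform_bound.
Variables (T : \bar R) (w : R -> rV -> R).
Hypothesis w_cont : continuous_into (@in_H1 R n) (@H1norm R n) T w.

(** Continuity into H^1 bounds the energy near each time, and compactness of [s0, s1] makes the
    bound uniform. *)
Lemma uniform_energy_bound s0 s1 : 0 <= s0 -> (s1%:E < T)%E ->
  exists E0, forall t, s0 <= t <= s1 ->
    exists D, weak_pair (w t) D /\ energy (w t) D <= E0.
Proof.
move=> s00 s1T; have [wH wc] := w_cont.
have inT t : s0 <= t <= s1 -> time T t.
  move=> /andP[h0 h1]; split; first exact: le_trans h0.
  by apply: le_lt_trans s1T; rewrite lee_fin.
have /compact_near_coveringP/(_ R +oo%R (fun E t => time T t ->
    exists D, weak_pair (w t) D /\ energy (w t) D <= E)) := @segment_compact R s0 s1.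
case.
  move=> t0 /=; rewrite in_itv/= => /inT Tt0.
  have [wp0 e0] := weak_gradient_pair (wH t0 Tt0).
  have /cvgrPdist_lt /(_ 1 ltr01) := wc t0 Tt0; rewrite near_withinE => ev.
  (* Near [t0] the increment of [w] has H^1 norm below 1, so it adds at most 2. *)
  pose E := 2 * energy (w t0) (weak_gradient (w t0)) + 2.
  exists ([set t | time T t -> `|0 - H1norm (w t - w t0)| < 1], [set e | E <= e]).
    split=> /=; first exact: ev.
    by exists E; split; [exact: num_real|move=> e /ltW].
  move=> [t e]/= [ht Ee] Tt.
  have dp : in_H1 (w t - w t0).
    have [wp _] := weak_gradient_pair (wH t Tt).
    exact: in_H1_weak_pair (weak_pairD wp (weak_pairN wp0)).1.
  have [wpd ed] := weak_gradient_pair dp.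
  have [wps es] := weak_pairD wp0 wpd.
  exists (fun i x => weak_gradient (w t0) i x + weak_gradient (w t - w t0) i x).
  have wE : (fun x => w t0 x + (w t - w t0) x) = w t.
    by apply/funext => x; rewrite (_ : (w t - w t0) x = w t x - w t0 x)// addrC subrK.
  rewrite wE in wps es; split => //; apply: (le_trans es); apply: le_trans Ee.
  rewrite lerD2l -[leRHS]mulr1 ler_wpM2l// -ed.
  have := ht Tt; rewrite sub0r normrN => h.
  rewrite -real_normK ?num_real//; apply: exprn_ile1 => //; exact: ltW.
move=> E [_ HE]; exists (E + 1) => t ht.
apply: (HE (E + 1)) => /=; rewrite ?ltrDl ?in_itv//.
exact: inT.
Qed.

End uniform_bound.

Lemma measurable_spacetime (T : \bar R) : measurable (spacetime T : set (measurableTypeR R * rV)).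
Proof.
have -> : spacetime T = [set t : R | 0 < t /\ (t%:E < T)%E] `*` [set: rV].
  by apply/seteqP; split=> z //= -[].
apply: measurableX => //.
case: T => [r| |].
- rewrite (_ : [set t | _] = [set` `]0, r[]); first exact: measurable_itv.
  by apply/seteqP; split=> t; rewrite /= in_itv/= lte_fin => /andP.
- rewrite (_ : [set t | _] = [set` `]0, +oo[]); first exact: measurable_itv.
  by apply/seteqP; split=> t; rewrite /= in_itv/= ltry andbT => // -[].
- by rewrite (_ : [set t | _] = set0) //; apply/seteqP; split=> t //= -[].
Qed.

Lemma measurable_perturbation (T : \bar R) (u : R -> rV -> R) (phi : rV -> R) s0 s1 :
  0 < s0 -> (s1%:E < T)%E -> continuous phi ->
  measurable_fun (spacetime T : set (measurableTypeR R * rV)) (fun z => u z.1 z.2) ->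
  measurable_fun [set: measurableTypeR R * rV] (perturbation phi u s0 s1).
Proof.
move=> s00 s1T cphi mu_.
pose S := ([set` `[s0, s1]] `*` [set: rV]) : set (measurableTypeR R * rV).
have mS : measurable S by apply: measurableX => //; exact: measurable_itv.
have ST : S `<=` spacetime T.
  move=> z [/= + _]; rewrite in_itv/= => /andP[h0 h1]; split; first exact: lt_le_trans h0.
  by apply: le_lt_trans s1T; rewrite lee_fin.
have mw : measurable_fun S (fun z : measurableTypeR R * rV => u z.1 z.2 - phi z.2).
  apply: measurable_funB; first exact: (measurable_funS (measurable_spacetime T) ST mu_).
  apply: (measurable_funS measurableT) => //.
  exact: (measurableT_comp (continuous_measurable_rV cphi) measurable_snd).
have := (measurable_restrict _ mS measurableT).1.
rewrite setTI => /(_ _ _ _ mw).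
rewrite (_ : _ \_ S = perturbation phi u s0 s1)//.
apply/funext => z; rewrite patchE /perturbation; case: ifPn => zS.
  rewrite indS_in ?mul1r//; move: zS; rewrite inE => -[/=].
  by rewrite in_itv.
rewrite indS_out ?mul0r// => h; move: zS; rewrite notin_setE; apply; split => //=.
Qed.

Lemma sq_integrable_spacetime (v : measurableTypeR R * rV -> R) s0 s1 E0 : s0 < s1 ->
  measurable_fun setT v -> (forall t x, ~ s0 <= t <= s1 -> v (t, x) = 0) ->
  (forall t, s0 <= t <= s1 -> sq_integrable mu (fun x => v (t, x)) /\
    sqint mu (fun x => v (t, x)) <= E0) ->
  sq_integrable (lam \x mu)%E v.
Proof.
move=> s01 mv v0 vE; split => //.
have mv2 : measurable_fun setT (EFin \o (fun z => v z ^+ 2)).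
  by apply/measurable_EFinP; exact: measurable_funX.
have pos z : (0 <= (v z ^+ 2)%:E)%E by rewrite lee_fin sqr_ge0.
apply/integrableP; split => //.
rewrite (eq_integral (EFin \o (fun z => v z ^+ 2))); last first.
  by move=> z _ /=; rewrite ger0_norm// sqr_ge0.
rewrite fubini_tonelli1//.
have [I _] := has_integral_indS s01.
apply: (@le_lt_trans _ _ (\int[lam]_t (E0 * indS s0 s1 t)%:E)%E); last first.
  by rewrite -EFin_Rintegral ?ltry//; exact: rintegrableZl.
apply: ge0_le_integral => //.
- by move=> t _; apply: integral_ge0 => x _; exact: pos.
- exact: measurable_fun_fubini_tonelli_F.
- by apply/measurable_EFinP; apply: measurable_funM => //; exact: measurable_indS.
move=> t _; rewrite /fubini_F/=; have [ht|ht] := pselect (s0 <= t <= s1).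
  have [vs ve] := vE t ht; rewrite indS_in// mulr1 -EFin_Rintegral ?lee_fin//.
  by have [] := vs.
rewrite indS_out// mulr0 integral0_eq// => x _.
by rewrite v0// expr0n.
Qed.

Section pairing_with_chi.
Variables (T : \bar R) (chi : rV -> R).
Hypothesis chi_sq : sq_integrable mu chi.

Lemma Rintegral_chiB g h : sq_integrable mu g -> sq_integrable mu h ->
  `|\int[mu]_x (chi x * g x) - \int[mu]_x (chi x * h x)| <= L2norm chi * L2norm (g - h).
Proof.
move=> gs hs; rewrite -RintegralB//; [|exact: rintegrable_sqM..].
rewrite (_ : \int[mu]_x _ = \int[mu]_x (chi x * (g - h) x)).
  by apply: cauchy_schwarz => //; exact: sq_integrableB.
by apply: eq_Rintegral => x _; rewrite -mulrBr.
Qed.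

Lemma pairing_continuous (v : R -> rV -> R) (F : R -> R) t0 : time T t0 ->
  (forall t, time T t -> sq_integrable mu (v t)) ->
  (forall t, time T t -> L2norm (v t - v t0) <= F t) ->
  F t @[t --> within (time T) (nbhs t0)] --> (0 : R) ->
  \int[mu]_x (chi x * v t x) @[t --> within (time T) (nbhs t0)] -->
    \int[mu]_x (chi x * v t0 x).
Proof.
move=> Tt0 vs vF F0; apply/subr_cvg0/norm_cvg0P.
apply: (@squeeze_cvgr _ _ _ _ (fun=> 0) (fun t => L2norm chi * F t)).
- rewrite near_withinE; apply: nearW => t Tt; rewrite normr_ge0/=.
  apply: (le_trans (Rintegral_chiB (vs t Tt) (vs t0 Tt0))).
  by rewrite ler_wpM2l ?L2norm_ge0// vF.
- exact: cvg_cst.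
- by rewrite -(mulr0 (L2norm chi)); apply: cvgMr.
Qed.

Lemma L2norm_le_H1norm g : in_H1 g -> L2norm g <= H1norm g.
Proof.
move=> gH; rewrite /H1norm -[leLHS]ger0_norm ?L2norm_ge0// -sqrtr_sqr ler_sqrt//.
  by rewrite lerDl sumr_ge0// => i _; exact: sqr_ge0.
by rewrite addr_ge0 ?sqr_ge0// sumr_ge0// => i _; exact: sqr_ge0.
Qed.

Variables (w v : R -> rV -> R).
Hypothesis w_cont : continuous_into (@in_H1 R n) (@H1norm R n) T w.
Hypothesis v_cont : continuous_into (@in_L2 R n) (@L2norm R n) T v.
Hypothesis wv : L2_time_derivative T w v.

Let G t := \int[mu]_x (chi x * w t x).
Let G' t := \int[mu]_x (chi x * v t x).

Lemma pairing_w_continuous t0 : time T t0 ->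
  G t @[t --> within (time T) (nbhs t0)] --> G t0.
Proof.
move=> Tt0; have [wH wc] := w_cont.
apply: (pairing_continuous Tt0) (wc t0 Tt0) => t Tt.
  by have [[]] := weak_gradient_pair (wH t Tt).
apply: L2norm_le_H1norm.
have [wp _] := weak_gradient_pair (wH t Tt); have [wp0 _] := weak_gradient_pair (wH t0 Tt0).
exact: in_H1_weak_pair (weak_pairD wp (weak_pairN wp0)).1.
Qed.

Lemma pairing_v_continuous t0 : time T t0 ->
  G' t @[t --> within (time T) (nbhs t0)] --> G' t0.
Proof.
move=> Tt0; have [vL vc] := v_cont.
by apply: (pairing_continuous Tt0) (vc t0 Tt0) => // t Tt; exact/in_L2P/vL.
Qed.

(** Pairing with [chi] is a bounded functional on L^2, so convergence of the difference quotients in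
    L^2 passes to the pairing. At an interior time the restriction to [0, T[ is void. *)
Lemma is_derive_pairing t0 : 0 < t0 -> (t0%:E < T)%E -> is_derive t0 (1 : R) G (G' t0).
Proof.
move=> t00 t0T; have Tt0 : time T t0 by split => //; exact: ltW.
have [wH wc] := w_cont; have [vL vc] := v_cont.
have sw t : time T t -> sq_integrable mu (w t).
  by move=> Tt; have [[]] := weak_gradient_pair (wH t Tt).
have sv t : time T t -> sq_integrable mu (v t) by move=> Tt; exact/in_L2P/vL.
have nT : \forall t \near t0, time T t.
  have h1 : \forall t \near t0, 0 < t by exact: (cvgr_gt t0 cvg_id 0 t00).
  have h2 : \forall t \near t0, (t%:E < T)%E.
    case: T t0T => [r| |].
    - rewrite lte_fin => t0r.
      have h : \forall t \near t0, t < r by exact: (cvgr_lt t0 cvg_id r t0r).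
      by apply: filterS h => t; rewrite lte_fin.
    - by move=> _; apply: filterS h1 => t _; rewrite ltry.
    - by [].
  by apply: filterS2 h1 h2 => t /ltW.
suff H : (h^-1 *: ((G \o shift t0) (h *: 1) - G t0)) @[h --> (0 : R)^'] --> G' t0.
  by split; [apply/cvg_ex; exists (G' t0)|exact: cvg_lim H].
apply/cvgrPdist_lt => e e0; have K0 : 0 < L2norm chi + 1 by rewrite ltr_wpDl ?L2norm_ge0.
have /cvgrPdist_lt /(_ (e / (L2norm chi + 1)) (divr_gt0 e0 K0)) := wv Tt0.
move=> ev.
have /nbhs_ballP[d /= d0 hd] : nbhs t0 ([set t | t != t0 -> time T t ->
    `|0 - L2norm ((t - t0)^-1 *: (w t - w t0) - v t0)| < e / (L2norm chi + 1)] `&`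
    [set t | time T t]) by apply: filterI.
rewrite near_withinE; apply/nbhs_ballP; exists d => //= h; rewrite /ball/= sub0r normrN => hd' h0.
have [|ht Tt] := hd (h + t0); first by rewrite /ball/= opprD addrCA subrr addr0 normrN.
have := ht _ Tt; rewrite -subr_eq0 addrK => /(_ h0); rewrite sub0r normrN.
rewrite ger0_norm ?L2norm_ge0// => hL.
rewrite /GRing.scale/= mulr1 distrC.
have -> : h^-1 * (G (h + t0) - G t0) =
    \int[mu]_x (chi x * (h^-1 *: (w (h + t0) - w t0)) x).
  rewrite /G -RintegralB//; [|exact: rintegrable_sqM (sw _ _)..].
  rewrite -RintegralZl//; last first.
    by apply: rintegrableB; exact: rintegrable_sqM (sw _ _).
  apply: eq_Rintegral => x _.
  by rewrite -mulrBr mulrCA.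
apply: (le_lt_trans (Rintegral_chiB _ (sv t0 Tt0))).
  by apply: sq_integrableZ; apply: sq_integrableB; exact: sw.
apply: (@le_lt_trans _ _ (L2norm chi * (e / (L2norm chi + 1)))).
  by rewrite ler_wpM2l ?L2norm_ge0// ltW.
by rewrite mulrCA gtr_pMr// ltr_pdivrMr// mul1r ltrDl.
Qed.

End pairing_with_chi.
End energy_space.

(** * The second-order differential inequality *)

Section weighted_derivative.
Context (R : realType).
Local Notation lam := (@lebesgue_measure R).
Variables (l r s0 s1 : R).
Hypotheses (ls0 : l < s0) (s01 : s0 < s1) (s1r : s1 < r).

Lemma near_outside t : ~ s0 <= t <= s1 -> \forall s \near t, ~ s0 <= s <= s1.
Proof.
move=> /negP; rewrite negb_and -!ltNge => /orP[h|h].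
- have H : \forall s \near t, s < s0 by exact: (cvgr_lt t cvg_id s0 h).
  by apply: filterS H => s hs; apply/negP; rewrite negb_and -ltNge hs.
- have H : \forall s \near t, s1 < s by exact: (cvgr_gt t cvg_id s1 h).
  by apply: filterS H => s hs; apply/negP; rewrite negb_and -!ltNge hs orbT.
Qed.

Lemma in_open t : s0 <= t <= s1 -> l < t < r.
Proof. by move=> /andP[h0 h1]; rewrite (lt_le_trans ls0 h0) (le_lt_trans h1 s1r). Qed.

Lemma continuous_cutM (tau g : R -> R) : continuous tau -> zero_outside s0 s1 tau ->
  (forall t, l < t < r -> {for t, continuous g}) -> continuous (fun t => tau t * g t).
Proof.
move=> ct t0 cg t; have [ht|ht] := pselect (s0 <= t <= s1).
  by apply: continuousM; [exact: ct|exact/cg/in_open].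
have E : {near t, (fun t => tau t * g t) =1 cst 0}.
  by apply: filterS (near_outside ht) => s /t0 /= ->; rewrite mul0r.
rewrite /continuous_at /= t0// mul0r.
by apply: cvg_near_cst; apply: filterS (near_outside ht) => s /t0 /= ->; rewrite mul0r.
Qed.

(** Integration by parts with [g] regular only on ]l, r[: off [s0, s1] the products vanish in a
    neighbourhood, which extends continuity and derivability to the whole line. *)
Lemma Rintegral_cut_derive (tau g g' : R -> R) : smooth tau -> zero_outside s0 s1 tau ->
  (forall t, l < t < r -> is_derive t (1 : R) g (g' t)) ->
  (forall t, l < t < r -> {for t, continuous g'}) ->
  \int[lam]_t (derive1 tau t * g t + tau t * g' t) = 0.
Proof.
move=> ts t0 dg cg'.
have cg t : l < t < r -> {for t, continuous g}.
  by move=> /dg[d _]; apply/differentiable_continuous/derivable1_diffP.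
have dt0 : zero_outside s0 s1 (derive1 tau) by exact: zero_outside_derive1.
have big x : `|s0| + `|s1| < `|x| -> ~ s0 <= x <= s1.
  move=> + /andP[h0 h1]; apply/negP; rewrite -leNgt ler_norml.
  have := ler_norm s1; have := ler_norm (- s0); rewrite normrN.
  have := normr_ge0 s1; have := normr_ge0 s0.
  by move=> *; apply/andP; split; lra.
apply: (@Rintegral_derive_eq0 R (fun t => tau t * g t) _ (`|s0| + `|s1|)).
- have c1 := continuous_cutM (smooth_continuous (smooth_derive1 ts)) dt0 cg.
  have c2 := continuous_cutM (smooth_continuous ts) t0 cg'.
  have c : continuous (fun t : R => derive1 tau t * g t + tau t * g' t).
    exact: (@CkD R _ 0 _ _ c1 c2).
  exact: c.
- move=> t; have [ht|ht] := pselect (s0 <= t <= s1).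
    have dg_t := dg t (in_open ht).
    have dt : is_derive t (1 : R) tau (derive1 tau t).
      by rewrite derive1E; apply: derivableP; exact: smooth_derivable.
    apply: is_derive_eq; rewrite /GRing.scale/=; ring.
  rewrite t0// dt0// !mul0r addr0.
  apply: (@near_eq_is_derive _ _ _ (cst 0)) => //.
  by apply: filterS (near_outside ht) => s /t0 /= ->; rewrite mul0r.
- by move=> x /big /t0 ->; rewrite mul0r.
- by move=> x /big h; rewrite t0// dt0// !mul0r addr0.
Qed.

End weighted_derivative.

Section second_order_inequality.
Context (R : realType).
Local Notation lam := (@lebesgue_measure R).

Lemma is_derive_expRM (c t : R) :
  is_derive t (1 : R) (fun t : R => expR (c * t)) (c * expR (c * t)).
Proof.
by apply: is_derive_eq; rewrite /GRing.scale/=; ring.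
Qed.

Variables (a sigma : R).
Hypothesis sigma_gt0 : 0 < sigma.

(* [growth_rate] and [- decay_rate] are the roots of [X^2 + a X - sigma^2]. *)
Definition root_sum : R := Num.sqrt (a ^+ 2 + 4 * sigma ^+ 2).
Definition growth_rate : R := (- a + root_sum) / 2.
Definition decay_rate : R := (a + root_sum) / 2.

Lemma root_sum_sq : root_sum ^+ 2 = a ^+ 2 + 4 * sigma ^+ 2.
Proof. by rewrite sqr_sqrtr// addr_ge0 ?sqr_ge0// mulr_ge0 ?sqr_ge0. Qed.

Lemma abs_lt_root_sum : `|a| < root_sum.
Proof.
rewrite -(@ltr_pXn2r _ 2)// ?nnegrE ?sqrtr_ge0// real_normK ?num_real// root_sum_sq ltrDl.
by rewrite mulr_gt0// exprn_gt0.
Qed.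

Lemma growth_rate_gt0 : 0 < growth_rate.
Proof.
have := abs_lt_root_sum; have := ler_norm a; rewrite /growth_rate; lra.
Qed.

Lemma decay_rate_gt0 : 0 < decay_rate.
Proof.
have := abs_lt_root_sum; have := ler_norm (- a); rewrite normrN /decay_rate; lra.
Qed.

Lemma growth_decay : growth_rate + decay_rate = root_sum.
Proof. by rewrite /growth_rate /decay_rate; lra. Qed.

Lemma growth_rate_root : growth_rate ^+ 2 + a * growth_rate - sigma ^+ 2 = 0.
Proof.
have := root_sum_sq; rewrite /growth_rate; move: root_sum => s hs.
have -> : ((- a + s) / 2) ^+ 2 + a * ((- a + s) / 2) - sigma ^+ 2 =
  (s ^+ 2 - (a ^+ 2 + 4 * sigma ^+ 2)) / 4 by field.
by rewrite hs subrr mul0r.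
Qed.

Variables (G G' : R -> R) (T : \bar R).
Hypothesis dG : forall t, 0 < t -> (t%:E < T)%E -> is_derive t (1 : R) G (G' t).
Hypothesis cG' : forall t, 0 < t -> (t%:E < T)%E -> {for t, continuous G'}.
Hypothesis G_ineq : forall s0 s1 (theta : R -> R), 0 < s0 -> s0 < s1 -> (s1%:E < T)%E ->
  smooth theta -> zero_outside s0 s1 theta -> (forall t, 0 <= theta t) ->
  0 <= \int[lam]_t ((derive1 (derive1 theta) t - a * derive1 theta t
    - sigma ^+ 2 * theta t) * G t).

Let e t : R := expR (- growth_rate * t).
Let E t := e t * (G' t + decay_rate * G t).

Let es : smooth e. Proof. exact: smooth_expRM. Qed.
Let e' : derive1 e = (fun t => - growth_rate * e t).
Proof.
apply/funext => t; rewrite derive1E.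
by have [_ ->] := is_derive_expRM (- growth_rate) t.
Qed.

Lemma Rintegral_derive_step_le0 s0 s1 (tau : R -> R) : 0 < s0 -> s0 < s1 -> (s1%:E < T)%E ->
  smooth tau -> zero_outside s0 s1 tau -> (forall t, 0 <= tau t) ->
  rintegrable lam (fun t => derive1 tau t * E t) /\
  \int[lam]_t (derive1 tau t * E t) <= 0.
Proof.
move=> s00 s01 s1T ts t0 tp.
(* A real end point beyond [s1] and not beyond [T], as [T] may be infinite. *)
have [r s1r rT] : exists2 r, s1 < r & (r%:E < T)%E \/ r%:E = T.
  case: (T) s1T => [q| |]; first by rewrite lte_fin; exists q => //; right.
    by exists (s1 + 1); [rewrite ltrDl|left; rewrite ltry].
  by [].
have inT t : 0 < t < r -> 0 < t /\ (t%:E < T)%E.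
  move=> /andP[h0 h1]; split => //; case: rT => [|<-]; rewrite ?lte_fin//.
  by apply: lt_trans; rewrite lte_fin.
have dG0 t : 0 < t < r -> is_derive t (1 : R) G (G' t) by move=> /inT[]; exact: dG.
have cG'0 t : 0 < t < r -> {for t, continuous G'} by move=> /inT[]; exact: cG'.
have cG0 t : 0 < t < r -> {for t, continuous G}.
  by move=> /dG0[d _]; apply/differentiable_continuous/derivable1_diffP.
have ts' := smooth_derive1 ts; have ts'' := smooth_derive1 ts'.
have t'0 : zero_outside s0 s1 (derive1 tau) by exact: zero_outside_derive1.
have t''0 : zero_outside s0 s1 (derive1 (derive1 tau)) by exact: zero_outside_derive1.
pose theta t := e t * tau t.
have ths : smooth theta by exact: smoothM.
have d1M (f g : R -> R) : smooth f -> smooth g ->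
    derive1 (fun t => f t * g t) = (fun t => f t * derive1 g t + g t * derive1 f t).
  move=> fs gs; apply/funext => t; rewrite !derive1E deriveM//;
    exact: smooth_derivable.
have dth : derive1 theta = (fun t => e t * (derive1 tau t - growth_rate * tau t)).
  by rewrite d1M// e'; apply/funext => t; ring.
have ps : smooth (fun t => derive1 tau t - growth_rate * tau t).
  by apply: smoothD => //; apply: smoothN; apply: smoothM => //; exact: smooth_cst.
have dp : derive1 (fun t => derive1 tau t - growth_rate * tau t) =
    (fun t => derive1 (derive1 tau) t - growth_rate * derive1 tau t).
  apply/funext => t; rewrite [LHS]derive1E.
  have d1 : is_derive t (1 : R) (derive1 tau) (derive1 (derive1 tau) t).
    by rewrite [X in is_derive _ _ _ X]derive1E; exact/derivableP/smooth_derivable.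
  have d2 : is_derive t (1 : R) tau (derive1 tau t).
    by rewrite [X in is_derive _ _ _ X]derive1E; exact/derivableP/smooth_derivable.
  have d3 : is_derive t (1 : R) (fun t => growth_rate * tau t) (growth_rate * derive1 tau t).
    by apply: is_derive_eq; rewrite /GRing.scale/=; ring.
  by have [_ ->] : is_derive t (1 : R) (fun t => derive1 tau t - growth_rate * tau t)
    (derive1 (derive1 tau) t - growth_rate * derive1 tau t) by exact: is_deriveB.
have ddth : derive1 (derive1 theta) = (fun t => e t * (derive1 (derive1 tau) t
    - 2 * growth_rate * derive1 tau t + growth_rate ^+ 2 * tau t)).
  rewrite dth d1M// e' dp; apply/funext => t.
  by move: (derive1 (derive1 tau) t) (derive1 tau t) (tau t) (e t) growth_rate => *; ring.
have ce : continuous e by exact: smooth_continuous.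
have ceM (g : R -> R) t : 0 < t < r -> {for t, continuous g} ->
    {for t, continuous (fun t => e t * g t)}.
  by move=> ht cg; apply: continuousM => //; exact: ce.
have cE t : 0 < t < r -> {for t, continuous E}.
  move=> ht; apply: ceM => //; apply: continuousD; first exact: cG'0.
  by apply: continuousM; [exact: cst_continuous|exact: cG0].
have IE : rintegrable lam (fun t => derive1 tau t * E t).
  apply: (rintegrable_zero_outside s01); last by move=> t nt; rewrite t'0// mul0r.
  exact: (continuous_cutM s00 s1r (smooth_continuous ts') t'0 cE).
split => //.
have := G_ineq s00 s01 s1T ths (zero_outsideM _ t0) (fun t => mulr_ge0 (expR_ge0 _) (tp t)).
pose g t := e t * G t; pose g' t := e t * (G' t - growth_rate * G t).
have dg t : 0 < t < r -> is_derive t (1 : R) g (g' t).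
  move=> ht; have := dG0 t ht => dGt; have det := is_derive_expRM (- growth_rate) t.
  by apply: is_derive_eq; rewrite /GRing.scale/= /g' -/(e t); ring.
have cg' t : 0 < t < r -> {for t, continuous g'}.
  move=> ht; apply: ceM => //; apply: continuousB; first exact: cG'0.
  by apply: continuousM; [exact: cst_continuous|exact: cG0].
have I0 := Rintegral_cut_derive s00 s1r ts' t'0 dg cg'.
have Ig : rintegrable lam (fun t => derive1 (derive1 tau) t * g t + derive1 tau t * g' t).
  apply: rintegrableD; apply: (rintegrable_zero_outside s01).
  - apply: (continuous_cutM s00 s1r (smooth_continuous ts'') t''0) => t ht.
    by apply: ceM => //; exact: cG0.
  - by move=> t nt; rewrite t''0// mul0r.
  - exact: (continuous_cutM s00 s1r (smooth_continuous ts') t'0 cg').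
  - by move=> t nt; rewrite t'0// mul0r.
rewrite (_ : \int[lam]_t _ = \int[lam]_t (derive1 (derive1 tau) t * g t + derive1 tau t * g' t
    - derive1 tau t * E t)); last first.
  apply: eq_Rintegral => t _; rewrite ddth dth /theta /g /g' /E.
  have h1 := growth_rate_root.
  have h3 : a = decay_rate - growth_rate by rewrite /growth_rate /decay_rate; field.
  move: h1; rewrite h3.
  move: (derive1 (derive1 tau) t) (derive1 tau t) (tau t) (e t) (G t) (G' t) growth_rate decay_rate.
  move=> x y z ee gg gg' k d h1.
  have -> : sigma ^+ 2 = k ^+ 2 + (d - k) * k by rewrite -[LHS]add0r -h1 subrK.
  by ring.
by rewrite RintegralB// I0 sub0r oppr_ge0.
Qed.

Lemma is_derive_smooth (p : R -> R) t : smooth p -> is_derive t (1 : R) p (derive1 p t).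
Proof. by move=> ps; rewrite derive1E; exact/derivableP/smooth_derivable. Qed.

Let cE t : 0 < t -> (t%:E < T)%E -> {for t, continuous E}.
Proof.
move=> t0 tT; have [d _] := dG t0 tT.
apply: continuousM; first exact/smooth_continuous/es.
apply: continuousD; first exact: cG'.
apply: continuousM; first exact: cst_continuous.
exact/differentiable_continuous/derivable1_diffP.
Qed.

(** If [E] were smaller at [q] than at [p], a test function rising near [p] and falling near [q]
    would contradict the weak form, since its derivative weighs [E] positively near [p] and
    negatively near [q]. *)
Lemma weighted_nondecreasing p q : 0 < p -> p < q -> (q%:E < T)%E -> E p <= E q.
Proof.
move=> p0 pq qT; have pT : (p%:E < T)%E by apply: lt_trans qT; rewrite lte_fin.
have q0 := lt_trans p0 pq.
rewrite leNgt; apply/negP => Eqp.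
(* A level between the two values, with a gap [eta] left over on the side of [p]. *)
pose m := (E p + E q) / 2; pose eta := (E p - E q) / 4.
have eta0 : 0 < eta by rewrite /eta; move: Eqp; move: (E p) (E q) => x y; lra.
have [lp lq] : m + eta < E p /\ E q < m.
  by rewrite /m /eta; move: Eqp; move: (E p) (E q) => x y; split; lra.
have hp : \forall t \near p, m + eta < E t by exact: (cvgr_gt _ (cE p0 pT) _ lp).
have hq : \forall t \near q, E t < m by exact: (cvgr_lt _ (cE q0 qT) _ lq).
have hT : \forall t \near q, (t%:E < T)%E.
  case: (T) qT => [r| |]; last by [].
    rewrite lte_fin => qr; have h : \forall t \near q, t < r by exact: (cvgr_lt q cvg_id r qr).
    by apply: filterS h => t; rewrite lte_fin.
  by move=> _; apply: filterS hq => t _; rewrite ltry.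
have /nbhs_ballP[d1 /= d10 hd1] := hp.
have /nbhs_ballP[d2 /= d20 hd2] : nbhs q ([set t | E t < m] `&` [set t | (t%:E < T)%E]).
  exact: filterI.
(* The windows of radius [d] stay where [E] is close to its values at [p] and [q], remain in
   positive times and do not overlap. *)
pose d := Num.min (Num.min (d1 / 2) (d2 / 2)) (Num.min (p / 2) ((q - p) / 2)).
have d0 : 0 < d by rewrite !lt_min !divr_gt0// subr_gt0.
have [dd1 dd2 dp dpq] : [/\ d < d1, d < d2, d < p & d + d <= q - p].
  have : d <= d1 / 2 by rewrite !ge_min lexx.
  have : d <= d2 / 2 by rewrite !ge_min lexx orbT.
  have : d <= p / 2 by rewrite !ge_min lexx ?orbT.
  have : d <= (q - p) / 2 by rewrite !ge_min lexx ?orbT.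
  by move: (d) d0 => x x0 h1 h2 h3 h4; split; lra.
clearbody d.
have [qdT] : ((q + d)%:E < T)%E.
  have [] := hd2 (q + d) => //.
  by rewrite /ball/= opprD addNKr normrN gtr0_norm.
pose b (y t : R) := d^-1 * bump (d^-1 * (t - y)).
have bS y : smooth (b y).
  rewrite /b; under eq_fun do rewrite mulrBr -[_ - _]/(_ + - _).
  by apply: smoothM; [exact: smooth_cst|apply: smooth_comp_line; exact: smooth_bump].
have b_ge0 y t : 0 <= b y t by rewrite mulr_ge0 ?bump_ge0// invr_ge0 ltW.
have b_eq0 y t : d <= `|t - y| -> b y t = 0.
  move=> h; rewrite /b bump_eq0 ?mulr0// normrM gtr0_norm ?invr_gt0//.
  by rewrite mulrC ler_pdivlMr// mul1r.
have bI y : has_integral lam (b y) 1.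
  split; last exact: Rintegral_bump.
  apply: (@rintegrable_zero_outside R (y - d) (y + d)).
  - by move: d0; lra.
  - exact: smooth_continuous.
  - move=> t /negP nt; apply: b_eq0; rewrite leNgt ltr_distl.
    by apply: contra nt => /andP[/ltW -> /ltW ->].
pose tau t := smooth_step (d^-1 * t + - (d^-1 * p)) - smooth_step (d^-1 * t + - (d^-1 * q)).
have step0 y t : t <= y - d -> smooth_step (d^-1 * t + - (d^-1 * y)) = 0.
  move=> h; apply: smooth_step_eq0; rewrite -mulrBr mulrC ler_pdivrMr//.
  by move: h; lra.
have step1 y t : y + d <= t -> smooth_step (d^-1 * t + - (d^-1 * y)) = 1.
  move=> h; apply: smooth_step_eq1; rewrite -mulrBr mulrC ler_pdivlMr//.
  by move: h; lra.
have ts : smooth tau.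
  by apply: smoothD; [|apply: smoothN]; apply: smooth_comp_line; exact: smooth_smooth_step.
have dtau t : derive1 tau t = b p t - b q t.
  have D y : is_derive t (1 : R) (fun t : R => smooth_step (d^-1 * t + - (d^-1 * y))) (b y t).
    have := is_derive_comp_line d^-1 (- (d^-1 * y)) t (@smooth_smooth_step R).
    rewrite derive1E; have [_ ->] := is_derive_smooth_step (d^-1 * t + - (d^-1 * y)).
    by rewrite /b mulrBr.
  have := is_deriveB (D p) (D q); rewrite derive1E => -[_ h]; exact: h.
have tau0 : zero_outside (p - d) (q + d) tau.
  move=> t /negP; rewrite negb_and -!ltNge => /orP[h|h].
    rewrite /tau !step0 ?subr0//; move: h dpq d0; lra.
  rewrite /tau !step1 ?subrr//; move: h dpq d0; lra.
have tau_ge0 t : 0 <= tau t.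
  have [h|h] := leP t (p + d).
    rewrite /tau (step0 q) ?subr0.
      by have /andP[] := @smooth_step_itv R (d^-1 * t + - (d^-1 * p)).
    by move: h dpq; lra.
  rewrite /tau (step1 p) ?(ltW h)// subr_ge0.
  by have /andP[] := @smooth_step_itv R (d^-1 * t + - (d^-1 * q)).
have pd0 : 0 < p - d by rewrite subr_gt0.
have pdq : p - d < q + d by move: dpq d0 pq; lra.
have [I le0] := Rintegral_derive_step_le0 pd0 pdq qdT ts tau0 tau_ge0.
(* Both bumps have mass one, so the level [m] can be subtracted from [E] under the integral. *)
have Hm := has_integralZ m (has_integralB (bI p) (bI q)).
rewrite subrr mulr0 in Hm.
have [Ie Ee] := has_integralZ eta (bI p); rewrite mulr1 in Ee.
have : eta <= \int[lam]_t (derive1 tau t * E t) - 0.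
  rewrite -[leLHS]Ee -[X in _ - X](proj2 Hm) -RintegralB//; last by have [] := Hm.
  apply: Rintegral_le => //; first by apply: rintegrableB => //; have [] := Hm.
  move=> t; rewrite dtau (_ : (b p t - b q t) * E t - m * (b p t - b q t) =
    b p t * (E t - m) - b q t * (E t - m)); last first.
    by move: (b p t) (b q t) (E t) (m) => *; ring.
  have h1 : eta * b p t <= b p t * (E t - m).
    have [h|h] := leP d `|t - p|; first by rewrite b_eq0// mulr0 mul0r.
    rewrite mulrC ler_wpM2l//; have : m + eta < E t.
      by apply: hd1; rewrite /ball/= distrC (lt_trans h).
    by move: (E t) (m) (eta) => *; lra.
  have h2 : b q t * (E t - m) <= 0.
    have [h|h] := leP d `|t - q|; first by rewrite b_eq0// mul0r.
    rewrite mulr_ge0_le0// subr_le0; have [] := hd2 t; last by move=> /ltW.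
    by rewrite /ball/= distrC (lt_trans h).
  by move: h1 h2; move: (_ * _) (_ * _) (_ * _) => x y z; lra.
by rewrite subr0 => /(lt_le_trans eta0) /lt_le_trans /(_ le0); rewrite ltxx.
Qed.

(** Monotonicity holds on positive times only; the initial data enter through the limit from the
    right at 0. *)
Lemma weighted_lower_bound (H0 : R) :
  E t @[t --> within (time T) (nbhs 0)] --> H0 ->
  forall t, 0 < t -> (t%:E < T)%E -> H0 <= E t.
Proof.
move=> cE0 t t0 tT; apply/ler_addgt0Pl => e0 e00.
have /cvgrPdist_lt /(_ e0 e00) := cE0; rewrite near_withinE => /nbhs_ballP[d /= d0 hd].
pose s := Num.min (d / 2) (t / 2).
have s0 : 0 < s by rewrite lt_min !divr_gt0.
have [sd st] : s < d /\ s < t.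
  have : s <= d / 2 by rewrite ge_min lexx.
  have : s <= t / 2 by rewrite ge_min lexx orbT.
  by move: s s0 => x; split; lra.
have sT : (s%:E < T)%E by apply: lt_trans tT; rewrite lte_fin.
have := hd s; rewrite /ball/= sub0r normrN gtr0_norm// => /(_ sd) h.
have := h (conj (ltW s0) sT).
have := weighted_nondecreasing s0 st tT; have := ler_norm (H0 - E s).
by move: (E s) (E t) `|H0 - E s| => *; lra.
Qed.

(** Integrates the first-order inequality G' + decay_rate G >= H0 exp(growth_rate t). It starts at
    time 1 because the derivative of [G] is known at positive times only. *)
Lemma exponential_lower_bound (H0 : R) : T = +oo%E -> 0 < H0 ->
  (forall t, 0 < t -> H0 <= E t) ->
  exists c K, 0 < c /\ forall t, 1 <= t -> c * expR (growth_rate * t) - K <= G t.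
Proof.
move=> Too H00 HE; have s0 : 0 < root_sum by rewrite -growth_decay addr_gt0 ?growth_rate_gt0 ?decay_rate_gt0.
(* The integrating factor minus the exact solution: [m] has derivative exp(root_sum t) (E - H0),
   which is nonnegative. *)
pose m t := expR (decay_rate * t) * G t - H0 / root_sum * expR (root_sum * t).
have dm (t : R) : 0 < t -> is_derive t (1 : R) m (expR (root_sum * t) * (E t - H0)).
  move=> t0; have dGt : is_derive t (1 : R) G (G' t) by apply: dG => //; rewrite Too ltry.
  have d1 := is_derive_expRM decay_rate t; have d2 := is_derive_expRM root_sum t.
  apply: is_derive_eq; rewrite /GRing.scale/= /E /e.
  have -> : expR (decay_rate * t) = expR (root_sum * t) * expR (- growth_rate * t).
    by rewrite -expRD -growth_decay; congr expR; ring.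
  move: (expR (root_sum * t)) (expR (- growth_rate * t)) => x y.
  by field; rewrite gt_eqF.
exists (H0 / root_sum), `|m 1|; split; first by rewrite divr_gt0.
move=> t t1; have m1t : m 1 <= m t.
  have [||c] := @MVT_segment R m (fun t => expR (root_sum * t) * (E t - H0)) 1 t t1.
  - by move=> x; rewrite in_itv/= => /andP[x1 _]; apply: dm; exact: lt_trans x1.
  - apply: continuous_in_subspaceT => x; rewrite inE/= in_itv/= => /andP[x1 _].
    have [d _] := dm x (lt_le_trans ltr01 x1).
    exact/differentiable_continuous/derivable1_diffP.
  rewrite in_itv/= => /andP[c1 _] Ec; rewrite -subr_ge0 Ec mulr_ge0 ?subr_ge0//.
  by rewrite mulr_ge0 ?expR_ge0// subr_ge0 HE// (lt_le_trans ltr01).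
have Eg : G t = expR (- decay_rate * t) * m t + H0 / root_sum * expR (growth_rate * t).
  rewrite /m mulrBr mulrA -expRD mulrCA -expRD.
  rewrite (_ : - decay_rate * t + decay_rate * t = 0); last by ring.
  rewrite (_ : - decay_rate * t + root_sum * t = growth_rate * t) ?expR0 ?mul1r ?subrK//.
  by rewrite -growth_decay; ring.
rewrite Eg addrC lerD2r.
have e1 : expR (- decay_rate * t) <= 1.
  rewrite -expR0 ler_expR mulNr oppr_le0 mulr_ge0 ?(ltW decay_rate_gt0)//.
  exact: le_trans ler01 t1.
have := expR_ge0 (- decay_rate * t); have := ler_norm (- m 1); rewrite normrN.
have := normr_ge0 (m 1).
move: e1 m1t; move: (expR _) (m 1) (m t) `|m 1| => x y z w h1 h2 h3 h4 h5.
nra.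
Qed.

End second_order_inequality.

(** * The mean of the solution against the eigenfunction *)

Section nonlinearity.
Context (R : realType) (n : nat).
Local Notation rV := 'rV[R]_n.
Variables (f : rV -> R -> R) (phi : rV -> R).
Hypothesis f_C1 : Ck 1 (fun z : rV * R => f z.1 z.2).

Lemma is_derive_f x s : is_derive s (1 : R) (f x) ('D_(0, 1) (fun z : rV * R => f z.1 z.2) (x, s)).
Proof.
have [df _] := f_C1.
have := @is_derive_line R _ (fun z : rV * R => f z.1 z.2) (0, 1) (x, 0) s (df _).
have E t : t *: ((0, 1) : rV * R) + (x, 0) = (x, t).
  by congr (_, _); rewrite /= ?scaler0 ?add0r// addr0 /GRing.scale/= mulr1.
rewrite E (_ : (fun t : R => _) = f x)//.
by apply/funext => t; rewrite E.
Qed.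

Lemma f_uE x s : f_u f x s = 'D_(0, 1) (fun z : rV * R => f z.1 z.2) (x, s).
Proof. by rewrite /f_u derive1E; have [_ ->] := is_derive_f x s. Qed.

Lemma continuous_f_u : continuous phi -> continuous (fun x => f_u f x (phi x)).
Proof.
move=> cphi x; have [_ /(_ (0, 1)) cD] := f_C1.
under eq_fun do rewrite f_uE.
apply: (@continuous_comp _ _ _ (fun x => (x, phi x))
  (fun z => 'D_(0, 1) (fun z : rV * R => f z.1 z.2) z)); last exact: cD.
exact: (cvg_pair (@cvg_id _ (nbhs x)) (cphi x)).
Qed.

(** Along the segment from [p] to [v] the difference quotients are at most [f x v - f x p] by
    convexity, and they tend to the derivative times [v - p]. *)
Lemma convex_tangent x (p v : R) : @convex_function R R^o setT (f x) ->
  f x p + f_u f x p * (v - p) <= f x v.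
Proof.
move=> fx.
have conv_le h : 0 <= h <= 1 -> f x (h * v + (1 - h) * p) <= h * f x v + (1 - h) * f x p.
  move=> /andP[h0 h1].
  by have := fx (Itv01 h0 h1) v p; rewrite !inE => /(_ I I).
have [df Df] := is_derive_f x p.
have dq : is_derive (0 : R) (1 : R) (fun h : R => f x (h * v + (1 - h) * p))
    ('D_(0, 1) (fun z : rV * R => f z.1 z.2) (x, p) * (v - p)).
  have d1 : is_derive (0 : R) (1 : R) (fun h : R => h * v + (1 - h) * p) (v - p).
    by apply: is_derive_eq; rewrite /GRing.scale/=; ring.
  have d2 : is_derive ((fun h : R => h * v + (1 - h) * p) 0) (1 : R) (f x)
      ('D_(0, 1) (fun z : rV * R => f z.1 z.2) (x, p)).
    by rewrite /= mul0r add0r subr0 mul1r.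
  have := @is_derive1_comp R (f x) (fun h : R => h * v + (1 - h) * p) 0 _ _ d2 d1.
  by rewrite mulrC.
rewrite -lerBrDl f_uE; move: ('D_(0, 1) _ (x, p)) dq => D dq.
apply/ler_addgt0Pl => e e0.
have [dd Dd] := dq; move: dd; rewrite /derivable => /cvg_ex[l cl].
have lD : l = D * (v - p) by rewrite -Dd; apply/esym/cvg_lim.
have /cvgrPdist_lt /(_ e e0) := cl; rewrite near_withinE => /nbhs_ballP[d /= d0 hd].
pose h := Num.min (d / 2) 1.
have h0 : 0 < h by rewrite lt_min divr_gt0//=.
have h1 : h <= 1 by rewrite ge_min lexx orbT.
have hdd : h < d.
  have : h <= d / 2 by rewrite ge_min lexx.
  by lra.
have := hd h; rewrite /ball/= sub0r normrN gtr0_norm// => /(_ hdd).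
rewrite gt_eqF// => /(_ isT); rewrite addr0 /GRing.scale/= mulr1 mul0r add0r subr0 mul1r lD.
have := conv_le h; rewrite h1 ltW// => /(_ isT) cv.
have : h^-1 * (f x (h * v + (1 - h) * p) - f x p) <= f x v - f x p.
  rewrite mulrC ler_pdivrMr//; move: cv.
  by move: (f x _) (f x v) (f x p) => *; lra.
have := ler_norm (D * (v - p) - h^-1 * (f x (h * v + (1 - h) * p) - f x p)).
by move: (h^-1 * _) (D * _) (f x v - f x p) `|_| => *; lra.
Qed.

End nonlinearity.

Section solution.
Context (R : realType) (n : nat).
Local Notation rV := 'rV[R]_n.
Local Notation mu := (lebesgue_rV R n).
Local Notation lam := (@lebesgue_measure R).

Variables (L : diffop2 R n) (f : rV -> R -> R) (a : R) (phi : rV -> R) (sigma : R)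
  (chi : rV -> R) (T : \bar R) (u ut : R -> rV -> R).
Hypotheses (L_coef : smooth_bounded L) (phi_C2 : Ck 2 phi)
  (phi_eq : forall x, apply_op L phi x = f x (phi x)) (sigma_gt0 : 0 < sigma).
Hypotheses (chi_sq : sq_integrable mu chi) (chi_int : rintegrable mu chi)
  (chi_ge0 : forall x, 0 <= chi x).
Hypothesis chi_eigen : forall psi, test_function setT psi ->
  \int[mu]_x (chi x * (apply_op L psi x - f_u f x (phi x) * psi x)) =
  - sigma ^+ 2 * \int[mu]_x (chi x * psi x).
Hypotheses (f_u_phi_bounded : bounded_fct (fun x => f_u f x (phi x)))
  (f_convex : forall x, @convex_function R R^o setT (f x))
  (f_C1 : Ck 1 (fun z : rV * R => f z.1 z.2)).
Hypotheses (u_meas : measurable_fun (spacetime T : set (measurableTypeR R * rV))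
    (fun z => u z.1 z.2))
  (f_loc : locally_integrable_spacetime T (fun z => f z.2 (u z.1 z.2)))
  (pde : distributional_wave_equation L f a T u).
Hypotheses (w_cont : continuous_into (@in_H1 R n) (@H1norm R n) T (fun t => u t - phi))
  (ut_cont : continuous_into (@in_L2 R n) (@L2norm R n) T ut)
  (w_deriv : L2_time_derivative T (fun t => u t - phi) ut).

Let V x := f_u f x (phi x).

Let phic : continuous phi. Proof. exact: Ck_continuous phi_C2. Qed.

Let V_meas : measurable_fun setT V.
Proof. by apply: continuous_measurable_rV; exact: continuous_f_u. Qed.

Definition chi_mean t : R := \int[mu]_x (chi x * (u t - phi) x).

(** The lower bound on the nonlinearity is left open: kappa = 0 and B = 0 give the linear
    differential inequality, kappa = theta'' - a theta' the bound on window means. *)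
Lemma chi_mean_inequality s0 s1 (theta kappa : R -> R) B : 0 < s0 -> s0 < s1 -> (s1%:E < T)%E ->
  smooth theta -> zero_outside s0 s1 theta -> continuous kappa ->
  (forall t x, s0 <= t <= s1 -> kappa t * (u t x - phi x) - B <=
    theta t * (f x (u t x) - f x (phi x) - V x * (u t x - phi x))) ->
  - (B * (s1 - s0) * \int[mu]_x chi x) <=
  \int[lam]_t ((derive1 (derive1 theta) t - a * derive1 theta t - indS s0 s1 t * kappa t
    - sigma ^+ 2 * theta t) * chi_mean t).
Proof.
move=> s00 s01 s1T ths th0 ck H.
have [E0 HE0] := uniform_energy_bound w_cont (ltW s00) s1T.
pose w := perturbation phi u s0 s1.
have wE t : s0 <= t <= s1 -> (fun x => w (t, x)) = u t - phi.
  by move=> ht; apply/funext => x; rewrite /w /perturbation indS_in// mul1r.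
(* An arbitrary selection of weak gradients, one for each time. *)
have [D HD] : exists D : R -> 'I_n -> rV -> R, forall t, s0 <= t <= s1 ->
    weak_pair (u t - phi) (D t) /\ energy (u t - phi) (D t) <= E0.
  have h t : exists D : 'I_n -> rV -> R, s0 <= t <= s1 ->
      weak_pair (u t - phi) D /\ energy (u t - phi) D <= E0.
    have [/HE0[D HD]|nt] := pselect (s0 <= t <= s1); first by exists D.
    by exists (fun _ _ => 0).
  by have [D HD] := choice h; exists D.
have w0 t x : ~ s0 <= t <= s1 -> w (t, x) = 0.
  by move=> ht; rewrite /w /perturbation indS_out// mul0r.
have w_sq : sq_integrable (lam \x mu)%E w.
  apply: (sq_integrable_spacetime s01 (measurable_perturbation s00 s1T phic u_meas) w0
    (E0 := E0)) => t ht.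
  rewrite wE//; have [[Ws _ _] e] := HD t ht; split => //.
  exact: le_trans (sqint_le_energy _ _) e.
have wD t : s0 <= t <= s1 ->
    weak_pair (fun x => w (t, x)) (D t) /\ energy (fun x => w (t, x)) (D t) <= E0.
  by move=> ht; rewrite wE//; exact: HD.
have th's := smooth_derive1 ths; have th''s := smooth_derive1 th's.
have th'0 := zero_outside_derive1 th0; have th''0 := zero_outside_derive1 th'0.
have cont (p : R -> R) : smooth p -> continuous p by exact: smooth_continuous.
pose alpha t := derive1 (derive1 theta) t - a * derive1 theta t - indS s0 s1 t * kappa t.
have alpha0 : zero_outside s0 s1 alpha.
  by move=> t nt; rewrite /alpha th''0// th'0// indS_out// mulr0 mul0r !subr0.
have meas (p : R -> R) : continuous p -> measurable_fun setT p.
  exact: continuous_measurable_fun.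
have ma : measurable_fun setT alpha.
  apply: measurable_funB; last by apply: measurable_funM; [exact: measurable_indS|exact: meas].
  apply: measurable_funB; first by apply: meas; apply: cont.
  by apply: measurable_funM; [exact: measurable_cst|apply: meas; apply: cont].
have [C0 H0] := @continuous_bounded_segment R s0 s1 theta (cont _ ths).
have [C1 H1] := @continuous_bounded_segment R s0 s1 _ (cont _ th's).
have [C2 H2] := @continuous_bounded_segment R s0 s1 _ (cont _ th''s).
have [C3 H3] := @continuous_bounded_segment R s0 s1 _ ck.
pose Ca := `|C0| + (`|C2| + `|a| * `|C1| + `|C3|).
have thC t : `|theta t| <= Ca.
  have [ht|ht] := pselect (s0 <= t <= s1); last first.
    by rewrite th0// normr0 /Ca !addr_ge0// mulr_ge0.
  apply: (le_trans (H0 t ht)); apply: (le_trans (ler_norm _)).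
  by rewrite /Ca lerDl !addr_ge0// mulr_ge0.
have aC t : `|alpha t| <= Ca.
  have [ht|ht] := pselect (s0 <= t <= s1); last first.
    by rewrite alpha0// normr0 /Ca !addr_ge0// mulr_ge0.
  rewrite /alpha indS_in// mul1r; apply: (@le_trans _ _ (`|C2| + `|a| * `|C1| + `|C3|)).
    apply: (le_trans (ler_normB _ _)); apply: lerD; last first.
      exact: le_trans (H3 t ht) (ler_norm _).
    apply: (le_trans (ler_normB _ _)); apply: lerD.
      exact: le_trans (H2 t ht) (ler_norm _).
    by rewrite normrM ler_wpM2l// (le_trans (H1 t ht))// ler_norm.
  by rewrite /Ca lerDr.
have tested k y := tested_inequality L_coef phi_C2 phi_eq V_meas f_u_phi_bounded f_loc pde
  s00 s01 s1T w_sq ths th0 k y ck H.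
have := key_inequality L_coef V_meas f_u_phi_bounded chi_sq chi_int chi_eigen chi_ge0
  s01 w_sq w0 wD ma (meas _ (cont _ ths)) alpha0 th0 aC thC tested.
rewrite (_ : \int[lam]_t _ = \int[lam]_t ((derive1 (derive1 theta) t - a * derive1 theta t
  - indS s0 s1 t * kappa t - sigma ^+ 2 * theta t) * chi_mean t))//.
apply: eq_Rintegral => t _; rewrite -/(alpha t).
have [ht|ht] := pselect (s0 <= t <= s1); last first.
  by rewrite alpha0// th0// mulr0 subr0 !mul0r.
congr (_ * _); rewrite /chi_mean; apply: eq_Rintegral => x _.
by rewrite mulrC -[w (t, x)]/((fun x => w (t, x)) x) wE.
Qed.

Definition chi_velocity t : R := \int[mu]_x (chi x * ut t x).

Lemma is_derive_chi_mean t : 0 < t -> (t%:E < T)%E ->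
  is_derive t (1 : R) chi_mean (chi_velocity t).
Proof. by move=> t0 tT; exact: (is_derive_pairing chi_sq w_cont ut_cont w_deriv t0 tT). Qed.

Lemma near_time t : 0 < t -> (t%:E < T)%E -> \forall s \near t, time T s.
Proof.
move=> t0 tT; have h1 : \forall s \near t, 0 < s by exact: (cvgr_gt t cvg_id 0 t0).
have h2 : \forall s \near t, (s%:E < T)%E.
  case: (T) tT => [r| |]; last by [].
    rewrite lte_fin => tr; have h : \forall s \near t, s < r by exact: (cvgr_lt t cvg_id r tr).
    by apply: filterS h => s; rewrite lte_fin.
  by move=> _; apply: filterS h1 => s _; rewrite ltry.
by apply: filterS2 h1 h2 => s /ltW.
Qed.

Lemma continuous_chi_velocity t : 0 < t -> (t%:E < T)%E -> {for t, continuous chi_velocity}.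
Proof.
move=> t0 tT; have Tt : time T t by split => //; exact: ltW.
have H := pairing_v_continuous chi_sq ut_cont Tt.
apply/cvgrPdist_lt => e e0; have /cvgrPdist_lt /(_ e e0) := H.
rewrite near_withinE => ev; have nT := near_time t0 tT.
by apply: filterS2 ev nT => s h /h.
Qed.

Lemma chi_mean_ge0_inequality s0 s1 (theta : R -> R) : 0 < s0 -> s0 < s1 -> (s1%:E < T)%E ->
  smooth theta -> zero_outside s0 s1 theta -> (forall t, 0 <= theta t) ->
  0 <= \int[lam]_t ((derive1 (derive1 theta) t - a * derive1 theta t
    - sigma ^+ 2 * theta t) * chi_mean t).
Proof.
move=> s00 s01 s1T ths th0 thp.
have c0 : continuous (fun _ : R => 0 : R) by move=> x; exact: cst_continuous.
have := @chi_mean_inequality s0 s1 theta (fun=> 0) 0 s00 s01 s1T ths th0 c0.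
rewrite !mul0r oppr0.
rewrite (_ : \int[lam]_t _ = \int[lam]_t ((derive1 (derive1 theta) t - a * derive1 theta t
    - sigma ^+ 2 * theta t) * chi_mean t)); last first.
  by apply: eq_Rintegral => t _; rewrite mulr0 subr0.
apply => t x ht; rewrite mul0r addr0 mulr_ge0//.
by rewrite -addrA -opprD subr_ge0; exact: convex_tangent.
Qed.

Lemma chi_mean_growth (H0 : R) : T = +oo%E -> 0 < H0 ->
  chi_velocity 0 + decay_rate a sigma * chi_mean 0 = H0 ->
  exists c K, 0 < c /\
    forall t, 1 <= t -> c * expR (growth_rate a sigma * t) - K <= chi_mean t.
Proof.
move=> Too H00 HE.
apply: (exponential_lower_bound sigma_gt0 is_derive_chi_mean Too H00) => t t0.
apply: (weighted_lower_bound is_derive_chi_mean continuous_chi_velocity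
  chi_mean_ge0_inequality) => //; last by rewrite Too ltry.
have T0 : time T 0 by split => //; rewrite Too ltry.
(* The exponential weight is 1 at time 0, so the weighted quantity starts from the value of the
   data. *)
rewrite -HE -[X in _ --> X]mul1r; apply: cvgM.
  have h : expR (- growth_rate a sigma * t) @[t --> nbhs 0] --> expR (- growth_rate a sigma * 0).
    have c := smooth_continuous (smooth_expRM (- growth_rate a sigma)); exact: (c 0).
  by move: h; rewrite mulr0 expR0 => /cvg_within_filter.
apply: cvgD; first exact: pairing_v_continuous.
by apply: cvgMr; exact: pairing_w_continuous.
Qed.

End solution.

(** * Superlinear forcing *)

Section plateau.
Context (R : realType).
Local Notation plateau := (@plateau R).

Lemma derive1_exp (b : R -> R) k t : smooth b ->
  derive1 (fun t => b t ^+ k.+1) t = k.+1%:R * b t ^+ k * derive1 b t.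
Proof.
move=> bs; have [_ D] := is_deriveX k.+1 (is_derive_smooth t bs).
rewrite derive1E (_ : (fun t => _) = b ^+ k.+1) ?D//.
by apply/funext => s; rewrite exprfctE.
Qed.

Lemma zero_outside_plateau : zero_outside (-3) 3 plateau.
Proof.
by move=> t /negP; rewrite -ler_norml -ltNge => /plateau_eq0.
Qed.

Lemma derive1_comp_shift (g : R -> R) c t : smooth g ->
  derive1 (fun s => g (1 * s + c)) t = derive1 g (1 * t + c).
Proof.
move=> gs; have [_ h] := is_derive_comp_line 1 c t gs.
by rewrite derive1E h mul1r.
Qed.

(** Two derivatives of a power [k.+2] leave a factor [plateau ^+ k]. The derivative terms are thus
    controlled by a lower power of the same function, which is what lets Young's inequality absorb
    them. *)
Lemma plateau_power_derivatives a k : exists2 C, 0 <= C & forall t,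
  `|derive1 (derive1 (fun t : R => plateau t ^+ k.+2)) t
    - a * derive1 (fun t : R => plateau t ^+ k.+2) t| <= C * plateau t ^+ k.
Proof.
have ps := @smooth_plateau R; have p's := smooth_derive1 ps; have p''s := smooth_derive1 p's.
have p'0 := zero_outside_derive1 zero_outside_plateau; have p''0 := zero_outside_derive1 p'0.
have bound (g : R -> R) : smooth g -> zero_outside (-3) 3 g -> exists2 C, 0 <= C & forall t, `|g t| <= C.
  move=> gs g0; have [C HC] := @continuous_bounded_segment R (-3) 3 g (smooth_continuous gs).
  exists `|C| => // t; have [/HC h|/g0 ->] := pselect (-3 <= t <= 3); last by rewrite normr0.
  exact: le_trans h (ler_norm _).
have [C1 C10 H1] := bound _ p's p'0; have [C2 C20 H2] := bound _ p''s p''0.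
pose d (t : R) := k.+2%:R * plateau t ^+ k.+1.
have dE : derive1 (fun t : R => plateau t ^+ k.+2) = (fun t => d t * derive1 plateau t).
  by apply/funext => t; rewrite derive1_exp.
have ddE t : derive1 (fun t => d t * derive1 plateau t) t =
    d t * derive1 (derive1 plateau) t + derive1 plateau t * (k.+2%:R * (k.+1%:R * plateau t ^+ k * derive1 plateau t)).
  have dd : is_derive t (1 : R) d (k.+2%:R * (k.+1%:R * plateau t ^+ k * derive1 plateau t)).
    rewrite -derive1_exp//; apply: is_deriveZ.
    by apply: is_derive_smooth; exact: smooth_exp.
  have [_ h] := is_deriveM dd (is_derive_smooth t p's).
  by rewrite derive1E h.
pose C := k.+2%:R * C2 + C1 * (k.+2%:R * (k.+1%:R * C1)) + `|a| * (k.+2%:R * C1).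
exists C; first by rewrite !addr_ge0// ?mulr_ge0.
move=> t; rewrite dE ddE /d exprS.
have := H1 t; have := H2 t; have := plateau_itv t.
move: (plateau t) (derive1 plateau t) (derive1 (derive1 plateau) t) => b x y /andP[b0 b1] hy hx.
have -> : k.+2%:R * (b * b ^+ k) * y + x * (k.+2%:R * (k.+1%:R * b ^+ k * x)) -
    a * (k.+2%:R * (b * b ^+ k) * x) =
    (k.+2%:R * (b * y) + x * (k.+2%:R * (k.+1%:R * x)) - a * (k.+2%:R * (b * x))) * b ^+ k.
  by move: (b ^+ k) k.+2%:R k.+1%:R => *; ring.
have m0 : 0 <= k.+2%:R :> R by []; have l0 : 0 <= k.+1%:R :> R by [].
rewrite normrM (ger0_norm (exprn_ge0 _ b0)) ler_wpM2r ?exprn_ge0//.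
move: (k.+2%:R : R) (k.+1%:R : R) m0 l0 @C => m l m0 l0 C.
have hb z Z : `|z| <= Z -> `|b * z| <= Z.
  by move=> hz; rewrite normrM (ger0_norm b0) (le_trans _ hz)// ler_piMl.
rewrite /C; apply: (le_trans (ler_normB _ _)); apply: lerD.
  apply: (le_trans (ler_normD _ _)); apply: lerD.
    by rewrite normrM (ger0_norm m0) ler_wpM2l// hb.
  by rewrite normrM ler_pM// normrM (ger0_norm m0) ler_wpM2l// normrM (ger0_norm l0) ler_wpM2l.
by rewrite normrM ler_wpM2l// normrM (ger0_norm m0) ler_wpM2l// hb.
Qed.

(* Where the superlinear term fails to dominate, [b^2 y^(p-1) < K / C0]; the
   exponent [q] turns this into a bound on [b^(2q) y]. *)
Lemma superlinear_absorption (C0 p K : R) (q : nat) : 0 < C0 -> 1 < p -> 0 <= K ->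
  1 <= (p - 1) * q%:R ->
  exists2 B, 0 <= B & forall b y, 0 <= b <= 1 -> 0 <= y ->
    K * b ^+ (2 * q) * y <= C0 * b ^+ (2 * q).+2 * y `^ p + B.
Proof.
move=> C00 p1 K0 hq.
(* The first summand covers [y <= 1], the second large [y] for which the superlinear term fails to
   dominate. *)
exists (K + K * (K / C0) ^+ q).
  by rewrite addr_ge0// mulr_ge0// exprn_ge0// divr_ge0// ltW.
move=> b y /andP[b0 b1] y0.
have bq0 : 0 <= b ^+ (2 * q) by exact: exprn_ge0.
have bq1 : b ^+ (2 * q) <= 1 by exact: exprn_ile1.
have R0 : 0 <= C0 * b ^+ (2 * q).+2 * y `^ p.
  by rewrite mulr_ge0 ?powR_ge0// mulr_ge0 ?exprn_ge0// ltW.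
have K1 : 0 <= K * (K / C0) ^+ q.
  by rewrite mulr_ge0// exprn_ge0// divr_ge0// ltW.
have [y1|y1] := leP y 1.
  have : K * b ^+ (2 * q) * y <= K.
    by rewrite -mulrA ler_piMr// mulr_ile1.
  by move: R0 K1; lra.
have yp : y `^ p = y * y `^ (p - 1).
  rewrite -{2}(powRr1 y0) -powRD; first by congr (_ `^ _); ring.
  by rewrite (gt_eqF (lt_trans ltr01 y1)) implybT.
have [h|h] := leP K (C0 * b ^+ 2 * y `^ (p - 1)).
  rewrite yp !exprSr.
  have -> : C0 * (b ^+ (2 * q) * b * b) * (y * y `^ (p - 1)) =
      b ^+ (2 * q) * y * (C0 * b ^+ 2 * y `^ (p - 1)).
    by move: (b ^+ (2 * q)) (y `^ (p - 1)) => *; ring.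
  have := ler_wpM2l (mulr_ge0 bq0 y0) h.
  rewrite [_ * K]mulrC mulrA; move: (_ * (C0 * _ * _)) (K * _ * y) => u v; move: K0 K1; lra.
have h2 : b ^+ 2 * y `^ (p - 1) <= K / C0.
  by rewrite ler_pdivlMr// mulrC mulrA ltW.
have h3 : (b ^+ 2 * y `^ (p - 1)) ^+ q <= (K / C0) ^+ q.
  by apply: lerXn2r h2; rewrite nnegrE ?divr_ge0 ?(ltW C00)// mulr_ge0 ?exprn_ge0 ?powR_ge0.
(* Here [y > 1] and the exponent [(p - 1) * q] is at least 1. *)
have yq : y <= (y `^ (p - 1)) ^+ q.
  rewrite -powR_mulrn ?powR_ge0// -powRrM -[leLHS]powRr1//.
  by apply: ler_powR => //; exact: ltW.
have : b ^+ (2 * q) * y <= (K / C0) ^+ q.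
  by apply: le_trans h3; rewrite exprMn -exprM ler_wpM2l.
move=> /(ler_wpM2l K0); rewrite mulrA.
by move: R0 K0; lra.
Qed.

Lemma le1_powR_ge_id (p y : R) : 1 <= p -> 1 <= y -> y <= y `^ p.
Proof. by move=> p1 y1; rewrite -[leLHS]powRr1 ?(le_trans ler01)//; exact: ler_powR. Qed.

(** The pointwise estimate with all functions replaced by numbers. In the constant, [B] is the cost
    of the absorption, [(C1 + M') * Phi] that of passing from [v - ph] to [v], and [M] bounds the
    term in [fp]. *)
Lemma absorbed_forcing (C1 M' Phi M bk bkk C0 B kap v ph fv fp fu vp : R) : 0 <= C1 ->
  0 <= bk -> bk <= 1 -> 0 <= bkk -> bkk <= bk ->
  `|kap| <= C1 * bk -> `|fu| <= M' -> `|fp| <= M -> `|ph| <= Phi -> C0 * vp <= fv ->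
  (C1 + M') * bk * `|v| <= C0 * bkk * vp + B ->
  kap * (v - ph) - (B + (C1 + M') * Phi + M) <= bkk * (fv - fp - fu * (v - ph)).
Proof.
move=> C10 bk0 bk1 bkk0 bkkbk hk hfu hfp hph hfv hB.
have Phi0 : 0 <= Phi := le_trans (normr_ge0 _) hph.
have M'0 : 0 <= M' := le_trans (normr_ge0 _) hfu.
have M0 : 0 <= M := le_trans (normr_ge0 _) hfp.
have vp' : `|v - ph| <= `|v| + Phi by rewrite (le_trans (ler_normB _ _))// lerD2l.
have cM : `|kap + bkk * fu| <= (C1 + M') * bk.
  apply: (le_trans (ler_normD _ _)); rewrite mulrDl lerD//.
  by rewrite normrM (ger0_norm bkk0) mulrC ler_pM.
have cM0 : 0 <= (C1 + M') * bk := le_trans (normr_ge0 _) cM.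
have t1 : (kap + bkk * fu) * (v - ph) <= (C1 + M') * bk * (`|v| + Phi).
  by apply: (le_trans (ler_norm _)); rewrite normrM; exact: ler_pM.
have C1M : 0 <= (C1 + M') * Phi by rewrite mulr_ge0 ?addr_ge0.
have t1' : (C1 + M') * bk * Phi <= (C1 + M') * Phi.
  by rewrite mulrAC ler_piMr.
have t2 : bkk * fp <= M.
  apply: (le_trans (ler_norm _)); rewrite normrM (ger0_norm bkk0).
  by rewrite (le_trans _ hfp)// ler_piMl// (le_trans bkkbk).
have t3 := ler_wpM2l bkk0 hfv.
move: t1 t1' t2 t3 hB; rewrite [_ * (`|v| + Phi)]mulrDr.
have -> : (kap + bkk * fu) * (v - ph) = kap * (v - ph) + bkk * (fu * (v - ph)) by ring.
have -> : bkk * (C0 * vp) = C0 * bkk * vp by ring.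
have -> : bkk * (fv - fp - fu * (v - ph)) = bkk * fv - bkk * fp - bkk * (fu * (v - ph)) by ring.
move: (bkk * fv) (bkk * fp) (bkk * (_ * _)) (kap * _) (C0 * _ * _) => *.
lra.
Qed.

End plateau.

(** * Exponential growth against bounded window means *)

Section blow_up.
Context (R : realType) (n : nat).
Local Notation rV := 'rV[R]_n.
Local Notation mu := (lebesgue_rV R n).
Local Notation lam := (@lebesgue_measure R).

Lemma grows_exponentially_chi (chi : rV -> R) (u ut : R -> rV -> R) (phi : rV -> R)
    (m c K : R) : sq_integrable mu chi ->
  continuous_into (@in_H1 R n) (@H1norm R n) +oo%E (fun t => u t - phi) ->
  0 < m -> 0 < c ->
  (forall t, 1 <= t -> c * expR (m * t) - K <= chi_mean phi chi u t) ->
  grows_exponentially (fun t => energy_norm (u t - phi) (ut t)).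
Proof.
move=> chi_sq [wH _] m0 c0 H; set A := L2norm chi + 1.
have A0 : 0 < A by rewrite ltr_wpDl ?L2norm_ge0.
(* From exp(m t) >= 1 + m t, beyond [t0] the constant [K] is at most half of c exp(m t). *)
pose t0 := 1 + 2 * `|K| / c / m.
have t01 : 1 <= t0 by rewrite lerDl divr_ge0 ?(ltW m0)// divr_ge0 ?(ltW c0)// mulr_ge0.
exists (c / 2 / A), m, t0; split; rewrite ?divr_gt0 ?(le_trans ler01)// => t tt0.
have t1 : 1 <= t by exact: le_trans tt0.
have Tt : time +oo%E t by split; [exact: le_trans t1|rewrite ltry].
have [[ws _ _] _] := weak_gradient_pair (wH t Tt).
have N1 : chi_mean phi chi u t <= A * energy_norm (u t - phi) (ut t).
  apply: (le_trans (ler_norm _)); apply: (le_trans (cauchy_schwarz chi_sq ws)).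
  have h : L2norm (u t - phi) <= energy_norm (u t - phi) (ut t).
    by apply: (le_trans (L2norm_le_H1norm (wH t Tt))); rewrite lerDl L2norm_ge0.
  by apply: ler_pM => //; rewrite ?L2norm_ge0// lerDl.
suff : c / 2 * expR (m * t) <= A * energy_norm (u t - phi) (ut t).
  by move=> h; rewrite mulrAC ler_pdivrMr// [leRHS]mulrC.
apply: le_trans (le_trans (H t t1) N1).
have e1 : 1 + m * t <= expR (m * t) by exact: expR_ge1Dx.
have e2 : 2 * `|K| / c <= m * t.
  have : m * t0 <= m * t by rewrite ler_pM2l.
  rewrite mulrDr mulr1 [m * (_ / m)]mulrC divfK ?gt_eqF//.
  by move: m0; move: (_ / c) => x; lra.
have : 2 * `|K| <= c * expR (m * t).
  by rewrite [leRHS]mulrC -ler_pdivrMr//; move: e1 e2; lra.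
by have := ler_norm K; rewrite -mulrA [2^-1 * _]mulrC mulrA; lra.
Qed.

(** Far enough out, [G] is at least |Z| + 1 on the whole window, and [theta] equals 1 on a
    subinterval of length 2. *)
Lemma unbounded_window_mean (G theta : R -> R) (m c K Z : R) : 0 < m -> 0 < c ->
  (forall t, 0 < t -> {for t, continuous G}) ->
  (forall t, 1 <= t -> c * expR (m * t) - K <= G t) ->
  smooth theta -> zero_outside (-3) 3 theta -> (forall t, 0 <= theta t) ->
  (forall t, `|t| <= 1 -> theta t = 1) ->
  exists tau, [/\ 4 <= tau, rintegrable lam (fun t => theta (1 * t + - tau) * G t) &
    Z < \int[lam]_t (theta (1 * t + - tau) * G t)].
Proof.
move=> m0 c0 cG HG ths th0 thp th1.
(* On the window t >= tau - 3 = 1 + X / m, so exp(m t) >= X and c exp(m t) - K is at least |Z| + 1.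
   The 4 keeps the window in [t >= 1]. *)
pose X := (`|K| + (`|Z| + 1)) / c; pose tau := 4 + X / m.
have X0 : 0 <= X by rewrite divr_ge0 ?(ltW c0)// !addr_ge0.
have tau4 : 4 <= tau by rewrite lerDl divr_ge0// ltW.
exists tau.
have cth : continuous (fun t : R => theta (1 * t + - tau)).
  by apply: smooth_continuous; exact: smooth_comp_line.
have tth0 : zero_outside (tau - 3) (tau + 3) (fun t : R => theta (1 * t + - tau)).
  by move=> t nt; apply: th0 => /andP[h0 h1]; apply: nt; apply/andP; split; lra.
have s01 : tau - 3 < tau + 3 by lra.
have i01 : tau - 1 < tau + 1 by lra.
have I : rintegrable lam (fun t => theta (1 * t + - tau) * G t).
  apply: (rintegrable_zero_outside s01); last by move=> t /tth0 ->; rewrite mul0r.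
  apply: (@continuous_cutM R 0 (tau + 4) (tau - 3) (tau + 3)) => //; first lra.
    lra.
  by move=> t /andP[t0 _]; exact: cG.
split => //.
have [Ii Ei] := has_integralZ (`|Z| + 1) (has_integral_indS i01).
apply: (@lt_le_trans _ _ ((`|Z| + 1) * (tau + 1 - (tau - 1)))).
  have -> : tau + 1 - (tau - 1) = 2 by ring.
  by have := ler_norm Z; have := normr_ge0 Z; lra.
rewrite -Ei; apply: Rintegral_le => // t.
have [ht|ht] := pselect (tau - 3 <= t <= tau + 3); last first.
  rewrite tth0// mul0r indS_out ?mulr0// => /andP[h0 h1].
  by apply: ht; apply/andP; split; lra.
have Gt : `|Z| + 1 <= G t.
  have /andP[h0 h1] := ht.
  have t1 : 1 <= t by lra.
  apply: le_trans (HG t t1).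
  have e1 : 1 + m * t <= expR (m * t) by exact: expR_ge1Dx.
  have e2 : m + X <= m * t.
    have : m * (tau - 3) <= m * t by rewrite ler_pM2l.
    rewrite /tau (_ : 4 + X / m - 3 = 1 + X / m); last by ring.
    by rewrite mulrDr mulr1 [m * (_ / m)]mulrC divfK ?gt_eqF.
  have : `|K| + (`|Z| + 1) <= c * expR (m * t).
    have -> : `|K| + (`|Z| + 1) = c * X by rewrite /X mulrC divfK ?gt_eqF.
    by rewrite ler_pM2l//; lra.
  by have := ler_norm K; lra.
have [hi|hi] := pselect (tau - 1 <= t <= tau + 1).
  rewrite indS_in// mulr1 th1 ?mul1r//.
  by move/andP: hi => [h0 h1]; rewrite ler_norml; apply/andP; split; lra.
by rewrite indS_out// mulr0 mulr_ge0// (le_trans _ Gt)// addr_ge0.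
Qed.

Variables (L : diffop2 R n) (f : rV -> R -> R) (a : R) (phi : rV -> R) (sigma : R)
  (chi : rV -> R) (u ut : R -> rV -> R).
Hypotheses (L_coef : smooth_bounded L) (phi_C2 : Ck 2 phi)
  (phi_eq : forall x, apply_op L phi x = f x (phi x)) (sigma_gt0 : 0 < sigma).
Hypotheses (chi_sq : sq_integrable mu chi) (chi_int : rintegrable mu chi)
  (chi_ge0 : forall x, 0 <= chi x).
Hypothesis chi_eigen : forall psi, test_function setT psi ->
  \int[mu]_x (chi x * (apply_op L psi x - f_u f x (phi x) * psi x)) =
  - sigma ^+ 2 * \int[mu]_x (chi x * psi x).
Hypotheses (f_phi_bounded : bounded_fct (fun x => f x (phi x)))
  (f_u_phi_bounded : bounded_fct (fun x => f_u f x (phi x)))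
  (f_C1 : Ck 1 (fun z : rV * R => f z.1 z.2)).
Hypotheses (u_meas : measurable_fun (spacetime +oo%E : set (measurableTypeR R * rV))
    (fun z => u z.1 z.2))
  (f_loc : locally_integrable_spacetime +oo%E (fun z => f z.2 (u z.1 z.2)))
  (pde : distributional_wave_equation L f a +oo%E u).
Hypotheses (w_cont : continuous_into (@in_H1 R n) (@H1norm R n) +oo%E (fun t => u t - phi)).
Variables (C0 p : R).
Hypotheses (C00 : 0 < C0) (p1 : 1 < p) (f_ge : forall x s, C0 * `|s| `^ p <= f x s).

(** Superlinear growth applied to [f x (phi x)], which is bounded; where |phi| > 1, it is at most
    its own power [p]. *)
Lemma bounded_phi : bounded_fct phi.
Proof.
have [M HM] := f_phi_bounded; exists (1 + `|M| / C0) => x.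
have [h|h] := leP `|phi x| 1; first by rewrite (le_trans h)// lerDl divr_ge0// ltW.
have h1 : `|phi x| <= `|phi x| `^ p by apply: le1_powR_ge_id; exact: ltW.
have h2 : C0 * `|phi x| `^ p <= `|M|.
  by apply: le_trans (f_ge x (phi x)) _; exact: le_trans (le_trans (ler_norm _) (HM x)) (ler_norm M).
have : `|phi x| <= `|M| / C0 by rewrite (le_trans h1)// ler_pdivlMr// mulrC.
by lra.
Qed.

(** With kappa = theta'' - a theta' the inequality for the mean bounds its integral against
    translates of [theta] from above, uniformly in the translation; exponential growth makes these
    integrals unbounded. *)
Lemma no_exponential_chi_mean (c K m : R) : 0 < m -> 0 < c ->
  (forall t, 0 < t -> {for t, continuous (chi_mean phi chi u)}) ->
  (forall t, 1 <= t -> c * expR (m * t) - K <= chi_mean phi chi u t) -> False.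
Proof.
move=> m0 c0 cG HG.
have [Phi HPhi] := bounded_phi; have [M HM] := f_phi_bounded.
have [M' HM'] := f_u_phi_bounded.
have Phi0 : 0 <= Phi by exact: le_trans (HPhi 0).
have M0 : 0 <= M by exact: le_trans (HM 0).
have M'0 : 0 <= M' by exact: le_trans (HM' 0).
(* The power is fixed before the constant [K], since the bound [C1] on the derivatives, part of that
   constant, depends on the power. Any even [k] with (p - 1) k / 2 >= 1 will do. *)
have [k Hk] : exists k : nat, forall K, 0 <= K -> exists2 B, 0 <= B & forall b y : R,
    0 <= b <= 1 -> 0 <= y -> K * b ^+ k * y <= C0 * b ^+ k.+2 * y `^ p + B.
  have p10 : 0 < p - 1 by rewrite subr_gt0.
  exists (2 * (Num.truncn (p - 1)^-1).+1)%N => K1 K10; apply: superlinear_absorption => //.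
  by rewrite mulrC -ler_pdivrMr// mul1r ltW// truncnS_gt.
pose theta (t : R) := plateau t ^+ k.+2.
have ths : smooth theta by exact: smooth_exp (smooth_plateau R).
have th's := smooth_derive1 ths; have th''s := smooth_derive1 th's.
have [C1 C10 HC1] := @plateau_power_derivatives R a k.
have th_ge0 t : 0 <= theta t by have /andP[h _] := plateau_itv t; exact: exprn_ge0.
have th1 t : `|t| <= 1 -> theta t = 1 by move=> h; rewrite /theta plateau_eq1// expr1n.
have th0 : zero_outside (-3) 3 theta.
  by move=> t /zero_outside_plateau h; rewrite /theta h expr0n.
have [B B0 HB] := Hk _ (addr_ge0 C10 M'0).
pose I := \int[mu]_x chi x.
pose B1 := B + (C1 + M') * Phi + M.
(* The threshold to be exceeded is the upper bound found below: constant, window length 6 and mass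
   of [chi], divided by [sigma ^+ 2]. *)
have [tau [tau4 Ith]] :=
  unbounded_window_mean (B1 * 6 * I / sigma ^+ 2) m0 c0 cG HG ths th0 th_ge0 th1.
rewrite ltr_pdivrMr ?exprn_gt0// ltNge => /negP; apply.
pose thetat (t : R) := theta (1 * t + - tau).
pose kappa (t : R) := derive1 (derive1 theta) (1 * t + - tau) - a * derive1 theta (1 * t + - tau).
have d1 : derive1 thetat = (fun t => derive1 theta (1 * t + - tau)).
  by apply/funext => t; exact: derive1_comp_shift.
have d2 : derive1 (derive1 thetat) = (fun t => derive1 (derive1 theta) (1 * t + - tau)).
  by rewrite d1; apply/funext => t; exact: derive1_comp_shift.
have kE t : derive1 (derive1 thetat) t - a * derive1 thetat t = kappa t by rewrite d2 d1.
have s00 : 0 < tau - 3 by lra.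
have s01 : tau - 3 < tau + 3 by lra.
have out t : ~ tau - 3 <= t <= tau + 3 -> ~ -3 <= 1 * t + - tau <= 3.
  by move=> nt /andP[h0 h1]; apply: nt; apply/andP; split; lra.
have ck : continuous kappa.
  apply: smooth_continuous; apply: smoothD; first exact: smooth_comp_line.
  by apply: smoothN; apply: smoothM; [exact: smooth_cst|exact: smooth_comp_line].
have H t x : tau - 3 <= t <= tau + 3 -> kappa t * (u t x - phi x) - B1 <=
    thetat t * (f x (u t x) - f x (phi x) - f_u f x (phi x) * (u t x - phi x)).
  move=> _; rewrite /kappa /thetat; move: (1 * t + - tau) => s.
  have b01 := plateau_itv s; have /andP[b0 b1] := b01.
  have e0 : 0 <= plateau s ^+ k by exact: exprn_ge0.
  have e1 : plateau s ^+ k <= 1 by exact: exprn_ile1.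
  have e20 : 0 <= plateau s ^+ k.+2 by exact: exprn_ge0.
  have e2 : plateau s ^+ k.+2 <= plateau s ^+ k by exact: (ler_wiXn2l b0 b1 (leqW (leqnSn k))).
  exact: (@absorbed_forcing R C1 M' Phi M (plateau s ^+ k) (plateau s ^+ k.+2) C0 B
    (derive1 (derive1 theta) s - a * derive1 theta s) (u t x) (phi x) (f x (u t x))
    (f x (phi x)) (f_u f x (phi x)) (`|u t x| `^ p) C10 e0 e1 e20 e2 (HC1 s) (HM' x) (HM x)
    (HPhi x) (f_ge x (u t x)) (HB _ _ b01 (normr_ge0 _))).
have ttth0 : zero_outside (tau - 3) (tau + 3) thetat by move=> t /out /th0.
have := @chi_mean_inequality R n L f a phi sigma chi +oo%E u L_coef phi_C2 phi_eq chi_sq chi_int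
  chi_ge0 chi_eigen f_u_phi_bounded f_C1 u_meas f_loc pde w_cont
  (tau - 3) (tau + 3) thetat kappa B1 s00 s01 (ltry _)
  (smooth_comp_line 1 (- tau) ths) ttth0 ck H.
rewrite (_ : tau + 3 - (tau - 3) = 6); last by ring.
have [_ EI] := has_integralZ (- sigma ^+ 2) (has_integralP Ith).
rewrite (_ : \int[lam]_t _ = - sigma ^+ 2 * \int[lam]_t (thetat t * chi_mean phi chi u t)).
  by move: (\int[lam]_t _) => J; rewrite mulNr lerN2 [J * _]mulrC.
have tth'0 := zero_outside_derive1 ttth0; have tth''0 := zero_outside_derive1 tth'0.
(* This is the purpose of the choice of [kappa]: only the term in [sigma ^+ 2] survives, with a
   negative sign. *)
have key t : derive1 (derive1 thetat) t - a * derive1 thetat t -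
    indS (tau - 3) (tau + 3) t * kappa t = 0.
  have [ht|ht] := pselect (tau - 3 <= t <= tau + 3).
    by rewrite (kE t) (indS_in ht); move: (kappa t) => z; rewrite mul1r subrr.
  rewrite (tth''0 t ht) (tth'0 t ht) (indS_out ht); move: (kappa t) => z.
  by rewrite mulr0 mul0r !subr0.
rewrite -EI; apply: eq_Rintegral => t _; rewrite key sub0r -/(thetat t).
by move: (thetat t) (chi_mean phi chi u t) => x y; rewrite !mulNr mulrA.
Qed.

End blow_up.

(** * Conclusion *)

Lemma smooth_apply_op (R : realType) n (L : diffop2 R n) (psi : 'rV[R]_n -> R) :
  smooth_bounded L -> smooth psi -> smooth (apply_op L psi).
Proof.
move=> [c2 c1 [c0 _]] ps; apply: smoothD; last exact: smoothM.
apply: smoothD; apply: smooth_sum => i.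
  apply: smooth_sum => j; apply: smoothM; first by have [] := c2 i j.
  exact/smooth_partial/smooth_partial.
by apply: smoothM; [have [] := c1 i|exact: smooth_partial].
Qed.

Theorem theorem2p1 (R : realType) (n : nat) (n_ge1 : (1 <= n)%N)
  (L : diffop2 R n) (L_elliptic : elliptic L) (L_coef : smooth_bounded L)
  (f : 'rV[R]_n -> R -> R) (a : R)
  (phi : 'rV[R]_n -> R) (phi_C2 : Ck 2 phi)
  (phi_eq : forall x, apply_op L phi x = f x (phi x))
  (sigma : R) (sigma_gt0 : 0 < sigma)
  (chi : 'rV[R]_n -> R) (chi_L1 : in_L1 chi) (chi_L2 : in_L2 chi)
  (chi_ge0 : {ae lebesgue_rV R n, forall x, 0 <= chi x})
  (chi_eigen :
    adjoint_eigenfunction L (fun x => f_u f x (phi x)) (- sigma ^+ 2) chi)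
  (f_phi_bounded : bounded_fct (fun x => f x (phi x)))
  (f_u_phi_bounded : bounded_fct (fun x => f_u f x (phi x)))
  (f_convex : forall x, @convex_function R R^o setT (f x))
  (f_C1 : Ck 1 (fun z : 'rV[R]_n * R => f z.1 z.2))
  (psi0 psi1 : 'rV[R]_n -> R) (psi0_H1 : in_H1 psi0) (psi1_L2 : in_L2 psi1)
  (data_pos :
    0 < (a + Num.sqrt (a ^+ 2 + 4 * sigma ^+ 2)) / 2
          * \int[lebesgue_rV R n]_x (chi x * psi0 x)
        + \int[lebesgue_rV R n]_x (chi x * psi1 x))
  (T : \bar R) (T_gt0 : (0 < T)%E) (u ut : R -> 'rV[R]_n -> R)
  (u_sol : energy_solution L f a phi psi0 psi1 T u ut) :
  (T = +oo%E ->
     grows_exponentially (fun t => energy_norm (u t - phi) (ut t))) /\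
  ((exists C0 p : R, [/\ 0 < C0, 1 < p &
      forall x s, C0 * `|s| `^ p <= f x s]) ->
    (lebesgue_rV R n).-integrable setT (fun x => (phi x * chi x)%:E) ->
   (T < +oo)%E).
Proof.
have [[u_meas f_loc pde] [[w_cont ut_cont w_deriv] [u0 ut0]]] := u_sol.
have [_ eigen] := chi_eigen; have chi_sq := in_L2_sq chi_L2.
have mchi := proj1 chi_sq.
(* The eigenfunction is nonnegative almost everywhere only; its absolute value is nonnegative
   everywhere and has the same integrals. *)
pose chi' x := `|chi x|.
have chi'E : {ae lebesgue_rV R n, forall x, chi' x = chi x}.
  by apply: filterS chi_ge0 => x h; rewrite /chi' ger0_norm.
have mchi' : measurable_fun setT chi' by exact: measurableT_comp mchi.
have chi'_sq : sq_integrable (lebesgue_rV R n) chi'.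
  split => //; have [_] := chi_sq.
  by under eq_fun do rewrite -real_normK ?num_real//.
have chi'_int : rintegrable (lebesgue_rV R n) chi'.
  by apply: rintegrable_norm; apply/Lfun1_integrable; move: chi_L1; rewrite /in_L1.
have pairE (g h : 'rV[R]_n -> R) : measurable_fun setT g -> measurable_fun setT h ->
    {ae lebesgue_rV R n, forall x, g x = h x} ->
    \int[lebesgue_rV R n]_x (chi' x * g x) = \int[lebesgue_rV R n]_x (chi x * h x).
  move=> mg mh gh; apply: ae_eq_Rintegral; [exact: measurable_funM..|].
  by apply: filterS2 chi'E gh => x -> ->.
have mV : measurable_fun setT (fun x => f_u f x (phi x)).
  by apply: continuous_measurable_rV; apply: continuous_f_u => //; exact: Ck_continuous phi_C2.
have eigen' psi : test_function setT psi ->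
    \int[lebesgue_rV R n]_x (chi' x * (apply_op L psi x - f_u f x (phi x) * psi x)) =
    - sigma ^+ 2 * \int[lebesgue_rV R n]_x (chi' x * psi x).
  move=> tpsi; have [ps _] := tpsi; have mpsi := smooth_measurable ps.
  have mop : measurable_fun setT (fun x => apply_op L psi x - f_u f x (phi x) * psi x).
    apply: measurable_funB; last exact: measurable_funM.
    by apply: smooth_measurable; exact: smooth_apply_op.
  rewrite (pairE _ _ mop mop); last by apply: aeW.
  by rewrite (pairE _ _ mpsi mpsi) ?eigen//; exact: aeW.
have T0 : time T 0 by split.
have [wH _] := w_cont; have [vL _] := ut_cont.
have mw0 : measurable_fun setT (u 0 - phi) by have [[]] := wH 0 T0 => /in_L2_sq[].
have mv0 : measurable_fun setT (ut 0) by have /in_L2_sq[] := vL 0 T0.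
have mpsi0 : measurable_fun setT psi0 by have [/in_L2_sq[]] := psi0_H1.
have mpsi1 : measurable_fun setT psi1 by have /in_L2_sq[] := psi1_L2.
have chi'_ge0 x : 0 <= chi' x by exact: normr_ge0.
have growth : T = +oo%E -> exists c K, 0 < c /\
    forall t, 1 <= t -> c * expR (growth_rate a sigma * t) - K <= chi_mean phi chi' u t.
  move=> Too.
  apply: (chi_mean_growth L_coef phi_C2 phi_eq sigma_gt0 chi'_sq chi'_int chi'_ge0 eigen'
    f_u_phi_bounded f_convex f_C1 u_meas f_loc pde w_cont ut_cont w_deriv Too _ erefl).
  (* The initial values of the mean and of its velocity are those of the data, which turns
     positivity at time 0 into the hypothesis on [psi0] and [psi1], the factor there being
     [decay_rate]. *)
  rewrite /chi_velocity /chi_mean (pairE _ _ mv0 mpsi1 ut0) (pairE _ _ mw0 mpsi0 u0).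
  by rewrite addrC.
have g0 := growth_rate_gt0 a sigma_gt0.
split=> [Too|[C0 [p [C00 p1 fge]]] _].
  have [c [K [c0 H]]] := growth Too; rewrite Too in w_cont.
  exact: (grows_exponentially_chi ut chi'_sq w_cont g0 c0 H).
(* A global solution would have an exponentially growing mean, as in the first part, against the
   bound on window means. *)
rewrite ltNge leye_eq; apply/negP => /eqP Too.
have [c [K [c0 H]]] := growth Too.
have cG t : 0 < t -> {for t, continuous (chi_mean phi chi' u)}.
  move=> t0; have [d _] : is_derive t (1 : R) (chi_mean phi chi' u) (chi_velocity chi' ut t).
    by apply: (is_derive_chi_mean chi'_sq w_cont ut_cont w_deriv t0); rewrite Too ltry.
  exact/differentiable_continuous/derivable1_diffP.
rewrite {}Too in u_meas f_loc pde w_cont.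
exact: (no_exponential_chi_mean L_coef phi_C2 phi_eq sigma_gt0 chi'_sq chi'_int chi'_ge0 eigen'
  f_phi_bounded f_u_phi_bounded f_C1 u_meas f_loc pde w_cont C00 p1 fge g0 c0 cG H).
Qed.
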